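(* The map $\rho:\mathcal{X}_{\mathbb{F}}\to A_{\mathbb{F}}.\operatorname{Id}$, $\rho(uak.\operatorname{Id})=a.\operatorname{Id}$ for $u\in U_{\mathbb{F}}$, $a\in A_{\mathbb{F}}$, $k\in K_{\mathbb{F}}$, is a $d$-diminishing retraction to $A_{\mathbb{F}}.\operatorname{Id}$; that is, $\rho$ restricts to the identity on $A_{\mathbb{F}}.\operatorname{Id}$ and $$d(\rho(x),\rho(y))\le d(x,y)\qquad\text{for all }x,y\in\mathcal{X}_{\mathbb{F}}.$$
   Context: Let $\mathbb{K},\mathbb{F}$ be real closed fields with $\mathbb{K}\subseteq\mathbb{R}\cap\mathbb{F}$. Let $O\subsetneq\mathbb{F}$ be an order convex subring ($a,b\in O$ and $a\le c\le b$ imply $c\in O$); it is a valuation ring. Let $\Lambda=\mathbb{F}^\times/O^\times$, written additively, and let $v:\mathbb{F}\to\Lambda\cup\{\infty\}$ be the associated valuation, with $\Lambda$ ordered so that $(-v)(a)\ge(-v)(b)$ whenever $a\ge b>0$; thus $O=\{a:(-v)(a)\le 0\}$. For a semialgebraic set $V$ defined over $\mathbb{K}$, $V_{\mathbb{F}}$ denotes its $\mathbb{F}$-extension. $G<\operatorname{SL}_n$ is a connected semisimple algebraic group over $\mathbb{K}$, self-adjoint ($g\in G$ implies $g^{\mathsf T}\in G$). $S<G$ is a maximal $\mathbb{K}$-split torus with $s=s^{\mathsf T}$ for all $s\in S$; $A_{\mathbb{F}}$ is the $\mathbb{F}$-extension of the semialgebraic connected component of $S_{\mathbb{K}}$ containing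 $\operatorname{Id}$; $K_{\mathbb{F}}=G_{\mathbb{F}}\cap\operatorname{SO}_n(\mathbb{F})$. Let $\mathfrak{g}=\operatorname{Lie}(G_{\mathbb{R}})$, $\mathfrak{a}=\operatorname{Lie}(A_{\mathbb{R}})$; $\Sigma\subseteq\mathfrak{a}^\star$ is the root system of $\mathfrak{g}$ with respect to $\mathfrak{a}$, with root spaces $\mathfrak{g}_\alpha$. For $\alpha\in\Sigma$, $\chi_\alpha:A_{\mathbb{F}}\to\mathbb{F}_{>0}$ is the restriction of the algebraic character of $S$ over $\mathbb{K}$ which over $\mathbb{R}$ satisfies $\chi_\alpha(\exp H)=e^{\alpha(H)}$, $H\in\mathfrak{a}$. Fix a basis $\Delta$ of $\Sigma$ with positive roots $\Sigma_{>0}$; let $A^+_{\mathbb{F}}=\{a\in A_{\mathbb{F}}:\chi_\alpha(a)\ge1\ \forall\alpha\in\Delta\}$ and $U_{\mathbb{F}}=\exp(\bigoplus_{\alpha\in\Sigma_{>0}}(\mathfrak{g}_\alpha)_{\mathbb{F}})$. $G_{\mathbb{F}}$ acts on symmetric positive definite matrices of determinant $1$ over $\mathbb{F}$ by $g.x=gxg^{\mathsf T}$, and $\mathcal{X}_{\mathbb{F}}=G_{\mathbb{F}}.\operatorname{Id}$; the stabilizer of $\operatorname{Id}$ is $K_{\mathbb{F}}$. For $x=g.\operatorname{Id}$, $y=h.\operatorname{Id}$, $\delta_{\mathbb{F}}(x,y)$ is the unique $a\in A^+_{\mathbb{F}}$ with $g^{-1}h\in K_{\mathbb{F}}aK_{\mathbb{F}}$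 (Cartan decomposition). For $a\in A_{\mathbb{F}}$, $N_{\mathbb{F}}(a)=\prod_{\alpha\in\Sigma}\max\{\chi_\alpha(a),\chi_\alpha(a)^{-1}\}$, and $d(x,y)=(-v)(N_{\mathbb{F}}(\delta_{\mathbb{F}}(x,y)))\in\Lambda$. By the Iwasawa decomposition $G_{\mathbb{F}}=U_{\mathbb{F}}A_{\mathbb{F}}K_{\mathbb{F}}$ every $g\in G_{\mathbb{F}}$ is uniquely $g=uak$, so $\rho$ is well defined. *)

(* Defs.v *)
From HB Require Import structures.
From mathcomp Require Import all_boot all_order all_algebra.
From mathcomp Require Import complex.
From mathcomp Require Import (canonicals) mpoly.
From mathcomp Require Import boolp classical_sets functions cardinality fsbigop.
From mathcomp Require Import reals topology normedtype sequences exp.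
Import numFieldNormedType.Exports.

Set Implicit Arguments.
Unset Strict Implicit.
Unset Printing Implicit Defensive.

Import Order.TTheory GRing.Theory Num.Theory.

Local Open Scope classical_set_scope.
Local Open Scope ring_scope.
Local Open Scope quotient_scope.

Record convexSubring (F : rcfType) := ConvexSubring {
  convex_pred :> {pred F};
  convex_subring : GRing.subring_closed convex_pred;
  convex_convex : forall a b c : F, a \in convex_pred -> b \in convex_pred ->
    a <= c <= b -> c \in convex_pred;
  convex_proper : exists a : F, a \notin convex_pred }.

Section ValueGroup.
Variables (F : rcfType) (O : convexSubring F).

Definition Fstar := {x : F | x != 0}.

Implicit Types a b c : Fstar.

Let O1 : 1 \in convex_pred O. Proof. by case: (convex_subring O). Qed.
Let OM x y : x \in convex_pred O -> y \in convex_pred O ->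
  x * y \in convex_pred O.
Proof. by case: (convex_subring O) => _ _; apply. Qed.
Let ON1 : -1 \in convex_pred O.
Proof.
case: (convex_subring O) => _ OB _.
by rewrite -[-1]add0r -{1}(subrr 1); apply: (OB); rewrite ?O1 ?(OB).
Qed.

Definition star_mul a b : Fstar :=
  exist _ (val a * val b) (mulf_neq0 (valP a) (valP b)).
Lemma star_inv_subproof a : (val a)^-1 != 0.
Proof. by rewrite invr_eq0 (valP a). Qed.
Definition star_inv a : Fstar := exist _ (val a)^-1 (star_inv_subproof a).
Definition star_one : Fstar := exist _ 1 (oner_neq0 F).

(* [star_le a b] is v a <= v b. *)
Definition star_le : rel Fstar := fun a b => val b / val a \in convex_pred O.
Definition star_eq : rel Fstar := fun a b => star_le a b && star_le b a.

Lemma star_le_refl : reflexive star_le.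
Proof. by move=> a; rewrite /star_le divff ?(valP a). Qed.

Lemma star_le_trans : transitive star_le.
Proof.
move=> b a c; rewrite /star_le => ab bc.
have -> : val c / val a = (val c / val b) * (val b / val a).
  by rewrite mulrA mulfVK ?(valP b).
exact: OM.
Qed.

Lemma star_eq_refl : reflexive star_eq.
Proof. by move=> a; rewrite /star_eq star_le_refl. Qed.

Lemma star_eq_sym : symmetric star_eq.
Proof. by move=> a b; rewrite /star_eq andbC. Qed.

Lemma star_eq_trans : transitive star_eq.
Proof.
move=> b a c /andP[ab ba] /andP[bc cb].
by rewrite /star_eq (star_le_trans ab bc) (star_le_trans cb ba).
Qed.

Canonical star_equiv :=
  EquivRel star_eq star_eq_refl star_eq_sym star_eq_trans.

(* F^* / O^*, written additively. *)
Definition valueGroup := {eq_quot star_equiv}.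
HB.instance Definition _ := Choice.on valueGroup.
HB.instance Definition _ := EqQuotient.on valueGroup.

Local Notation cls := \pi_valueGroup.

Let piP a b : reflect (cls a = cls b) (star_eq a b).
Proof. exact: (@eqmodP _ star_equiv a b). Qed.

Let reprP a : star_eq (repr (cls a)) a.
Proof. by apply/piP; rewrite reprK. Qed.

Definition value_add (x y : valueGroup) : valueGroup :=
  cls (star_mul (repr x) (repr y)).
Definition value_opp (x : valueGroup) : valueGroup := cls (star_inv (repr x)).
Definition value_zero : valueGroup := \pi star_one.
Definition value_le (x y : valueGroup) := star_le (repr x) (repr y).
Definition value_lt (x y : valueGroup) := (y != x) && value_le x y.

Let star_le_mul a b c d :
  star_le a b -> star_le c d -> star_le (star_mul a c) (star_mul b d).
Proof. by rewrite /star_le /= invfM mulrACA; exact: OM. Qed.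

Let star_eq_mul a b c d :
  star_eq a b -> star_eq c d -> star_eq (star_mul a c) (star_mul b d).
Proof.
by move=> /andP[ab ba] /andP[cd dc]; rewrite /star_eq !star_le_mul.
Qed.

Let star_eq_inv a b : star_eq a b -> star_eq (star_inv a) (star_inv b).
Proof.
move=> /andP[ab ba]; rewrite /star_eq /star_le /= !invrK.
by rewrite mulrC (mulrC _ (val b)); apply/andP; split.
Qed.

Lemma pi_star_mul a b :
  cls (star_mul a b) = value_add (cls a) (cls b).
Proof. by apply/piP; rewrite star_eq_sym star_eq_mul ?reprP. Qed.

Lemma pi_star_inv a : cls (star_inv a) = value_opp (cls a).
Proof. by apply/piP; rewrite star_eq_sym star_eq_inv ?reprP. Qed.

Lemma pi_star_le a b : value_le (cls a) (cls b) = star_le a b.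
Proof.
have /andP[a1 a2] := reprP a; have /andP[b1 b2] := reprP b.
apply/idP/idP => h; first exact: (star_le_trans a2 (star_le_trans h b1)).
exact: (star_le_trans a1 (star_le_trans h b2)).
Qed.

Let value_addA : associative value_add.
Proof.
elim/quotW=> a; elim/quotW=> b; elim/quotW=> c.
rewrite -(pi_star_mul b c) -(pi_star_mul a b) -!pi_star_mul.
by congr (cls _); apply: val_inj; rewrite /= mulrA.
Qed.

Let value_addC : commutative value_add.
Proof.
elim/quotW=> a; elim/quotW=> b; rewrite -!pi_star_mul.
by congr (cls _); apply: val_inj; rewrite /= mulrC.
Qed.

Let value_add0 : left_id value_zero value_add.
Proof.
elim/quotW=> a; rewrite -pi_star_mul.
by congr (cls _); apply: val_inj; rewrite /= mul1r.
Qed.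

Let value_addN : left_inverse value_zero value_opp value_add.
Proof.
elim/quotW=> a; rewrite -pi_star_inv -pi_star_mul.
by congr (cls _); apply: val_inj; rewrite /= mulVf ?(valP a).
Qed.

HB.instance Definition _ := GRing.isZmodule.Build valueGroup
  value_addA value_addC value_add0 value_addN.

Let value_le_refl : reflexive value_le.
Proof. by elim/quotW=> a; rewrite pi_star_le star_le_refl. Qed.

Let value_le_anti : antisymmetric value_le.
Proof.
elim/quotW=> a; elim/quotW=> b; rewrite !pi_star_le => h.
exact/piP.
Qed.

Let value_le_trans : transitive value_le.
Proof.
elim/quotW=> b; elim/quotW=> a; elim/quotW=> c; rewrite !pi_star_le.
exact: star_le_trans.
Qed.

Let value_le_total : total value_le.
Proof.
elim/quotW=> a; elim/quotW=> b; rewrite !pi_star_le /star_le.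
have key (x : F) : `|x| <= 1 -> x \in convex_pred O.
  by rewrite ler_norml => /(convex_convex ON1 O1).
have [h|/ltW h] := leP `|val b / val a| 1; first by rewrite key.
rewrite (key (val a / val b)) ?orbT//.
by rewrite -invf_div normfV invf_le1// (lt_le_trans ltr01).
Qed.

HB.instance Definition _ := Order.isPOrder.Build ring_display valueGroup
  (fun x y => erefl (value_lt x y)) value_le_refl value_le_anti value_le_trans.
HB.instance Definition _ :=
  Order.POrder_isTotal.Build ring_display valueGroup value_le_total.

Lemma value_leD2l (x y z : valueGroup) : y <= z -> x + y <= x + z.
Proof.
elim/quotW: x => a; elim/quotW: y => b; elim/quotW: z => c.
change (value_le (cls b) (cls c) ->
  value_le (value_add (cls a) (cls b)) (value_add (cls a) (cls c))).
by rewrite -!pi_star_mul !pi_star_le => h; rewrite star_le_mul ?star_le_refl.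
Qed.

(* [None] is the value oo of 0. *)
Definition valuation (x : F) : option valueGroup :=
  omap cls (insub x).

Lemma valuation0 : valuation 0 = None.
Proof. by rewrite /valuation insubF ?eqxx. Qed.

Lemma valuationM (x y : F) (a b : valueGroup) :
  valuation x = Some a -> valuation y = Some b ->
  valuation (x * y) = Some (a + b).
Proof.
rewrite /valuation; case: insubP => //= u ux <- [<-].
case: insubP => //= w wy <- [<-].
rewrite insubT ?mulf_neq0 ?(valP u) ?(valP w)//= => h.
by congr Some; rewrite -[RHS]pi_star_mul; congr (cls _); apply: val_inj.
Qed.

Lemma valuation_ge0 (x : F) (a : valueGroup) :
  valuation x = Some a -> (x \in convex_pred O) = (- a <= 0).
Proof.
rewrite /valuation; case: insubP => //= u _ <- [<-].
change ((val u \in convex_pred O) = value_le (value_opp (cls u)) value_zero).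
by rewrite -pi_star_inv pi_star_le /star_le /= invrK mul1r.
Qed.

Lemma valuation_mono (x y : F) (a b : valueGroup) : 0 < y -> y <= x ->
  valuation x = Some a -> valuation y = Some b -> - b <= - a.
Proof.
rewrite /valuation => y0 yx; case: insubP => //= u _ ux [<-].
case: insubP => //= w _ wy [<-].
change (value_le (value_opp (cls w)) (value_opp (cls u))).
rewrite -!pi_star_inv pi_star_le /star_le /= invrK ux wy.
have x0 := lt_le_trans y0 yx.
apply: (convex_convex (a := -1) (b := 1)) => //; apply/andP; split.
  by rewrite (le_trans (lerN10 _))// mulr_ge0// ?invr_ge0 ltW.
by rewrite mulrC ler_pdivrMr// mul1r.
Qed.

(* (-v)(x); only used for x <> 0, the value at 0 is a default. *)
Definition oppval (x : F) : valueGroup := - odflt 0 (valuation x).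

End ValueGroup.

Notation mxpoly K n := (mpoly.mpoly (n * n) K).

Definition mxeval (K L : comNzRingType) (n : nat) (i : K -> L)
    (p : mxpoly K n) (x : 'M[L]_n) : L :=
  mpoly.mmap i (fun k => mxvec x 0 k) p.

Definition zeros (K L : comNzRingType) (n : nat) (i : K -> L)
    (P : seq (mxpoly K n)) : set 'M[L]_n :=
  [set x | forall p : mxpoly K n, p \in P -> mxeval i p x = 0].

(* A closed subset of SL_n over K is given by finitely many equations; these
   are its L-points. *)
Definition points (K L : comNzRingType) (n : nat) (i : K -> L)
    (P : seq (mxpoly K n)) : set 'M[L]_n :=
  [set x | \det x = 1 /\ zeros i P x].

(* Finite unions of sets {f_1 = ... = f_l = 0, g_1 > 0, ..., g_m > 0}. *)
Definition saformula (K : rcfType) (n : nat) :=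
  seq (seq (mxpoly K n) * seq (mxpoly K n)).

Definition sapoints (K L : rcfType) (n : nat) (i : K -> L)
    (f : saformula K n) : set 'M[L]_n :=
  [set x | exists2 c, c \in f & (forall p, p \in c.1 -> mxeval i p x = 0) /\
                                (forall p, p \in c.2 -> 0 < mxeval i p x)].

(* The L-extension of the subset V of M_n(M), semialgebraic and defined over
   K, where iM : K -> M and iL : K -> L. By the Tarski-Seidenberg transfer
   principle all formulas f describing V define the same subset of M_n(L). *)
Definition saext (K M L : rcfType) (n : nat) (iM : K -> M) (iL : K -> L)
    (V : set 'M[M]_n) : set 'M[L]_n :=
  [set x | exists2 f : saformula K n, V = sapoints iM f & sapoints iL f x].

Definition semialgebraic (K : rcfType) (n : nat) (V : set 'M[K]_n) :=
  exists f : saformula K n, V = sapoints idfun f.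

Definition closed_in (T : topologicalType) (V B : set T) :=
  exists2 C, closed C & B = V `&` C.

Definition saconnected (K : rcfType) (n : nat) (V : set 'M[K]_n) :=
  semialgebraic V /\
  forall B1 B2 : set 'M[K]_n, semialgebraic B1 -> semialgebraic B2 ->
    closed_in V B1 -> closed_in V B2 -> B1 `&` B2 = set0 -> B1 `|` B2 = V ->
    B1 = V \/ B2 = V.

Definition sacomponent (K : rcfType) (n : nat) (V : set 'M[K]_n) x :=
  [set y | exists W, [/\ W `<=` V, saconnected W, W x & W y]].

Section Groups.
Variables (C : comUnitRingType) (n : nat).
Implicit Types H N : set 'M[C]_n.

Definition subgroup H := [/\ H 1%:M,
  (forall g h, H g -> H h -> H (g *m h)) & (forall g, H g -> H (invmx g))].

Definition normalized N H :=
  forall g h, H g -> N h -> N (g *m h *m invmx g).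

Definition derived H : set 'M[C]_n :=
  [set x | forall D, subgroup D ->
     (forall g h, H g -> H h -> D (g *m h *m invmx g *m invmx h)) -> D x].

Definition solvable_set H := exists m, iter m derived H `<=` [set 1%:M].

Definition zclosed H := exists P : seq (mxpoly C n), H = zeros idfun P.

Definition zconnected H := forall Z1 Z2, zclosed Z1 -> zclosed Z2 ->
  H `<=` Z1 `|` Z2 -> H `&` Z1 `&` Z2 = set0 -> H `<=` Z1 \/ H `<=` Z2.

(* Trivial radical. *)
Definition semisimple H := forall N, N `<=` H -> zclosed N -> zconnected N ->
  subgroup N -> normalized N H -> solvable_set N -> N `<=` [set 1%:M].

End Groups.

Section Tori.
Variables (K : rcfType) (n : nat).
Implicit Types S T : seq (mxpoly K n).

Definition Cpoints S : set 'M[K[i]]_n := points (real_complex K) S.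

Definition in_Gm (r : nat) (t : 'rV[K[i]]_r) := forall j, t 0 j != 0.

(* Isomorphic over K to (G_m)^r for some r: the isomorphism phi has entries in
   K[t_1, ..., t_r, t_1^-1, ..., t_r^-1] and its inverse psi is polynomial in
   the matrix entries. *)
Definition split_torus T := subgroup (Cpoints T) /\
  exists (r : nat) (phi : 'I_n -> 'I_n -> mpoly.mpoly (r + r) K)
         (psi : 'I_r -> mxpoly K n),
  let f (t : 'rV[K[i]]_r) : 'M[K[i]]_n := \matrix_(i, j)
    mpoly.mmap (real_complex K)
      (fun k => row_mx t (map_mx (fun z => z^-1) t) 0 k) (phi i j) in
  let h (s : 'M[K[i]]_n) : 'rV[K[i]]_r :=
    \row_j mxeval (real_complex K) (psi j) s in
  [/\ forall t, in_Gm t -> Cpoints T (f t),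
      forall t t', in_Gm t -> in_Gm t' ->
        f (\row_j (t 0 j * t' 0 j)) = f t *m f t',
      forall s, Cpoints T s -> in_Gm (h s),
      forall t, in_Gm t -> h (f t) = t &
      forall s, Cpoints T s -> f (h s) = s].

Definition maximal_split_torus S G :=
  [/\ split_torus S, Cpoints S `<=` Cpoints G &
      forall T, split_torus T -> Cpoints T `<=` Cpoints G ->
        Cpoints S `<=` Cpoints T -> Cpoints T = Cpoints S].

Definition character S (q : mxpoly K n) :=
  let ev := mxeval (real_complex K) q in
  (forall s, Cpoints S s -> ev s != 0) /\
  (forall s t, Cpoints S s -> Cpoints S t -> ev (s *m t) = ev s * ev t).

End Tori.

Section Lie.
Variables (R : realType) (n : nat).

Definition expmx (X : 'M[R]_n) : 'M[R]_n :=
  \matrix_(i, j) limn (fun m => \sum_(k < m) (X ^+ k) i j / k`!%:R).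

Definition Lie (H : set 'M[R]_n) : set 'M[R]_n :=
  [set X | forall t : R, H (expmx (t *: X))].

Variables (fg : set 'M[R]_n) (fa : {vspace 'M[R]_n}).

Definition dual := 'Hom(subvs_of fa, R^o).

Definition rootspace (alpha : dual) : set 'M[R]_n :=
  [set X | fg X /\ forall H : subvs_of fa,
     vsval H *m X - X *m vsval H = alpha H *: X].

Definition rootset : set dual :=
  [set alpha | alpha != 0 /\ exists2 X, rootspace alpha X & X != 0].

Definition nneg_comb (Delta : seq dual) (beta : dual) :=
  exists c : 'I_(size Delta) -> nat, 
    beta = \sum_(i < size Delta) Delta`_i *+ c i.

Definition root_basis (Delta : seq dual) :=
  [/\ basis_of fullv Delta, (forall alpha, alpha \in Delta -> rootset alpha) &
      forall beta, rootset beta ->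
        nneg_comb Delta beta \/ nneg_comb Delta (- beta)].

Definition posroots (Delta : seq dual) : set dual :=
  [set beta | rootset beta /\ nneg_comb Delta beta].

End Lie.

Arguments rootset {R n} fg fa.

Section Building.
Variables (F : rcfType) (n : nat).
Implicit Types (x y g : 'M[F]_n) (GF KF UF AF Aplus : set 'M[F]_n).

Definition congact g x := g *m x *m g^T.

Definition orbit1 GF : set 'M[F]_n := [set congact g 1%:M | g in GF].

Definition SOset : set 'M[F]_n := [set g | g *m g^T = 1%:M /\ \det g = 1].

(* The exponential of a nilpotent n x n matrix. *)
Definition nilexp (X : 'M[F]_n) : 'M[F]_n :=
  \sum_(k < n) (k`!%:R)^-1 *: X ^+ k.

(* xget chooses the element a, unique by the Cartan decomposition. *)
Definition delta GF KF Aplus x y : 'M[F]_n :=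
  xget 1%:M [set a | Aplus a /\ exists g h k k',
    [/\ GF g, GF h, x = congact g 1%:M & y = congact h 1%:M] /\
    [/\ KF k, KF k' & invmx g *m h = k *m a *m k']].

(* The multiplicative N_F, given the root set and the values chi alpha a. *)
Definition Nmult (I : choiceType) (Sigma : set I) (chi : I -> 'M[F]_n -> F)
    (a : 'M[F]_n) : F :=
  \big[*%R/1]_(alpha \in Sigma) Num.max (chi alpha a) (chi alpha a)^-1.

(* xget chooses the point y, unique by the Iwasawa decomposition. *)
Definition rho UF AF KF x : 'M[F]_n :=
  xget 1%:M [set y | exists u a k,
    [/\ UF u, AF a & KF k] /\
    x = congact (u *m a *m k) 1%:M /\ y = congact a 1%:M].

(* exp of the sum of the subspaces V i, i in Sigma. *)
Definition expsum (I : choiceType) (Sigma : set I) (V : I -> set 'M[F]_n) :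
    set 'M[F]_n :=
  [set g | exists2 X : I -> 'M[F]_n, (forall i, Sigma i -> V i (X i)) &
                                     g = nilexp (\sum_(i \in Sigma) X i)].

End Building.

(* Main.v *)
Require Import Defs.
From HB Require Import structures.
From mathcomp Require Import all_boot all_order all_algebra.
From mathcomp Require Import complex polyrcf qe_rcf_th.
From mathcomp Require qe_rcf ordered_qelim.
From mathcomp Require Import (canonicals) mpoly.
From mathcomp Require Import boolp classical_sets functions cardinality fsbigop.
From mathcomp Require Import reals topology normedtype sequences exp.
From mathcomp Require Import ring lra.
Import numFieldNormedType.Exports.

(** The torus is simultaneously diagonalised over K: its points are the sums of
    t^e F_e with orthogonal idempotents F_e, so over the reals A is the
    exponential of a space of combinations of the F_e, which is maximal abelian
    among the symmetric matrices of the Lie algebra. Over the reals the Cartan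
    and Iwasawa decompositions follow by maximising and minimising traces on
    closed subsets of G. If u c lies in K b K with u unipotent and a, b, c in A,
    then tr(Q log c) is at most the maximum of tr(Q k (log b) k^T) over K, for
    all Q in the Lie algebra of A; choosing Q with tr(Q H) = sum of
    sign(alpha(log c)) alpha(H) bounds the sum of the |alpha(log c)| by that of
    the |alpha(log b)|, that is, N(c) <= N(b). Distances in G.Id involve
    u c = (u1 a1)^-1 (u2 a2) with c = a1^-1 a2. These statements are first-order
    with coefficients in K, hence hold over F by quantifier elimination. *)

Set Implicit Arguments.
Unset Strict Implicit.
Unset Printing Implicit Defensive.

Import Order.TTheory GRing.Theory Num.Theory.

Local Open Scope classical_set_scope.
Local Open Scope ring_scope.

(** * Quantifier elimination and transfer *)

(** Exponentials, Lie algebras and compactness are available over [R] only, the theorem lives over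
    [F], and the link between the two fields is [K]. So every object must be rewritten as a
    condition on matrices with coefficients in [K]: [A] by finitely many inequalities on the torus,
    a root space by the vanishing of blocks F_a X F_b together with [nilexp X] in the group, [N] on
    the dominant chamber by one polynomial. This is why the idempotents must have entries in [K],
    and why elimination must be uniform: one quantifier-free formula over [K] has to serve all
    extensions. Maximality of the torus speaks of tori over [K]; it is turned into a statement about
    a symmetric q commuting with the torus before it is carried to [R]. The trace bound is the
    linear half of Kostant's convexity theorem. The A-components add up along exp(X) = exp(X/N)^N,
    so a first-order estimate of one factor suffices. The bound is used twice: once as described,
    and once with u = 1 to compare an element of A with its dominant representative. *)

Module Q := qe_rcf.

(** * Compatibility of the elimination algorithm with a change of constants *)

Section Naturality.
Variables (K L : rcfType) (i : {rmorphism K -> L}).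

Fixpoint tmap (t : Q.term K) : Q.term L :=
  match t with
  | Q.Var x => Q.Var L x
  | Q.Const c => Q.Const (i c)
  | Q.NatConst k => Q.NatConst L k
  | Q.Add u v => Q.Add (tmap u) (tmap v)
  | Q.Opp u => Q.Opp (tmap u)
  | Q.NatMul u k => Q.NatMul (tmap u) k
  | Q.Mul u v => Q.Mul (tmap u) (tmap v)
  | Q.Exp u k => Q.Exp (tmap u) k
  end.

Fixpoint fmap (f : Q.formula K) : Q.formula L :=
  match f with
  | Q.Bool b => Q.Bool b
  | Q.Equal u v => Q.Equal (tmap u) (tmap v)
  | Q.Lt u v => Q.Lt (tmap u) (tmap v)
  | Q.Le u v => Q.Le (tmap u) (tmap v)
  | Q.And f g => Q.And (fmap f) (fmap g)
  | Q.Or f g => Q.Or (fmap f) (fmap g)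
  | Q.Implies f g => Q.Implies (fmap f) (fmap g)
  | Q.Not f => Q.Not (fmap f)
  end.

Notation pmap := (map tmap).
Implicit Types (p q r : Q.polyF K).

(** The algorithm is in continuation-passing style and tests coefficients only inside the formulas
    that it builds. Each stage therefore commutes with a change of constants as soon as its
    continuations do; the lemmas up to [fmap_CcountGt0] propagate this through all stages. *)
Lemma fmap_Size p k k' : (forall n, fmap (k n) = k' n) ->
  fmap (Q.Size p k) = Q.Size (pmap p) k'.
Proof.
elim: p k k' => [|c p IH] k k' kk' /=; first exact: kk'.
rewrite /Q.bind_def; apply: IH => -[|m] /=; last exact: kk'.
by rewrite !kk'.
Qed.

Lemma fmap_LeadCoef p k k' : (forall t, fmap (k t) = k' (tmap t)) ->
  fmap (Q.LeadCoef p k) = Q.LeadCoef (pmap p) k'.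
Proof.
elim: p k k' => [|c p IH] k k' kk' /=; first by rewrite kk' /= rmorph0.
by rewrite /Q.bind_def; apply: IH => l /=; rewrite !kk'.
Qed.

Lemma pmap_AmulXn a n : pmap (Q.AmulXn a n) = Q.AmulXn (tmap a) n.
Proof. by elim: n => //= n ->; rewrite rmorph0. Qed.

Lemma pmap_Add p q : pmap (Q.AddPoly p q) = Q.AddPoly (pmap p) (pmap q).
Proof. by elim: p q => [|a p IH] [|b q] //=; rewrite IH. Qed.

Lemma pmap_Scal c p : pmap (Q.ScalPoly c p) = Q.ScalPoly (tmap c) (pmap p).
Proof. by elim: p => //= a p ->. Qed.

Lemma pmap_Mul p q : pmap (Q.MulPoly p q) = Q.MulPoly (pmap p) (pmap q).
Proof. by elim: p => //= a p IH; rewrite pmap_Add pmap_Scal /= IH. Qed.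

Lemma pmap_Exp p n : pmap (Q.ExpPoly p n) = Q.ExpPoly (pmap p) n.
Proof.
case: n => // n; rewrite /Q.ExpPoly !iteropS.
by elim: n => //= n <-; rewrite pmap_Mul.
Qed.

Lemma pmap_Opp p : pmap (Q.OppPoly p) = Q.OppPoly (pmap p).
Proof. by rewrite /Q.OppPoly pmap_Scal /= rmorphN1. Qed.

Lemma pmap_NatMul n p : pmap (Q.NatMulPoly n p) = Q.NatMulPoly n (pmap p).
Proof. exact: pmap_Scal. Qed.

Lemma pmap_Deriv p : pmap (Q.Deriv p) = Q.Deriv (pmap p).
Proof. by elim: p => //= a p IH; rewrite pmap_Add /= IH. Qed.

Definition pmapE := (pmap_AmulXn, pmap_Add, pmap_Scal, pmap_Mul, pmap_Exp,
  pmap_Opp, pmap_NatMul, pmap_Deriv).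

Lemma fmap_Rediv p q k k' :
  (forall c qq r, fmap (k (c, qq, r)) = k' (c, pmap qq, pmap r)) ->
  fmap (Q.Rediv p q k) = Q.Rediv (pmap p) (pmap q) k'.
Proof.
move=> kk'; rewrite /Q.Rediv /Q.Isnull /Q.bind_def.
apply: fmap_Size => n; case: eqP => _; first by rewrite kk' /= rmorph0.
apply: fmap_Size => sq; apply: fmap_Size => sp; apply: fmap_LeadCoef => lq.
have -> : [:: Q.Const 0] = pmap [:: Q.Const 0] by rewrite /= rmorph0.
move: 0%N [:: Q.Const 0] p; elim: sp => [|m IH] c qq r /=.
  rewrite /Q.bind_def; apply: fmap_Size => sr; case: ltnP => _ //.
  by apply: fmap_LeadCoef => lr; rewrite kk' !pmapE.
rewrite /Q.bind_def; apply: fmap_Size => sr; case: ltnP => _ //.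
by apply: fmap_LeadCoef => lr; rewrite IH !pmapE.
Qed.

Lemma fmap_Rgcd_loop n p q k k' : (forall r, fmap (k r) = k' (pmap r)) ->
  fmap (Q.Rgcd_loop n p q k) = Q.Rgcd_loop n (pmap p) (pmap q) k'.
Proof.
elim: n p q k k' => [|n IH] p q k k' kk' /=; rewrite /Q.bind_def /Q.Rmod;
  apply: fmap_Rediv => _ _ r /=; apply: fmap_Size => m; case: eqP => _ //.
exact: IH.
Qed.

Lemma fmap_Rgcd p q k k' : (forall r, fmap (k r) = k' (pmap r)) ->
  fmap (Q.Rgcd p q k) = Q.Rgcd (pmap p) (pmap q) k'.
Proof.
move=> kk'; rewrite /Q.Rgcd /Q.LtSize /Q.bind_def.
apply: fmap_Size => n; apply: fmap_Size => m.
by case: ltnP => _; apply: fmap_Size => s; case: eqP => _ //;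
  apply: fmap_Size => s'; apply: fmap_Rgcd_loop.
Qed.

Lemma fmap_BigRgcd ps k k' : (forall r, fmap (k r) = k' (pmap r)) ->
  fmap (Q.BigRgcd ps k) = Q.BigRgcd (map pmap ps) k'.
Proof.
elim: ps k k' => [|p ps IH] k k' kk' /=; first by rewrite kk' /= rmorph0.
by rewrite /Q.bind_def; apply: IH => r; apply: fmap_Rgcd.
Qed.

Lemma fmap_Changes s k k' : (forall n, fmap (k n) = k' n) ->
  fmap (Q.Changes s k) = Q.Changes (map tmap s) k'.
Proof.
elim: s k k' => [|a s IH] k k' kk' /=; first exact: kk'.
rewrite /Q.bind_def; apply: IH => n; rewrite /= !kk'.
by case: s.
Qed.

Lemma fmap_SeqPInfty ps k k' : (forall s, fmap (k s) = k' (map tmap s)) ->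
  fmap (Q.SeqPInfty ps k) = Q.SeqPInfty (map pmap ps) k'.
Proof.
elim: ps k k' => [|p ps IH] k k' kk' /=; first by rewrite kk'.
rewrite /Q.bind_def; apply: fmap_LeadCoef => l.
by apply: IH => r; rewrite kk'.
Qed.

Lemma fmap_SeqMInfty ps k k' : (forall s, fmap (k s) = k' (map tmap s)) ->
  fmap (Q.SeqMInfty ps k) = Q.SeqMInfty (map pmap ps) k'.
Proof.
elim: ps k k' => [|p ps IH] k k' kk' /=; first by rewrite kk'.
rewrite /Q.bind_def; apply: fmap_LeadCoef => l; apply: fmap_Size => s.
by apply: IH => r; rewrite kk' /= rmorphN1.
Qed.

Lemma fmap_ChangesPoly ps k k' : (forall n, fmap (k n) = k' n) ->
  fmap (Q.ChangesPoly ps k) = Q.ChangesPoly (map pmap ps) k'.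
Proof.
move=> kk'; rewrite /Q.ChangesPoly /Q.bind_def.
apply: fmap_SeqMInfty => m; apply: fmap_SeqPInfty => p.
by apply: fmap_Changes => vm; apply: fmap_Changes => vp.
Qed.

Lemma fmap_NextMod p q k k' : (forall r, fmap (k r) = k' (pmap r)) ->
  fmap (Q.NextMod p q k) = Q.NextMod (pmap p) (pmap q) k'.
Proof.
move=> kk'; rewrite /Q.NextMod /Q.bind_def; apply: fmap_LeadCoef => l.
apply: fmap_Rediv => c _ _ /=; apply: fmap_Rediv => _ _ r /=.
by rewrite kk' pmap_Scal.
Qed.

Lemma fmap_ModsAux p q n k k' : (forall ps, fmap (k ps) = k' (map pmap ps)) ->
  fmap (Q.ModsAux p q n k) = Q.ModsAux (pmap p) (pmap q) n k'.
Proof.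
elim: n p q k k' => [|n IH] p q k k' kk' /=; first by rewrite kk'.
rewrite /Q.bind_def; apply: fmap_Size => m; case: eqP => _; first by rewrite kk'.
by apply: fmap_NextMod => r; apply: IH => ps; rewrite kk'.
Qed.

Lemma fmap_TaqR p q k k' : (forall n, fmap (k n) = k' n) ->
  fmap (Q.TaqR p q k) = Q.TaqR (pmap p) (pmap q) k'.
Proof.
move=> kk'; rewrite /Q.TaqR /Q.Mods /Q.bind_def -pmap_Deriv -pmap_Mul.
apply: fmap_Size => n; apply: fmap_Size => m.
by apply: fmap_ModsAux => r; apply: fmap_ChangesPoly.
Qed.

Lemma pmap_PolyComb (sq : seq (Q.polyF K)) sc :
  pmap (Q.PolyComb sq sc) = Q.PolyComb (map pmap sq) sc.
Proof.
rewrite /Q.PolyComb size_map.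
elim: (iota _ _) => //= a s IH; rewrite pmap_Mul IH pmap_Exp.
by congr (Q.MulPoly (Q.ExpPoly _ _) _); elim: sq a {IH} => [|? ? IH] [|a] //=.
Qed.

Lemma pmap_Pcq (sq : seq (Q.polyF K)) j :
  pmap (Q.Pcq sq j) = Q.Pcq (map pmap sq) j.
Proof.
rewrite /Q.Pcq size_map.
by elim: (sg_tab _) j => [|c s IH] [|j] //=; rewrite pmap_PolyComb.
Qed.

(** The coefficients are entries of the inverse of an integer matrix, so a ring morphism carries
    those of [K] to those of [L]. *)
Lemma rmorph_coefs n j : i (coefs K n j) = coefs L n j.
Proof.
have E a b : i ((castmx (erefl, exp3n n) (invmx (map_mx intr (ctmat n)))) a b)
    = castmx (erefl, exp3n n) (invmx (map_mx intr (ctmat n))) a b.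
  rewrite !castmxE; set M := map_mx intr (ctmat n) : 'M[K]__.
  have -> x y : i (invmx M x y) = map_mx i (invmx M) x y by rewrite mxE.
  rewrite map_invmx -map_mx_comp.
  by congr (invmx _ _ _); apply/matrixP => x y; rewrite !mxE /= rmorph_int.
rewrite /coefs; elim: (enum _) j => [|a s IH] [|j] //=; rewrite ?rmorph0 //.
Qed.

Lemma tmap_Coefs n j : tmap (Q.Coefs K n j) = Q.Coefs L n j.
Proof.
rewrite /Q.Coefs /=; case: n => [|[|n]]; last by rewrite rmorph_coefs.
  by rewrite rmorph_nat.
by congr Q.Const; case: j => [|[|[|j]]] /=; rewrite ?nth_nil ?fmorphV ?rmorph_nat ?rmorph0.
Qed.

Lemma fmap_TaqsR p sq j k k' : (forall t, fmap (k t) = k' (tmap t)) ->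
  fmap (Q.TaqsR p sq j k) = Q.TaqsR (pmap p) (map pmap sq) j k'.
Proof.
move=> kk'; rewrite /Q.TaqsR /Q.bind_def -pmap_Pcq.
by apply: fmap_TaqR => n; rewrite kk' /= rmorph_int.
Qed.

Lemma fmap_CcountWeak p sq k k' : (forall t, fmap (k t) = k' (tmap t)) ->
  fmap (Q.CcountWeak p sq k) = Q.CcountWeak (pmap p) (map pmap sq) k'.
Proof.
move=> kk'; rewrite /Q.CcountWeak size_map.
have -> : Q.NatConst L 0 = tmap (Q.NatConst K 0) by [].
elim: (3 ^ _)%N (Q.NatConst K 0) => [|m IH] s /=; first exact: kk'.
by rewrite /Q.bind_def; apply: fmap_TaqsR => t; rewrite IH -tmap_Coefs.
Qed.

Lemma fmap_CcountGt0 sp sq :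
  fmap (Q.CcountGt0 sp sq) = Q.CcountGt0 (map pmap sp) (map pmap sq).
Proof.
rewrite /Q.CcountGt0 /Q.bind_def.
apply: fmap_BigRgcd => p; apply: fmap_Size => n; case: eqP => _ /=.
  have bmap s : pmap (reducebig [:: Q.NatConst K 1] s
       (fun j => BigBody j (@Q.MulPoly K) true j)) =
     reducebig [:: Q.NatConst L 1] (map pmap s)
       (fun j => BigBody j (@Q.MulPoly L) true j).
    by elim: s => //= a s <-; rewrite pmap_Mul.
  rewrite /Q.BoundingPoly -bmap -pmap_Deriv.
  apply: fmap_CcountWeak => t /=; congr (Q.Or _ (Q.Or _ _)).
    elim: sq => //= q s <-; congr Q.And.
    exact: fmap_LeadCoef.
  elim: sq => //= q s <-; congr Q.And.
  by apply: fmap_Size => m; apply: fmap_LeadCoef.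
exact: fmap_CcountWeak.
Qed.

Lemma pmap_abstrX j t : pmap (Q.abstrX j t) = Q.abstrX j (tmap t).
Proof.
elim: t => //=.
- by move=> m; case: eqP.
- by move=> t <- u <-; rewrite pmapE.
- by move=> t <-; rewrite pmapE.
- by move=> t <- m; rewrite pmapE.
- by move=> t <- u <-; rewrite pmapE.
- by move=> t <- m; rewrite pmapE.
Qed.

End Naturality.

(** * Elimination of quantifiers, uniform in the extension field *)

Section UniformElimination.
Variable K : rcfType.
Implicit Types (f g : Q.formula K) (t : Q.term K).

(** Constants stay in [K] and are pushed along [i] only at evaluation, so that one syntactic object
    can be interpreted in all extensions. *)
Definition qeval (L : rcfType) (i : {rmorphism K -> L}) (e : seq L) t :=
  Q.eval e (tmap i t).
Definition qholds (L : rcfType) (i : {rmorphism K -> L}) (e : seq L) f :=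
  Q.qf_eval e (fmap i f).

Lemma qeval_ext (L : rcfType) (i : {rmorphism K -> L}) (e e' : seq L) t :
  (forall j, e`_j = e'`_j) -> qeval i e t = qeval i e' t.
Proof.
by move=> E; rewrite /qeval; elim: t => //= [t -> u ->|t ->|t -> m|t -> u ->|t -> m].
Qed.

Lemma qholds_ext (L : rcfType) (i : {rmorphism K -> L}) (e e' : seq L) f :
  (forall j, e`_j = e'`_j) -> qholds i e f = qholds i e' f.
Proof.
move=> E; rewrite /qholds; have T := fun t => qeval_ext i t E.
elim: f => //= [t u|t u|t u|f -> g ->|f -> g ->|f -> g ->|f ->] //;
  by rewrite -!/(qeval _ _ _) !T.
Qed.

Definition clause := (seq (Q.term K) * seq (Q.term K))%type.

Definition cholds (L : rcfType) (i : {rmorphism K -> L}) (e : seq L)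
    (c : clause) :=
  all (fun t => qeval i e t == 0) c.1 && all (fun t => 0 < qeval i e t) c.2.

Arguments cholds : simpl never.

Definition tsub t u := Q.Add t (Q.Opp u).
Definition clprod (c d : seq clause) : seq clause :=
  [seq (x.1 ++ y.1, x.2 ++ y.2) | x <- c, y <- d].
Definition clneg t u : seq clause := [:: ([::], [:: tsub u t])].

(** The boolean is the polarity: the result is a disjunctive normal form of the assertion that f has
    truth value b, and negation merely flips b. Clauses hold equations and strict inequalities only,
    the systems decided by [Q.CcountGt0]; [clneg t u] is the clause t < u. *)
Fixpoint dnf (b : bool) f : seq clause :=
  match f with
  | Q.Bool c => if c == b then [:: ([::], [::])] else [::]
  | Q.Equal t u => if b then [:: ([:: tsub t u], [::])]
                   else clneg t u ++ clneg u t
  | Q.Lt t u => if b then clneg t u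
                else ([:: tsub t u], [::]) :: clneg u t
  | Q.Le t u => if b then ([:: tsub t u], [::]) :: clneg t u
                else clneg u t
  | Q.And f g => if b then clprod (dnf b f) (dnf b g) else dnf b f ++ dnf b g
  | Q.Or f g => if b then dnf b f ++ dnf b g else clprod (dnf b f) (dnf b g)
  | Q.Implies f g => if b then dnf (~~ b) f ++ dnf b g
                     else clprod (dnf (~~ b) f) (dnf b g)
  | Q.Not f => dnf (~~ b) f
  end.

Lemma has_clprod (L : rcfType) (i : {rmorphism K -> L}) (e : seq L) c d :
  has (cholds i e) (clprod c d) = has (cholds i e) c && has (cholds i e) d.
Proof.
elim: c => //= x c IH; rewrite has_cat IH andb_orl; congr (_ || _).
elim: d {IH} => [|y d /= ->]; first by rewrite andbF.
by rewrite /= andb_orr {1}/cholds !all_cat /=; congr (_ || _); rewrite andbACA.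
Qed.

Lemma dnfP (L : rcfType) (i : {rmorphism K -> L}) (e : seq L) b f :
  has (cholds i e) (dnf b f) = (qholds i e f == b).
Proof.
have lt t u : cholds i e ([::], [:: tsub u t]) = (qeval i e t < qeval i e u).
  by rewrite /cholds /= andbT /qeval /= subr_gt0.
have eq t u : cholds i e ([:: tsub t u], [::]) = (qeval i e t == qeval i e u).
  by rewrite /cholds /= !andbT /qeval /= subr_eq0.
rewrite /qholds; elim: f b => /=.
- by do 2!case.
- move=> t u []; rewrite /= ?eq ?lt ?orbF -!/(qeval _ _ _) ?eqb_id //.
  by rewrite -neq_lt eqbF_neg.
- move=> t u []; rewrite /= ?eq ?lt ?orbF -!/(qeval _ _ _) ?eqb_id //.
  by rewrite eqbF_neg -leNgt le_eqVlt eq_sym.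
- move=> t u []; rewrite /= ?eq ?lt ?orbF -!/(qeval _ _ _) ?eqb_id //.
    by rewrite le_eqVlt.
  by rewrite eqbF_neg -ltNge.
- by move=> f Hf g Hg []; rewrite ?has_clprod ?has_cat Hf Hg;
    case: (Q.qf_eval _ _); case: (Q.qf_eval _ _).
- by move=> f Hf g Hg []; rewrite ?has_clprod ?has_cat Hf Hg;
    case: (Q.qf_eval _ _); case: (Q.qf_eval _ _).
- by move=> f Hf g Hg []; rewrite ?has_clprod ?has_cat /= Hf Hg;
    case: (Q.qf_eval _ _); case: (Q.qf_eval _ _).
- by move=> f Hf []; rewrite Hf; case: (Q.qf_eval _ _).
Qed.

Definition elim1 j f : Q.formula K :=
  foldr (fun c => Q.Or (Q.CcountGt0 (map (Q.abstrX j) c.1)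
                                    (map (Q.abstrX j) c.2)))
        (Q.Bool false) (dnf true f).

Lemma elim1P (L : rcfType) (i : {rmorphism K -> L}) (e : seq L) j f :
  qholds i e (elim1 j f) <-> exists x, qholds i (set_nth 0 e j x) f.
Proof.
have -> : (exists x, qholds i (set_nth 0 e j x) f) <->
    (exists x, has (cholds i (set_nth 0 e j x)) (dnf true f)).
  by split=> -[x] h; exists x; move: h; rewrite dnfP eqb_id.
rewrite /elim1; elim: (dnf true f) => [|c s IH]; first by split=> // -[].
rewrite /qholds [fmap i _]/= fmap_CcountGt0 [Q.qf_eval _ _]/= Q.eval_CcountGt0.
rewrite -!map_comp -/(qholds i e _).
have E t x : (Q.eval_poly e (map (tmap i) (Q.abstrX j t))).[x] =
    qeval i (set_nth 0 e j x) t by rewrite pmap_abstrX Q.abstrXP.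
split.
- case/orP => [/ccount_gt0P[x]|/IH[x h]]; last by exists x; rewrite /= h orbT.
  rewrite !big_map !big_all => h; exists x; apply/orP; left.
  rewrite /cholds; move: h; congr (is_true (_ && _)); apply: eq_all => t /=;
    by rewrite E.
- case=> x /orP[h|h]; apply/orP; [left|right; apply/IH; by exists x].
  apply/ccount_gt0P; exists x; rewrite !big_map !big_all.
  move: h; rewrite /cholds; congr (is_true (_ && _)); apply: eq_all => t /=;
    by rewrite E.
Qed.

Fixpoint elimn m f := if m is m'.+1 then elimn m' (elim1 m' f) else f.

Lemma elimnP (L : rcfType) (i : {rmorphism K -> L}) (e : seq L) m f :
  qholds i e (elimn m f) <->
  exists2 e', (forall j, (m <= j)%N -> e'`_j = e`_j) & qholds i e' f.
Proof.
elim: m e f => [|m IH] e f /=.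
  split=> [h|[e' E]]; first by exists e.
  by rewrite (qholds_ext i f (e' := e)) // => j; apply: E.
rewrite IH; split=> -[e' E].
  case/elim1P => x h; exists (set_nth 0 e' m x) => // j mj.
  by rewrite nth_set_nth /= gtn_eqF // E // ltnW.
move=> h; exists (set_nth 0 e' m e`_m) => [j mj|].
  by rewrite nth_set_nth /=; case: eqP => [->//|/eqP jm]; rewrite E // ltn_neqAle eq_sym jm.
apply/elim1P; exists (e'`_m).
rewrite (qholds_ext i f (e' := e')) // => j; rewrite !nth_set_nth /=.
by rewrite nth_set_nth /=; case: eqP => [->|].
Qed.

Fixpoint tsubst (s : nat -> Q.term K) t :=
  match t with
  | Q.Var x => s x
  | Q.Const c => Q.Const c
  | Q.NatConst k => Q.NatConst K k
  | Q.Add u v => Q.Add (tsubst s u) (tsubst s v)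
  | Q.Opp u => Q.Opp (tsubst s u)
  | Q.NatMul u k => Q.NatMul (tsubst s u) k
  | Q.Mul u v => Q.Mul (tsubst s u) (tsubst s v)
  | Q.Exp u k => Q.Exp (tsubst s u) k
  end.

Fixpoint fsubst s f :=
  match f with
  | Q.Bool b => Q.Bool b
  | Q.Equal u v => Q.Equal (tsubst s u) (tsubst s v)
  | Q.Lt u v => Q.Lt (tsubst s u) (tsubst s v)
  | Q.Le u v => Q.Le (tsubst s u) (tsubst s v)
  | Q.And f g => Q.And (fsubst s f) (fsubst s g)
  | Q.Or f g => Q.Or (fsubst s f) (fsubst s g)
  | Q.Implies f g => Q.Implies (fsubst s f) (fsubst s g)
  | Q.Not f => Q.Not (fsubst s f)
  end.

Lemma fsubstP (L : rcfType) (i : {rmorphism K -> L}) (e e' : seq L) s f :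
  (forall x, qeval i e (s x) = e'`_x) ->
  qholds i e (fsubst s f) = qholds i e' f.
Proof.
move=> E; rewrite /qholds.
have T t : Q.eval e (tmap i (tsubst s t)) = Q.eval e' (tmap i t).
  by elim: t => //= [t -> u ->|t ->|t -> m|t -> u ->|t -> m].
by elim: f => //= [t u|t u|t u|f -> g ->|f -> g ->|f -> g ->|f ->] //;
  rewrite !T.
Qed.

Fixpoint qsum (s : seq (Q.term K)) :=
  if s is t :: s then Q.Add t (qsum s) else Q.NatConst K 0.
Fixpoint qprod (s : seq (Q.term K)) :=
  if s is t :: s then Q.Mul t (qprod s) else Q.NatConst K 1.

Lemma qeval_sum (L : rcfType) (i : {rmorphism K -> L}) e I (s : seq I) F :
  qeval i e (qsum (map F s)) = \sum_(x <- s) qeval i e (F x).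
Proof.
elim: s => [|x s IH]; rewrite ?big_nil ?big_cons //.
by rewrite -IH.
Qed.

Lemma qeval_prod (L : rcfType) (i : {rmorphism K -> L}) e I (s : seq I) F :
  qeval i e (qprod (map F s)) = \prod_(x <- s) qeval i e (F x).
Proof.
elim: s => [|x s IH]; rewrite ?big_nil ?big_cons //.
by rewrite -IH.
Qed.

End UniformElimination.

(** * First-order formulas in matrix variables, and transfer *)

Section MatrixFormulas.
Variables (K : rcfType) (n : nat).

(* Variables are de Bruijn indices into a list of matrices. [MSub f ts] replaces
   all variables of f by ts. *)
Inductive mterm :=
| MVar of nat
| MConst of 'M[K]_n
| MAdd of mterm & mterm
| MMul of mterm & mterm
| MTr of mterm
| MScale of K & mterm.

Inductive mform :=
| MTrue
| MEq of mterm & mterm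
| MZero of mxpoly K n & mterm
| MPos of mxpoly K n & mterm
| MAnd of mform & mform
| MImp of mform & mform
| MNot of mform
| MAll of mform
| MEx of mform
| MSub of mform & seq mterm.

Fixpoint meval (L : rcfType) (i : {rmorphism K -> L}) (ms : seq 'M[L]_n) t
    : 'M[L]_n :=
  match t with
  | MVar k => nth 0 ms k
  | MConst C => map_mx i C
  | MAdd t u => meval i ms t + meval i ms u
  | MMul t u => meval i ms t *m meval i ms u
  | MTr t => (meval i ms t)^T
  | MScale c t => i c *: meval i ms t
  end.

Fixpoint mholds (L : rcfType) (i : {rmorphism K -> L}) (ms : seq 'M[L]_n) f
    : Prop :=
  match f with
  | MTrue => True
  | MEq t u => meval i ms t = meval i ms u
  | MZero p t => mxeval i p (meval i ms t) = 0
  | MPos p t => 0 < mxeval i p (meval i ms t)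
  | MAnd f g => mholds i ms f /\ mholds i ms g
  | MImp f g => mholds i ms f -> mholds i ms g
  | MNot f => ~ mholds i ms f
  | MAll f => forall M, mholds i (M :: ms) f
  | MEx f => exists M, mholds i (M :: ms) f
  | MSub f ts => mholds i (map (meval i ms) ts) f
  end.

Definition mflat (L : rcfType) (ms : seq 'M[L]_n) : seq L :=
  flatten [seq [seq mxvec M 0 l | l <- enum 'I_(n * n)] | M <- ms].

Lemma nth_block (T U : Type) (x0 : U) (y0 : T) (g : T -> 'I_(n * n) -> U)
  ms k (l : 'I_(n * n)) : (forall l, g y0 l = x0) ->
  nth x0 (flatten [seq [seq g M l | l <- enum 'I_(n * n)] | M <- ms])
      (k * (n * n) + l)%N = g (nth y0 ms k) l.
Proof.
move=> gy; elim: ms k => [|M ms IH] k /=; first by rewrite !nth_nil gy.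
rewrite nth_cat size_map size_enum_ord; case: k => [|k].
  rewrite mul0n add0n ltn_ord (nth_map l) ?size_enum_ord //.
  by rewrite nth_ord_enum.
by rewrite mulSn -addnA -ltn_subRL subnn ltn0 addKn IH.
Qed.

Lemma nth_mflat (L : rcfType) (ms : seq 'M[L]_n) k (l : 'I_(n * n)) :
  nth 0 (mflat ms) (k * (n * n) + l)%N = mxvec (nth 0 ms k) 0 l.
Proof. by apply: nth_block => ?; rewrite linear0 mxE. Qed.

Fixpoint mentry t (a b : 'I_n) : Q.term K :=
  match t with
  | MVar k => Q.Var K (k * (n * n) + mxvec_index a b)%N
  | MConst C => Q.Const (C a b)
  | MAdd t u => Q.Add (mentry t a b) (mentry u a b)
  | MMul t u => qsum [seq Q.Mul (mentry t a c) (mentry u c b) | c <- enum 'I_n]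
  | MTr t => mentry t b a
  | MScale c t => Q.Mul (Q.Const c) (mentry t a b)
  end.

Lemma qeval_mentry (L : rcfType) (i : {rmorphism K -> L}) ms t a b :
  qeval i (mflat ms) (mentry t a b) = meval i ms t a b.
Proof.
elim: t a b => [k|C|t IHt u IHu|t IHt u IHu|t IH|c t IH] a b /=.
- by rewrite -mxvecE; have h := nth_mflat ms k (mxvec_index a b); refine h.
- by rewrite mxE.
- by rewrite mxE -IHt -IHu.
- rewrite qeval_sum mxE big_enum; apply: eq_bigr => c _.
  by rewrite -IHt -IHu.
- by rewrite mxE IH.
- by rewrite mxE -IH.
Qed.

Definition mcoord t (l : 'I_(n * n)) : Q.term K :=
  mxvec (\matrix_(a, b) mentry t a b) 0 l.

Lemma qeval_mcoord (L : rcfType) (i : {rmorphism K -> L}) ms t l :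
  qeval i (mflat ms) (mcoord t l) = mxvec (meval i ms t) 0 l.
Proof.
by rewrite /mcoord; case/mxvec_indexP: l => a b; rewrite !mxvecE mxE qeval_mentry.
Qed.

Definition mpoly_term (p : mxpoly K n) (T : 'I_(n * n) -> Q.term K) :=
  qsum [seq Q.Mul (Q.Const (mpoly.mcoeff m p))
     (qprod [seq Q.Exp (T l) (mpoly.fun_of_multinom m l) | l <- enum 'I_(n * n)]) | m <- mpoly.msupp p].

Lemma qeval_mpoly_term (L : rcfType) (i : {rmorphism K -> L}) e p T :
  qeval i e (mpoly_term p T) = mpoly.mmap i (fun l => qeval i e (T l)) p.
Proof.
rewrite qeval_sum /mpoly.mmap; apply: eq_bigr => m _.
by rewrite /mpoly.mmap1 {1}/qeval /= -/(qeval _ _ _) qeval_prod big_enum.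
Qed.

Definition mterms_nth (ts : seq mterm) (x : nat) : Q.term K :=
  nth (Q.NatConst K 0)
    (flatten [seq [seq mcoord t l | l <- enum 'I_(n * n)] | t <- ts]) x.

(** A quantified matrix occupies the variables 0, ..., n^2 - 1. After [elimn] the truth value no
    longer depends on them, so 0 may be substituted there; the other variables are shifted down by
    one block. Universal quantifiers go through negation. *)
Fixpoint mform_qf (f : mform) : Q.formula K :=
  match f with
  | MTrue => Q.Bool true
  | MEq t u => foldr (fun l => Q.And (Q.Equal (mcoord t l) (mcoord u l)))
                     (Q.Bool true) (enum 'I_(n * n))
  | MZero p t => Q.Equal (mpoly_term p (mcoord t)) (Q.NatConst K 0)
  | MPos p t => Q.Lt (Q.NatConst K 0) (mpoly_term p (mcoord t))
  | MAnd f g => Q.And (mform_qf f) (mform_qf g)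
  | MImp f g => Q.Implies (mform_qf f) (mform_qf g)
  | MNot f => Q.Not (mform_qf f)
  | MAll f => Q.Not (fsubst (fun x => if (x < n * n)%N then Q.NatConst K 0
                                      else Q.Var K (x - n * n)%N)
                       (elimn (n * n) (Q.Not (mform_qf f))))
  | MEx f => fsubst (fun x => if (x < n * n)%N then Q.NatConst K 0
                              else Q.Var K (x - n * n)%N)
               (elimn (n * n) (mform_qf f))
  | MSub f ts => fsubst (mterms_nth ts) (mform_qf f)
  end.

Lemma qholds_exists (L : rcfType) (i : {rmorphism K -> L}) ms f :
  qholds i (mflat ms) (fsubst (fun x => if (x < n * n)%N then Q.NatConst K 0
                              else Q.Var K (x - n * n)%N) (elimn (n * n) f)) <->
  exists M, qholds i (mflat (M :: ms)) f.
Proof.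
have sz (M : 'M[L]_n) : size [seq mxvec M 0 l | l <- enum 'I_(n * n)] = (n * n)%N.
  by rewrite size_map size_enum_ord.
rewrite (fsubstP (e' := nseq (n * n) 0 ++ mflat ms)) => [|x]; last first.
  by rewrite nth_cat size_nseq nth_nseq; case: ltnP.
split=> [/elimnP[e' E h]|[M h]].
  exists (vec_mx (\row_l e'`_l)); move: h.
  rewrite (qholds_ext i f (e' := mflat (vec_mx (\row_l e'`_l) :: ms))) // => j.
  rewrite /mflat /= nth_cat sz; case: ltnP => jn; last first.
    by rewrite E // nth_cat size_nseq ltnNge jn.
  rewrite (nth_map (Ordinal jn)) ?size_enum_ord // vec_mxK mxE.
  by rewrite (nth_ord_enum (Ordinal jn) (Ordinal jn)).
apply/elimnP; exists (mflat (M :: ms)) => // j jn.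
by rewrite /mflat /= !nth_cat sz size_nseq ltnNge jn.
Qed.

Lemma mform_qfP (L : rcfType) (i : {rmorphism K -> L}) ms f :
  mholds i ms f <-> qholds i (mflat ms) (mform_qf f).
Proof.
elim: f ms => [|t u|p t|p t|f IHf g IHg|f IHf g IHg|f IHf|f IHf|f IHf|f IHf ts] ms /=.
- by [].
- transitivity (all (fun l => mxvec (meval i ms t) 0 l == mxvec (meval i ms u) 0 l)
    (enum 'I_(n * n))).
    split=> [->|/allP h]; first by apply/allP => l _.
    apply: (can_inj mxvecK); apply/rowP => l; apply/eqP/h.
    by rewrite mem_enum.
  elim: (enum _) => //= l s IH; rewrite /qholds /= -!/(qeval _ _ _) !qeval_mcoord.
  by split=> /andP[-> /IH].
- rewrite /qholds /= -!/(qeval _ _ _) qeval_mpoly_term.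
  have -> : mpoly.mmap i (fun l => qeval i (mflat ms) (mcoord t l)) p =
      mxeval i p (meval i ms t).
    by rewrite /mxeval; congr (mpoly.mmap _ _ _); apply: funext => l; rewrite qeval_mcoord.
  by split=> /eqP.
- rewrite /qholds /= -!/(qeval _ _ _) qeval_mpoly_term.
  suff -> : mpoly.mmap i (fun l => qeval i (mflat ms) (mcoord t l)) p =
      mxeval i p (meval i ms t) by [].
  by rewrite /mxeval; congr (mpoly.mmap _ _ _); apply: funext => l; rewrite qeval_mcoord.
- rewrite IHf IHg /qholds /=; split=> [[-> ->]|/andP[]] //.
- rewrite IHf IHg /qholds /=; split=> [h|/implyP] //; exact/implyP.
- rewrite IHf /qholds /=; split=> [/negP|/negP] //.
- rewrite /qholds /= -/(qholds _ _ _); split=> [h|/negP h M].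
    by apply/negP => /qholds_exists[M]; rewrite /qholds /= => /negP; apply; apply/IHf/h.
  apply/IHf; apply: contrapT => h'; apply: h; apply/qholds_exists; exists M.
  by rewrite /qholds /=; apply/negP.
- split=> [[M /IHf h]|/qholds_exists[M /IHf h]]; last by exists M.
  by apply/qholds_exists; exists M.
- rewrite IHf (fsubstP (e' := mflat (map (meval i ms) ts))) // => x.
  rewrite /mterms_nth.
  have nthE (l : seq (Q.term K)) y : qeval i (mflat ms) (nth (Q.NatConst K 0) l y) =
      nth 0 (map (qeval i (mflat ms)) l) y by elim: l y => [|? l IH] [|y] /=.
  rewrite nthE map_flatten -map_comp /mflat -map_comp; congr (nth 0 (flatten _) x).
  by apply: eq_map => t /=; rewrite -map_comp; apply: eq_map => l; apply: qeval_mcoord.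
Qed.

(** Nonnegative elements of a real closed field are squares and morphisms preserve squares; hence
    every ring morphism between such fields is an order embedding. *)
Lemma rmorph_ge0 (L L' : rcfType) (i : {rmorphism L -> L'}) x :
  (0 <= i x) = (0 <= x).
Proof.
have pos y : 0 <= y -> 0 <= i y.
  by move=> y0; rewrite -(sqr_sqrtr y0) rmorphXn /= sqr_ge0.
apply/idP/idP; last exact: pos.
apply: contraLR; rewrite -!ltNge => x0; rewrite lt_neqAle fmorph_eq0 lt_eqF //=.
by rewrite -oppr_ge0 -rmorphN pos // oppr_ge0 ltW.
Qed.

Lemma rmorph_le (L L' : rcfType) (i : {rmorphism L -> L'}) x y :
  (i x <= i y) = (x <= y).
Proof. by rewrite -subr_ge0 -rmorphB rmorph_ge0 subr_ge0. Qed.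

Lemma rmorph_lt (L L' : rcfType) (i : {rmorphism L -> L'}) x y :
  (i x < i y) = (x < y).
Proof. by rewrite !ltNge rmorph_le. Qed.

(** After elimination the formula is evaluated in the empty environment, where variables take the
    default value 0. Its atoms then compare elements of [K], and [i] preserves these comparisons. *)
Lemma transfer_base (L : rcfType) (i : {rmorphism K -> L}) f :
  mholds i [::] f <-> mholds [the {rmorphism K -> K} of idfun] [::] f.
Proof.
rewrite !mform_qfP /mflat /=; move: (mform_qf f) => {}f.
have T t : Q.eval [::] (tmap i t) = i (Q.eval [::] (tmap idfun t)).
  elim: t => //= [x|m|t -> u ->|t ->|t -> m|t -> u ->|t -> m].
  - by rewrite !nth_nil rmorph0.
  - by rewrite rmorph_nat.
  - by rewrite rmorphD.
  - by rewrite rmorphN.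
  - by rewrite rmorphMn.
  - by rewrite rmorphM.
  - by rewrite rmorphXn.
suff -> : qholds i [::] f = qholds [the {rmorphism K -> K} of idfun] [::] f by [].
rewrite /qholds; elim: f => //= [t u|t u|t u|f -> g ->|f -> g ->|f -> g ->|f ->] //.
- by rewrite !T (inj_eq (fmorph_inj _)).
- by rewrite !T rmorph_lt.
- by rewrite !T rmorph_le.
Qed.

Lemma transfer (L L' : rcfType) (i : {rmorphism K -> L}) (i' : {rmorphism K -> L'}) f :
  mholds i [::] f -> mholds i' [::] f.
Proof. by move=> /transfer_base h; apply/transfer_base. Qed.

Definition mset (f : mform) (L : rcfType) (i : {rmorphism K -> L}) : set 'M[L]_n :=
  [set x | mholds i [:: x] f].

End MatrixFormulas.

(** * Semialgebraic extensions *)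

Section SemialgebraicExtension.
Variables (K : rcfType) (n : nat).

Fixpoint term_mpoly (t : Q.term K) : mxpoly K n :=
  match t with
  | Q.Var x => if insub x is Some l then mpoly.mpolyX K (mpoly.mnm1 l) else 0
  | Q.Const c => mpoly.mpolyC (n * n) c
  | Q.NatConst k => k%:R
  | Q.Add u v => term_mpoly u + term_mpoly v
  | Q.Opp u => - term_mpoly u
  | Q.NatMul u k => term_mpoly u *+ k
  | Q.Mul u v => term_mpoly u * term_mpoly v
  | Q.Exp u k => term_mpoly u ^+ k
  end.

Lemma mxeval_term (L : rcfType) (i : {rmorphism K -> L}) (x : 'M[L]_n) t :
  mxeval i (term_mpoly t) x = qeval i (mflat [:: x]) t.
Proof.
rewrite /mxeval; elim: t => /=.
- move=> j; case: insubP => [l _ <-|jn].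
    by rewrite mpoly.mmapX mpoly.mmap1U /qeval /= -[nat_of_ord l]add0n (nth_mflat [:: x] 0).
  rewrite rmorph0 /qeval /= nth_default // /mflat /= cats0 size_map size_enum_ord.
  by rewrite leqNgt.
- by move=> c; rewrite mpoly.mmapC.
- by move=> k; rewrite rmorph_nat.
- by move=> t IHt u IHu; rewrite rmorphD /= IHt IHu.
- by move=> t IHt; rewrite rmorphN /= IHt.
- by move=> t IHt k; rewrite rmorphMn /= IHt.
- by move=> t IHt u IHu; rewrite rmorphM /= IHt IHu.
- by move=> t IHt k; rewrite rmorphXn /= IHt.
Qed.

(** The point is the order of the quantifiers: one list of polynomials describes the set in all
    extensions. *)
Lemma mset_sapoints (f : mform K n) : exists s : saformula K n,
  forall (L : rcfType) (i : {rmorphism K -> L}), sapoints i s = mset f i.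
Proof.
exists [seq (map term_mpoly c.1, map term_mpoly c.2) | c <- dnf true (mform_qf f)].
move=> L i; apply/seteqP; rewrite /sapoints /mset.
suff E x : (exists2 c, c \in [seq (map term_mpoly c.1, map term_mpoly c.2)
        | c <- dnf true (mform_qf f)] & (forall p, p \in c.1 -> mxeval i p x = 0) /\
          (forall p, p \in c.2 -> 0 < mxeval i p x)) <-> mholds i [:: x] f.
  by split=> x /E.
rewrite mform_qfP -[qholds _ _ _]eqb_id -dnfP; elim: (dnf _ _) => [|c s IH] /=.
  by split=> // -[].
have all_map (A : pred L) (l : seq (Q.term K)) :
    (forall p, p \in map term_mpoly l -> A (mxeval i p x)) <->
    all (fun t => A (qeval i (mflat [:: x]) t)) l.
  elim: l => //= t l IHl; rewrite -mxeval_term; split=> [h|/andP[At /IHl h] p].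
    rewrite h ?mem_head //; apply/IHl => p pl; apply: h.
    by rewrite inE pl orbT.
  by rewrite inE => /predU1P[->|/h].
have cE : cholds i (mflat [:: x]) c <->
    (forall p, p \in map term_mpoly c.1 -> mxeval i p x = 0) /\
    (forall p, p \in map term_mpoly c.2 -> 0 < mxeval i p x).
  split=> [/andP[/(all_map (eq_op^~ 0)) h1 /(all_map (fun y => 0 < y)) h2]|[h1 h2]].
    by split=> // p /h1 /eqP.
  apply/andP; split; first by apply/(all_map (eq_op^~ 0)) => p /h1/eqP.
  exact/(all_map (fun y => 0 < y)).
split=> [[d]|/orP[/cE h|/IH[d ds h]]].
- rewrite inE => /predU1P[->/cE -> //|ds h]; apply/orP; right.
  by apply/IH; exists d.
- by exists (map term_mpoly c.1, map term_mpoly c.2); rewrite ?mem_head.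
- by exists d => //; rewrite inE ds orbT.
Qed.

Definition mconj (I : Type) (s : seq I) (F : I -> mform K n) : mform K n :=
  foldr (fun x => MAnd (F x)) (MTrue K n) s.

Lemma mholds_conj (I : eqType) (s : seq I) (F : I -> mform K n)
    (L : rcfType) (i : {rmorphism K -> L}) ms :
  mholds i ms (mconj s F) <-> forall x, x \in s -> mholds i ms (F x).
Proof.
elim: s => [|x s IH] /=; first by split.
rewrite IH; split=> [[Fx Fs] y|h].
  by rewrite inE => /predU1P[->|/Fs].
by split=> [|y ys]; apply: h; rewrite inE ?eqxx ?ys ?orbT.
Qed.

Lemma sapoints_mset (s : saformula K n) : exists f : mform K n,
  forall (L : rcfType) (i : {rmorphism K -> L}), sapoints i s = mset f i.
Proof.
pose cf (c : seq (mxpoly K n) * seq (mxpoly K n)) : mform K n :=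
  MAnd (mconj c.1 (fun p => MZero p (MVar K n 0)))
       (mconj c.2 (fun p => MPos p (MVar K n 0))).
exists (MNot (mconj s (fun c => MNot (cf c)))) => L i.
apply/seteqP; split=> x /=.
  case=> c cs [c1 c2] /mholds_conj /(_ c cs); apply.
  by split; apply/mholds_conj.
move=> h; apply: contrapT => h'; apply: h; apply/mholds_conj => c cs /= [].
move=> /mholds_conj c1 /mholds_conj c2; apply: h'.
by exists c.
Qed.

Lemma mset_transfer (f g : mform K n) (L L' : rcfType) (i : {rmorphism K -> L})
    (i' : {rmorphism K -> L'}) : mset f i `<=` mset g i -> mset f i' `<=` mset g i'.
Proof.
move=> h; apply: (@transfer _ _ _ _ i i' (MAll (MImp f g))) => M; exact: h.
Qed.

(** Any other description of the same subset over [M] agrees with f there; this agreement is a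
    sentence over [K], so it persists over [L]. *)
Lemma saext_mset (M L : rcfType) (iM : {rmorphism K -> M}) (iL : {rmorphism K -> L})
    (f : mform K n) : saext iM iL (mset f iM) = mset f iL.
Proof.
apply/seteqP; split=> x; last first.
  have [s sE] := mset_sapoints f.
  by move=> fx; exists s; rewrite sE.
case=> s; have [g gE] := sapoints_mset s; rewrite !gE => fg.
by apply: (@mset_transfer _ _ _ _ iM); rewrite fg.
Qed.

End SemialgebraicExtension.

Section GenericMatrix.
Variables (K L : comNzRingType) (n : nat) (i : {rmorphism K -> L}) (x : 'M[L]_n).
Implicit Types p q : mxpoly K n.

Definition genericmx : 'M[mxpoly K n]_n :=
  \matrix_(a, b) mpoly.mpolyX K (mpoly.mnm1 (mxvec_index a b)).

Lemma mxevalB p q : mxeval i (p - q) x = mxeval i p x - mxeval i q x.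
Proof. exact: rmorphB. Qed.
Lemma mxevalM p q : mxeval i (p * q) x = mxeval i p x * mxeval i q x.
Proof. exact: rmorphM. Qed.
Lemma mxeval1 : mxeval i (1 : mxpoly K n) x = 1.
Proof. exact: rmorph1. Qed.
Lemma mxevalC c : mxeval i (mpoly.mpolyC (n * n) c) x = i c.
Proof. exact: mpoly.mmapC. Qed.
Lemma mxeval_prod I (s : seq I) P (F : I -> mxpoly K n) :
  mxeval i (\prod_(k <- s | P k) F k) x = \prod_(k <- s | P k) mxeval i (F k) x.
Proof. exact: rmorph_prod. Qed.

(** Made a ring morphism so that determinant, trace and adjugate of the generic matrix become
    polynomials with the expected values at x. *)
Definition mxev (p : mxpoly K n) : L := mxeval i p x.
HB.instance Definition _ :=
  GRing.RMorphism.copy mxev (mpoly.mmap i (fun k => mxvec x 0 k)).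

Lemma mxev_generic : map_mx mxev genericmx = x.
Proof.
apply/matrixP => a b; rewrite !mxE /mxev /mxeval mpoly.mmapX mpoly.mmap1U.
by rewrite mxvecE.
Qed.

Lemma mxev_const m (P : 'M[K]_(n, m)) :
  map_mx mxev (map_mx (@mpoly.mpolyC (n * n) K) P) = map_mx i P.
Proof. by apply/matrixP => a b; rewrite !mxE /mxev mxevalC. Qed.

Lemma mxev_const_sq (P : 'M[K]_n) :
  map_mx mxev (map_mx (@mpoly.mpolyC (n * n) K) P) = map_mx i P.
Proof. exact: mxev_const. Qed.

End GenericMatrix.

(** * Characters and symmetric matrices *)

Section Characters.
Variables (X : Type) (op : X -> X -> X) (x0 : X) (C : fieldType) (J : finType).
Variable chi : J -> X -> C.
Hypothesis chiM : forall j x y, chi j (op x y) = chi j x * chi j y.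
Hypothesis chi0 : forall j, chi j x0 != 0.

(** Artin's argument: replacing x by [op y x] in the relation and subtracting [chi j0 y] times the
    relation removes the term [j0]; induct on the number of characters. No law of [op] is involved
    beyond multiplicativity of the characters. *)
Lemma characters_free (P : {set J}) (d : J -> C) :
  {in P &, forall j k, chi j =1 chi k -> j = k} ->
  (forall x, \sum_(j in P) d j * chi j x = 0) -> {in P, forall j, d j = 0}.
Proof.
move: {2}#|P| (leqnn #|P|) => m; elim: m P d => [|m IH] P d.
  by rewrite leqn0 cards_eq0 => /eqP-> _ _ j; rewrite inE.
move=> Pm inj sum0 j0 j0P.
have d0 k : k \in P -> k != j0 -> d k = 0.
  move=> kP kj0; have [y Dy] : exists y, chi k y != chi j0 y.
    apply: contrapT => h; case/negP: kj0; apply/eqP/inj => // y.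
    by apply: contrapT => h'; apply: h; exists y; apply/eqP.
  suff /eqP : d k * (chi k y - chi j0 y) = 0.
    by rewrite mulf_eq0 subr_eq0 (negbTE Dy) orbF => /eqP.
  apply: (IH (P :\ j0) (fun j => d j * (chi j y - chi j0 y))).
  - by rewrite -ltnS (leq_trans _ Pm) // [in X in (_ < X)%N](cardsD1 j0) j0P.
  - by move=> a b /setD1P[_ aP] /setD1P[_ bP]; apply: inj.
  - move=> x; rewrite (eq_bigr (fun j => d j * chi j (op y x) - chi j0 y * (d j * chi j x))); last first.
      by move=> j _; rewrite chiM mulrBr mulrBl; congr (_ - _); rewrite ?mulrA // [chi j0 y * _]mulrC mulrAC.
    have := sum0 (op y x); have := sum0 x.
    rewrite (big_setD1 j0) //= => /eqP; rewrite addrC addr_eq0 => /eqP E1.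
    rewrite (big_setD1 j0) //= => /eqP; rewrite addrC addr_eq0 => /eqP E2.
    by rewrite sumrB -mulr_sumr E1 E2 chiM; ring.
  - by rewrite !inE kj0.
have := sum0 x0; rewrite (big_setD1 j0) //= big1 ?addr0 => [/eqP|j].
  by rewrite mulf_eq0 (negbTE (chi0 j0)) orbF => /eqP.
by move=> /setD1P[jj0 jP]; rewrite d0 ?mul0r.
Qed.

(** By independence the coefficients of each class of equal characters sum to 0, so any g constant
    on the classes satisfies the same relation. This is how vanishing at integer points spreads to
    real or complex parameters. *)
Lemma character_relation (d g : J -> C) :
  (forall x, \sum_j d j * chi j x = 0) ->
  (forall j k, chi j =1 chi k -> g j = g k) -> \sum_j d j * g j = 0.
Proof.
move=> sum0 geq.
pose rep j := odflt j [pick k | `[< chi k =1 chi j >]].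
have repP j : chi (rep j) =1 chi j.
  by rewrite /rep; case: pickP => [k /asboolP|].
have repE j k : chi j =1 chi k -> rep j = rep k.
  move=> jk; rewrite /rep (eq_pick (Q := fun l => `[< chi l =1 chi k >])).
    by case: pickP => // /(_ k) /asboolP [].
  by move=> l; apply/asboolP/asboolP => h x; rewrite h ?jk.
have big (h : J -> C) : (forall j k, chi j =1 chi k -> h j = h k) ->
    \sum_j d j * h j = \sum_(k in [set rep j | j in J]%SET) (\sum_(j | rep j == k) d j) * h k.
  move=> hE; rewrite (partition_big_imset rep) /=; apply: eq_bigr => k _.
  rewrite mulr_suml; apply: eq_bigr => j /eqP <-.
  by congr (_ * _); apply: hE => x; rewrite repP.
rewrite big // big1 // => k kP; rewrite (characters_free (d := fun k => \sum_(j | rep j == k) d j) _ _ kP) ?mul0r //.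
  move=> _ _ /imsetP[a _ ->] /imsetP[b _ ->] h.
  by apply: repE => x; rewrite -repP h repP.
by move=> x; rewrite -(big (fun j => chi j x)).
Qed.

End Characters.

(** * The spectral theorem over a real closed field *)

Section Symmetric.
Variable K : rcfType.

Definition orthmx n (k : 'M[K]_n) := k *m k^T = 1%:M.

Lemma sum_sqr_eq0 (I : finType) (F : I -> K) :
  \sum_j F j ^+ 2 = 0 -> forall j, F j = 0.
Proof.
move/eqP; rewrite psumr_eq0 => [|j _]; last exact: sqr_ge0.
by move=> /allP h j; have := h j (mem_index_enum j); rewrite sqrf_eq0 => /eqP.
Qed.

(** An eigenvector x + iy exists over the algebraically closed field [K[i]]. With eigenvalue a + ib,
    symmetry gives b (|x|^2 + |y|^2) = 0, hence b = 0, and x or y is an eigenvector over [K]. *)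
Lemma symmetric_eigenvector n (A : 'M[K]_n.+1) : A^T = A ->
  exists l, exists2 v : 'rV[K]_n.+1, v *m A = l *: v & v *m v^T = 1%:M.
Proof.
move=> Asym; pose c := real_complex K.
have [z /eigenvalueP[u uA u0]] := eigenvalue_closed (map_mx c A) (ltn0Sn n).
pose x := map_mx (@complex.Re K) u; pose y := map_mx (@complex.Im K) u.
have uE a b : u a b = (x a b +i* y a b)%C by rewrite !mxE; case: (u a b).
have [a [b zE]] : exists a b, z = (a +i* b)%C by case: z {uA} => a b; exists a, b.
have xA : x *m A = a *: x - b *: y.
  apply/rowP => j; have /rowP /(_ j) := uA; rewrite !mxE.
  move/(congr1 (@complex.Re K)); rewrite raddf_sum /= zE uE /= !mxE => <-.
  by apply: eq_bigr => k _; rewrite !mxE uE /= !mxE mulr0 subr0.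
have yA : y *m A = b *: x + a *: y.
  apply/rowP => j; have /rowP /(_ j) := uA; rewrite !mxE.
  move/(congr1 (@complex.Im K)); rewrite raddf_sum /= zE uE /= !mxE addrC => <-.
  by apply: eq_bigr => k _; rewrite !mxE uE /= !mxE mulr0 add0r.
have sq0 (w : 'rV[K]_n.+1) : (w *m w^T) 0 0 = 0 -> w = 0.
  rewrite mxE => h; apply/rowP => j; rewrite mxE.
  apply: (sum_sqr_eq0 (F := fun j => w 0 j)); rewrite -[RHS]h.
  by apply: eq_bigr => k _; rewrite mxE.
have sq_ge0 (w : 'rV[K]_n.+1) : 0 <= (w *m w^T) 0 0.
  by rewrite mxE sumr_ge0 // => k _; rewrite mxE -expr2 sqr_ge0.
have b0 : b = 0.
  have E : x *m A *m y^T = (y *m A *m x^T)^T.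
    by rewrite !trmx_mul trmxK Asym mulmxA.
  have yx : (y *m x^T) 0 0 = (x *m y^T) 0 0.
    by rewrite -[y in LHS]trmxK -trmx_mul mxE.
  move/(congr1 (fun M : 'M_1 => M 0 0)): E; rewrite [RHS]mxE xA yA !mulmxDl mulNmx -!scalemxAl.
  rewrite [LHS]mxE [X in _ + X]mxE [X in X - _]mxE [X in _ - X]mxE.
  rewrite [RHS]mxE [X in _ = X + _]mxE [X in _ = _ + X]mxE yx => E.
  have /eqP : b * ((x *m x^T) 0 0 + (y *m y^T) 0 0) = 0 by move: E; lra.
  rewrite mulf_eq0 paddr_eq0 ?sq_ge0 // => /orP[/eqP//|/andP[/eqP/sq0 x0 /eqP/sq0 y0]].
  case/negP: u0; apply/eqP/matrixP => j k; rewrite uE x0 y0 !mxE.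
  by [].
have [w w0 wA] : exists2 w : 'rV[K]_n.+1, w != 0 & w *m A = a *: w.
  have [x0|x0] := eqVneq x 0; last by exists x; rewrite // xA b0 scale0r subr0.
  exists y; last by rewrite yA b0 scale0r add0r.
  apply: contraNneq u0 => y0; apply/eqP/matrixP => j k.
  by rewrite uE x0 y0 !mxE.
pose N := (w *m w^T) 0 0.
have N0 : 0 < N.
  by rewrite lt_neqAle sq_ge0 andbT eq_sym; apply: contraNneq w0 => /sq0->.
exists a; exists ((Num.sqrt N)^-1 *: w).
  by rewrite -scalemxAl wA scalerA mulrC -scalerA.
rewrite linearZ /= -scalemxAl -scalemxAr scalerA -invfM -expr2 sqr_sqrtr ?ltW //.
by rewrite [w *m _]mx11_scalar -/N -scalemx1 scalerA mulVf ?scale1r // gt_eqF.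
Qed.

(** The reflection along v - e exchanges the unit vectors v and e; its denominator |v - e|^2 equals
    2 (1 - v0), v0 being the first coordinate of v. *)
Lemma householder n (v : 'rV[K]_n.+1) : v *m v^T = 1%:M ->
  exists H : 'M[K]_n.+1, [/\ H^T = H, H *m H = 1%:M & delta_mx 0 0 *m H = v].
Proof.
move=> vv; pose e : 'rV[K]_n.+1 := delta_mx 0 0; pose w := v - e.
have ee : e *m e^T = 1%:M.
  by rewrite /e trmx_delta mul_delta_mx; apply/matrixP => a b; rewrite !ord1 !mxE.
have [w0|w0] := eqVneq w 0.
  exists 1%:M; rewrite trmx1 mulmx1; split=> //; rewrite mulmx1.
  by apply/esym/eqP; rewrite -subr_eq0 -/e -/w w0.
pose N := (w *m w^T) 0 0; pose v0 := (v *m e^T) 0 0.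
have ww : w *m w^T = N%:M by rewrite [LHS]mx11_scalar.
have ve : v *m e^T = v0%:M by rewrite [LHS]mx11_scalar.
have ev : e *m v^T = v0%:M by rewrite -[e]trmxK -trmx_mul ve tr_scalar_mx.
have NE : N = 2 * (1 - v0).
  have : w *m w^T = (2 * (1 - v0))%:M.
    rewrite /w linearB /= mulmxBl !mulmxBr vv ee ev ve -!raddfB /=.
    by congr (_%:M); ring.
  by rewrite ww => /(congr1 (fun M : 'M_1 => M 0 0)); rewrite !mxE !mulr1n.
have N0 : N != 0.
  apply: contraNneq w0 => N0; apply/eqP/rowP => j; rewrite [RHS]mxE.
  apply: (sum_sqr_eq0 (F := fun j => w 0 j)); rewrite -[RHS]N0 [RHS]mxE.
  by apply: eq_bigr => k _; rewrite [w^T _ _]mxE expr2.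
have wE : w = v - e by [].
clearbody w N; exists (1%:M - (2 / N) *: (w^T *m w)); split.
- by rewrite linearB /= trmx1 linearZ /= trmx_mul trmxK.
- rewrite mulmxBl mul1mx mulmxBr mulmx1 -!scalemxAl -!scalemxAr !scalerA.
  rewrite mulmxA -(mulmxA w^T) ww mul_mx_scalar -scalemxAl scalerA.
  move: (w^T *m w) => P; apply/matrixP => a b; rewrite !mxE.
  by field.
- rewrite mulmxBr mulmx1 -scalemxAr mulmxA.
  have -> : delta_mx 0 0 *m w^T = (v0 - 1)%:M.
    by rewrite -/e wE linearB /= mulmxBr ev ee -raddfB.
  rewrite mul_scalar_mx scalerA -/e.
  have D0 : 1 - v0 != 0 by apply: contraNneq N0 => h; rewrite NE h mulr0.
  have -> : 2 / N * (v0 - 1) = -1 by rewrite NE; field.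
  by rewrite scaleN1r opprK wE addrC subrK.
Qed.

Lemma symmetric_diag n (A : 'M[K]_n) : A^T = A ->
  exists k d, orthmx k /\ A = k^T *m diag_mx d *m k.
Proof.
elim: n A => [|n IH] A Asym.
  exists 1%:M, 0; rewrite /orthmx trmx1 mulmx1; split=> //.
  by apply/matrixP => -[].
have [l [v vA vv]] := symmetric_eigenvector Asym.
have [H [Hsym HH eH]] := householder vv.
pose B : 'M_(1 + n) := H *m A *m H.
have Bsym : B^T = B by rewrite /B !trmx_mul Asym Hsym mulmxA.
have e0E : delta_mx 0 0 = row_mx 1%:M 0 :> 'rV[K]_(1 + n).
  apply/rowP => j; rewrite mxE [RHS]mxE eqxx /=; case: (splitP j) => i ji.
    have -> : j = 0 by apply: val_inj; rewrite /= ji ord1.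
    by rewrite !mxE !ord1 eqxx.
  rewrite [RHS]mxE; case: eqP => // j0.
  by move: ji; rewrite j0.
have eB : row_mx 1%:M 0 *m B = l *: row_mx 1%:M 0.
  by rewrite -e0E /B !mulmxA eH vA -scalemxAl -eH -mulmxA HH mulmx1.
pose A' := drsubmx B.
have BE : B = block_mx l%:M 0 0 A'.
  move: eB; rewrite -{1}[B]submxK mul_row_block !mul1mx !mul0mx !addr0.
  rewrite scale_row_mx scaler0 scalemx1 => /eq_row_mx[ul ur].
  rewrite -[LHS]submxK ur ul; congr block_mx.
  by rewrite -[dlsubmx B]trmxK trmx_dlsub Bsym ur trmx0.
have A'sym : A'^T = A' by rewrite trmx_drsub Bsym.
have [k [d [kk A'E]]] := IH A' A'sym.
pose k1 : 'M_(1 + n) := block_mx 1%:M 0 0 k.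
have k1T : k1^T = block_mx 1%:M 0 0 k^T by rewrite tr_block_mx !trmx0 trmx1.
have k1k1 : k1 *m k1^T = 1%:M.
  rewrite k1T mulmx_block !mulmx0 !mul0mx !mulmx1 !addr0 !add0r kk.
  by rewrite -scalar_mx_block.
have BD : B = k1^T *m diag_mx (row_mx l%:M d) *m k1.
  rewrite BE k1T diag_mx_row !mulmx_block !mulmx0 !mul0mx !mulmx1 !mul1mx.
  rewrite ?mul0mx ?mulmx0 !addr0 !add0r -A'E.
  congr block_mx; rewrite ?mul0mx //.
  by apply/matrixP => a b; rewrite !ord1 !mxE.
exists (k1 *m H), (row_mx l%:M d); split.
  rewrite /orthmx trmx_mul Hsym mulmxA -(mulmxA k1) HH mulmx1.
  exact: k1k1.
have -> : A = H *m B *m H by rewrite /B !mulmxA HH mul1mx -mulmxA HH mulmx1.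
by rewrite trmx_mul Hsym BD !mulmxA.
Qed.

End Symmetric.

(** * The exponential of real matrices *)

Section MatrixLimits.
Variables (R : numFieldType) (n : nat) (T : Type) (F : set_system T).
Context {FF : ProperFilter F}.
Implicit Types (X Y : 'M[R]_n) (A B : T -> 'M[R]_n).

Lemma cvg_bigsum (I : Type) (s : seq I) (u : I -> T -> R) (l : I -> R) :
  (forall a, u a @ F --> l a) ->
  (fun k => \sum_(a <- s) u a k) @ F --> \sum_(a <- s) l a.
Proof.
move=> h; elim: s => [|a s IH].
  by rewrite big_nil; under eq_fun do rewrite big_nil; apply: cvg_cst.
by rewrite big_cons; under eq_fun do rewrite big_cons; apply: cvgD.
Qed.

Lemma cvg_bigprod (I : Type) (s : seq I) (u : I -> T -> R) (l : I -> R) :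
  (forall a, u a @ F --> l a) ->
  (fun k => \prod_(a <- s) u a k) @ F --> \prod_(a <- s) l a.
Proof.
move=> h; elim: s => [|a s IH].
  by rewrite big_nil; under eq_fun do rewrite big_nil; apply: cvg_cst.
by rewrite big_cons; under eq_fun do rewrite big_cons; apply: cvgM.
Qed.

(** Entrywise, along an arbitrary filter: the same lemmas serve sequences, the ultrafilter of the
    extreme value argument, and neighbourhoods of a point. *)
Definition mcvg A X := forall i j, (fun k => A k i j) @ F --> X i j.

Lemma mcvg_cst X : mcvg (fun=> X) X.
Proof. by move=> i j; apply: cvg_cst. Qed.

Lemma mcvg_add A B X Y : mcvg A X -> mcvg B Y -> mcvg (fun k => A k + B k) (X + Y).
Proof.
move=> AX BY i j; rewrite mxE; under eq_fun do rewrite mxE.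
by apply: cvgD; [apply: AX|apply: BY].
Qed.

Lemma mcvg_scale (u : T -> R) (l : R) A X : u @ F --> l -> mcvg A X ->
  mcvg (fun k => u k *: A k) (l *: X).
Proof.
move=> ul AX i j; rewrite mxE; under eq_fun do rewrite mxE.
by apply: cvgM => //; apply: AX.
Qed.

Lemma mcvg_mul A B X Y : mcvg A X -> mcvg B Y -> mcvg (fun k => A k *m B k) (X *m Y).
Proof.
move=> AX BY i j; rewrite mxE; under eq_fun do rewrite mxE.
by apply: cvg_bigsum => l; apply: cvgM; [apply: AX|apply: BY].
Qed.

Lemma mcvg_tr A X : mcvg A X -> mcvg (fun k => (A k)^T) X^T.
Proof. by move=> AX i j; rewrite mxE; under eq_fun do rewrite mxE; apply: AX. Qed.

Lemma mcvg_sum (I : Type) (s : seq I) (A : I -> T -> 'M[R]_n) (X : I -> 'M[R]_n) :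
  (forall a, mcvg (A a) (X a)) ->
  mcvg (fun k => \sum_(a <- s) A a k) (\sum_(a <- s) X a).
Proof.
move=> h i j; rewrite summxE; under eq_fun do rewrite summxE.
by apply: cvg_bigsum => a; apply: h.
Qed.

Lemma cvg_mxtrace A X : mcvg A X -> (fun k => \tr (A k)) @ F --> \tr X.
Proof. by move=> AX; apply: cvg_bigsum => a; apply: AX. Qed.

Lemma mcvg_unique A X Y : mcvg A X -> mcvg A Y -> X = Y.
Proof. by move=> AX AY; apply/matrixP => i j; apply: cvg_unique (AX i j) (AY i j). Qed.

Lemma cvg_mxeval (K : rcfType) (iK : {rmorphism K -> R}) (p : mxpoly K n) A X :
  mcvg A X -> (fun k => mxeval iK p (A k)) @ F --> mxeval iK p X.
Proof.
move=> AX; rewrite /mxeval /mpoly.mmap; apply: cvg_bigsum => m.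
apply: cvgM; first exact: cvg_cst.
rewrite /mpoly.mmap1; apply: cvg_bigprod => l.
have h : (fun k => mxvec (A k) 0 l) @ F --> mxvec X 0 l.
  case/mxvec_indexP: l => a b; rewrite mxvecE; under eq_fun do rewrite mxvecE.
  exact: AX.
elim: (mpoly.fun_of_multinom m l) => [|e IH].
  by rewrite expr0; under eq_fun do rewrite expr0; apply: cvg_cst.
by rewrite exprS; under eq_fun do rewrite exprS; apply: cvgM.
Qed.

End MatrixLimits.
Arguments mcvg {R n T} F A X.

Lemma mcvg_ext (R : realType) n T (F : set_system T) (A B : T -> 'M[R]_n) X :
  A =1 B -> mcvg F A X -> mcvg F B X.
Proof. by move=> /funext ->. Qed.

(** * Maxima of continuous functions on bounded closed sets of matrices *)

Section ExtremeValue.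
Variables (R : realType) (n : nat).

Definition mclosed (P : set 'M[R]_n) := forall (T : Type) (F : set_system T),
  ProperFilter F -> forall (A : T -> 'M[R]_n) X, mcvg F A X ->
  (\forall k \near F, P (A k)) -> P X.

Definition mcontinuous (f : 'M[R]_n -> R) := forall (T : Type) (F : set_system T),
  ProperFilter F -> forall (A : T -> 'M[R]_n) X, mcvg F A X -> f (A k) @[k --> F] --> f X.

(* The sets {Z in P : f Y <= f Z} form a filter base; by boundedness of P an
   ultrafilter containing them converges entrywise, to a maximum point. *)
Lemma extreme_value (P : set 'M[R]_n) f (c : R) : P !=set0 -> mclosed P -> mcontinuous f ->
  (forall X, P X -> forall i j, `|X i j| <= c) ->
  exists2 X, P X & forall Y, P Y -> f Y <= f X.
Proof.
move=> [Y0 PY0] Pc fc Pb.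
pose B Y := [set Z | P Z /\ f Y <= f Z].
have Bf : ProperFilter (filter_from P B).
  apply: filter_from_proper; last by move=> Y PY; exists Y.
  apply: filter_from_filter; first by exists Y0.
  move=> Y Y' PY PY'; case: (leP (f Y) (f Y')) => [h|/ltW h].
    by exists Y' => // Z [PZ hZ]; split; split=> //; apply: le_trans h hZ.
  by exists Y => // Z [PZ hZ]; split; split=> //; apply: le_trans h hZ.
have [G [GU BG]] := ultraFilterLemma Bf.
have GPr : ProperFilter G by case: GU.
have GP : G P by apply: BG; exists Y0 => // Z [].
have [X GX] : exists X, mcvg G id X.
  have h i j : exists x : R, (fun Z : 'M[R]_n => Z i j) @ G --> x.
    have [|x [_ Gx]] := @segment_compact R (- c) c ((fun Z : 'M[R]_n => Z i j) @ G) _.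
      rewrite /= /fmap /=; apply: filterS GP => Z PZ /=.
      by rewrite in_itv /= -ler_norml Pb.
    exists x => V xV; have [//|GV] := in_ultra_setVsetC ((fun Z : 'M[R]_n => Z i j) @^-1` V) GU.
    have [y [yV /yV]] := Gx (~` V) V GV xV; by [].
  exists (\matrix_(i, j) xget 0 [set x : R | (fun Z : 'M[R]_n => Z i j) @ G --> x]).
  move=> i j; rewrite mxE; have [x hx] := h i j.
  exact: (@xgetPex R 0 [set x : R | (fun Z : 'M[R]_n => Z i j) @ G --> x] (ex_intro _ x hx)).
exists X; first exact: Pc GX GP.
move=> Y PY; have fX := fc _ _ GPr _ _ GX.
rewrite -(cvg_lim _ fX) //; apply: limr_ge; first by apply/cvg_ex; exists (f X).
by apply: BG; exists Y => // Z [].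
Qed.

End ExtremeValue.

Section MatrixExponential.
Variables (R : realType) (n : nat).
Implicit Types (X Y Z : 'M[R]_n) (A B : nat -> 'M[R]_n) (c : R).

Local Notation mcvg := (mcvg \oo).

Lemma mcvg_shift A X m : mcvg A X -> mcvg (fun k => A (k + m)%N) X.
Proof. by move=> AX i j; have /(_ i j) := AX; rewrite -(cvg_shiftn m). Qed.

Definition mnorm X : R := \sum_i \sum_j `|X i j|.

Lemma mnorm_ge0 X : 0 <= mnorm X.
Proof. by apply: sumr_ge0 => i _; apply: sumr_ge0. Qed.

Lemma mnormD X Y : mnorm (X + Y) <= mnorm X + mnorm Y.
Proof.
rewrite /mnorm -big_split /=; apply: ler_sum => i _.
by rewrite -big_split /=; apply: ler_sum => j _; rewrite mxE ler_normD.
Qed.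

Lemma mnormZ a X : mnorm (a *: X) = `|a| * mnorm X.
Proof.
rewrite /mnorm mulr_sumr; apply: eq_bigr => i _; rewrite mulr_sumr.
by apply: eq_bigr => j _; rewrite mxE normrM.
Qed.

Lemma mnormN X : mnorm (- X) = mnorm X.
Proof. by rewrite -scaleN1r mnormZ normrN1 mul1r. Qed.

Lemma mnorm_le_entry X c : (forall i j, `|X i j| <= c) -> mnorm X <= n%:R * (n%:R * c).
Proof.
move=> h; rewrite /mnorm (le_trans (y := \sum_(i < n) \sum_(j < n) c)) //.
  by apply: ler_sum => i _; apply: ler_sum.
by rewrite !sumr_const !card_ord !mulr_natl.
Qed.

Lemma mulmx_entry_le X Y (a : R) i j : (forall k, `|X i k| <= a) ->
  `|(X *m Y) i j| <= a * mnorm Y.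
Proof.
move=> h; rewrite mxE (le_trans (ler_norm_sum _ _ _)) //.
rewrite /mnorm mulr_sumr; apply: ler_sum => k _; rewrite normrM.
apply: ler_pM => //; rewrite (bigD1 j) //= lerDl; exact: sumr_ge0.
Qed.

Lemma mulmx3_entry_le X Y Z (a b : R) i j : (forall k l, `|X k l| <= a) ->
  (forall k l, `|Z k l| <= b) -> `|(X *m Y *m Z) i j| <= a * mnorm Y * b.
Proof.
move=> h h'; rewrite -mulmxA mxE (le_trans (ler_norm_sum _ _ _)) //.
have -> : a * mnorm Y * b = \sum_k a * \sum_l `|Y k l| * b.
  rewrite /mnorm mulr_sumr mulr_suml; apply: eq_bigr => k _.
  by rewrite -mulrA mulr_suml.
apply: ler_sum => k _; rewrite normrM; apply: ler_pM => //.
rewrite mxE (le_trans (ler_norm_sum _ _ _)) //.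
by apply: ler_sum => l _; rewrite normrM ler_pM.
Qed.

Lemma expmx_entry_le X k i j : `|(X ^+ k) i j| <= mnorm X ^+ k.
Proof.
elim: k i j => [|k IH] i j; last by rewrite !exprSr -mulmxE mulmx_entry_le.
by rewrite !expr0 mxE; case: eqP => _; rewrite ?normr1 ?normr0 ?ler01.
Qed.

Lemma unip_entry_le X k i j : `|((1%:M + X) ^+ k) i j| <= (1 + mnorm X) ^+ k.
Proof.
elim: k i j => [|k IH] i j.
  by rewrite !expr0 mxE; case: eqP => _; rewrite ?normr1 ?normr0 ?ler01.
rewrite !exprSr -mulmxE mulmxDr mulmx1 mxE mulrDr mulr1.
by rewrite (le_trans (ler_normD _ _)) // lerD // mulmx_entry_le.
Qed.

Definition exppart X m : 'M[R]_n := \sum_(k < m) (k`!%:R)^-1 *: X ^+ k.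

Lemma exppartE X m i j : exppart X m i j = \sum_(k < m) (X ^+ k) i j / k`!%:R.
Proof. by rewrite summxE; apply: eq_bigr => k _; rewrite mxE mulrC. Qed.

Lemma fact_gt0R k : 0 < k`!%:R :> R.
Proof. by rewrite ltr0n fact_gt0. Qed.

Lemma sum_exp_le (x : R) m : 0 <= x -> \sum_(k < m) x ^+ k / k`!%:R <= expR x.
Proof.
move=> x0; rewrite -(big_mkord xpredT (fun k => x ^+ k / k`!%:R)).
apply: (nondecreasing_cvgn_le (u_ := series (exp_coeff x))).
  by apply: nondecreasing_series => k _ _; rewrite divr_ge0 // exprn_ge0.
exact: is_cvg_series_exp_coeff.
Qed.

Lemma mcvg_exppart X : mcvg (exppart X) (expmx X).
Proof.
move=> i j; rewrite mxE /=.
have -> : (fun m => exppart X m i j) = (fun m => \sum_(k < m) (X ^+ k) i j / k`!%:R).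
  by apply: funext => m; rewrite exppartE.
suff : cvgn (series (fun k => (X ^+ k) i j / k`!%:R)).
  rewrite (_ : series _ = (fun m => \sum_(k < m) (X ^+ k) i j / k`!%:R)) //.
  by apply: funext => m; rewrite /series /= big_mkord.
apply: normed_cvg; apply: (series_le_cvg _ _ _ (is_cvg_series_exp_coeff (mnorm X))).
- by move=> k; apply: normr_ge0.
- by move=> k; rewrite divr_ge0 // exprn_ge0 // mnorm_ge0.
- move=> k; rewrite /exp_coeff /= normrM normfV normr_nat.
  by rewrite ler_pM2r ?invr_gt0 ?fact_gt0R // expmx_entry_le.
Qed.

Lemma exppart_diff X m N i j : `|(exppart X (m + N)%N - exppart X N) i j| <=
  mnorm X ^+ N * expR (mnorm X).
Proof.
rewrite /exppart addnC big_split_ord /= addrAC subrr add0r summxE.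
rewrite (le_trans (ler_norm_sum _ _ _)) //.
rewrite (le_trans _ (ler_wpM2l (exprn_ge0 _ (mnorm_ge0 X)) (sum_exp_le m (mnorm_ge0 X)))) //.
rewrite mulr_sumr; apply: ler_sum => k _.
rewrite mxE normrM mulrA -exprD mulrC normfV normr_nat.
apply: ler_pM => //; first by rewrite invr_ge0 ler0n.
  exact: expmx_entry_le.
by rewrite lef_pV2 ?posrE ?fact_gt0R // ler_nat leq_fact // leq_addl.
Qed.

Lemma expmx_remainder X N i j :
  `|(expmx X - exppart X N) i j| <= mnorm X ^+ N * expR (mnorm X).
Proof.
have cv : (fun m => `|(exppart X (m + N)%N - exppart X N) i j|) @ \oo -->
    `|(expmx X - exppart X N) i j|.
  apply: cvg_norm; apply: mcvg_add; last exact: mcvg_cst.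
  by apply: mcvg_shift; apply: mcvg_exppart.
rewrite -(cvg_lim _ cv) //; apply: limr_le; first by apply/cvg_ex; exists (`|(expmx X - exppart X N) i j|).
by near=> m; apply: exppart_diff.
Unshelve. all: by end_near.
Qed.

Lemma big_triangle (V : nmodType) m (F : nat -> nat -> V) :
  \sum_(k < m) \sum_(i < k.+1) F (k - i)%N i =
  \sum_(i < m) \sum_(j < m | (i + j < m)%N) F j i.
Proof.
transitivity (\sum_(k < m) \sum_(i < m | (i <= k)%N) F (k - i)%N i).
  by apply: eq_bigr => k _; rewrite (big_ord_widen m (fun i => F (k - i)%N i)).
rewrite (exchange_big_dep xpredT) //=; apply: eq_bigr => i _.
transitivity (\sum_(i <= k < m) F (k - i)%N i); first by rewrite big_geq_mkord.
rewrite -{1}[nat_of_ord i]add0n big_addn big_mkord.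
rewrite (big_ord_widen m (fun j => F (j + i - i)%N i)) ?leq_subr //.
by apply: eq_big => [j|j _]; rewrite ?addnK // ltn_subRL.
Qed.

Lemma exppart_add X Y m : GRing.comm X Y -> exppart X m *m exppart Y m -
  exppart (X + Y) m = \sum_(i < m) \sum_(j < m | (m <= i + j)%N)
    ((j`!%:R)^-1 * (i`!%:R)^-1) *: (X ^+ j *m Y ^+ i).
Proof.
move=> XY; pose G j i := ((j`!%:R)^-1 * (i`!%:R)^-1) *: (X ^+ j *m Y ^+ i).
have -> : exppart (X + Y) m = \sum_(i < m) \sum_(j < m | (i + j < m)%N) G j i.
  rewrite -(big_triangle m G); apply: eq_bigr => k _.
  rewrite exprDn_comm // scaler_sumr; apply: eq_bigr => i _.
  have ik : (i <= k)%N by rewrite -ltnS.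
  rewrite /G -[X in _ *: X = _]scaler_nat scalerA; congr (_ *: _).
  rewrite -(bin_fact ik) !natrM; field.
  by rewrite !pnatr_eq0 -!lt0n !fact_gt0 bin_gt0 ik.
rewrite /exppart mulmx_suml; under [X in X - _]eq_bigr do rewrite mulmx_sumr.
rewrite exchange_big -sumrB; apply: eq_bigr => i _ /=.
rewrite (bigID (fun j : 'I_m => (i + j < m)%N)) /= addrAC.
have -> : \sum_(j < m | (i + j < m)%N) (j`!%:R)^-1 *: X ^+ j *m ((i`!%:R)^-1 *: Y ^+ i) =
    \sum_(j < m | (i + j < m)%N) G j i.
  by apply: eq_bigr => j _; rewrite /G -scalemxAl -scalemxAr scalerA.
rewrite subrr add0r; apply: eq_big => [j|j _]; first by rewrite -leqNgt.
by rewrite -scalemxAl -scalemxAr scalerA.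
Qed.

Lemma exppart_scalar (x : R) m : \sum_(k < m) x ^+ k / k`!%:R = series (exp_coeff x) m.
Proof. by rewrite /series /= big_mkord. Qed.

Lemma sum_exp_prod (x y : R) m :
  \sum_(i < m) \sum_(j < m | (m <= i + j)%N) (x ^+ j / j`!%:R) * (y ^+ i / i`!%:R) =
  (\sum_(k < m) x ^+ k / k`!%:R) * (\sum_(k < m) y ^+ k / k`!%:R) -
  \sum_(k < m) (x + y) ^+ k / k`!%:R.
Proof.
pose G j i := (x ^+ j / j`!%:R) * (y ^+ i / i`!%:R).
have -> : \sum_(k < m) (x + y) ^+ k / k`!%:R =
    \sum_(i < m) \sum_(j < m | (i + j < m)%N) G j i.
  rewrite -(big_triangle m G); apply: eq_bigr => k _.
  rewrite exprDn mulr_suml; apply: eq_bigr => i _.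
  have ik : (i <= k)%N by rewrite -ltnS.
  rewrite /G -mulr_natl -(bin_fact ik) !natrM; field.
  by rewrite !pnatr_eq0 -!lt0n !fact_gt0 bin_gt0 ik.
rewrite mulr_suml; under [X in _ = X - _]eq_bigr do rewrite mulr_sumr.
rewrite exchange_big -sumrB; apply: eq_bigr => i _ /=.
rewrite [X in _ = X - _](bigID (fun j : 'I_m => (i + j < m)%N)) /= addrAC subrr add0r.
by apply: eq_bigl => j; rewrite -leqNgt.
Qed.

(** The product of partial sums differs from the partial sum for X + Y by the terms with i + j >= m.
    Up to a factor n for an entry of a product, these are dominated by the corresponding scalar
    terms with x, y the norms of X, Y, whose sum tends to e^x e^y - e^(x+y) = 0. *)
Lemma expmxD X Y : GRing.comm X Y -> expmx (X + Y) = expmx X *m expmx Y.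
Proof.
move=> XY; apply/esym; apply: (mcvg_unique (F := \oo) (A := fun m => exppart X m *m exppart Y m)).
  by apply: mcvg_mul; apply: mcvg_exppart.
apply: (mcvg_ext (A := fun m => exppart (X + Y) m + (exppart X m *m exppart Y m - exppart (X + Y) m))).
  by move=> m; rewrite addrC subrK.
rewrite -[expmx _]addr0; apply: mcvg_add; first exact: mcvg_exppart.
pose x := mnorm X; pose y := mnorm Y.
pose u m : R := n%:R * (series (exp_coeff x) m * series (exp_coeff y) m - series (exp_coeff (x + y)) m).
have u0 : u @ \oo --> 0.
  rewrite -[0 in X in _ --> X](mulr0 n%:R); apply: cvgM; first exact: cvg_cst.
  rewrite -[0 in X in _ --> X](subrr (expR x * expR y)) -{2}expRD.
  by apply: cvgB; [apply: cvgM|]; apply: is_cvg_series_exp_coeff.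
move=> i j; rewrite mxE; apply: norm_cvg0; apply: (squeeze_cvgr _ (cvg_cst 0) u0).
near=> m; rewrite normr_ge0 /= exppart_add // /u -!exppart_scalar -sum_exp_prod.
rewrite summxE mulr_sumr (le_trans (ler_norm_sum _ _ _)) //; apply: ler_sum => k _.
rewrite summxE mulr_sumr (le_trans (ler_norm_sum _ _ _)) //; apply: ler_sum => l _.
rewrite !mxE normrM mulrC normrM !normfV !normr_nat.
rewrite (le_trans (ler_wpM2r _ (_ : _ <= n%:R * (x ^+ l * y ^+ k)))) //.
- by rewrite mulr_ge0 // invr_ge0 ler0n.
- rewrite (le_trans (ler_norm_sum _ _ _)) //.
  rewrite -[n in n%:R]card_ord mulr_natl -sumr_const; apply: ler_sum => p _.
  by rewrite normrM ler_pM // expmx_entry_le.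
- by rewrite le_eqVlt; apply/orP; left; apply/eqP; rewrite ?invfM; ring.
Unshelve. all: by end_near.
Qed.

Lemma exppart_nil X m : X ^+ n = 0 -> exppart X (n + m) = nilexp X.
Proof.
move=> X0; rewrite /exppart big_split_ord /= [X in _ + X]big1 ?addr0 // => i _.
by rewrite exprD X0 mul0r scaler0.
Qed.

Lemma expmx_nil X : X ^+ n = 0 -> expmx X = nilexp X.
Proof.
move=> X0; apply: (mcvg_unique (F := \oo) (A := fun m => exppart X (m + n)%N)).
  by apply: mcvg_shift; apply: mcvg_exppart.
apply: (mcvg_ext (A := fun=> nilexp X)) => [m|]; last exact: mcvg_cst.
by rewrite addnC exppart_nil.
Qed.

Lemma expmx0 : expmx 0 = 1%:M :> 'M[R]_n.
Proof.
apply: (mcvg_unique (F := \oo) (A := fun m => exppart 0 (m + 1)%N)).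
  by apply: mcvg_shift; apply: mcvg_exppart.
apply: (mcvg_ext (A := fun=> 1%:M)) => [m|]; last exact: mcvg_cst.
rewrite /exppart addn1 big_ord_recl big1 ?addr0 => [|i _].
  by rewrite expr0 fact0 invr1 scale1r.
by rewrite exprS mul0r scaler0.
Qed.

Lemma expmxNl X : expmx (- X) *m expmx X = 1%:M.
Proof.
rewrite -expmxD ?addNr ?expmx0 // /GRing.comm.
by rewrite mulNr mulrN.
Qed.

Lemma expmxNr X : expmx X *m expmx (- X) = 1%:M.
Proof. by have := expmxNl (- X); rewrite opprK. Qed.

Lemma expmx_mulrn X k : expmx (X *+ k) = expmx X ^+ k.
Proof.
elim: k => [|k IH]; first by rewrite mulr0n expmx0 expr0.
rewrite mulrSr expmxD ?IH ?exprSr // /GRing.comm.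
by rewrite mulrnAl mulrnAr.
Qed.

Lemma trmx_exp X k : (X ^+ k)^T = X^T ^+ k.
Proof.
elim: k => [|k IH]; first by rewrite !expr0 trmx1.
by rewrite exprS exprSr -!mulmxE trmx_mul IH.
Qed.

Lemma trmx_expmx X : (expmx X)^T = expmx X^T.
Proof.
apply: (mcvg_unique (F := \oo) (A := fun m => (exppart X m)^T)).
  by apply: mcvg_tr; apply: mcvg_exppart.
apply: (mcvg_ext (A := exppart X^T)) => [m|]; last exact: mcvg_exppart.
rewrite /exppart raddf_sum; apply: eq_bigr => k _.
by rewrite /= linearZ /= trmx_exp.
Qed.

Lemma expmx_conj (g h : 'M[R]_n) X : h *m g = 1%:M -> expmx (g *m X *m h) = g *m expmx X *m h.
Proof.
move=> hg; have gh := mulmx1C hg.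
apply: (mcvg_unique (F := \oo) (A := exppart (g *m X *m h))).
  exact: mcvg_exppart.
apply: (mcvg_ext (A := fun m => g *m exppart X m *m h)).
  move=> m; rewrite /exppart mulmx_sumr mulmx_suml; apply: eq_bigr => k _.
  rewrite -scalemxAr -scalemxAl; congr (_ *: _).
  elim: (nat_of_ord k) => [|l IH]; first by rewrite !expr0 mulmx1.
  rewrite !exprS -!mulmxE -IH; move: (X ^+ l) => Y.
  have -> : g *m X *m h *m (g *m Y *m h) = g *m X *m (h *m g) *m Y *m h.
    by rewrite !mulmxA.
  by rewrite hg mulmx1 !mulmxA.
by apply: mcvg_mul; [apply: mcvg_mul|]; [apply: mcvg_cst|apply: mcvg_exppart|apply: mcvg_cst].
Qed.

Lemma spectral_exp (I : finType) (P : I -> 'M[R]_n) (x : I -> R) k :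
  (forall a b : I, P a *m P b = if a == b then P a else 0) -> \sum_a P a = 1%:M ->
  (\sum_a x a *: P a) ^+ k = \sum_a x a ^+ k *: P a.
Proof.
move=> PP P1; elim: k => [|k IH].
  by rewrite expr0 -[LHS]P1; apply: eq_bigr => a _; rewrite expr0 scale1r.
rewrite exprS IH -mulmxE mulmx_suml; apply: eq_bigr => a _.
rewrite mulmx_sumr (bigD1 a) //= big1 ?addr0 => [|b ba].
  by rewrite -scalemxAl -scalemxAr PP eqxx scalerA exprS.
by rewrite -scalemxAl -scalemxAr PP eq_sym (negbTE ba) !scaler0.
Qed.

Lemma expmx_spectral (I : finType) (P : I -> 'M[R]_n) (x : I -> R) :
  (forall a b : I, P a *m P b = if a == b then P a else 0) -> \sum_a P a = 1%:M ->
  expmx (\sum_a x a *: P a) = \sum_a expR (x a) *: P a.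
Proof.
move=> PP P1; apply: (mcvg_unique (F := \oo) (A := exppart (\sum_a x a *: P a))).
  exact: mcvg_exppart.
apply: (mcvg_ext (A := fun m => \sum_a series (exp_coeff (x a)) m *: P a)).
  move=> m; rewrite /exppart; under [RHS]eq_bigr do rewrite spectral_exp // scaler_sumr.
  rewrite exchange_big; apply: eq_bigr => a _; rewrite -exppart_scalar scaler_suml.
  by apply: eq_bigr => k _; rewrite scalerA mulrC.
apply: mcvg_sum => a; apply: mcvg_scale; last exact: mcvg_cst.
exact: is_cvg_series_exp_coeff.
Qed.

Lemma telescope_exp X Y m : X ^+ m - Y ^+ m =
  \sum_(i < m) X ^+ i *m (X - Y) *m Y ^+ (m.-1 - i).
Proof.
elim: m => [|m IH]; first by rewrite big_ord0 !expr0 subrr.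
rewrite big_ord_recr /= subnn expr0 mulmx1.
have -> : X ^+ m.+1 - Y ^+ m.+1 = (X ^+ m - Y ^+ m) *m Y + X ^+ m *m (X - Y).
  by rewrite mulmxBl mulmxBr !mulmxE -!exprSr [RHS]addrC addrA subrK.
rewrite IH mulmx_suml; congr (_ + _); apply: eq_bigr => i _.
rewrite -mulmxA mulmxE -exprSr -mulmxE; congr (_ *m _ ^+ _).
by case: m i {IH} => [[]//|m i] /=; rewrite subSn // -ltnS.
Qed.

(** Compared with B_k = exp(X/(k+1)), whose power is exactly exp(X), the difference of the (k+1)-st
    powers telescopes into k + 1 terms, each a product of bounded powers with A_k - B_k =
    O(1/(k+1)^2). *)
Lemma power_limit A X c : (forall k, mnorm (A k - 1%:M - k.+1%:R^-1 *: X) <= c / k.+1%:R ^+ 2) ->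
  mcvg (fun k => A k ^+ k.+1) (expmx X).
Proof.
move=> hA; pose x := mnorm X; pose B k := expmx (k.+1%:R^-1 *: X).
have k1 k : 0 < k.+1%:R :> R by rewrite ltr0n.
have iv_le k : k.+1%:R^-1 <= 1 :> R by rewrite invf_le1 // ler1n.
have c0 : 0 <= c by have := le_trans (mnorm_ge0 _) (hA 0%N); rewrite expr1n divr1.
have x0 : 0 <= x := mnorm_ge0 X.
pose c2 := n%:R * (n%:R * (x ^+ 2 * expR x)).
have c20 : 0 <= c2 by rewrite /c2 !mulr_ge0 ?ler0n ?exprn_ge0 ?expR_ge0.
have hB k : mnorm (B k - 1%:M - k.+1%:R^-1 *: X) <= c2 / k.+1%:R ^+ 2.
  pose Z := k.+1%:R^-1 *: X; have Zn : mnorm Z = x / k.+1%:R.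
    by rewrite mnormZ normfV normr_nat mulrC.
  have -> : B k - 1%:M - Z = expmx Z - exppart Z 2.
    rewrite /exppart !big_ord_recl big_ord0 /= addr0 expr0 expr1 !fact0 !invr1 !scale1r.
    by rewrite opprD addrA.
  rewrite (le_trans (mnorm_le_entry (fun i j => expmx_remainder Z 2 i j))) //.
  have h : mnorm Z ^+ 2 * expR (mnorm Z) <= x ^+ 2 * expR x / k.+1%:R ^+ 2.
    rewrite Zn exprMn exprVn mulrAC ler_wpM2r ?invr_ge0 ?exprn_ge0 //.
    by rewrite ler_wpM2l ?exprn_ge0 // ler_expR ler_piMr.
  by rewrite /c2 -!(mulrA n%:R) !(ler_wpM2l (ler0n _ _)).
(* Chosen so that both A_k and B_k lie within d/(k+1) of the identity; all their powers up to k + 1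
   are then bounded by e^d. *)
pose d := x + c + c2.
have small (D : 'M[R]_n) e k : 0 <= e -> e <= c + c2 ->
    mnorm (D - 1%:M - k.+1%:R^-1 *: X) <= e / k.+1%:R ^+ 2 -> mnorm (D - 1%:M) <= d / k.+1%:R.
  move=> e0 ec h; rewrite -[D - _](subrK (k.+1%:R^-1 *: X)) (le_trans (mnormD _ _)) //.
  have -> : d / k.+1%:R = (c + c2) / k.+1%:R + x / k.+1%:R by rewrite /d; ring.
  apply: lerD; last by rewrite mnormZ normfV normr_nat mulrC.
  rewrite (le_trans h) // expr2 invfM mulrA (le_trans (y := e / k.+1%:R)) //.
    by rewrite ler_piMr // divr_ge0 // ltW.
  by rewrite ler_wpM2r // invr_ge0 ltW.
have pow (D : 'M[R]_n) k m i j : mnorm (D - 1%:M) <= d / k.+1%:R -> (m <= k.+1)%N ->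
    `|(D ^+ m) i j| <= expR d.
  move=> h mk; have d0 : 0 <= d / k.+1%:R by rewrite divr_ge0 ?(ltW (k1 k)) // /d !addr_ge0.
  have -> : D = 1%:M + (D - 1%:M) by rewrite addrC subrK.
  rewrite (le_trans (unip_entry_le _ _ _ _)) //.
  rewrite (le_trans (y := (1 + d / k.+1%:R) ^+ k.+1)) //.
    rewrite (le_trans (y := (1 + d / k.+1%:R) ^+ m)) //.
      by rewrite lerXn2r ?nnegrE ?addr_ge0 ?mnorm_ge0 // lerD2l.
    by rewrite ler_weXn2l // lerDl.
  have -> : expR d = expR (d / k.+1%:R) ^+ k.+1.
    by rewrite -expRM_natl mulrC divfK // gt_eqF.
  by rewrite lerXn2r ?nnegrE ?addr_ge0 ?expR_ge0 // expR_ge1Dx.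
have BX k : B k ^+ k.+1 = expmx X.
  by rewrite -expmx_mulrn -scaler_nat scalerA mulfV ?scale1r // gt_eqF.
pose E := expR d * (c + c2) * expR d.
apply: (mcvg_ext (A := fun k => expmx X + (A k ^+ k.+1 - expmx X))).
  by move=> k; rewrite addrC subrK.
rewrite -[in X in mcvg _ X](addr0 (expmx X)); apply: mcvg_add; first exact: mcvg_cst.
have E0 : (fun k => E * harmonic k) @ \oo --> 0.
  by rewrite -[0 in X in _ --> X](mulr0 E); apply: cvgM; [apply: cvg_cst|apply: cvg_harmonic].
move=> i j; rewrite mxE; apply: norm_cvg0; apply: (squeeze_cvgr _ (cvg_cst 0) E0).
near=> k; rewrite normr_ge0 /= -(BX k) telescope_exp summxE.
rewrite (le_trans (ler_norm_sum _ _ _)) //.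
have AB : mnorm (A k - B k) <= (c + c2) / k.+1%:R ^+ 2.
  have -> : A k - B k = (A k - 1%:M - k.+1%:R^-1 *: X) - (B k - 1%:M - k.+1%:R^-1 *: X).
    by rewrite !opprB; apply/matrixP => a b; rewrite !mxE; ring.
  by rewrite (le_trans (mnormD _ _)) // mnormN mulrDl lerD.
rewrite (le_trans (y := \sum_(l < k.+1) expR d * ((c + c2) / k.+1%:R ^+ 2) * expR d)) //.
  apply: ler_sum => l _; rewrite (le_trans (y := expR d * mnorm (A k - B k) * expR d)) //.
    apply: mulmx3_entry_le => a b.
      apply: (pow _ k); last by rewrite ltnW.
      by apply: (small _ c) => //; rewrite lerDl.
    apply: (pow _ k); last by rewrite (leq_trans (leq_subr _ _)).
    by apply: (small _ c2) => //; rewrite lerDr.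
  by rewrite ler_wpM2r ?expR_ge0 // ler_wpM2l ?expR_ge0.
rewrite sumr_const card_ord -[leLHS]mulr_natl /E /harmonic /=.
rewrite le_eqVlt; apply/orP; left; apply/eqP.
have := k1 k; move: (k.+1%:R : R) => K K0; field.
by rewrite gt_eqF.
Unshelve. all: by end_near.
Qed.

End MatrixExponential.

(** * Lie algebras of closed matrix groups *)

Section PolynomialsOnSpectra.
Variables (K M : comNzRingType) (i0 : {rmorphism K -> M}) (n : nat).

Definition detpoly : mxpoly K n := \det (genericmx K n) - 1.

Lemma mxeval_det (L : comNzRingType) (i : {rmorphism K -> L}) (x : 'M[L]_n) :
  mxeval i detpoly x = \det x - 1.
Proof.
rewrite mxevalB mxeval1; congr (_ - _).
by rewrite -[in RHS](mxev_generic i x) det_map_mx.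
Qed.

Lemma points_zeros (L : comNzRingType) (i : {rmorphism K -> L}) P (x : 'M[L]_n) :
  points i P x <-> zeros i (detpoly :: P) x.
Proof.
split=> [[dx Px] p|h].
  by rewrite inE => /predU1P[->|/Px //]; rewrite mxeval_det dx subrr.
split=> [|p pP]; last by apply: h; rewrite inE pP orbT.
by apply/eqP; rewrite -subr_eq0 -(mxeval_det i); apply/eqP/h/mem_head.
Qed.

Variables (I : finType) (P : I -> 'M[M]_n).

(** On the span of fixed matrices a polynomial becomes a polynomial in the coefficients [tau]. Its
    monomials are chosen before the field and before [tau], which allows [character_relation] to
    compare different families of [tau]. *)
Lemma mxeval_combination (q : mxpoly K n) : exists (J : finType) (d : J -> M) (c : J -> I -> nat),
  forall (L : comNzRingType) (i : {rmorphism M -> L}) (tau : I -> L),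
    mxeval (i \o i0) q (\sum_a tau a *: map_mx i (P a)) =
    \sum_j i (d j) * \prod_a tau a ^+ c j a.
Proof.
pose Q := mpoly.mmap (@mpoly.mpolyC #|I| M \o i0) (fun k : 'I_(n * n) =>
  \sum_a mpoly.mpolyC #|I| (mxvec (P a) 0 k) * mpoly.mpolyX M (mpoly.mnm1 (enum_rank a))) q.
exists 'I_(size (mpoly.msupp Q)).
pose m j := nth mpoly.mnm0 (mpoly.msupp Q) j.
exists (fun j : 'I__ => mpoly.mcoeff (m j) Q), (fun (j : 'I__) a => mpoly.fun_of_multinom (m j) (enum_rank a)).
move=> L i tau; pose h (k : 'I_#|I|) := tau (enum_val k).
transitivity (mpoly.mmap i h Q).
  have -> : Q = \sum_(k <- mpoly.msupp q) mpoly.mpolyC #|I| (i0 (mpoly.mcoeff k q)) *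
      mpoly.mmap1 (fun k : 'I_(n * n) => \sum_a mpoly.mpolyC #|I| (mxvec (P a) 0 k) *
      mpoly.mpolyX M (mpoly.mnm1 (enum_rank a))) k by [].
  rewrite rmorph_sum /mxeval [LHS]/mpoly.mmap; apply: eq_bigr => k _ /=.
  rewrite rmorphM /= mpoly.mmapC; congr (_ * _).
  rewrite /mpoly.mmap1 rmorph_prod; apply: eq_bigr => l _.
  rewrite rmorphXn /=; congr (_ ^+ _); rewrite rmorph_sum /= linear_sum summxE.
  apply: eq_bigr => a _; rewrite rmorphM /= mpoly.mmapC mpoly.mmapX mpoly.mmap1U /h enum_rankK.
  rewrite linearZ mxE /= mulrC; congr (_ * _).
  by case/mxvec_indexP: l => x y; rewrite !mxvecE mxE.
rewrite /mpoly.mmap (big_nth mpoly.mnm0) big_mkord; apply: eq_bigr => j _; congr (_ * _).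
rewrite /mpoly.mmap1 (reindex (@enum_rank I)) /=; last first.
  by exists enum_val => x _; [apply: enum_rankK|apply: enum_valK].
by apply: eq_bigr => a _; rewrite /h enum_rankK.
Qed.

End PolynomialsOnSpectra.

Definition orthidem (K : comNzRingType) n (I : finType) (P : I -> 'M[K]_n) :=
  (forall a b : I, P a *m P b = if a == b then P a else 0) /\ \sum_a P a = 1%:M.

Lemma orthmx_idem (K : comNzRingType) n (k : 'M[K]_n) : k *m k^T = 1%:M ->
  orthidem (fun a => k^T *m delta_mx a a *m k).
Proof.
move=> kk; split=> [a b|].
  rewrite -!mulmxA (mulmxA k) kk mul1mx (mulmxA (delta_mx a a)) mul_delta_mx_cond.
  by case: eqP => [->|_]; rewrite ?mulr0n ?mul0mx ?mulmx0.
rewrite -mulmx_suml -mulmx_sumr.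
have -> : \sum_a delta_mx a a = 1%:M :> 'M[K]_n.
  apply/matrixP => x y; rewrite summxE (bigD1 x) //= big1 => [|a ax].
    by rewrite !mxE eqxx addr0 eq_sym.
  by rewrite mxE eq_sym (negbTE ax).
by rewrite mulmx1; apply: mulmx1C.
Qed.

Lemma diag_idem (K : comNzRingType) n (k : 'M[K]_n) (d : 'rV_n) :
  k^T *m diag_mx d *m k = \sum_a d 0 a *: (k^T *m delta_mx a a *m k).
Proof.
rewrite diag_mx_sum_delta mulmx_sumr mulmx_suml; apply: eq_bigr => a _.
by rewrite -scalemxAr -scalemxAl.
Qed.

Section PowersInZeros.
Variables (K : rcfType) (R : realType) (iR : {rmorphism K -> R}) (n : nat).
Variables (I : finType) (E : I -> 'M[R]_n).

(* t |-> q (sum_a e^(t x_a) E_a) is a combination of exponentials of t, hence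
   vanishes identically as soon as it vanishes at the natural numbers. *)
Lemma zeros_exp (Q : seq (mxpoly K n)) (x : I -> R) :
  (forall j : nat, zeros iR Q (\sum_a expR (x a *+ j) *: E a)) ->
  forall t : R, zeros iR Q (\sum_a expR (t * x a) *: E a).
Proof.
move=> h t q qQ; have [J [d [c hc]]] := mxeval_combination iR E q.
have eE (y : I -> R) : mxeval iR q (\sum_a expR (y a) *: E a) =
    \sum_j d j * expR (\sum_a y a *+ c j a).
  have := hc R [the {rmorphism R -> R} of idfun] (fun a => expR (y a)).
  under eq_bigr do rewrite map_mx_id //.
  move=> ->; apply: eq_bigr => j _; congr (_ * _).
  by rewrite expR_sum; apply: eq_bigr => a _; rewrite -expRM_natl mulr_natl.
rewrite eE; apply: (character_relation (op := addn) (x0 := 0%N)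
  (chi := fun j k => expR (\sum_a (x a *+ k) *+ c j a))).
- move=> j k l; rewrite -expRD -big_split /=; congr expR.
  by apply: eq_bigr => a _; rewrite mulrnDr mulrnDl.
- by move=> j; rewrite gt_eqF ?expR_gt0.
- by move=> k; rewrite -eE; apply: h.
- move=> j k /(_ 1%N); under eq_bigr do rewrite mulr1n.
  under [in RHS]eq_bigr do rewrite mulr1n.
  move=> /expR_inj jk; congr expR.
  have lin l : \sum_a (t * x a) *+ c l a = t * \sum_a x a *+ c l a.
    by rewrite mulr_sumr; apply: eq_bigr => a _; rewrite mulrnAr.
  by rewrite !lin jk.
Qed.

End PowersInZeros.

Section LieAlgebra.
Variables (R : realType) (n : nat).
Implicit Types (X Y Z : 'M[R]_n).

Lemma mnormM X Y : mnorm (X *m Y) <= mnorm X * mnorm Y.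
Proof.
rewrite {1}/mnorm (le_trans (y := \sum_i \sum_j \sum_k `|X i k| * `|Y k j|)) //.
  apply: ler_sum => i _; apply: ler_sum => j _; rewrite mxE.
  by rewrite (le_trans (ler_norm_sum _ _ _)) //; apply: ler_sum => k _; rewrite normrM.
rewrite {1}/mnorm mulr_suml; apply: ler_sum => i _.
rewrite exchange_big mulr_suml; apply: ler_sum => k _ /=.
rewrite -mulr_sumr ler_wpM2l // /mnorm [leRHS](bigD1 k) //= lerDl.
by apply: sumr_ge0 => l _; apply: sumr_ge0.
Qed.

Lemma mxtrace_le_mnorm X : `|\tr X| <= mnorm X.
Proof.
rewrite (le_trans (ler_norm_sum _ _ _)) //; apply: ler_sum => i _.
by rewrite (bigD1 i) //= lerDl sumr_ge0.
Qed.

Definition exprem X N := n%:R * (n%:R * (mnorm X ^+ N * expR (mnorm X))).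

Lemma exprem_ge0 X N : 0 <= exprem X N.
Proof. by rewrite /exprem !mulr_ge0 ?ler0n ?exprn_ge0 ?expR_ge0 ?mnorm_ge0. Qed.

Lemma exp_order X N (t : R) : `|t| <= 1 ->
  mnorm (expmx (t *: X) - exppart (t *: X) N) <= exprem X N * `|t| ^+ N.
Proof.
move=> t1; rewrite (le_trans (mnorm_le_entry (fun i j => expmx_remainder _ N i j))) //.
rewrite /exprem -!(mulrA n%:R) !(ler_wpM2l (ler0n _ _)) // mnormZ exprMn.
rewrite mulrAC [_ * mnorm X ^+ N]mulrC -!mulrA ler_wpM2l ?exprn_ge0 ?mnorm_ge0 //.
rewrite mulrC ler_wpM2r ?exprn_ge0 // ler_expR ler_piMl ?mnorm_ge0 //.
Qed.

Lemma exp_order2 X (t : R) : `|t| <= 1 ->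
  mnorm (expmx (t *: X) - (1%:M + t *: X)) <= exprem X 2 * t ^+ 2.
Proof.
move=> t1; have := exp_order X 2 t1; rewrite /exppart !big_ord_recl big_ord0 /=.
by rewrite addr0 expr0 expr1 !fact0 !invr1 !scale1r real_normK ?num_real.
Qed.

Lemma exp_order3 X (t : R) : `|t| <= 1 ->
  mnorm (expmx (t *: X) - (1%:M + t *: X + (t ^+ 2 / 2) *: (X *m X))) <=
  exprem X 3 * `|t| ^+ 3.
Proof.
move=> t1; have := exp_order X 3 t1; rewrite /exppart !big_ord_recl big_ord0 /=.
rewrite addr0 expr0 expr1 !fact0 !invr1 !scale1r /bump /= !addrA.
rewrite (_ : (t *: X) ^+ _ = t ^+ 2 *: (X *m X)).
  by rewrite scalerA [_^-1 * _]mulrC.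
by rewrite [LHS]expr2 -mulmxE -scalemxAl -scalemxAr scalerA.
Qed.

Variable G : set 'M[R]_n.
Hypothesis Gc : mclosed G.
Hypothesis G1 : G 1%:M.
Hypothesis GM : forall g h, G g -> G h -> G (g *m h).

Lemma group_exp g k : G g -> G (g ^+ k).
Proof.
by move=> Gg; elim: k => [|k IH]; rewrite ?expr0 // exprS -mulmxE; apply: GM.
Qed.

Lemma Lie_exp X : Lie G X -> G (expmx X).
Proof. by move=> /(_ 1); rewrite scale1r. Qed.

Lemma LieZ (t : R) X : Lie G X -> Lie G (t *: X).
Proof. by move=> GX s; rewrite scalerA; apply: GX. Qed.

Lemma Lie0 : Lie G 0.
Proof. by move=> t; rewrite scaler0 expmx0. Qed.

Lemma LieN X : Lie G X -> Lie G (- X).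
Proof. by move=> GX; rewrite -scaleN1r; apply: LieZ. Qed.

Lemma near_group_limit (A : nat -> 'M[R]_n) X c : (forall k, G (A k)) ->
  (forall k, mnorm (A k - 1%:M - k.+1%:R^-1 *: X) <= c / k.+1%:R ^+ 2) -> G (expmx X).
Proof.
move=> GA h; apply: (@Gc nat \oo _ (fun k => A k ^+ k.+1)).
  exact: power_limit h.
by near=> k; apply: group_exp.
Unshelve. all: by end_near.
Qed.

(** Lie product formula: exp(X/k) exp(Y/k) = 1 + (X + Y)/k + O(1/k^2), so its powers stay in the
    closed group and converge to exp(X + Y). The constant c collects the three error terms of the
    decomposition of P Q - 1 - e(X + Y). *)
Lemma LieD X Y : Lie G X -> Lie G Y -> Lie G (X + Y).
Proof.
move=> GX GY t; rewrite scalerDr.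
have {}GX := LieZ t GX; have {}GY := LieZ t GY.
move: (t *: X) (t *: Y) GX GY => {}X {}Y GX GY.
pose A k := expmx (k.+1%:R^-1 *: X) *m expmx (k.+1%:R^-1 *: Y).
pose c := (n%:R + mnorm X) * exprem Y 2 + mnorm X * mnorm Y + exprem X 2 * (n%:R + mnorm Y + exprem Y 2).
apply: (@near_group_limit A _ c) => k; first by apply: GM.
set e : R := k.+1%:R^-1; have e0 : 0 <= e by rewrite invr_ge0 ler0n.
have e1 : e <= 1 by rewrite invf_le1 ?ler1n // ltr0n.
have en : `|e| <= 1 by rewrite ger0_norm.
have oX := exp_order2 X en; have oY := exp_order2 Y en.
rewrite /A -/e; set P := expmx _; set Q := expmx _.
have -> : P *m Q - 1%:M - e *: (X + Y) = (1%:M + e *: X) *m (Q - (1%:M + e *: Y)) +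
    e ^+ 2 *: (X *m Y) + (P - (1%:M + e *: X)) *m Q.
  rewrite mulmxBl mulmxBr !mulmxDl !mulmxDr !mul1mx !mulmx1 -!scalemxAl -!scalemxAr.
  by apply/matrixP => a b; rewrite !mxE; ring.
have n1 : mnorm (1%:M : 'M[R]_n) <= n%:R.
  rewrite /mnorm -[n in n%:R]card_ord -sumr_const; apply: ler_sum => i _.
  rewrite (bigD1 i) //= big1 => [|j ji]; first by rewrite mxE eqxx normr1 addr0.
  by rewrite mxE eq_sym (negbTE ji) normr0.
have nl Z : mnorm (1%:M + e *: Z) <= n%:R + mnorm Z.
  rewrite (le_trans (mnormD _ _)) // lerD // mnormZ ger0_norm //.
  by rewrite ler_piMl ?mnorm_ge0.
have nQ : mnorm Q <= n%:R + mnorm Y + exprem Y 2.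
  rewrite -[Q](subrK (1%:M + e *: Y)) addrC (le_trans (mnormD _ _)) // lerD //.
  by rewrite (le_trans oY) // ler_piMr ?exprem_ge0 // expr_le1.
have A1 : mnorm ((1%:M + e *: X) *m (Q - (1%:M + e *: Y))) <=
    (n%:R + mnorm X) * (exprem Y 2 * e ^+ 2).
  by rewrite (le_trans (mnormM _ _)) // ler_pM ?mnorm_ge0.
have A2 : mnorm (e ^+ 2 *: (X *m Y)) <= mnorm X * mnorm Y * e ^+ 2.
  by rewrite mnormZ ger0_norm ?exprn_ge0 // mulrC ler_wpM2r ?exprn_ge0 // mnormM.
have A3 : mnorm ((P - (1%:M + e *: X)) *m Q) <=
    exprem X 2 * e ^+ 2 * (n%:R + mnorm Y + exprem Y 2).
  by rewrite (le_trans (mnormM _ _)) // ler_pM ?mnorm_ge0.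
have -> : c / k.+1%:R ^+ 2 = (n%:R + mnorm X) * (exprem Y 2 * e ^+ 2) +
    mnorm X * mnorm Y * e ^+ 2 + exprem X 2 * e ^+ 2 * (n%:R + mnorm Y + exprem Y 2).
  by rewrite -exprVn -/e /c; ring.
rewrite (le_trans (mnormD _ _)) // lerD //.
by rewrite (le_trans (mnormD _ _)) // lerD.
Qed.

Lemma Lie_sum (I : Type) (s : seq I) (P : pred I) (X : I -> 'M[R]_n) :
  (forall j, P j -> Lie G (X j)) -> Lie G (\sum_(j <- s | P j) X j).
Proof. by move=> h; apply: big_ind => //; [apply: Lie0|apply: LieD]. Qed.

Lemma Lie_conj g h X : G g -> G h -> h *m g = 1%:M -> Lie G X -> Lie G (g *m X *m h).
Proof.
move=> Gg Gh hg GX t; rewrite scalemxAl scalemxAr expmx_conj //.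
by apply: GM => //; apply: GM.
Qed.

Lemma Lie_tr X : (forall g, G g -> G g^T) -> Lie G X -> Lie G X^T.
Proof. by move=> Gt GX t; rewrite -linearZ /= -trmx_expmx; apply: Gt. Qed.

End LieAlgebra.

(** * Taylor expansion of conjugation by exponentials *)

Section Expansions.
Variables (R : realType) (n : nat).
Implicit Types (X Y Z : 'M[R]_n).

Definition bracket X Y := X *m Y - Y *m X.

Lemma first_order_eq0 (a C : R) : (forall t : R, `|t| <= 1 -> a * t <= C * t ^+ 2) -> a = 0.
Proof.
move=> h; have C0 : 0 <= C.
  have h1 := h 1; have h2 := h (-1); rewrite normrN normr1 in h1 h2.
  by have := h1 (lexx _); have := h2 (lexx _); rewrite sqrrN expr1n; lra.
apply/eqP; rewrite -normr_eq0 eq_le normr_ge0 andbT; apply/ler_addgt0Pr => e e0.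
rewrite add0r; pose t := Num.min 1 (e / (C + 1)).
have t0 : 0 < t by rewrite /t lt_min ltr01 divr_gt0 //; lra.
have t1 : `|t| <= 1 by rewrite gtr0_norm // /t ge_min lexx.
have te : C * t <= e.
  rewrite (le_trans (y := C * (e / (C + 1)))) ?ler_wpM2l // ?ge_min ?lexx ?orbT //.
  rewrite mulrCA ger_pMr // ler_pdivrMr; lra.
have b s : `|s| <= 1 -> s ^+ 2 = t ^+ 2 -> a * s <= e * t.
  by move=> /h hs s2; rewrite (le_trans hs) // s2 expr2 mulrA ler_wpM2r // ltW.
have h1 := b t t1 erefl; have h2 := b (- t); rewrite normrN sqrrN in h2.
have {}h2 := h2 t1 erefl.
rewrite ler_norml -(ler_pM2r t0) -[a <= e](ler_pM2r t0) h1 andbT; lra.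
Qed.

Lemma second_order_le0 (a C : R) : 
  (forall t : R, 0 <= t -> t <= 1 -> a * t ^+ 2 <= C * t ^+ 3) -> a <= 0.
Proof.
move=> h; apply/ler_addgt0Pr => e e0; rewrite add0r.
pose t := Num.min 1 (e / (`|C| + 1)).
have C1 : 0 < `|C| + 1 by rewrite ltr_wpDl.
have t0 : 0 < t by rewrite /t lt_min ltr01 divr_gt0.
have t1 : t <= 1 by rewrite /t ge_min lexx.
have te : C * t <= e.
  apply: (le_trans (y := `|C| * t)); first by rewrite ler_wpM2r ?ler_norm // ltW.
  rewrite (le_trans (y := `|C| * (e / (`|C| + 1)))) ?ler_wpM2l // ?ge_min ?lexx ?orbT //.
  rewrite mulrCA ger_pMr // ler_pdivrMr; lra.
rewrite -(ler_pM2r (exprn_gt0 2 t0)) (le_trans (h t (ltW t0) t1)) //.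
by rewrite exprSr mulrA mulrAC ler_wpM2r // exprn_ge0 // ltW.
Qed.

Lemma conj_order3 Y Z : exists C : R, forall t : R, `|t| <= 1 ->
  mnorm (expmx (t *: Y) *m Z *m expmx (- (t *: Y)) -
    (Z + t *: bracket Y Z + (t ^+ 2 / 2) *: bracket Y (bracket Y Z))) <= C * `|t| ^+ 3.
Proof.
pose c := exprem Y 3; pose y := mnorm Y; pose z := mnorm Z.
pose m := n%:R * n%:R + y + y * y : R.
(* W and V are the coefficients of t^3 and t^4 in (1 + tY + t^2 Y^2/2) Z (1 - tY + t^2 Y^2/2). *)
pose W := (2^-1) *: (Y *m Z *m (Y *m Y)) - (2^-1) *: (Y *m Y *m Z *m Y).
pose V := (4^-1) *: (Y *m Y *m Z *m (Y *m Y)).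
exists (mnorm W + mnorm V + m * z * c + c * z * (m + c)) => t t1.
have t0 : 0 <= `|t| by [].
have cc : 0 <= c := exprem_ge0 Y 3.
have oY := exp_order3 Y t1; have := @exp_order3 R n Y (- t); rewrite normrN => /(_ t1) oN.
rewrite scaleNr sqrrN in oN; rewrite -/c in oY oN.
set P := expmx _ in oY *; set Q := expmx _ in oN *.
set E := _ + _ *: (Y *m Y) in oY *; set E' := _ + _ *: (Y *m Y) in oN *.
have key : E *m Z *m E' = Z + t *: bracket Y Z + (t ^+ 2 / 2) *: bracket Y (bracket Y Z) +
   t ^+ 3 *: W + t ^+ 4 *: V.
  rewrite /E /E' /W /V /bracket !(mulmxDl, mulmxDr, mulmxN, mulNmx, mulmxBl, mulmxBr) -?scalemxAl -?scalemxAr.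
  rewrite -?scalemxAl -?scalemxAr !mul1mx !mulmx1 !mulmxA.
  by apply/matrixP => a b; rewrite !mxE; field.
have -> : P *m Z *m Q - (Z + t *: bracket Y Z + (t ^+ 2 / 2) *: bracket Y (bracket Y Z)) =
    t ^+ 3 *: W + t ^+ 4 *: V + E *m Z *m (Q - E') + (P - E) *m Z *m Q.
  rewrite mulmxBr !mulmxBl key.
  by apply/matrixP => a b; rewrite !mxE; ring.
have t41 : `|t| ^+ 4 <= `|t| ^+ 3 by rewrite exprSr ler_piMr // exprn_ge0.
have t31 : `|t| ^+ 3 <= 1 by rewrite exprn_ile1.
have n1 : mnorm (1%:M : 'M[R]_n) <= n%:R * n%:R.
  rewrite -[X in _ <= _ * X]mulr1; apply: mnorm_le_entry => i j.
  by rewrite mxE; case: eqP; rewrite ?normr1 ?normr0.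
have nE (s : R) : `|s| <= 1 -> mnorm (1%:M + s *: Y + (s ^+ 2 / 2) *: (Y *m Y)) <= m.
  move=> s1; rewrite (le_trans (mnormD _ _)) // lerD //.
    rewrite (le_trans (mnormD _ _)) // lerD // mnormZ ler_piMl ?mnorm_ge0 //.
  rewrite mnormZ (le_trans _ (mnormM _ _)) // ler_piMl ?mnorm_ge0 //.
  rewrite normrM normrX normfV normr_nat ler_pdivrMr // mul1r.
  by rewrite (le_trans (y := 1)) ?expr_le1 //; lra.
have m0 : 0 <= m by rewrite (le_trans _ (nE 0 _)) ?mnorm_ge0 // normr0.
have nE1 : mnorm E <= m by apply: nE.
have nQ : mnorm Q <= m + c.
  have nE' : mnorm E' <= m by rewrite /E' -scaleNr -(sqrrN t); apply: nE; rewrite normrN.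
  rewrite -[Q](subrK E') addrC (le_trans (mnormD _ _)) // lerD //.
  by rewrite (le_trans oN) // ler_piMr.
have A1 : mnorm (t ^+ 3 *: W) <= mnorm W * `|t| ^+ 3 by rewrite mnormZ normrX mulrC.
have A2 : mnorm (t ^+ 4 *: V) <= mnorm V * `|t| ^+ 3.
  by rewrite mnormZ normrX mulrC ler_wpM2l ?mnorm_ge0.
have A3 : mnorm (E *m Z *m (Q - E')) <= m * z * (c * `|t| ^+ 3).
  rewrite (le_trans (mnormM _ _)) // ler_pM ?mnorm_ge0 //.
  by rewrite (le_trans (mnormM _ _)) // ler_pM ?mnorm_ge0.
have A4 : mnorm ((P - E) *m Z *m Q) <= c * `|t| ^+ 3 * z * (m + c).
  rewrite (le_trans (mnormM _ _)) // ler_pM ?mnorm_ge0 //.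
  by rewrite (le_trans (mnormM _ _)) // ler_pM ?mnorm_ge0.
have -> : (mnorm W + mnorm V + m * z * c + c * z * (m + c)) * `|t| ^+ 3 =
  mnorm W * `|t| ^+ 3 + mnorm V * `|t| ^+ 3 + m * z * (c * `|t| ^+ 3) +
  c * `|t| ^+ 3 * z * (m + c) by ring.
rewrite (le_trans (mnormD _ _)) // lerD // (le_trans (mnormD _ _)) // lerD //.
by rewrite (le_trans (mnormD _ _)) // lerD.
Qed.

End Expansions.

(** * Weight decompositions *)

(** The minimal polynomial divides a power of the indeterminate and also the characteristic
    polynomial, of degree n. The exponent n is needed because [nilexp] stops after n terms. *)
Lemma nilpotent_exp (K : fieldType) n (X : 'M[K]_n) k : X ^+ k = 0 -> X ^+ n = 0.
Proof.
case: n X => [|n] X X0; first by apply/matrixP => -[].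
have dv : mxminpoly X %| ('X - 0%:P) ^+ k.
  by apply: mxminpoly_min; rewrite polyC0 subr0 rmorphXn /= horner_mx_X.
have [j jk E] := dvdp_exp_XsubCP dv.
have sz : (j <= n.+1)%N.
  have := dvdp_leq (monic_neq0 (char_poly_monic X)) (mxminpoly_dvd_char X).
  by rewrite size_char_poly (eqp_size E) size_exp_XsubC ltnS.
have : horner_mx X (('X - 0%:P) ^+ j) = 0.
  by apply/mxminpoly_minP; case/andP: E.
rewrite polyC0 subr0 rmorphXn /= horner_mx_X => Xj.
have -> : X ^+ n.+1 = X ^+ (n.+1 - j) * X ^+ j by rewrite -exprD subnK.
by rewrite Xj mulr0.
Qed.

Section Weights.
Variables (R : realType) (n : nat) (I : finType) (F : I -> 'M[R]_n).
Variable fa : {vspace 'M[R]_n}.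
Hypothesis Fid : orthidem F.
Hypothesis Fsym : forall a, (F a)^T = F a.
Hypothesis Fn0 : forall a, F a != 0.

Implicit Types (X Y : 'M[R]_n) (H : subvs_of fa) (alpha beta : dual fa).

Lemma FF a b : F a *m F b = if a == b then F a else 0.
Proof. by case: Fid. Qed.

Lemma sumF : \sum_a F a = 1%:M.
Proof. by case: Fid. Qed.

Lemma trFF X : \tr (X *m X^T) = \sum_i \sum_j X i j ^+ 2.
Proof.
apply: eq_bigr => i _; rewrite mxE; apply: eq_bigr => j _.
by rewrite mxE expr2.
Qed.

Lemma trFF_ge0 X : 0 <= \tr (X *m X^T).
Proof. by rewrite trFF; apply: sumr_ge0 => i _; apply: sumr_ge0 => j _; apply: sqr_ge0. Qed.

Lemma trFF_eq0 X : \tr (X *m X^T) = 0 -> X = 0.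
Proof.
rewrite trFF => /eqP; rewrite psumr_eq0 => [/allP h|i _]; last first.
  by apply: sumr_ge0 => j _; apply: sqr_ge0.
apply/matrixP => i j; rewrite [RHS]mxE; apply: (sum_sqr_eq0 (F := fun j => X i j)).
by apply/eqP/h/mem_index_enum.
Qed.

Lemma trF_gt0 a : 0 < \tr (F a).
Proof.
have E : \tr (F a) = \tr (F a *m (F a)^T) by rewrite Fsym FF eqxx.
rewrite lt_neqAle eq_sym E trFF_ge0 andbT.
by apply: contra (Fn0 a) => /eqP/trFF_eq0 ->.
Qed.

(** On combinations of the F this is the coefficient of F_a; for other X it is a normalised trace of
    the diagonal block, the form in which it enters the trace estimates. *)
Definition lam a X : R := \tr (F a *m X) / \tr (F a).

Lemma lamD a X Y : lam a (X + Y) = lam a X + lam a Y.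
Proof. by rewrite /lam mulmxDr mxtraceD mulrDl. Qed.

Lemma lamZ a (c : R) X : lam a (c *: X) = c * lam a X.
Proof. by rewrite /lam -scalemxAr mxtraceZ mulrA. Qed.

Definition wtf a b H : R := lam a (vsval H) - lam b (vsval H).

Lemma wtf_linear a b : linear (wtf a b : subvs_of fa -> R^o).
Proof.
move=> c H H'; rewrite /wtf linearP !lamD !lamZ /GRing.scale /=; ring.
Qed.

HB.instance Definition _ a b := GRing.isLinear.Build R (subvs_of fa) R^o _
  (wtf a b : subvs_of fa -> R^o) (wtf_linear a b).

Definition wt a b : dual fa := linfun (wtf a b : subvs_of fa -> R^o).

Lemma wtE a b H : wt a b H = lam a (vsval H) - lam b (vsval H).
Proof. by rewrite lfunE. Qed.

Hypothesis faF : forall H, vsval H = \sum_a lam a (vsval H) *: F a.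

Lemma fa_sym H : (vsval H)^T = vsval H.
Proof.
rewrite [vsval H]faF linear_sum; apply: eq_bigr => a _.
by rewrite linearZ /= Fsym.
Qed.

Lemma faFl H a : vsval H *m F a = lam a (vsval H) *: F a.
Proof.
rewrite {1}[vsval H]faF mulmx_suml (bigD1 a) //= big1 ?addr0 => [|b ba].
  by rewrite -scalemxAl FF eqxx.
by rewrite -scalemxAl FF (negbTE ba) scaler0.
Qed.

Lemma faFr H a : F a *m vsval H = lam a (vsval H) *: F a.
Proof. by have := congr1 trmx (faFl H a); rewrite trmx_mul linearZ /= Fsym fa_sym. Qed.

Lemma fa_exp H : expmx (vsval H) = \sum_a expR (lam a (vsval H)) *: F a.
Proof.
by rewrite {1}[vsval H]faF (@expmx_spectral _ _ I F (fun a => lam a (vsval H))) ?sumF // => a b;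
  apply: FF.
Qed.

Lemma expFl H a : expmx (vsval H) *m F a = expR (lam a (vsval H)) *: F a.
Proof.
rewrite fa_exp mulmx_suml (bigD1 a) //= big1 ?addr0 => [|b ba].
  by rewrite -scalemxAl FF eqxx.
by rewrite -scalemxAl FF (negbTE ba) scaler0.
Qed.

Lemma expFr H a : F a *m expmx (vsval H) = expR (lam a (vsval H)) *: F a.
Proof.
by have := congr1 trmx (expFl H a); rewrite trmx_mul linearZ /= Fsym trmx_expmx fa_sym.
Qed.

Lemma fa_comm H H' : vsval H *m vsval H' = vsval H' *m vsval H.
Proof.
rewrite [vsval H']faF mulmx_sumr mulmx_suml; apply: eq_bigr => a _.
by rewrite -scalemxAr -scalemxAl faFl faFr.
Qed.

(** Functional calculus of the adjoint action: the part of X of weight al is multiplied by c(al).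
    The maps ad H and Ad(exp H) are instances, with c(al) = al(H) and e^(al(H)), and compositions
    multiply the c. *)
Definition wsum (c : dual fa -> R) X := \sum_a \sum_b c (wt a b) *: (F a *m X *m F b).

Lemma sumFXF X : X = \sum_a \sum_b F a *m X *m F b.
Proof.
rewrite -{1}[X]mul1mx -{1}[_ *m X]mulmx1 -sumF !mulmx_suml; apply: eq_bigr => a _.
by rewrite mulmx_sumr.
Qed.

Lemma wsum1 X : wsum (fun=> 1) X = X.
Proof.
rewrite [RHS]sumFXF; apply: eq_bigr => a _; apply: eq_bigr => b _.
by rewrite scale1r.
Qed.

Lemma FwsumF c X a b : F a *m wsum c X *m F b = c (wt a b) *: (F a *m X *m F b).
Proof.
rewrite mulmx_sumr mulmx_suml (bigD1 a) //= [X in _ + X]big1 ?addr0 => [|a' aa'].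
  rewrite mulmx_sumr mulmx_suml (bigD1 b) //= big1 ?addr0 => [|b' bb'].
    rewrite -scalemxAr -scalemxAl !mulmxA FF eqxx.
    by rewrite -(mulmxA _ (F b)) FF eqxx.
  rewrite -scalemxAr -scalemxAl -!mulmxA [F b' *m F b]FF (negbTE bb').
  by rewrite !mulmx0 scaler0.
rewrite mulmx_sumr mulmx_suml big1 // => b' _.
by rewrite -scalemxAr -scalemxAl !mulmxA FF eq_sym (negbTE aa') !mul0mx scaler0.
Qed.

Lemma eq_blocks X Y : (forall a b, F a *m X *m F b = F a *m Y *m F b) -> X = Y.
Proof.
move=> h; rewrite [X]sumFXF [Y]sumFXF.
by apply: eq_bigr => a _; apply: eq_bigr => b _; apply: h.
Qed.

Lemma wsum_comp c c' X : wsum c (wsum c' X) = wsum (fun al => c al * c' al) X.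
Proof. by apply: eq_blocks => a b; rewrite !FwsumF scalerA. Qed.

Lemma wsumDc c c' X : wsum (fun al => c al + c' al) X = wsum c X + wsum c' X.
Proof.
apply: eq_blocks => a b; rewrite mulmxDr mulmxDl !FwsumF.
by rewrite scalerDl.
Qed.

Lemma wsumZc (r : R) c X : wsum (fun al => r * c al) X = r *: wsum c X.
Proof. by apply: eq_blocks => a b; rewrite -scalemxAr -scalemxAl !FwsumF scalerA. Qed.

Lemma bracket_wsum H X : bracket (vsval H) X = wsum (fun al => al H) X.
Proof.
apply: eq_blocks => a b; rewrite FwsumF wtE /bracket mulmxBr mulmxBl.
by rewrite mulmxA faFr -!mulmxA faFl !mulmxA -!scalemxAl -scalemxAr scalerBl.
Qed.

Lemma Ad_wsum H X : expmx (vsval H) *m X *m expmx (- vsval H) =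
  wsum (fun al => expR (al H)) X.
Proof.
apply: eq_blocks => a b; rewrite FwsumF wtE !mulmxA expFr -!mulmxA.
have -> : - vsval H = vsval (- H) by rewrite linearN.
rewrite expFl linearN /= -scaleN1r lamZ mulN1r -scalemxAl -!scalemxAr scalerA.
by rewrite -expRD !mulmxA.
Qed.

Definition wcomp alpha := wsum (fun al => (al == alpha)%:R).

Definition weights : seq (dual fa) := undup [seq wt a b | a <- enum I, b <- enum I].

Lemma mem_weights a b : wt a b \in weights.
Proof. by rewrite mem_undup; apply: allpairs_f; rewrite mem_enum. Qed.

Lemma wsum_weights c X : wsum c X = \sum_(al <- weights) c al *: wcomp al X.
Proof.
apply: eq_blocks => a b; rewrite FwsumF mulmx_sumr mulmx_suml.
rewrite (bigD1_seq (wt a b)) ?undup_uniq ?mem_weights //= big1 ?addr0.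
  by rewrite -scalemxAr -scalemxAl FwsumF eqxx scale1r.
move=> al ne; rewrite -scalemxAr -scalemxAl FwsumF eq_sym (negbTE ne).
by rewrite scale0r scaler0.
Qed.

Lemma eq_wsum c c' X : (forall a b, F a *m X *m F b != 0 -> c (wt a b) = c' (wt a b)) ->
  wsum c X = wsum c' X.
Proof.
move=> h; apply: eq_blocks => a b; rewrite !FwsumF.
by have [->|/h ->//] := eqVneq (F a *m X *m F b) 0; rewrite !scaler0.
Qed.

Lemma bracket_wcomp H alpha X :
  bracket (vsval H) (wcomp alpha X) = alpha H *: wcomp alpha X.
Proof.
rewrite bracket_wsum /wcomp wsum_comp -wsumZc; apply: eq_wsum => a b _.
by case: eqP => [->|_]; rewrite ?mulr0.
Qed.

(** X strictly raises h, so a nonzero block (a, b) of X^k requires a chain of k indices with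
    increasing heights above h b and up to h a; the finite index set bounds k. *)
Lemma raising_nilpotent (h : I -> R) X :
  (forall a b, h a <= h b -> F a *m X *m F b = 0) -> X ^+ n = 0.
Proof.
move=> raise.
have pow k a b : F a *m X ^+ k *m F b != 0 ->
    (k <= #|[set c : I | (h b < h c)%R && (h c <= h a)%R]%SET|)%N.
  elim: k a b => // k IH a b nz.
  have [c [nz1 nz2]] : exists c, F a *m X *m F c != 0 /\ F c *m X ^+ k *m F b != 0.
    apply: contrapT => no; case/negP: nz; apply/eqP.
    rewrite exprS -mulmxE -[X ^+ k]mul1mx -sumF mulmx_suml.
    rewrite !mulmx_sumr mulmx_suml big1 // => c _.
    have [z1|nz1] := eqVneq (F a *m X *m F c) 0.
      by rewrite !mulmxA z1 !mul0mx.
    have [z2|nz2] := eqVneq (F c *m X ^+ k *m F b) 0; last by case: no; exists c.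
    by rewrite -!mulmxA (mulmxA (F c)) z2 !mulmx0.
  have hca : h c < h a by rewrite ltNge; apply: contra nz1 => /raise ->.
  have /IH kc := nz2.
  rewrite (leq_ltn_trans kc) //; apply: proper_card; apply/properP; split.
    apply/fintype.subsetP => d; rewrite !inE => /andP[-> dc]; exact: le_trans dc (ltW hca).
  exists a; last by rewrite !inE negb_and -!ltNge hca orbT.
  rewrite !inE lexx andbT; case: k IH nz2 kc {nz} => [_|k IH nz2 kc].
    rewrite expr0 mulmx1 FF; case: (c =P b) => [<- //|_]; by rewrite eqxx.
  rewrite (lt_trans _ hca) //.
  move: (leq_ltn_trans (leq0n k) kc); rewrite card_gt0 => /set0Pn[d].
  by rewrite inE => /andP[bd dc]; apply: lt_le_trans bd dc.
have X0 : X ^+ #|I|.+1 = 0.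
  apply: eq_blocks => a b; rewrite mulmx0 mul0mx; apply/eqP.
  apply: contraT => /pow; rewrite leqNgt ltnS max_card //.
exact: nilpotent_exp X0.
Qed.

End Weights.

(** * Cartan and Iwasawa decompositions over the reals *)

Lemma mxtraceB (K : nzRingType) n (X Y : 'M[K]_n) : \tr (X - Y) = \tr X - \tr Y.
Proof. exact: raddfB. Qed.

Lemma mxtraceN (K : nzRingType) n (X : 'M[K]_n) : \tr (- X) = - \tr X.
Proof. exact: raddfN. Qed.

Lemma tr_bracket (R : realType) n (X Y Z : 'M[R]_n) :
  \tr (bracket X Y *m Z) = - \tr (Y *m bracket X Z).
Proof.
rewrite /bracket mulmxBl mulmxBr !mxtraceB opprB -(mulmxA X) [\tr (X *m _)]mxtrace_mulC.
by rewrite !mulmxA.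
Qed.

Section ClosedSets.
Variables (R : realType) (n : nat).
Implicit Types (X Y : 'M[R]_n).

Definition mxcontinuous (f : 'M[R]_n -> 'M[R]_n) := forall (T : Type) (F : set_system T),
  ProperFilter F -> forall (A : T -> 'M[R]_n) X, mcvg F A X -> mcvg F (f \o A) (f X).

Lemma mclosed_eq (f g : 'M[R]_n -> 'M[R]_n) : mxcontinuous f -> mxcontinuous g ->
  mclosed [set X | f X = g X].
Proof.
move=> fc gc T F PF A X AX h.
apply: (mcvg_unique (fc _ _ _ _ _ AX)) => i j.
apply: cvg_trans (gc _ _ _ _ _ AX i j); apply: near_eq_cvg.
by apply: filterS h => t /= ->.
Qed.

Lemma mclosedI (P Q : set 'M[R]_n) : mclosed P -> mclosed Q -> mclosed (P `&` Q).
Proof.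
move=> Pc Qc T F PF A X AX h; split; [apply: (Pc _ _ _ _ _ AX)|apply: (Qc _ _ _ _ _ AX)];
  by apply: filterS h => t [].
Qed.

Lemma expmx_commute X Y : X *m Y = Y *m X -> expmx X *m Y = Y *m expmx X.
Proof.
move=> XY; apply: (mcvg_unique (F := \oo) (A := fun m => exppart X m *m Y)).
  by apply: mcvg_mul; [apply: mcvg_exppart|apply: mcvg_cst].
apply: (mcvg_ext (A := fun m => Y *m exppart X m)) => [m|]; last first.
  by apply: mcvg_mul; [apply: mcvg_cst|apply: mcvg_exppart].
rewrite /exppart mulmx_sumr mulmx_suml; apply: eq_bigr => k _.
rewrite -scalemxAr -scalemxAl; congr (_ *: _).
by have : GRing.comm Y (X ^+ k) by apply: commrX; rewrite /GRing.comm -!mulmxE XY.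
Qed.

End ClosedSets.

Section RealGroup.
Variables (R : realType) (n : nat) (G : set 'M[R]_n).
Hypothesis Gc : mclosed G.
Hypothesis G1 : G 1%:M.
Hypothesis GM : forall g h, G g -> G h -> G (g *m h).
Hypothesis GV : forall g, G g -> G (invmx g).
Hypothesis GT : forall g, G g -> G g^T.
Hypothesis Gdet : forall g, G g -> \det g = 1.
(** Together with [Gpoly] this is the form in which algebraicity of the group enters the real
    arguments: exponential or polynomial curves that meet the group at the relevant integers remain
    in it. *)
Hypothesis Glog : forall (J : finType) (E : J -> 'M[R]_n) (x : J -> R), orthidem E ->
  G (\sum_a expR (x a) *: E a) -> forall t, G (\sum_a expR (t * x a) *: E a).
Hypothesis Gpoly : forall (gam : 'M[{poly R}]_n),
  (forall k : nat, G (map_mx (fun p => p.[k%:R]) gam)) ->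
  forall t, G (map_mx (fun p => p.[t]) gam).

Variables (I : finType) (F : I -> 'M[R]_n) (fa : {vspace 'M[R]_n}).
Hypothesis Fid : orthidem F.
Hypothesis Fsym : forall a, (F a)^T = F a.
Hypothesis Fn0 : forall a, F a != 0.
Hypothesis faF : forall H : subvs_of fa, vsval H = \sum_a lam F a (vsval H) *: F a.
Hypothesis faLie : forall H : subvs_of fa, Lie G (vsval H).
Hypothesis famax : forall X, Lie G X -> X^T = X ->
  (forall H : subvs_of fa, vsval H *m X = X *m vsval H) -> X \in fa.

Variable Delta : seq (dual fa).
Hypothesis basisD : root_basis (Lie G) Delta.

Implicit Types (X Y : 'M[R]_n) (H : subvs_of fa) (alpha beta : dual fa).

(** Linear independence of the simple roots makes their matrix of values right invertible. At this
    element a root takes its height as value, so it is regular and its signs detect positivity. *)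
Lemma exists_regular : exists H0, forall alpha, alpha \in Delta -> alpha H0 = 1.
Proof.
have [bD _ _] := basisD; have fD := basis_free bD.
pose b := vbasis {: subvs_of fa}; pose m := size Delta.
pose M := \matrix_(i < m, j < \dim {: subvs_of fa}) (Delta`_i b`_j : R).
have : row_free M.
  rewrite -kermx_eq0; apply/rowV0P => y /sub_kermxP yM.
  have /freeP fD' : free (in_tuple Delta) by [].
  apply/rowP => i; rewrite mxE; apply: fD'; apply/lfunP => H.
  rewrite zero_lfunE sum_lfunE [H](coord_vbasis (memvf H)).
  under eq_bigr do rewrite scale_lfunE linear_sum scaler_sumr.
  rewrite exchange_big big1 // => j _ /=.
  under eq_bigr do rewrite linearZ /= scalerA mulrC -scalerA.
  rewrite -scaler_sumr; have := congr1 (fun N : 'rV_ _ => N 0 j) yM; rewrite !mxE => E.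
  rewrite [X in _ *: X](_ : _ = 0) ?scaler0 // -[RHS]E; apply: eq_bigr => k _.
  by rewrite mxE.
case/row_freeP => B MB; exists (\sum_j (B *m (const_mx 1 : 'cV_m)) j 0 *: b`_j).
move=> al /(nthP 0)[i im <-]; have := congr1 (fun N : 'M_m => (N *m (const_mx 1 : 'cV_m)) (Ordinal im) 0) MB.
rewrite mul1mx -mulmxA !mxE => E; rewrite linear_sum -[RHS]E; apply: eq_bigr => j _.
by rewrite linearZ /= !mxE mulrC.
Qed.

(** Weights are removed one at a time by the factor (Ad(exp H) - e^(beta H)) / (e^(alpha H) -
    e^(beta H)), with H separating alpha from beta. Using Ad in place of ad requires stability of
    the Lie algebra under conjugation only, not under brackets. *)
Lemma Lie_wsum_sep alpha X (s : seq (dual fa)) : Lie G X -> alpha \notin s ->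
  exists c, [/\ c alpha = 1, forall beta, beta \in s -> c beta = 0 & Lie G (wsum F c X)].
Proof.
move=> GX; elim: s => [|beta s IH]; first by exists (fun=> 1); rewrite (wsum1 fa Fid).
rewrite inE negb_or => /andP[ab /IH[c [c1 c0 cX]]].
have [H Hab] : exists H, alpha H != beta H.
  apply: contrapT => h; case/eqP: ab; apply/lfunP => H.
  by apply: contrapT => /eqP h'; apply: h; exists H.
pose e1 := expR (alpha H); pose e2 := expR (beta H).
have e12 : e1 - e2 != 0 by rewrite subr_eq0; apply: contra Hab => /eqP/expR_inj ->.
exists (fun al : dual fa => (e1 - e2)^-1 * ((expR (al H) - e2) * c al)); split.
- by rewrite c1 mulr1 mulVf.
- move=> b; rewrite inE => /predU1P[->|/c0 ->]; last by rewrite !mulr0.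
  by rewrite subrr mul0r mulr0.
rewrite (wsumZc Fid); apply: LieZ.
have -> : wsum F (fun al : dual fa => (expR (al H) - e2) * c al) X =
    expmx (vsval H) *m wsum F c X *m expmx (- vsval H) - e2 *: wsum F c X.
  rewrite (Ad_wsum Fid) // (wsum_comp Fid); apply: (eq_blocks Fid) => a b.
  rewrite mulmxBr mulmxBl -scalemxAr -scalemxAl !(FwsumF Fid) scalerA -scalerBl.
  by rewrite mulrBl.
apply: (LieD Gc) => //; last by apply: LieN; apply: LieZ.
have GH t : G (expmx (t *: vsval H)) by apply: faLie.
apply: (Lie_conj GM) => //.
- by have := GH 1; rewrite scale1r.
- by have := GH (-1); rewrite scaleN1r.
- exact: expmxNl.
Qed.

Lemma Lie_wcomp alpha X : Lie G X -> Lie G (wcomp F alpha X).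
Proof.
move=> GX; have [|c [c1 c0 cX]] := @Lie_wsum_sep alpha X [seq be <- weights F fa | be != alpha] GX.
  by rewrite mem_filter eqxx.
rewrite /wcomp (eq_wsum Fid (c' := c)) // => a b _.
case: eqP => [->|/eqP ne]; first by rewrite c1.
by rewrite c0 // mem_filter ne mem_weights.
Qed.

Lemma Lie_wsum c X : Lie G X -> Lie G (wsum (fa := fa) F c X).
Proof.
move=> GX; rewrite (wsum_weights Fid); apply: (Lie_sum Gc) => // al _.
by apply: LieZ; apply: Lie_wcomp.
Qed.

Lemma root_wcomp alpha X : Lie G X -> wcomp F alpha X != 0 -> alpha != 0 ->
  rootset (Lie G) fa alpha.
Proof.
move=> GX nz a0; split=> //; exists (wcomp F alpha X) => //; split; first exact: Lie_wcomp.
by move=> H; apply: (bracket_wcomp Fid Fsym).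
Qed.

Lemma rootspace_block alpha X a b : rootspace (Lie G) alpha X ->
  F a *m X *m F b != 0 -> wt F fa a b = alpha.
Proof.
move=> [GX hX] nz; apply/lfunP => H.
have : F a *m bracket (vsval H) X *m F b = alpha H *: (F a *m X *m F b).
  by rewrite /bracket hX -scalemxAr -scalemxAl.
rewrite (bracket_wsum Fid Fsym) // (FwsumF Fid) => /eqP.
rewrite -subr_eq0 -scalerBl scaler_eq0 (negbTE nz) orbF subr_eq0.
by move/eqP.
Qed.

Lemma rootspace_wsum alpha X c : rootspace (Lie G) alpha X -> wsum F c X = c alpha *: X.
Proof.
move=> hX; rewrite -[in RHS](wsum1 fa Fid X) -(wsumZc Fid).
by apply: (eq_wsum Fid) => a b nz; rewrite (rootspace_block hX nz) mulr1.
Qed.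

Lemma root_weights alpha : rootset (Lie G) fa alpha -> alpha \in weights F fa.
Proof.
move=> [_ [X hX X0]]; have [a [b nz]] : exists a b, F a *m X *m F b != 0.
  apply: contrapT => h; case/eqP: X0; apply: (eq_blocks Fid) => a b.
  rewrite mulmx0 mul0mx; apply: contrapT => /eqP nz; apply: h.
  by exists a, b.
by rewrite -(rootspace_block hX nz) mem_weights.
Qed.

Variable H0 : subvs_of fa.
Hypothesis H0E : forall alpha, alpha \in Delta -> alpha H0 = 1.

Lemma nneg_comb_H0 beta : nneg_comb Delta beta -> beta != 0 -> 0 < beta H0.
Proof.
move=> [c ->] nz; rewrite sum_lfunE.
have E (i : 'I_(size Delta)) : (Delta`_i *+ c i) H0 = (c i)%:R :> R^o.
  by rewrite -scaler_nat scale_lfunE H0E ?mem_nth // /GRing.scale /= mulr1.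
rewrite (eq_bigr _ (fun i _ => E i)) lt_neqAle sumr_ge0 ?andbT => [|i _]; last exact: ler0n.
rewrite eq_sym; apply: contra nz; rewrite psumr_eq0 => [/allP h|i _]; last exact: ler0n.
apply/eqP; rewrite big1 // => i _; have := h i (mem_index_enum i).
by rewrite pnatr_eq0 => /eqP ->.
Qed.

Lemma root_H0 beta : rootset (Lie G) fa beta -> nneg_comb Delta beta /\ 0 < beta H0 \/
  nneg_comb Delta (- beta) /\ beta H0 < 0.
Proof.
move=> rb; have [_ _ /(_ _ rb)] := basisD; have [b0 _] := rb.
case=> h; [left|right]; split=> //; first exact: nneg_comb_H0.
rewrite -oppr_gt0; have : 0 < (- beta) H0 by apply: nneg_comb_H0; rewrite ?oppr_eq0.
by rewrite opp_lfunE.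
Qed.

(** A nonzero block of X has a weight vanishing at [H0]. If that weight were nonzero it would be a
    root, and roots do not vanish at [H0]; so X commutes with [fa] and maximality applies. *)
Lemma centralizer_regular X : Lie G X -> X^T = X -> bracket (vsval H0) X = 0 -> X \in fa.
Proof.
move=> GX Xs X0; apply: famax => // H; apply/eqP; rewrite -subr_eq0 -/(bracket _ _).
rewrite (bracket_wsum Fid Fsym) // (eq_wsum Fid (c' := fun=> 0 * 1)).
  by rewrite (wsumZc Fid) scale0r.
move=> a b nz; rewrite mul0r; have [->|ab0] := eqVneq (wt F fa a b) 0.
  by rewrite zero_lfunE.
have : rootset (Lie G) fa (wt F fa a b).
  apply: (root_wcomp GX) => //; apply: contra nz => /eqP h; apply/eqP.
  have := FwsumF Fid (fun al : dual fa => (al == wt F fa a b)%:R) X a b.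
  by rewrite -/(wcomp _ _ _) h mulmx0 mul0mx eqxx scale1r.
have wt0 : wt F fa a b H0 = 0.
  apply/eqP; have := congr1 (fun M => F a *m M *m F b) X0.
  rewrite (bracket_wsum Fid Fsym) // (FwsumF Fid) mulmx0 mul0mx => /eqP.
  by rewrite scaler_eq0 (negbTE nz) orbF.
by case/root_H0 => -[_]; rewrite wt0 ltxx.
Qed.

(** * The orthogonal subgroup, its orbits on symmetric elements, and the Cartan decomposition *)

Definition Kset : set 'M[R]_n := [set k | G k /\ k *m k^T = 1%:M].

Lemma Kset_entry k i j : Kset k -> `|k i j| <= 1.
Proof.
move=> [_ kk]; rewrite -(@ler_pXn2r _ 2) ?nnegrE // expr1n real_normK ?num_real //.
have := congr1 (fun M : 'M_n => M i i) kk; rewrite !mxE eqxx => E.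
rewrite -[leRHS]/(true%:R : R) -E (bigD1 j) //= mxE -expr2 lerDl; apply: sumr_ge0 => l _.
by rewrite mxE -expr2 sqr_ge0.
Qed.

Lemma KsetM k l : Kset k -> Kset l -> Kset (k *m l).
Proof.
move=> [Gk kk] [Gl ll]; split; first exact: GM.
by rewrite trmx_mul mulmxA -(mulmxA k) ll mulmx1.
Qed.

Lemma KsetT k : Kset k -> Kset k^T.
Proof. by move=> [Gk kk]; split; [apply: GT|rewrite trmxK; apply: mulmx1C]. Qed.

Lemma Kset1 : Kset 1%:M.
Proof. by split=> //; rewrite trmx1 mulmx1. Qed.

Lemma Kset_exp Y (t : R) : Lie G Y -> Y^T = - Y -> Kset (expmx (t *: Y)).
Proof.
move=> GY Ys; split; first exact: GY.
by rewrite trmx_expmx linearZ /= Ys scalerN expmxNr.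
Qed.

Lemma Kset_closed : mclosed Kset.
Proof.
apply: (mclosedI Gc); apply: mclosed_eq => T FF PF A X AX; last exact: mcvg_cst.
by apply: mcvg_mul => //; apply: mcvg_tr.
Qed.

(** At a maximum of the trace over a compact group, the first derivative along a skew direction Y
    vanishes and the second is at most 0; both are read off the expansion of exp(tY) X' exp(-tY).
    The matrix B gives a version relative to a centraliser; B = 0 means all of K. *)
Lemma max_orbit B C X : exists k, [/\ Kset k, k *m B = B *m k,
  forall l, Kset l -> l *m B = B *m l -> \tr (l *m X *m l^T *m C) <= \tr (k *m X *m k^T *m C) &
  forall Y, Lie G Y -> Y^T = - Y -> Y *m B = B *m Y ->
    \tr (bracket Y (k *m X *m k^T) *m C) = 0 /\
    \tr (bracket Y (bracket Y (k *m X *m k^T)) *m C) <= 0].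
Proof.
pose P := Kset `&` [set k | k *m B = B *m k].
have Pc : mclosed P.
  apply: (mclosedI Kset_closed); apply: mclosed_eq => T FF PF A Z AZ;
    by apply: mcvg_mul => //; apply: mcvg_cst.
have [||||k [Kk kB] kmax] := @extreme_value _ n P (fun k => \tr (k *m X *m k^T *m C)) 1.
- by exists 1%:M; split; [apply: Kset1|rewrite /= mul1mx mulmx1].
- exact: Pc.
- move=> T FF PF A Z AZ; apply: cvg_mxtrace; apply: mcvg_mul; last exact: mcvg_cst.
  apply: mcvg_mul; last exact: mcvg_tr.
  by apply: mcvg_mul => //; apply: mcvg_cst.
- by move=> Z [KZ _] i j; apply: Kset_entry.
exists k; split=> // [l Kl lB|Y GY Ys YB]; first exact: kmax.
set X' := k *m X *m k^T.
have [D hD] := conj_order3 Y X'.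
set a := \tr (bracket Y X' *m C); set b := \tr (bracket Y (bracket Y X') *m C).
have key (t : R) : `|t| <= 1 -> a * t + b / 2 * t ^+ 2 <= D * mnorm C * `|t| ^+ 3.
  move=> t1; have Kt := Kset_exp t GY Ys.
  have tB : expmx (t *: Y) *m B = B *m expmx (t *: Y).
    by apply: expmx_commute; rewrite -scalemxAl YB scalemxAr.
  have := kmax (expmx (t *: Y) *m k); rewrite trmx_mul trmx_expmx linearZ /= Ys scalerN.
  rewrite (_ : _ *m k *m X *m _ = expmx (t *: Y) *m X' *m expmx (- (t *: Y))); last first.
    by rewrite /X' !mulmxA.
  move=> h; have {}h : \tr (expmx (t *: Y) *m X' *m expmx (- (t *: Y)) *m C) <= \tr (X' *m C).
    apply: h; split; first exact: KsetM.
    by rewrite /= -mulmxA kB mulmxA tB mulmxA.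
  have {}hD := hD t t1; set E := expmx _ *m _ *m _ in h hD.
  set Z := _ + _ *: bracket Y (bracket Y X') in hD.
  have ZE : \tr (Z *m C) = \tr (X' *m C) + (a * t + b / 2 * t ^+ 2).
    by rewrite /Z !mulmxDl !mxtraceD -!scalemxAl !mxtraceZ -/a -/b; ring.
  have : \tr ((Z - E) *m C) <= D * `|t| ^+ 3 * mnorm C.
    rewrite (le_trans (ler_norm _)) // (le_trans (mxtrace_le_mnorm _)) //.
    rewrite (le_trans (mnormM _ _)) // ler_wpM2r ?mnorm_ge0 //.
    by rewrite -opprB mnormN.
  rewrite mulmxBl mxtraceD mxtraceN ZE mulrAC; move: h; lra.
have C0 := mnorm_ge0 C; have a0 : a = 0.
  apply: (first_order_eq0 (C := `|D * mnorm C| + `|b / 2|)) => t t1.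
  have := key t t1; have t2 : 0 <= t ^+ 2 := sqr_ge0 t.
  have t3 : `|t| ^+ 3 <= t ^+ 2.
    by rewrite exprSr real_normK ?num_real // ler_piMr.
  have n3 : 0 <= `|t| ^+ 3 by rewrite exprn_ge0.
  have h1 : D * mnorm C * `|t| ^+ 3 <= `|D * mnorm C| * t ^+ 2.
    by rewrite (le_trans (y := `|D * mnorm C| * `|t| ^+ 3)) ?ler_wpM2l ?ler_wpM2r ?ler_norm.
  have h2 : - (b / 2) * t ^+ 2 <= `|b / 2| * t ^+ 2.
    by rewrite ler_wpM2r // -normrN ler_norm.
  by move: h1 h2; rewrite mulrDl; lra.
split=> //; suff : b / 2 <= 0 by lra.
apply: (second_order_le0 (C := D * mnorm C)) => t t0 t1.
by have := key t; rewrite ger0_norm // a0 mul0r add0r; apply.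
Qed.

Lemma bracket_regular X : Lie G X -> Lie G (bracket (vsval H0) X).
Proof. by move=> GX; rewrite (bracket_wsum Fid Fsym) //; apply: Lie_wsum. Qed.

Lemma bracketC X Y : bracket X Y = - bracket Y X.
Proof. by rewrite /bracket opprB. Qed.

Lemma Kset_conj_Lie k X : Kset k -> Lie G X -> Lie G (k *m X *m k^T).
Proof.
move=> [Gk kk] GX; apply: (Lie_conj GM) => //; first exact: GT.
exact: mulmx1C.
Qed.

Lemma conj_sym (k X : 'M[R]_n) : X^T = X -> (k *m X *m k^T)^T = k *m X *m k^T.
Proof. by move=> Xs; rewrite !trmx_mul trmxK Xs mulmxA. Qed.

Lemma tr_skew_eq0 Y : Y^T = - Y -> \tr (Y *m Y) = 0 -> Y = 0.
Proof.
move=> Ys h; apply: trFF_eq0.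
by rewrite Ys mulmxN mxtraceN h oppr0.
Qed.

(** Test criticality in the direction Y = [X', H0], which is skew: tr([Y, X'] H0) = tr(Y Y), so Y =
    0. Thus X' commutes with the regular element [H0] and lies in [fa]. *)
Lemma critical_in_fa H B k X : vsval H = B -> Lie G X -> X^T = X -> X *m B = B *m X ->
  Kset k -> k *m B = B *m k ->
  (forall Y, Lie G Y -> Y^T = - Y -> Y *m B = B *m Y ->
     \tr (bracket Y (k *m X *m k^T) *m vsval H0) = 0) -> k *m X *m k^T \in fa.
Proof.
move=> HB GX Xs XB Kk kB crit; have Bs : B^T = B by rewrite -HB (fa_sym Fsym).
have kTB : k^T *m B = B *m k^T.
  by have := congr1 trmx kB; rewrite !trmx_mul Bs => ->.
set X' := k *m X *m k^T in crit *.
have GX' : Lie G X' by apply: Kset_conj_Lie.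
have X's : X'^T = X' by apply: conj_sym.
have X'B : X' *m B = B *m X'.
  by rewrite /X' -!mulmxA kTB (mulmxA X) XB !mulmxA kB.
clearbody X'.
apply: centralizer_regular => //; apply/eqP; rewrite -oppr_eq0 -bracketC; apply/eqP.
have H0B : vsval H0 *m B = B *m vsval H0 by rewrite -HB (fa_comm Fid Fsym).
have Ys : (bracket X' (vsval H0))^T = - bracket X' (vsval H0).
  by rewrite /bracket linearB /= !trmx_mul X's (fa_sym Fsym) // opprB.
apply: (tr_skew_eq0 Ys).
have := crit (bracket X' (vsval H0)); rewrite {3}/bracket.
set Y := bracket X' (vsval H0) => h.
have : \tr (bracket Y X' *m vsval H0) = 0.
  rewrite /bracket; apply: h => //.
    by rewrite /Y bracketC; apply: LieN; apply: bracket_regular.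
  have c1 : X' *m vsval H0 *m B = B *m (X' *m vsval H0).
    by rewrite -mulmxA H0B mulmxA X'B mulmxA.
  have c2 : vsval H0 *m X' *m B = B *m (vsval H0 *m X').
    by rewrite -mulmxA X'B mulmxA H0B mulmxA.
  by rewrite /Y /bracket mulmxBl mulmxBr c1 c2.
rewrite /bracket mulmxBl mxtraceB -mulmxA -(mulmxA X') [\tr (X' *m _)]mxtrace_mulC -mulmxA.
by rewrite -mxtraceB -mulmxBr.
Qed.

Lemma conj_in_fa H X : Lie G X -> X^T = X -> X *m vsval H = vsval H *m X ->
  exists k, [/\ Kset k, k *m vsval H = vsval H *m k & k *m X *m k^T \in fa].
Proof.
move=> GX Xs XH; have [k [Kk kB _ crit]] := max_orbit (vsval H) (vsval H0) X.
exists k; split=> //; apply: (@critical_in_fa H (vsval H)) => // Y GY Ys YB.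
by have [] := crit Y GY Ys YB.
Qed.

Definition dominant H := forall alpha, alpha \in Delta -> 0 <= alpha H.

(** Criticality puts the conjugate H in [fa]; dominance is the second-order condition. For a root
    vector Z of a simple root alpha, with Y = Z - Z^T and W = Z + Z^T, the second derivative is -
    alpha(H) tr(W W^T), because alpha(H0) = 1. *)
Lemma conj_dominant X : Lie G X -> X^T = X ->
  exists k H, [/\ Kset k, k *m X *m k^T = vsval H & dominant H].
Proof.
move=> GX Xs; have [k [Kk _ _ crit]] := max_orbit 0 (vsval H0) X.
have Xfa : k *m X *m k^T \in fa.
  apply: (@critical_in_fa 0 0) => //; rewrite ?mulmx0 ?mul0mx ?linear0 // => Y GY Ys _.
  by have [] := crit Y GY Ys _; rewrite ?mulmx0 ?mul0mx.
pose H := vsproj fa (k *m X *m k^T); have HE : k *m X *m k^T = vsval H by rewrite vsprojK.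
exists k, H; split=> // alpha aD; have [_ /(_ _ aD) [a0 [Z hZ Z0]] _] := basisD.
have [GZ bZ] := hZ; pose Y := Z - Z^T; pose W := Z + Z^T.
have Ys : Y^T = - Y by rewrite /Y linearB /= trmxK opprB.
have GY : Lie G Y by apply: (LieD Gc) => //; apply: LieN; apply: Lie_tr.
have bT L : vsval L *m Z^T - Z^T *m vsval L = - (alpha L *: Z^T).
  have := congr1 trmx (bZ L); rewrite linearB /= !trmx_mul (fa_sym Fsym) // linearZ /= => <-.
  by rewrite opprB.
have bY L : bracket Y (vsval L) = - (alpha L *: W).
  rewrite /bracket /Y mulmxBr mulmxBl.
  have -> : Z *m vsval L - Z^T *m vsval L - (vsval L *m Z - vsval L *m Z^T) =
    - ((vsval L *m Z - Z *m vsval L) - (vsval L *m Z^T - Z^T *m vsval L)).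
    by apply/matrixP => i j; rewrite !mxE; ring.
  by rewrite bZ bT opprK -scalerDr.
have Y0 : Y *m 0 = 0 *m Y :> 'M[R]_n by rewrite mulmx0 mul0mx.
have [_] := crit Y GY Ys Y0; rewrite HE bY.
have Ws : W^T = W by rewrite /W linearD /= trmxK addrC.
have -> : \tr (bracket Y (- (alpha H *: W)) *m vsval H0) = - (alpha H * \tr (W *m W^T)).
  have -> : bracket Y (- (alpha H *: W)) = - (alpha H *: bracket Y W).
    by rewrite /bracket mulmxN mulNmx -scalemxAr -scalemxAl -opprD -scalerBr.
  rewrite mulNmx mxtraceN -scalemxAl mxtraceZ Ws; congr (- (_ * _)).
  rewrite tr_bracket.
  by rewrite bY H0E // scale1r mulmxN mxtraceN opprK.
rewrite oppr_le0; have W0 : 0 < \tr (W *m W^T).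
  rewrite lt_neqAle trFF_ge0 andbT eq_sym; apply: contra Z0 => /eqP/trFF_eq0 W0.
  have ZT : Z^T = - Z by apply/eqP; rewrite -addr_eq0 addrC -/W W0.
  have b1 := bZ H0; have b2 := bT H0; rewrite H0E // scale1r in b1.
  rewrite H0E // scale1r in b2.
  rewrite ZT mulmxN mulNmx !opprK addrC -opprB b1 in b2.
  have : 2%:R *: Z = 0 by rewrite scaler_nat mulr2n -{1}b2 addNr.
  by move/eqP; rewrite scaler_eq0 pnatr_eq0.
by rewrite pmulr_lge0.
Qed.

(** The positive definite g g^T is diagonalised and X is half of its logarithm; [Glog] keeps all its
    real powers in the group. *)
Lemma polar_log g : G g -> exists X, [/\ Lie G X, X^T = X & g *m g^T = expmx X *m expmx X].
Proof.
move=> Gg; set p := g *m g^T; have ps : p^T = p by rewrite /p trmx_mul trmxK.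
have [k [d [kk pE]]] := symmetric_diag ps.
have dE : diag_mx d = (k *m g) *m (k *m g)^T.
  have -> : k *m g *m (k *m g)^T = k *m p *m k^T by rewrite trmx_mul /p !mulmxA.
  by rewrite pE !mulmxA kk mul1mx -mulmxA kk mulmx1.
have d0 a : 0 < d 0 a.
  rewrite lt_neqAle eq_sym; apply/andP; split; last first.
    have := congr1 (fun M : 'M_n => M a a) dE; rewrite !mxE eqxx mulr1n => ->.
    by apply: sumr_ge0 => j _; rewrite [_^T _ _]mxE -expr2 sqr_ge0.
  have : \det (diag_mx d) != 0.
    rewrite dE det_mulmx det_tr det_mulmx (Gdet Gg) mulr1 mulf_eq0 orbb.
    apply/eqP => k0; have := congr1 determinant kk.
    by rewrite det_mulmx k0 mul0r det1 => /eqP; rewrite eq_sym oner_eq0.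
  by rewrite det_diag prodf_seq_neq0 => /allP /(_ a (mem_index_enum a)).
pose E a := k^T *m delta_mx a a *m k; have Eid : orthidem E by apply: orthmx_idem.
have [EE E1] := Eid.
have pX : p = \sum_a expR (ln (d 0 a)) *: E a.
  rewrite pE diag_idem; apply: eq_bigr => a _; by rewrite lnK ?posrE.
have GX : Lie G (\sum_a (ln (d 0 a) / 2) *: E a).
  move=> t; rewrite scaler_sumr; under eq_bigr do rewrite scalerA.
  rewrite expmx_spectral //.
  under eq_bigr do rewrite [t * _]mulrCA mulrC.
  by apply: Glog => //; rewrite -pX; apply: GM => //; apply: GT.
exists (\sum_a (ln (d 0 a) / 2) *: E a); split=> //.
  rewrite linear_sum; apply: eq_bigr => a _; rewrite linearZ /= /E !trmx_mul trmxK.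
  by rewrite trmx_delta mulmxA.
rewrite -expmxD // -big_split /= pX.
rewrite -(expmx_spectral (fun a => ln (d 0 a)) EE E1); congr expmx.
by apply: eq_bigr => a _; rewrite -scalerDl; congr (_ *: _); field.
Qed.

Lemma polar_orth g X : G g -> Lie G X -> X^T = X -> g *m g^T = expmx X *m expmx X ->
  Kset (expmx (- X) *m g).
Proof.
move=> Gg GX Xs gg; split.
  by apply: GM => //; have := GX (-1); rewrite scaleN1r.
rewrite trmx_mul mulmxA -(mulmxA _ g) gg trmx_expmx linearN /= Xs !mulmxA.
by rewrite expmxNl mul1mx expmxNr.
Qed.

Lemma cartan g : G g -> exists k k' H, [/\ Kset k, Kset k', dominant H &
  g = k *m expmx (vsval H) *m k'].
Proof.
move=> Gg; have [X [GX Xs gg]] := polar_log Gg.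
have [k [H [Kk kX Hd]]] := conj_dominant GX Xs.
exists k^T, (k *m (expmx (- X) *m g)), H; split=> //; first exact: KsetT.
  by apply: KsetM => //; apply: polar_orth.
have [_ kk] := Kk; have kTk := mulmx1C kk.
rewrite -kX expmx_conj // !mulmxA kTk mul1mx -(mulmxA (expmx X)) kTk mulmx1.
by rewrite expmxNr mul1mx.
Qed.

(** * The unipotent group and the Iwasawa decomposition *)

Hypothesis Ac : mclosed [set expmx (vsval H) | H in [set: subvs_of fa]].

(** Heights order the blocks. [strict] allows only strictly raising blocks; [upper] allows in
    addition the diagonal blocks a = b, but not two different indices of equal height. *)
Definition height a : R := lam F a (vsval H0).
Definition strict X := forall a b, height a <= height b -> F a *m X *m F b = 0.
Definition upper X := forall a b, a != b -> height a <= height b -> F a *m X *m F b = 0.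

Lemma strict_upper X : strict X -> upper X.
Proof. by move=> sX a b _; apply: sX. Qed.

Lemma upper1 : upper 1%:M.
Proof. by move=> a b ab _; rewrite mulmx1 (FF Fid) (negbTE ab). Qed.

Lemma strict0 : strict 0.
Proof. by move=> a b _; rewrite mulmx0 mul0mx. Qed.

Lemma strictD X Y : strict X -> strict Y -> strict (X + Y).
Proof. by move=> sX sY a b h; rewrite mulmxDr mulmxDl sX // sY // addr0. Qed.

Lemma strictZ (c : R) X : strict X -> strict (c *: X).
Proof. by move=> sX a b h; rewrite -scalemxAr -scalemxAl sX // scaler0. Qed.

Lemma strict_sum (J : Type) (s : seq J) (P : pred J) (X : J -> 'M[R]_n) :
  (forall j, P j -> strict (X j)) -> strict (\sum_(j <- s | P j) X j).
Proof. by move=> h; apply: big_ind => //; [apply: strict0|apply: strictD]. Qed.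

Lemma mid_sum X Y a b : F a *m (X *m Y) *m F b = \sum_c F a *m X *m F c *m (F c *m Y *m F b).
Proof.
have FFc c : F c = F c *m F c by rewrite (FF Fid) eqxx.
rewrite -{1}[X]mulmx1 -(sumF Fid) !(mulmx_sumr, mulmx_suml); apply: eq_bigr => c _.
by rewrite {1}(FFc c) !mulmxA.
Qed.

Lemma strict_mul X Y : strict X -> upper Y -> strict (X *m Y).
Proof.
move=> sX uY a b ab; rewrite mid_sum big1 // => c _.
have [ac|ca] := leP (height a) (height c); first by rewrite sX // mul0mx.
have cb : c != b by apply: contraTneq ca => ->; rewrite -leNgt.
by rewrite uY ?mulmx0 // (le_trans (ltW ca)).
Qed.

Lemma strict_exp X k : strict X -> strict (X ^+ k.+1).
Proof.
move=> sX; elim: k => [|k IH]; first by rewrite expr1.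
by rewrite exprS -mulmxE; apply: strict_mul => //; apply: strict_upper.
Qed.

Lemma strict_nilpotent X : strict X -> X ^+ n = 0.
Proof. by move=> sX; apply: (@raising_nilpotent _ _ _ _ Fid height). Qed.

Lemma strict_exppart X m : strict X -> strict (exppart X m.+1 - 1%:M).
Proof.
move=> sX; rewrite /exppart big_ord_recl /= fact0 invr1 scale1r expr0 addrAC subrr add0r.
by apply: strict_sum => k _; apply: strictZ; apply: strict_exp.
Qed.

Lemma strict_expmx X : strict X -> strict (expmx X - 1%:M).
Proof.
move=> sX; have X0 := strict_nilpotent sX.
by rewrite expmx_nil // -(exppart_nil 1 X0) addn1; apply: strict_exppart.
Qed.

(** Group properties and conjugation by A are easy in this triangular form; [Uset_roots] identifies
    it with the exponential of the positive root spaces. *)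
Definition Uset : set 'M[R]_n := [set u | G u /\ strict (u - 1%:M)].

Lemma Uset_upper u : Uset u -> upper u.
Proof.
move=> [_ su] a b ab hab; rewrite -[u](subrK 1%:M) mulmxDr mulmxDl su // add0r.
exact: upper1.
Qed.

Lemma Uset_diag u a : Uset u -> F a *m u *m F a = F a.
Proof.
move=> [_ su]; rewrite -[u](subrK 1%:M) mulmxDr mulmxDl su // add0r.
by rewrite mulmx1 (FF Fid) eqxx.
Qed.

Lemma Uset1 : Uset 1%:M.
Proof. by split=> //; rewrite subrr; apply: strict0. Qed.

Lemma UsetM u v : Uset u -> Uset v -> Uset (u *m v).
Proof.
move=> Uu Uv; split; first by apply: GM; [case: Uu|case: Uv].
have -> : u *m v - 1%:M = (u - 1%:M) *m v + (v - 1%:M).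
  by rewrite mulmxBl mul1mx addrA subrK.
apply: strictD; last by case: Uv.
by apply: strict_mul; [case: Uu|apply: Uset_upper].
Qed.

Lemma G_unit g : G g -> g \in unitmx.
Proof. by move=> Gg; rewrite unitmxE Gdet // unitr1. Qed.

Lemma UsetV u : Uset u -> Uset (invmx u).
Proof.
move=> Uu; have [Gu su] := Uu; split; first exact: GV.
pose M := - (u - 1%:M); have sM : strict M by rewrite /M -scaleN1r; apply: strictZ.
have uM : u = 1%:M - M by rewrite /M opprK addrC subrK.
have E : u *m \sum_(k < n.+1) M ^+ k = 1%:M.
  have X0 : M ^+ n.+1 = 0 by rewrite exprS (strict_nilpotent sM) mulr0.
  rewrite uM mulmxBl mul1mx mulmx_sumr big_ord_recl expr0.
  rewrite [X in _ - X]big_ord_recr /= mulmxE -exprS X0 addr0.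
  rewrite [X in _ - X](eq_bigr (fun k : 'I_n => M ^+ k.+1)) => [|k _]; last by rewrite -exprS.
  by rewrite addrK.
have -> : invmx u = \sum_(k < n.+1) M ^+ k.
  by rewrite -[LHS]mulmx1 -E mulmxA mulVmx ?mul1mx // G_unit.
rewrite big_ord_recl expr0 addrAC subrr add0r.
by apply: strict_sum => k _; apply: strict_exp.
Qed.

Lemma Uset_conj u H : Uset u -> Uset (expmx (vsval H) *m u *m expmx (- vsval H)).
Proof.
move=> [Gu su]; split.
  apply: GM; first by apply: GM => //; apply: Lie_exp.
  by apply: Lie_exp; apply: LieN.
have -> : expmx (vsval H) *m u *m expmx (- vsval H) - 1%:M =
    expmx (vsval H) *m (u - 1%:M) *m expmx (- vsval H).
  by rewrite mulmxBr mulmxBl mulmx1 expmxNr.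
move=> a b ab; rewrite !mulmxA (expFr Fid Fsym faF) -!mulmxA.
have -> : - vsval H = vsval (- H) by rewrite linearN.
by rewrite (expFl Fid faF) -scalemxAl -!scalemxAr !mulmxA su // !scaler0.
Qed.

Definition diagpart X := \sum_a F a *m X *m F a.

Lemma diagpart_block X a : F a *m diagpart X = F a *m X *m F a.
Proof.
rewrite mulmx_sumr (bigD1 a) //= big1 ?addr0 => [|b ba].
  by rewrite !mulmxA (FF Fid) eqxx.
by rewrite !mulmxA (FF Fid) eq_sym (negbTE ba) !mul0mx.
Qed.

(** This is the product UA, described so that closedness follows entry by entry from that of A; see
    [Bset_dec] for the factorisation. *)
Definition Bset : set 'M[R]_n := [set b | [/\ G b, upper b &
  exists H, diagpart b = expmx (vsval H)]].

Lemma Bset_dec b : Bset b -> exists u H, Uset u /\ b = u *m expmx (vsval H).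
Proof.
move=> [Gb ub [H bH]]; exists (b *m expmx (- vsval H)), H; split; last first.
  by rewrite -mulmxA expmxNl mulmx1.
split; first by apply: GM => //; apply: Lie_exp; apply: LieN.
have -> : - vsval H = vsval (- H) by rewrite linearN.
move=> a c ac; rewrite mulmxBr mulmxBl mulmx1 (FF Fid) -!mulmxA (expFl Fid faF) -!scalemxAr mulmxA.
have [<-|ne] := eqVneq a c; last by rewrite ub // scaler0 subrr.
rewrite -diagpart_block bH (expFr Fid Fsym faF) scalerA -expRD.
by rewrite linearN /= -scaleN1r lamZ mulN1r addNr expR0 scale1r subrr.
Qed.

Lemma Bset1 : Bset 1%:M.
Proof.
split=> //; first exact: upper1.
exists 0; rewrite linear0 expmx0 -(sumF Fid); apply: eq_bigr => a _.
by rewrite (sumF Fid) mulmx1 (FF Fid) eqxx.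
Qed.

Lemma Bset_closed : mclosed Bset.
Proof.
have cf a b : mxcontinuous (fun X => F a *m X *m F b).
  move=> T FF PF A X AX; apply: mcvg_mul; last exact: mcvg_cst.
  by apply: mcvg_mul => //; apply: mcvg_cst.
move=> T FF PF A X AX h; split.
- by apply: (Gc _ AX); apply: filterS h => t [].
- move=> a b ab hab.
  apply: (@mclosed_eq _ _ (fun X => F a *m X *m F b) (fun=> 0) _ _ T FF PF A X AX).
  + exact: cf.
  + by move=> T' FF' PF' A' X' _; apply: mcvg_cst.
  + by apply: filterS h => t [_ ub _]; apply: ub.
- have [H _ HE] : [set expmx (vsval H) | H in [set: subvs_of fa]] (diagpart X).
    apply: (@Ac T FF PF (fun t => diagpart (A t))).
      by apply: mcvg_sum => a; apply: cf.
    by apply: filterS h => t [_ _ [H ->]]; exists H.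
  by exists H.
Qed.

Lemma Bset_mulA H b : Bset b -> Bset (expmx (vsval H) *m b).
Proof.
move=> [Gb ub [H' bH]]; split; first by apply: GM => //; apply: Lie_exp.
  by move=> a c ac hac; rewrite !mulmxA (expFr Fid Fsym faF) -!scalemxAl ub // scaler0.
exists (H + H'); rewrite linearD /= expmxD; last exact: (fa_comm Fid Fsym faF).
rewrite -bH /diagpart mulmx_sumr; apply: eq_bigr => a _.
by rewrite !mulmxA (expFr Fid Fsym faF) (expFl Fid faF).
Qed.

Lemma Bset_mulU u b : Uset u -> Bset b -> Bset (u *m b).
Proof.
move=> [Gu su] [Gb ub [H bH]]; have sub := strict_mul su ub.
have E a c : height a <= height c -> F a *m (u *m b) *m F c = F a *m b *m F c.
  move=> ac; have -> : u *m b = (u - 1%:M) *m b + b by rewrite mulmxBl mul1mx subrK.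
  by rewrite mulmxDr mulmxDl sub // add0r.
split; first exact: GM.
  by move=> a c ac hac; rewrite E // ub.
by exists H; rewrite -bH; apply: eq_bigr => a _; apply: E.
Qed.

Lemma congr_order2 (Z p : 'M[R]_n) : exists C : R, forall t : R, `|t| <= 1 ->
  `|\tr (expmx (t *: Z) *m p *m (expmx (t *: Z))^T) - \tr p - t * (\tr (Z *m p) + \tr (p *m Z^T))|
    <= C * t ^+ 2.
Proof.
pose c := exprem Z 2; pose m := n%:R * n%:R + mnorm Z; pose mT := n%:R * n%:R + mnorm Z^T : R.
pose cT := exprem Z^T 2.
exists (c * mnorm p * (mT + cT) + m * mnorm p * cT + mnorm (Z *m p *m Z^T)) => t t1.
have oZ := exp_order2 Z t1; have oT := exp_order2 Z^T t1.
rewrite trmx_expmx linearZ /=; set E := expmx _ in oZ *; set E' := expmx _ in oT *.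
set P := _ + t *: Z in oZ; set P' := _ + t *: Z^T in oT.
have t2 : 0 <= t ^+ 2 := sqr_ge0 t.
have t21 : t ^+ 2 <= 1 by rewrite -real_normK ?num_real // expr_le1.
have n1 : mnorm (1%:M : 'M[R]_n) <= n%:R * n%:R.
  rewrite -[X in _ <= _ * X]mulr1; apply: mnorm_le_entry => i j.
  by rewrite mxE; case: eqP; rewrite ?normr1 ?normr0.
have nP (W : 'M[R]_n) : mnorm (1%:M + t *: W) <= n%:R * n%:R + mnorm W.
  by rewrite (le_trans (mnormD _ _)) // lerD // mnormZ ler_piMl ?mnorm_ge0.
have nE' : mnorm E' <= mT + cT.
  rewrite -[E'](subrK P') addrC (le_trans (mnormD _ _)) // lerD ?nP //.
  by rewrite (le_trans oT) // ler_piMr ?exprem_ge0.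
have PpP : \tr (P *m p *m P') = \tr p + t * (\tr (Z *m p) + \tr (p *m Z^T)) +
    t ^+ 2 * \tr (Z *m p *m Z^T).
  rewrite /P /P' !(mulmxDl, mulmxDr, mul1mx, mulmx1) -?scalemxAl -?scalemxAr -?scalemxAl.
  by rewrite !mxtraceD !mxtraceZ; ring.
have -> : \tr (E *m p *m E') - \tr p - t * (\tr (Z *m p) + \tr (p *m Z^T)) =
    \tr ((E - P) *m p *m E') + \tr (P *m p *m (E' - P')) + t ^+ 2 * \tr (Z *m p *m Z^T).
  rewrite mulmxBr !mulmxBl !mxtraceB PpP; ring.
have A1 : `|\tr ((E - P) *m p *m E')| <= c * t ^+ 2 * mnorm p * (mT + cT).
  rewrite (le_trans (mxtrace_le_mnorm _)) // (le_trans (mnormM _ _)) // ler_pM ?mnorm_ge0 //.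
  by rewrite (le_trans (mnormM _ _)) // ler_wpM2r ?mnorm_ge0.
have A2 : `|\tr (P *m p *m (E' - P'))| <= m * mnorm p * (cT * t ^+ 2).
  rewrite (le_trans (mxtrace_le_mnorm _)) // (le_trans (mnormM _ _)) // ler_pM ?mnorm_ge0 //.
  by rewrite (le_trans (mnormM _ _)) // ler_wpM2r ?mnorm_ge0 ?nP.
have A3 : `|t ^+ 2 * \tr (Z *m p *m Z^T)| <= mnorm (Z *m p *m Z^T) * t ^+ 2.
  by rewrite normrM ger0_norm // mulrC ler_wpM2r // mxtrace_le_mnorm.
rewrite (le_trans (ler_normD _ _)) //.
have -> : (c * mnorm p * (mT + cT) + m * mnorm p * cT + mnorm (Z *m p *m Z^T)) * t ^+ 2 =
  c * t ^+ 2 * mnorm p * (mT + cT) + m * mnorm p * (cT * t ^+ 2) + mnorm (Z *m p *m Z^T) * t ^+ 2.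
  by ring.
by rewrite lerD // (le_trans (ler_normD _ _)) // lerD.
Qed.

(** With eigenvalues d_i of X the hypotheses say that the d_i and the d_i e^(2 d_i) both sum to 0.
    Subtracting, the nonnegative terms d_i (e^(2 d_i) - 1) sum to 0, so each d_i is 0. *)
Lemma trace_exp_eq0 X : X^T = X -> \det (expmx X *m expmx X) = 1 ->
  \tr (X *m (expmx X *m expmx X)) = 0 -> X = 0.
Proof.
move=> Xs; have [k [d [kk XE]]] := symmetric_diag Xs.
have Eid := orthmx_idem kk; have [EE E1] := Eid; have kTk := mulmx1C kk.
rewrite -expmxD //.
have eX : expmx (X + X) = k^T *m diag_mx (\row_i expR (d 0 i *+ 2)) *m k.
  rewrite diag_idem; under eq_bigr do rewrite mxE.
  rewrite -expmx_spectral // XE diag_idem -big_split; congr expmx.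
  by apply: eq_bigr => i _ /=; rewrite mulr2n scalerDl.
rewrite eX !det_mulmx mulrAC -det_mulmx kTk det1 mul1r det_diag => dE.
have {}dE : \sum_i d 0 i *+ 2 = 0.
  apply: expR_inj; rewrite expR0 expR_sum -[RHS]dE.
  by apply: eq_bigr => i _; rewrite mxE.
rewrite XE -!mulmxA (mulmxA k) kk mul1mx mxtrace_mulC -!mulmxA kk mulmx1 => trE.
have {}trE : \sum_i d 0 i * expR (d 0 i *+ 2) = 0.
  rewrite -[RHS]trE; apply: eq_bigr => i _.
  rewrite mul_diag_mx.
  by rewrite !mxE eqxx mulr1n.
have d0 i : d 0 i = 0.
  have s0 : \sum_i d 0 i * (expR (d 0 i *+ 2) - 1) = 0.
    under eq_bigr do rewrite mulrBr mulr1.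
    by move: dE; rewrite sumrB trE sumrMnl mulr2n; lra.
  have ge0 (x : R) : 0 <= x * (expR (x *+ 2) - 1).
    have [x0|x0] := leP 0 x.
      by rewrite mulr_ge0 // subr_ge0 -expR0 ler_expR mulrn_wge0.
    by rewrite mulr_le0 // ?(ltW x0) // subr_le0 -expR0 ler_expR mulrn_wle0 // ltW.
  move/eqP: s0; rewrite psumr_eq0 => [/allP /(_ i (mem_index_enum i))|j _]; last exact: ge0.
  rewrite mulf_eq0 subr_eq0 -expR0 => /orP[/eqP //|/eqP/expR_inj/eqP].
  by rewrite mulrn_eq0 => /eqP.
have -> : diag_mx d = 0 by apply/matrixP => i j; rewrite !mxE d0 mul0rn.
by rewrite mul0mx mulmx0.
Qed.

Lemma mclosed_le (f : 'M[R]_n -> R) (c : R) : mcontinuous f -> mclosed [set X | f X <= c].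
Proof.
move=> fc T FF PF A X AX h; have fX := fc _ _ PF _ _ AX.
rewrite /= -(cvg_lim _ fX) //; apply: limr_le => //; first by apply/cvg_ex; exists (f X).
Qed.

Lemma mcontinuous_congr (q : 'M[R]_n) : mcontinuous (fun b => \tr (b *m q *m b^T)).
Proof.
move=> T FF PF A X AX; apply: cvg_mxtrace; apply: mcvg_mul; last exact: mcvg_tr.
by apply: mcvg_mul => //; apply: mcvg_cst.
Qed.

Lemma Bset_min g : G g -> exists2 b, Bset b &
  forall b', Bset b' -> \tr (b *m g *m (b *m g)^T) <= \tr (b' *m g *m (b' *m g)^T).
Proof.
move=> Gg; pose q := g *m g^T; pose T := \tr q.
have qE (b : 'M[R]_n) : b *m g *m (b *m g)^T = b *m q *m b^T.
  by rewrite trmx_mul /q !mulmxA.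
pose f (b : 'M[R]_n) := \tr (b *m q *m b^T).
pose P := Bset `&` [set b | f b <= T].
have T0 : 0 <= T by apply: trFF_ge0.
(* The sublevel set is bounded: the squares of the entries of bg are at most T, so these entries are
   at most 1 + T in absolute value, and b = (bg) g^-1. *)
have Pb b : P b -> forall i j, `|b i j| <= (1 + T) * mnorm (invmx g).
  move=> [_ bT] i j; rewrite -[b](mulmxK (G_unit Gg)); apply: mulmx_entry_le => k.
  have le1 : `|(b *m g) i k| ^+ 2 <= T.
    rewrite real_normK ?num_real // (le_trans _ bT) // /f -qE trFF.
    rewrite (bigD1 i) //= (bigD1 k) //= -addrA lerDl addr_ge0 ?sumr_ge0 // => [l _|l _].
      exact: sqr_ge0.
    by apply: sumr_ge0 => l' _; apply: sqr_ge0.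
  have [x1|/ltW x1] := leP `|(b *m g) i k| 1; first by rewrite (le_trans x1) // lerDl.
  rewrite (le_trans (y := `|(b *m g) i k| ^+ 2)) // ?(le_trans le1) ?lerDr //.
  by rewrite expr2 ler_peMl.
have [|||b [Bb bT] bmax] := @extreme_value _ n P (fun b => - f b) _ _ _ _ Pb.
- by exists 1%:M; split; [apply: Bset1|rewrite /= /f mul1mx trmx1 mulmx1].
- by apply: mclosedI; [apply: Bset_closed|apply: mclosed_le; apply: mcontinuous_congr].
- by move=> T' FF PF A X AX; apply: cvgN; apply: mcontinuous_congr.
exists b => // b' Bb'; rewrite !qE.
have [b'T|/ltW Tb'] := leP (f b') T; last exact: le_trans bT Tb'.
by rewrite -lerN2; apply: bmax.
Qed.

Lemma Uset_expstrict Z (t : R) : Lie G Z -> strict Z -> Uset (expmx (t *: Z)).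
Proof. by move=> GZ sZ; split; [apply: GZ|apply/strict_expmx/strictZ]. Qed.

(* Kempf-Ness: at a minimum of |bg|^2 over b in UA, p = (bg)(bg)^T is
   orthogonal to the Lie algebra of UA, hence to its own logarithm, so p = 1. *)
Lemma iwasawa g : G g -> exists u H k, [/\ Uset u, Kset k & g = u *m expmx (vsval H) *m k].
Proof.
move=> Gg; have [b Bb bmin] := Bset_min Gg; have [Gb _ _] := Bb.
pose h := b *m g; have Gh : G h by apply: GM.
pose p := h *m h^T; have ps : p^T = p by rewrite /p trmx_mul trmxK.
have crit Z : (forall t : R, Bset (expmx (t *: Z) *m b)) -> \tr (Z *m p) = 0.
  move=> BZ; have [C hC] := congr_order2 Z p.
  have pZ : \tr (p *m Z^T) = \tr (Z *m p) by rewrite -mxtrace_tr trmx_mul trmxK ps.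
  suff : - (\tr (Z *m p) + \tr (Z *m p)) = 0 by lra.
  apply: (@first_order_eq0 _ _ C) => t t1.
  have := hC t t1; rewrite pZ; have := bmin _ (BZ t).
  rewrite -/h -/p -(mulmxA _ b) -/h trmx_mul mulmxA -(mulmxA _ h) -/p.
  rewrite ler_norml => h1 /andP[h2 h3]; move: h1 h2 h3; lra.
have critA H : \tr (vsval H *m p) = 0.
  by apply: crit => t; rewrite -linearZ; apply: Bset_mulA.
have critU Z : Lie G Z -> strict Z -> \tr (Z *m p) = 0.
  by move=> GZ sZ; apply: crit => t; apply: Bset_mulU => //; apply: Uset_expstrict.
have [X [GX Xs pX]] := polar_log Gh; rewrite -/p in pX.
(* X is split by the sign of its weights at [H0]. The zero part lies in [fa] and the positive part
   is strict, so both are orthogonal to p by minimality; the negative part is the transpose of the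
   positive one, and p is symmetric. *)
pose sel (s : R -> bool) : 'M[R]_n := wsum F (fun al : dual fa => (s (al H0) : bool)%:R) X.
have GS s : Lie G (sel s) by apply: Lie_wsum.
have dec : X = sel (fun x => x == 0) + sel (fun x => 0 < x) + sel (fun x => x < 0).
  rewrite /sel -!(wsumDc Fid) -[LHS](wsum1 fa Fid); apply: (eq_wsum Fid) => a c _.
  by case: (ltgtP ((wt F fa a c) H0 : R) 0); rewrite ?addr0 ?add0r.
have selT (s s' : R -> bool) : (forall x, s x = s' (- x)) -> (sel s)^T = sel s'.
  move=> ss; apply: (eq_blocks Fid) => a c.
  have -> : F a *m (sel s)^T *m F c = (F c *m sel s *m F a)^T by rewrite !trmx_mul !Fsym mulmxA.
  rewrite !(FwsumF Fid) linearZ /= !trmx_mul !Fsym Xs mulmxA ss; congr (_%:R *: _).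
  by congr (nat_of_bool (s' _)); rewrite !wtE opprB.
have tr0 : \tr (sel (fun x => x == 0) *m p) = 0.
  have S0 : sel (fun x => x == 0) \in fa.
    apply: centralizer_regular => //; first by apply: selT => x; rewrite oppr_eq0.
    rewrite (bracket_wsum Fid Fsym faF) (wsum_comp Fid) (eq_wsum Fid (c' := fun=> 0 * 1)).
      by rewrite (wsumZc Fid) scale0r.
    by move=> a c _; case: eqP => [->|_]; rewrite ?mul0r ?mulr0.
  by rewrite -(vsprojK S0).
have trp : \tr (sel (fun x => 0 < x) *m p) = 0.
  apply: critU => // a c ac; rewrite (FwsumF Fid) wtE -/(height a) -/(height c).
  by rewrite subr_gt0 ltNge ac scale0r.
have trm : \tr (sel (fun x => x < 0) *m p) = 0.
  have E : (sel (fun x => x < 0))^T = sel (fun x => 0 < x).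
    by apply: selT => x; rewrite oppr_gt0.
  by rewrite -mxtrace_tr trmx_mul ps E mxtrace_mulC.
have X0 : X = 0.
  apply: trace_exp_eq0 => //; first by rewrite -pX /p det_mulmx det_tr Gdet // mulr1.
  by rewrite -pX {1}dec !mulmxDl !mxtraceD tr0 trp trm !addr0.
have hh : h *m h^T = 1%:M by rewrite -/p pX X0 expmx0 mulmx1.
have [u [H [Uu bE]]] := Bset_dec Bb.
have mH : - vsval H = vsval (- H) by rewrite linearN.
(* From h = b g and b = u exp(H): g = exp(-H) u^-1 h, and u^-1 is moved to the left of exp(-H). *)
exists (expmx (vsval (- H)) *m invmx u *m expmx (- vsval (- H))), (- H), h; split.
- by apply: Uset_conj; apply: UsetV.
- by split.
- rewrite /h bE !mulmxA -mH opprK -(mulmxA _ (expmx (vsval H)) (expmx (- _))) expmxNr mulmx1.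
  rewrite -(mulmxA _ (invmx u)) mulVmx ?mulmx1; last by apply: G_unit; case: Uu.
  by rewrite expmxNl mul1mx.
Qed.

(** Multiplying by transposes removes k, leaving u exp(2H) u^T = u' exp(2H') u'^T. After moving the
    unipotent factors one side is upper and the other lower triangular; diagonal blocks give e^(2
    lam_a(H)) = e^(2 lam_a(H')). *)
Lemma iwasawa_unique u H k u' H' k' : Uset u -> Uset u' -> Kset k -> Kset k' ->
  u *m expmx (vsval H) *m k = u' *m expmx (vsval H') *m k' -> H = H'.
Proof.
move=> Uu Uu' [_ kk] [_ kk'] E.
have p2 v (L : subvs_of fa) (l : 'M[R]_n) : l *m l^T = 1%:M -> (v *m expmx (vsval L) *m l) *m (v *m expmx (vsval L) *m l)^T =
    v *m expmx (vsval L) *m expmx (vsval L) *m v^T :> 'M[R]_n.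
  move=> ll; rewrite !trmx_mul trmx_expmx (fa_sym Fsym faF) !mulmxA.
  by rewrite -(mulmxA _ l) ll mulmx1.
have {}E : u *m expmx (vsval H) *m expmx (vsval H) *m u^T =
    u' *m expmx (vsval H') *m expmx (vsval H') *m u'^T.
  by rewrite -(p2 _ _ _ kk) E (p2 _ _ _ kk').
have Gu : G u by case: Uu. have Gu' : G u' by case: Uu'.
pose w := invmx u' *m u; have Uw : Uset w by apply: UsetM => //; apply: UsetV.
pose w' := invmx u *m u'; have Uw' : Uset w' by apply: UsetM => //; apply: UsetV.
have {}E : w *m expmx (vsval H) *m expmx (vsval H) = expmx (vsval H') *m expmx (vsval H') *m w'^T.
  rewrite /w /w' trmx_mul -!mulmxA.
  have -> : u *m (expmx (vsval H) *m expmx (vsval H)) =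
      u' *m expmx (vsval H') *m expmx (vsval H') *m u'^T *m (invmx u)^T.
    rewrite -E -!mulmxA -trmx_mul mulVmx ?G_unit // trmx1 mulmx1 //.
  by rewrite !mulmxA mulVmx ?G_unit // mul1mx.
clearbody w w'.
apply: val_inj; rewrite /= [vsval H]faF [vsval H']faF; apply: eq_bigr => a _; congr (_ *: _).
have wT : F a *m w'^T *m F a = F a.
  have := congr1 trmx (Uset_diag a Uw'); rewrite !trmx_mul Fsym mulmxA //.
have := congr1 (fun M => F a *m M *m F a) E.
rewrite -!mulmxA !(expFl Fid faF) -!scalemxAr (expFl Fid faF) -!scalemxAr !mulmxA.
rewrite Uset_diag //.
rewrite (expFr Fid Fsym faF) -!scalemxAl (expFr Fid Fsym faF) -!scalemxAl wT !scalerA -!expRD.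
move/eqP; rewrite -subr_eq0 -scalerBl scaler_eq0 (negbTE (Fn0 a)) orbF subr_eq0.
by move/eqP/expR_inj; lra.
Qed.

(** * Logarithms of unipotent elements; root spaces described without the Lie algebra *)

Lemma poly_eq_nat (p q : {poly R}) : (forall k : nat, p.[k%:R] = q.[k%:R]) -> p = q.
Proof.
move=> h; apply/eqP; rewrite -subr_eq0; apply: contraT => pq0.
pose s := [seq k%:R | k <- iota 0 (size (p - q))] : seq R.
have : (size s < size (p - q)%R)%N.
  apply: max_poly_roots => //.
    apply/allP => _ /mapP[k _ ->]; rewrite /root hornerD hornerN h subrr //.
  rewrite map_inj_uniq ?iota_uniq // => x y /eqP.
  by rewrite eqr_nat => /eqP.
by rewrite size_map size_iota ltnn.
Qed.

Definition mxhorner (t : R) (gam : 'M[{poly R}]_n) : 'M[R]_n := map_mx (fun p => p.[t]) gam.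

Lemma mxhornerE t gam : mxhorner t gam = map_mx (horner_eval t) gam.
Proof. by []. Qed.

Lemma map_mx_exp (S T : nzRingType) (f : {rmorphism S -> T}) (M : 'M[S]_n) k :
  map_mx f (M ^+ k) = map_mx f M ^+ k.
Proof.
elim: k => [|k IH]; first by rewrite !expr0 map_mx1.
by rewrite !exprS -!mulmxE map_mxM IH.
Qed.

Lemma poly_order2 (p : {poly R}) : exists C : R, forall t : R, 0 <= t -> t <= 1 ->
  `|p.[t] - p`_0 - t * p`_1| <= C * t ^+ 2.
Proof.
exists (\sum_(i < size p) `|p`_i|) => t t0 t1; rewrite horner_coef.
have -> : \sum_(i < size p) p`_i * t ^+ i - p`_0 - t * p`_1 =
    \sum_(i < size p) (if (i < 2)%N then 0 else p`_i * t ^+ i).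
  have [s1|s1] := leqP (size p) 1.
    rewrite [p`_1]nth_default // mulr0 subr0.
    case: (size p) s1 (fun i => @nth_default R 0 p i) => [|[|//]] _ d.
      by rewrite !big_ord0 d // subr0.
    by rewrite !big_ord1 expr0 mulr1 subrr.
  move: (size p) s1 => [|[|m]] // _.
  rewrite 2!big_ord_recl [RHS]big_ord_recl [X in _ = _ + X]big_ord_recl /= /bump /=.
  by rewrite expr0 expr1; ring.
rewrite (le_trans (ler_norm_sum _ _ _)) // mulr_suml; apply: ler_sum => i _.
case: ltnP => i2; first by rewrite normr0 mulr_ge0 ?sqr_ge0.
rewrite normrM ler_wpM2l // ger0_norm ?exprn_ge0 // -(subnKC i2) exprD.
by rewrite ler_piMr ?exprn_ge0 // exprn_ile1.
Qed.

(** The binomial coefficient as a polynomial in its upper argument, so that (1 + N)^t makes sense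
    for real t and nilpotent N. *)
Definition binpoly k : {poly R} := (k`!%:R)^-1 *: \prod_(l < k) ('X - l%:R%:P).

Lemma binpoly_nat k j : (binpoly k).[j%:R] = 'C(j, k)%:R.
Proof.
rewrite /binpoly hornerZ horner_prod; under eq_bigr do rewrite hornerXsubC.
have -> : \prod_(l < k) (j%:R - l%:R) = (j ^_ k)%:R :> R.
  elim: k => [|k IH]; first by rewrite big_ord0 ffactn0.
  rewrite big_ord_recr /= IH ffactnSr natrM.
  have [kj|jk] := leqP k j; first by rewrite natrB.
  by rewrite ffact_small // !mul0r.
by rewrite -bin_ffact natrM mulrC mulfK // gt_eqF // ltr0n fact_gt0.
Qed.

(* The powers u^k of a unipotent u form a polynomial in k, whose values at real
   arguments are a one-parameter subgroup of G. *)
Lemma Uset_log u : Uset u -> exists X, [/\ Lie G X, strict X & u = expmx X].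
Proof.
move=> [Gu su]; pose N := u - 1%:M; have N0 := strict_nilpotent su.
pose gam : 'M[{poly R}]_n := \sum_(k < n.+1) binpoly k *: map_mx polyC (N ^+ k).
have gamE t : mxhorner t gam = \sum_(k < n.+1) (binpoly k).[t] *: N ^+ k.
  apply/matrixP => i j; rewrite !mxE !summxE horner_sum; apply: eq_bigr => k _.
  by rewrite !mxE hornerM hornerC.
have gam_nat j : mxhorner j%:R gam = u ^+ j.
  have -> : u = N + 1 by rewrite /N subrK.
  rewrite exprD1n gamE.
  have Nk k : (n < k)%N -> N ^+ k = 0 by move=> nk; rewrite -(subnKC (ltnW nk)) exprD N0 mul0r.
  transitivity (\sum_(k < (n.+1 + j.+1)%N) 'C(j, k)%:R *: N ^+ k).
    rewrite big_split_ord /= [X in _ = _ + X]big1 ?addr0 => [|k _].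
      by apply: eq_bigr => k _; rewrite binpoly_nat.
    by rewrite Nk ?scaler0 ?leq_addr.
  rewrite addnC big_split_ord /= [X in _ + X = _]big1 ?addr0 => [|k _].
    by apply: eq_bigr => k _; rewrite scaler_nat.
  by rewrite bin_small ?scale0r ?leq_addr.
have Ggam t : G (mxhorner t gam).
  by apply: Gpoly => k; rewrite -/(mxhorner _ _) gam_nat; apply: group_exp.
(* The derivative at 0 of the curve t -> (1 + N)^t, that is, the logarithm of u. *)
pose X := \sum_(k < n.+1) (binpoly k)`_1 *: N ^+ k.
have XE i j : X i j = (gam i j)`_1.
  rewrite !summxE coef_sum; apply: eq_bigr => k _; rewrite !mxE.
  by rewrite coefMC.
have gam0 i j : (gam i j)`_0 = (1%:M : 'M[R]_n) i j.
  have := congr1 (fun M : 'M[R]_n => M i j) (gam_nat 0%N); rewrite expr0 mxE horner_coef0.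
  by [].
have ord2 : exists2 C : R, 0 <= C & forall t : R, 0 <= t -> t <= 1 -> mnorm (mxhorner t gam - 1%:M - t *: X) <= C * t ^+ 2.
  pose D i j : R := xget 0 [set C : R | 0 <= C /\ forall t : R, 0 <= t -> t <= 1 ->
    `|(gam i j).[t] - (gam i j)`_0 - t * (gam i j)`_1| <= C * t ^+ 2].
  have DP i j : 0 <= D i j /\ forall t : R, 0 <= t -> t <= 1 ->
    `|(gam i j).[t] - (gam i j)`_0 - t * (gam i j)`_1| <= D i j * t ^+ 2.
    have [C hC] := poly_order2 (gam i j).
    apply: (@xgetPex R 0 [set C : R | 0 <= C /\ forall t : R, 0 <= t -> t <= 1 ->
      `|(gam i j).[t] - (gam i j)`_0 - t * (gam i j)`_1| <= C * t ^+ 2]).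
    exists C; split=> //; have := hC 1 ler01 (lexx _); rewrite expr1n mulr1.
    exact: le_trans.
  exists (\sum_i \sum_j D i j); first by apply: sumr_ge0 => i _; apply: sumr_ge0 => j _; case: (DP i j).
  move=> t t0 t1; rewrite /mnorm mulr_suml; apply: ler_sum => i _.
  rewrite mulr_suml; apply: ler_sum => j _; have [_ /(_ t t0 t1)] := DP i j.
  by rewrite gam0 -XE !mxE.
have [C C0 hC] := ord2.
have gam_pow m t : mxhorner t gam ^+ m = mxhorner (m%:R * t) gam.
  have E : gam ^+ m = map_mx (fun p => p \Po (m%:R *: 'X)) gam.
    apply/matrixP => i j; apply: poly_eq_nat => k; rewrite [in RHS]mxE horner_comp hornerZ hornerX.
    have := congr1 (fun M : 'M[R]_n => M i j) (gam_nat (m * k)%N); rewrite mxE natrM => ->.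
    have := congr1 (fun M : 'M[R]_n => M i j) (map_mx_exp (horner_eval (k%:R : R)) gam m).
    by rewrite mxE /= /horner_eval => ->; rewrite -mxhornerE gam_nat -exprM mulnC.
  rewrite mxhornerE -map_mx_exp E; apply/matrixP => i j.
  by rewrite !mxE /= /horner_eval horner_comp hornerZ hornerX.
have gam_exp t : 0 <= t -> mxhorner t gam = expmx (t *: X).
  (* The quadratic estimate holds on [0, 1] only; a larger t is reached as the M-th power of the
     value at t/M. *)
  move=> t0; pose M := (Num.truncn t).+1.
  have tM : t / M%:R <= 1 by rewrite ler_pdivrMr ?ltr0n // mul1r ltW // truncnS_gt.
  have step s : 0 <= s -> s <= 1 -> mxhorner s gam = expmx (s *: X).
    move=> s0 s1; apply: (mcvg_unique (F := \oo) (A := fun k => mxhorner (s / k.+1%:R) gam ^+ k.+1)).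
      apply: (mcvg_ext (A := fun=> mxhorner s gam)); last exact: mcvg_cst.
      by move=> k; rewrite gam_pow mulrC divfK // pnatr_eq0.
    apply: (power_limit (c := C * s ^+ 2)) => k.
    have k0 : 0 <= s / k.+1%:R by rewrite divr_ge0.
    have k1 : s / k.+1%:R <= 1 by rewrite ler_pdivrMr ?ltr0n // mul1r (le_trans s1) // ler1n.
    have := hC _ k0 k1; by rewrite expr_div_n mulrA scalerA [_^-1 * s]mulrC.
  have -> : t = M%:R * (t / M%:R) by rewrite mulrC divfK // pnatr_eq0.
  rewrite -gam_pow step ?divr_ge0 // -expmx_mulrn -scaler_nat scalerA.
  by [].
exists X; split.
- move=> t; have [t0|t0] := leP 0 t; first by rewrite -gam_exp.
  have := GV (Ggam (- t)); rewrite gam_exp; last by rewrite oppr_ge0 ltW.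
  have E := expmxNr (- t *: X); rewrite scaleNr opprK in E.
  suff -> : invmx (expmx (- t *: X)) = expmx (t *: X) by [].
  have [un _] := mulmx1_unit E; rewrite scaleNr.
  by rewrite -[RHS]mul1mx -(mulVmx un) -mulmxA E mulmx1.
- rewrite /X big_ord_recl; apply: strictD.
    rewrite /binpoly big_ord0 fact0 invr1 scale1r coefC /= scale0r; exact: strict0.
  by apply: strict_sum => k _; apply/strictZ/strict_exp.
- by have := gam_exp 1 ler01; rewrite scale1r => <-; rewrite -[1]/(1%:R) gam_nat expr1.
Qed.

Lemma expmx_nil_nat X k : X ^+ n = 0 -> nilexp (k%:R *: X) = nilexp X ^+ k.
Proof.
move=> X0; have kX0 : (k%:R *: X) ^+ n = 0.
  have h (c : R) m : (c *: X) ^+ m = c ^+ m *: X ^+ m.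
    elim: m => [|m IH]; first by rewrite !expr0 scale1r.
    by rewrite !exprS IH -!mulmxE -scalemxAl -scalemxAr scalerA.
  by rewrite h X0 scaler0.
by rewrite -!expmx_nil // scaler_nat expmx_mulrn.
Qed.

(** The curve t -> exp(tX) is polynomial and lies in the group at natural t, being a power of
    [nilexp X]; hence it lies there for all t. *)
Lemma Lie_nilpotent X : X ^+ n = 0 -> G (nilexp X) -> Lie G X.
Proof.
move=> X0 GX t.
have h (c : R) m : (c *: X) ^+ m = c ^+ m *: X ^+ m.
  elim: m => [|m IH]; first by rewrite !expr0 scale1r.
  by rewrite !exprS IH -!mulmxE -scalemxAl -scalemxAr scalerA.
rewrite expmx_nil; last by rewrite h X0 scaler0.
pose gam : 'M[{poly R}]_n := \sum_(k < n) ((k`!%:R)^-1 *: 'X^k) *: map_mx polyC (X ^+ k).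
have gamE s : mxhorner s gam = nilexp (s *: X).
  apply/matrixP => i j; rewrite /nilexp !mxE !summxE horner_sum; apply: eq_bigr => k _.
  rewrite h !mxE hornerM hornerC hornerZ hornerXn.
  by rewrite mulrA.
rewrite -gamE; apply: Gpoly => k; rewrite -/(mxhorner _ _) gamE expmx_nil_nat //.
exact: group_exp.
Qed.

Lemma weight_nilpotent alpha X : alpha H0 != 0 ->
  (forall a b, F a *m X *m F b != 0 -> wt F fa a b H0 = alpha H0) -> X ^+ n = 0.
Proof.
move=> a0 hX; have hX' a b : F a *m X *m F b != 0 -> height a - height b = alpha H0.
  by move=> /hX; rewrite wtE.
case: (ltgtP (alpha H0 : R) 0) => [neg|pos|]; last by move/eqP: a0.
- apply: (@raising_nilpotent _ _ _ _ Fid (fun a => - height a)) => a b ab.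
  apply: contrapT => /eqP /hX' E; move: ab neg; rewrite -E; lra.
- apply: (@raising_nilpotent _ _ _ _ Fid height) => a b ab.
  apply: contrapT => /eqP /hX' E; move: ab pos; rewrite -E; lra.
Qed.

Lemma root_H0_neq0 alpha : rootset (Lie G) fa alpha -> alpha H0 != 0.
Proof. by case/root_H0 => -[_ h]; apply/eqP => E; rewrite E ltxx in h. Qed.

Lemma rootspace_group alpha X : rootset (Lie G) fa alpha ->
  rootspace (Lie G) alpha X <->
  (forall H, expmx (vsval H) *m X = expR (alpha H) *: (X *m expmx (vsval H))) /\ G (nilexp X).
Proof.
move=> ra; have a0 := root_H0_neq0 ra; split=> [hX|[hX GX]].
  have [GX _] := hX; split.
    move=> H; have := Ad_wsum Fid Fsym faF H X; rewrite (rootspace_wsum _ hX) => E.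
    by rewrite -[LHS]mulmx1 -(expmxNl (vsval H)) mulmxA E -scalemxAl.
  rewrite -expmx_nil; first exact: Lie_exp.
  by apply: (@weight_nilpotent alpha) => // a b nz; rewrite (rootspace_block hX nz).
have blk a b : F a *m X *m F b != 0 -> wt F fa a b = alpha.
  move=> nz; apply/lfunP => H; rewrite wtE.
  have := congr1 (fun M => F a *m M *m F b) (hX H).
  rewrite -scalemxAr -scalemxAl !mulmxA (expFr Fid Fsym faF) -!mulmxA (expFl Fid faF).
  rewrite -!scalemxAr -scalemxAl scalerA mulmxA => /eqP.
  rewrite -subr_eq0 -scalerBl scaler_eq0 (negbTE nz) orbF subr_eq0 -expRD => /eqP/expR_inj.
  by move=> ->; rewrite addrK.
have X0 : X ^+ n = 0 by apply: (@weight_nilpotent alpha) => // a b nz; rewrite blk.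
split; first exact: Lie_nilpotent.
move=> H; rewrite -/(bracket _ _) (bracket_wsum Fid Fsym faF).
rewrite -[in RHS](wsum1 fa Fid X) -(wsumZc Fid); apply: (eq_wsum Fid) => a b nz.
by rewrite (blk _ _ nz) mulr1.
Qed.

Definition posseq : seq (dual fa) := [seq al <- weights F fa | `[< posroots (Lie G) Delta al >]].

Lemma mem_posseq al : (al \in posseq) <-> posroots (Lie G) Delta al.
Proof.
rewrite mem_filter; split=> [/andP[/asboolP]//|h].
by apply/andP; split; [apply/asboolP|apply: root_weights; case: h].
Qed.

Lemma posseq_uniq : uniq posseq.
Proof. by rewrite filter_uniq // undup_uniq. Qed.

Lemma pos_H0 al : al \in posseq -> 0 < al H0.
Proof. by move=> /mem_posseq[[a0 _] na]; apply: nneg_comb_H0. Qed.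

(** The logarithm of u is strict, so its nonzero weight components have positive value at [H0];
    these components are root vectors, and roots positive at [H0] are the positive roots. *)
Lemma Uset_roots u : Uset u <-> exists2 X : dual fa -> 'M[R]_n,
  (forall al, al \in posseq -> rootspace (Lie G) al (X al)) & u = nilexp (\sum_(al <- posseq) X al).
Proof.
split=> [/Uset_log[X [GX sX ->]]|[X hX ->]].
  exists (fun al => wcomp F al X).
    move=> al _; split; first exact: Lie_wcomp.
    by move=> H; apply: (bracket_wcomp Fid Fsym faF).
  rewrite expmx_nil ?strict_nilpotent //; congr nilexp.
  rewrite -[LHS](wsum1 fa Fid) (wsum_weights Fid) /posseq big_filter [LHS]big_seq_cond.
  rewrite [RHS]big_seq_cond [RHS]big_mkcondr [LHS]big_mkcondr /=.
  apply: eq_bigr => al alw; rewrite scale1r; case: asboolP => // npos.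
  apply: contrapT => /eqP nz.
  have al0 : 0 < al H0.
    rewrite ltNge; apply/negP => al0; case/eqP: nz; apply: (eq_blocks Fid) => a b.
    rewrite mulmx0 mul0mx (FwsumF Fid); case: eqP => [wE|_]; last by rewrite scale0r.
    by rewrite sX ?scaler0 //; move: al0; rewrite -wE wtE subr_le0.
  have ra : rootset (Lie G) fa al.
    apply: (root_wcomp GX) => //.
    by apply: contraTneq al0 => ->; rewrite zero_lfunE ltxx.
  apply: npos; split=> //; case: (root_H0 ra) => -[] // _ h.
  by move: al0; rewrite ltNge (ltW h).
have sX al : al \in posseq -> strict (X al).
  move=> alp a b ab; apply: contrapT => /eqP nz.
  have := pos_H0 alp; rewrite -(rootspace_block (hX _ alp) nz) wtE.
  by rewrite subr_gt0 ltNge ab.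
have sS : strict (\sum_(al <- posseq) X al).
  by rewrite big_seq; apply: strict_sum.
have GS : Lie G (\sum_(al <- posseq) X al).
  by rewrite big_seq; apply: (Lie_sum Gc) => // al /hX[].
rewrite -expmx_nil ?strict_nilpotent //; split; first exact: Lie_exp.
exact: strict_expmx.
Qed.

(** * The trace inequality for the A-component *)

Lemma block_trace X a (c : R) : F a *m X *m F a = c *: F a ->
  c ^+ 2 * \tr (F a) <= \tr (F a *m (X *m X^T)).
Proof.
move=> XE; have FFa b : F b *m F b = F b by rewrite (FF Fid) eqxx.
have E b : \tr ((F a *m X *m F b) *m (F a *m X *m F b)^T) = \tr (F a *m X *m F b *m X^T *m F a).
  by rewrite !trmx_mul !Fsym !mulmxA -(mulmxA _ (F b) (F b)) FFa.
have -> : \tr (F a *m (X *m X^T)) = \sum_b \tr (F a *m X *m F b *m (F a *m X *m F b)^T).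
  rewrite (eq_bigr _ (fun b _ => E b)) -linear_sum /= -!mulmx_suml -mulmx_sumr (sumF Fid) mulmx1.
  by rewrite [RHS]mxtrace_mulC !mulmxA FFa.
(* The trace is the sum over b of the squared norms of the blocks (a, b); only b = a is kept. *)
rewrite (bigD1 a) //= XE linearZ /= Fsym -scalemxAl -scalemxAr FFa !mxtraceZ mulrA -expr2 lerDl.
by apply: sumr_ge0 => b _; apply: trFF_ge0.
Qed.

(** Here h is the inverse transpose of g, whose A-component is exp(-C). The pair of lower bounds
    controls lam_a(C) from both sides, which avoids differentiating the Iwasawa projection. *)
Lemma iwasawa_trace (u k h : 'M[R]_n) (C : subvs_of fa) a : Uset u -> Kset k ->
  h *m (u *m expmx (vsval C) *m k)^T = 1%:M ->
  let g := u *m expmx (vsval C) *m k in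
  expR (lam F a (vsval C)) ^+ 2 * \tr (F a) <= \tr (F a *m (g *m g^T)) /\
  expR (- lam F a (vsval C)) ^+ 2 * \tr (F a) <= \tr (F a *m (h *m h^T)).
Proof.
move=> Uu [_ kk] hg g; have kTk := mulmx1C kk.
have sq (Y : 'M[R]_n) : (Y *m k) *m (Y *m k)^T = Y *m Y^T.
  by rewrite trmx_mul mulmxA -(mulmxA Y) kk mulmx1.
split.
  rewrite sq; apply: block_trace.
  by rewrite -!mulmxA (expFl Fid faF) -!scalemxAr mulmxA Uset_diag.
have hE : h = (invmx u)^T *m expmx (vsval (- C)) *m k.
  rewrite -[RHS]mul1mx -hg -[LHS]mulmx1 -!mulmxA; congr (_ *m _).
  rewrite !trmx_mul trmx_expmx (fa_sym Fsym faF) linearN /= -!mulmxA.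
  rewrite (mulmxA u^T) -trmx_mul mulVmx ?trmx1 ?mul1mx; last by apply: G_unit; case: Uu.
  by rewrite (mulmxA (expmx _)) expmxNr mul1mx kTk.
rewrite hE sq; apply: block_trace.
rewrite -!mulmxA (expFl Fid faF) -!scalemxAr mulmxA.
have := congr1 trmx (Uset_diag a (UsetV Uu)); rewrite !trmx_mul Fsym mulmxA => ->.
by rewrite linearN /= -scaleN1r lamZ mulN1r.
Qed.

Lemma trace_fa (Q : subvs_of fa) X : \tr (vsval Q *m X) = \sum_a lam F a (vsval Q) * (lam F a X * \tr (F a)).
Proof.
rewrite [in LHS](faF Q) mulmx_suml linear_sum; apply: eq_bigr => a _.
rewrite -scalemxAl /= mxtraceZ /lam divfK // gt_eqF //; exact: trF_gt0.
Qed.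

(** First-order estimate of the A-component, with D independent of k and e. The bounds of
    [iwasawa_trace] for exp(eX) and exp(-eX), expanded to first order and combined with 1 + 2x <=
    e^(2x), give |lam_a(C) - e lam_a(k X k^T)| = O(e^2). *)
Lemma iwasawa_step (Q : subvs_of fa) X : Lie G X -> X^T = X -> exists2 D : R, 0 <= D &
  forall k (e : R), Kset k -> 0 <= e -> e <= 1 -> exists u (C : subvs_of fa) k',
  [/\ Uset u, Kset k', k *m expmx (e *: X) = u *m expmx (vsval C) *m k' &
    \tr (vsval Q *m vsval C) <= e * \tr (vsval Q *m (k *m X *m k^T)) + D * e ^+ 2].
Proof.
(* Entries of elements of K are at most 1 in absolute value, so this bounds their norms. *)
move=> GX Xs; pose kap : R := n%:R * (n%:R * 1).
pose d a := mnorm (F a) * (kap * exprem (X + X) 2 * kap).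
have kap0 : 0 <= kap by rewrite /kap !mulr_ge0.
have d0 a : 0 <= d a.
  apply: mulr_ge0; first exact: mnorm_ge0.
  by apply: mulr_ge0 => //; apply: mulr_ge0 => //; apply: exprem_ge0.
exists (\sum_a `|lam F a (vsval Q)| * d a).
  by apply: sumr_ge0 => a _; rewrite mulr_ge0.
move=> k e Kk e0 e1; have [Gk kk] := Kk; have kTk := mulmx1C kk.
have [u [C [k' [Uu Kk' E]]]] : exists u (C : subvs_of fa) k', [/\ Uset u, Kset k' &
    k *m expmx (e *: X) = u *m expmx (vsval C) *m k'].
  by apply: iwasawa; apply: GM.
exists u, C, k'; split=> //.
have est (t : R) a : `|t| <= 1 ->
    \tr (F a *m ((k *m expmx (t *: X)) *m (k *m expmx (t *: X))^T)) <=
    \tr (F a) + 2 * t * \tr (F a *m (k *m X *m k^T)) + d a * t ^+ 2.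
  move=> t1; have o2 := exp_order2 (X + X) t1.
  rewrite trmx_mul trmx_expmx linearZ /= Xs !mulmxA -(mulmxA _ (expmx _) (expmx _)).
  rewrite -expmxD // -scalerDr.
  set W := expmx _ in o2 *; set P := _ + _ *: _ in o2.
  have -> : F a *m k *m W *m k^T = F a *m (k *m (W - P) *m k^T) + F a *m (k *m P *m k^T).
    by rewrite -mulmxDr -mulmxDl -mulmxDr subrK !mulmxA.
  have nk l : Kset l -> mnorm l <= kap.
    by move=> Kl; apply: mnorm_le_entry => i j; apply: Kset_entry.
  have le1 : \tr (F a *m (k *m (W - P) *m k^T)) <= d a * t ^+ 2.
    rewrite (le_trans (ler_norm _)) // (le_trans (mxtrace_le_mnorm _)) //.
    rewrite (le_trans (mnormM _ _)) // /d -mulrA ler_wpM2l ?mnorm_ge0 //.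
    rewrite (le_trans (mnormM _ _)) // mulrAC ler_pM ?mnorm_ge0 ?nk //; last exact: KsetT.
    by rewrite (le_trans (mnormM _ _)) // -mulrA ler_pM ?mnorm_ge0 ?nk.
  have -> : F a *m (k *m P *m k^T) = F a + (2 * t) *: (F a *m (k *m X *m k^T)).
    rewrite /P mulmxDr mulmxDl mulmx1 kk mulmxDr mulmx1; congr (_ + _).
    rewrite -scalemxAr -scalemxAl -scalemxAr mulmxDr mulmxDl mulmxDr.
    by rewrite -mulr2n -scaler_nat scalerA mulrC.
  rewrite mxtraceD mxtraceD mxtraceZ; move: le1; rewrite !mulmxA; lra.
have hg : (k *m expmx (- e *: X)) *m (u *m expmx (vsval C) *m k')^T = 1%:M.
  rewrite -E trmx_mul trmx_expmx linearZ /= Xs mulmxA -(mulmxA k) scaleNr expmxNl.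
  by rewrite mulmx1.
rewrite !trace_fa mulr_sumr mulr_suml -big_split; apply: ler_sum => a _ /=.
have [l1 l2] := iwasawa_trace a Uu Kk' hg; rewrite -E in l1.
have e1' : `|e| <= 1 by rewrite ger0_norm.
have e1'' : `|- e| <= 1 by rewrite normrN.
have {}l1 := le_trans l1 (est _ a e1'); have {}l2 := le_trans l2 (est _ a e1'').
have T0 : 0 < \tr (F a) by apply: trF_gt0.
set lC := lam F a (vsval C) in l1 l2 *; set lZ := lam F a (k *m X *m k^T).
have ZE : \tr (F a *m (k *m X *m k^T)) = lZ * \tr (F a).
  by rewrite /lZ /lam divfK // gt_eqF.
rewrite ZE sqrrN in l2; rewrite ZE in l1.
have ex (x : R) : 1 + 2 * x <= expR x ^+ 2.
  by rewrite expr2 -expRD (le_trans _ (expR_ge1Dx _)) //; lra.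
have {}l1 := le_trans (ler_wpM2r (ltW T0) (ex _)) l1.
have {}l2 := le_trans (ler_wpM2r (ltW T0) (ex _)) l2.
have de : 0 <= d a * e ^+ 2 by rewrite mulr_ge0 ?sqr_ge0.
have ab : `|lC * \tr (F a) - e * (lZ * \tr (F a))| <= d a * e ^+ 2.
  by rewrite ler_norml; move: l1 l2 de; set T := \tr _; lra.
move: (lam F a (vsval Q)) => q; clearbody lC lZ.
rewrite -lerBlDl -mulrA [e * _]mulrCA -mulrBr (le_trans (ler_norm _)) // normrM.
by rewrite ler_wpM2l.
Qed.

(* Writing exp X as an N-th power and letting N tend to infinity. *)
Lemma iwasawa_linear (Q C : subvs_of fa) X (M : R) u k : Lie G X -> X^T = X ->
  (forall l, Kset l -> \tr (vsval Q *m (l *m X *m l^T)) <= M) ->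
  Uset u -> Kset k -> expmx X = u *m expmx (vsval C) *m k -> \tr (vsval Q *m vsval C) <= M.
Proof.
move=> GX Xs hM Uu Kk XE; have [D D0 step] := iwasawa_step Q GX Xs.
apply/ler_addgt0Pr => eps eps0; pose N := (Num.truncn (D / eps)).+1.
have N0 : 0 < N%:R :> R by rewrite ltr0n.
have DN : D / N%:R <= eps.
  by rewrite ler_pdivrMr // mulrC -ler_pdivrMr // ltW // truncnS_gt.
pose e : R := N%:R^-1; have e0 : 0 <= e by rewrite invr_ge0 ltW.
have e1 : e <= 1 by rewrite invf_le1 ?ler1n.
(* Applying the step to the current K-component makes the A-components add: exp(C1) u2 exp(C2) =
   (exp(C1) u2 exp(-C1)) exp(C1 + C2). The errors sum to at most N D e^2 = D/N. *)
have chain m : exists u (C : subvs_of fa) k, [/\ Uset u, Kset k, expmx (e *: X) ^+ m = u *m expmx (vsval C) *m k &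
    \tr (vsval Q *m vsval C) <= m%:R * (e * M + D * e ^+ 2)].
  elim: m => [|m [u1 [C1 [k1 [Uu1 Kk1 E1 le1]]]]].
    exists 1%:M, 0, 1%:M; split; [exact: Uset1|exact: Kset1| |].
      by rewrite linear0 expmx0 !mulmx1 expr0.
    have -> : vsval (0 : subvs_of fa) = 0 by rewrite linear0.
    by rewrite mulmx0 mxtrace0 mul0r.
  have [u2 [C2 [k2 [Uu2 Kk2 E2 le2]]]] := step k1 e Kk1 e0 e1.
  exists (u1 *m (expmx (vsval C1) *m u2 *m expmx (- vsval C1))), (C1 + C2), k2; split=> //.
  - by apply: UsetM => //; apply: Uset_conj.
  - rewrite exprSr -mulmxE E1 -!mulmxA E2 linearD /= expmxD; last exact: (fa_comm Fid Fsym faF).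
    have := expmxNl (vsval C1); move: (expmx (vsval C1)) (expmx (- vsval C1)) => P Q' QP.
    by rewrite !mulmxA -(mulmxA _ Q' P) QP mulmx1.
  - have -> : vsval (C1 + C2) = vsval C1 + vsval C2 by rewrite linearD.
    rewrite mulmxDr mxtraceD -natr1 mulrDl mul1r lerD // (le_trans le2) // lerD2r.
    by rewrite ler_wpM2l // hM.
have [u' [C' [k' [Uu' Kk' E' le']]]] := chain N.
have -> : C = C'.
  apply: (iwasawa_unique Uu Uu' Kk Kk'); rewrite -XE -E' -expmx_mulrn -scaler_nat scalerA.
  by rewrite mulfV ?gt_eqF // scale1r.
rewrite (le_trans le') // mulrDr mulrA mulfV ?gt_eqF // mul1r lerD2l.
by rewrite (le_trans _ DN) // expr2 mulrCA (mulrA N%:R) mulfV ?gt_eqF // mul1r.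
Qed.

(** A maximiser X' on the orbit commutes with Q: test criticality in the direction [X', Q]. Then X'
    can be conjugated into [fa] inside the centraliser of Q, which leaves tr(Q X') unchanged. *)
Lemma linear_max (Q : subvs_of fa) X : Lie G X -> X^T = X -> exists k (B : subvs_of fa),
  [/\ Kset k, vsval B = k *m X *m k^T &
  forall l, Kset l -> \tr (vsval Q *m (l *m X *m l^T)) <= \tr (vsval Q *m vsval B)].
Proof.
move=> GX Xs; have [k [Kk _ kmax crit]] := max_orbit 0 (vsval Q) X.
set X' := k *m X *m k^T in kmax crit.
have GX' : Lie G X' by apply: Kset_conj_Lie.
have X's : X'^T = X' by apply: conj_sym.
have X'E : X' = k *m X *m k^T by [].
clearbody X'; have X'Q : bracket X' (vsval Q) = 0.
  have Ys : (bracket X' (vsval Q))^T = - bracket X' (vsval Q).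
    by rewrite /bracket linearB /= !trmx_mul X's (fa_sym Fsym) // opprB.
  apply: (tr_skew_eq0 Ys); set Y := bracket X' (vsval Q) in Ys *.
  have GY : Lie G Y.
    by rewrite /Y bracketC (bracket_wsum Fid Fsym faF); apply: LieN; apply: Lie_wsum.
  have Y0 : Y *m 0 = 0 *m Y :> 'M[R]_n by rewrite mulmx0 mul0mx.
  have [+ _] := crit Y GY Ys Y0.
  rewrite /bracket mulmxBl mxtraceB -mulmxA -(mulmxA X') [\tr (X' *m _)]mxtrace_mulC -mulmxA.
  by rewrite -mxtraceB -mulmxBr.
have {}X'Q : X' *m vsval Q = vsval Q *m X'.
  by apply/eqP; rewrite -subr_eq0 -/(bracket _ _) X'Q.
have [l [Kl lQ lX]] := conj_in_fa GX' X's X'Q.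
have [_ ll] := Kl.
exists (l *m k), (vsproj fa (l *m X' *m l^T)); split; first exact: KsetM.
  by rewrite vsprojK // trmx_mul X'E !mulmxA.
move=> l' Kl'; rewrite vsprojK // mxtrace_mulC.
have -> : \tr (vsval Q *m (l *m X' *m l^T)) = \tr (X' *m vsval Q).
  rewrite !mulmxA -lQ [LHS]mxtrace_mulC -!mulmxA (mulmxA l^T) (mulmx1C ll) mul1mx.
  by rewrite mxtrace_mulC.
by apply: kmax => //; rewrite mulmx0 mul0mx.
Qed.

(** Elements of [fa] are symmetric, so the trace form is positive definite there and the Gram matrix
    of a basis is invertible. *)
Lemma riesz (l : dual fa) : exists Q : subvs_of fa, forall H, \tr (vsval Q *m vsval H) = l H.
Proof.
pose b := vbasis {: subvs_of fa}; pose d := \dim {: subvs_of fa}.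
pose M := \matrix_(i < d, j < d) \tr (vsval b`_i *m vsval b`_j).
have trl (q : 'I_d -> R) H : \tr (vsval (\sum_i q i *: b`_i) *m vsval H) =
    \sum_i q i * \tr (vsval b`_i *m vsval H).
  rewrite linear_sum mulmx_suml linear_sum; apply: eq_bigr => i _.
  by rewrite linearZ /= -scalemxAl mxtraceZ.
have Hb H : H = \sum_i coord b i H *: b`_i by apply: coord_vbasis; apply: memvf.
have free_b : row_free M.
  rewrite -kermx_eq0; apply/rowV0P => y /sub_kermxP yM.
  pose v := \sum_i y 0 i *: b`_i.
  have v0 (i : 'I_d) : \tr (vsval b`_i *m vsval v) = 0.
    rewrite mxtrace_mulC trl; have := congr1 (fun N : 'rV_ _ => N 0 i) yM; rewrite !mxE => E.
    by rewrite -[RHS]E; apply: eq_bigr => j _; rewrite mxE.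
  have {}v0 : v = 0.
    apply: val_inj => /=; apply: trFF_eq0; rewrite (fa_sym Fsym faF) {1}/v trl.
    by rewrite big1 // => i _; rewrite v0 mulr0.
  have /freeP fb : free b by apply: basis_free; apply: vbasisP.
  by apply/rowP => i; rewrite mxE; apply: fb.
case/row_freeP: free_b => B MB; have BM := mulmx1C MB.
pose q := (\row_j (l b`_j : R)) *m B.
exists (\sum_i q 0 i *: b`_i) => H; rewrite trl.
have qE (j : 'I_d) : \sum_i q 0 i * \tr (vsval b`_i *m vsval b`_j) = l b`_j.
  have := congr1 (fun N : 'rV_ _ => N 0 j) (mulmxA (\row_j (l b`_j : R)) B M).
  rewrite BM mulmx1 -/q; clearbody q; rewrite !mxE => ->.
  by apply: eq_bigr => i _; rewrite mxE.
transitivity (\sum_j coord b j H * (l b`_j : R)); last first.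
  by rewrite [in RHS](Hb H) [RHS]linear_sum; apply: eq_bigr => j _; rewrite linearZ.
transitivity (\sum_i \sum_j coord b j H * (q 0 i * \tr (vsval b`_i *m vsval b`_j))).
  apply: eq_bigr => i _; rewrite mxtrace_mulC {1}(Hb H) trl mulr_sumr; apply: eq_bigr => j _.
  by rewrite mulrCA [\tr (vsval b`_j *m _)]mxtrace_mulC.
rewrite exchange_big; apply: eq_bigr => j _ /=.
by rewrite -mulr_sumr qE.
Qed.

Definition rootseq : seq (dual fa) := [seq al <- weights F fa | `[< rootset (Lie G) fa al >]].

Lemma mem_rootseq al : (al \in rootseq) <-> rootset (Lie G) fa al.
Proof.
rewrite mem_filter; split=> [/andP[/asboolP]//|h].
by apply/andP; split; [apply/asboolP|apply: root_weights].
Qed.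

Lemma rootseq_uniq : uniq rootseq.
Proof. by rewrite filter_uniq // undup_uniq. Qed.

(** The logarithm of N at exp(H). *)
Definition rootsum H : R := \sum_(al <- rootseq) `|al H : R|.

Definition conjf (s : 'M[R]_n) H : subvs_of fa := vsproj fa (s^T *m vsval H *m s).

Lemma conjf_linear s : linear (conjf s).
Proof.
move=> c H H'; rewrite /conjf -linearP; congr vsproj.
have -> : vsval (c *: H + H') = c *: vsval H + vsval H' by rewrite linearP.
by rewrite mulmxDr mulmxDl -scalemxAr -scalemxAl.
Qed.

HB.instance Definition _ s := GRing.isLinear.Build R (subvs_of fa) (subvs_of fa) _
  (conjf s) (conjf_linear s).

Lemma conj_normalizes s H1 H : Kset s -> vsval H1 = s *m vsval H0 *m s^T ->
  s^T *m vsval H *m s \in fa.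
Proof.
move=> Ks H1E; have [_ ss] := Ks; have sTs := mulmx1C ss; apply: centralizer_regular.
- by have := Kset_conj_Lie (KsetT Ks) (faLie H); rewrite trmxK.
- by have := conj_sym s^T (fa_sym Fsym faF H); rewrite trmxK.
- have -> : vsval H0 = s^T *m vsval H1 *m s by rewrite H1E !mulmxA sTs mul1mx -mulmxA sTs mulmx1.
  have ssA (X Y : 'M[R]_n) : (s^T *m X *m s) *m (s^T *m Y *m s) = s^T *m (X *m Y) *m s.
    by rewrite !mulmxA -(mulmxA _ s s^T) ss mulmx1.
  by rewrite /bracket !ssA (fa_comm Fid Fsym faF) subrr.
Qed.

(** The conjugating element m need not normalise [fa]. As m H0 m^T commutes with B', some k in K
    commuting with B' brings it into [fa]. Then s = k m still sends B to B', and it normalises [fa]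
    because [H0] is regular; so s permutes the roots. *)
Lemma rootsum_conj B B' m : Kset m -> vsval B' = m *m vsval B *m m^T -> rootsum B = rootsum B'.
Proof.
move=> Km B'E; have [_ mm] := Km; have mTm := mulmx1C mm.
have conjM (r X Y : 'M[R]_n) : r^T *m r = 1%:M ->
    (r *m X *m r^T) *m (r *m Y *m r^T) = r *m (X *m Y) *m r^T.
  by move=> rr; rewrite !mulmxA -(mulmxA _ r^T r) rr mulmx1.
have [k [Kk kB kH]] : exists k, [/\ Kset k, k *m vsval B' = vsval B' *m k &
    k *m (m *m vsval H0 *m m^T) *m k^T \in fa].
  apply: conj_in_fa; first exact: Kset_conj_Lie.
    by apply: conj_sym; apply: (fa_sym Fsym faF).
  by rewrite B'E !conjM // (fa_comm Fid Fsym faF).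
pose s := k *m m; have Ks : Kset s by apply: KsetM.
have [_ kk] := Kk; have [_ ss] := Ks; have sTs := mulmx1C ss.
pose H1 := vsproj fa (s *m vsval H0 *m s^T).
have H1E : vsval H1 = s *m vsval H0 *m s^T.
  by rewrite vsprojK // /s trmx_mul; move: kH; rewrite !mulmxA.
have sB : vsval B' = s *m vsval B *m s^T.
  have -> : s *m vsval B *m s^T = k *m vsval B' *m k^T by rewrite /s trmx_mul B'E !mulmxA.
  by rewrite kB -mulmxA kk mulmx1.
clearbody s; pose phi : 'End(subvs_of fa) := linfun (conjf s).
have phiE H : vsval (phi H) = s^T *m vsval H *m s.
  by rewrite lfunE /= vsprojK //; apply: conj_normalizes Ks H1E.
have phiB : phi B' = B.
  by apply: val_inj; rewrite /= phiE sB !mulmxA sTs mul1mx -mulmxA sTs mulmx1.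
have phi_ker : lker phi == 0%VS.
  apply/lker0P => H H' E; apply: val_inj; have := congr1 vsval E; rewrite !phiE => {}E.
  have := congr1 (fun M : 'M[R]_n => s *m M *m s^T) E.
  by rewrite !mulmxA ss !mul1mx -!mulmxA ss !mulmx1.
pose g (al : dual fa) : dual fa := (al \o phi)%VF.
have gK : cancel g (fun al => (al \o phi^-1)%VF) by move=> al; apply: lker0_compfK.
have g_root al : rootset (Lie G) fa al -> rootset (Lie G) fa (g al).
  move=> [al0 [X [GX hX] X0]]; split.
    by apply: contra al0 => /eqP E; rewrite -(gK al) E comp_lfun0l.
  exists (s *m X *m s^T); last first.
    apply: contra X0 => /eqP E; have := congr1 (fun M : 'M[R]_n => s^T *m M *m s) E.
    by rewrite !mulmxA sTs mul1mx -mulmxA sTs mulmx1 mulmx0 mul0mx => ->.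
  split; first exact: Kset_conj_Lie.
  move=> H; rewrite comp_lfunE scalemxAl scalemxAr -hX phiE.
  rewrite mulmxBr mulmxBl !mulmxA ss mul1mx; congr (_ - _).
  by rewrite -!mulmxA ss mulmx1.
have eqs : map g rootseq =i rootseq.
  apply: (uniq_min_size _ _ _).2; rewrite ?size_map //.
    by rewrite map_inj_uniq ?rootseq_uniq //; apply: can_inj gK.
  by move=> _ /mapP[al /mem_rootseq ra ->]; apply/mem_rootseq/g_root.
have peq : perm_eq rootseq (map g rootseq).
  by rewrite perm_sym uniq_perm ?rootseq_uniq // map_inj_uniq ?rootseq_uniq //; apply: can_inj gK.
rewrite /rootsum [RHS](perm_big _ peq) big_map; apply: eq_bigr => al _.
by rewrite comp_lfunE phiB.
Qed.

Lemma rootsum_iwasawa_cartan u k l B C : Uset u -> Kset k -> Kset l ->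
  u *m expmx (vsval C) = k *m expmx (vsval B) *m l -> rootsum C <= rootsum B.
Proof.
move=> Uu Kk Kl E; have [_ kk] := Kk; have [_ ll] := Kl.
have [Q hQ] := riesz (\sum_(al <- rootseq) Num.sg (al C : R) *: al).
have trQ H : \tr (vsval Q *m vsval H) = \sum_(al <- rootseq) Num.sg (al C : R) * (al H : R).
  by rewrite hQ sum_lfunE; apply: eq_bigr => al _; rewrite scale_lfunE.
pose X := k *m vsval B *m k^T.
have GX : Lie G X by apply: Kset_conj_Lie.
have Xs : X^T = X by apply: conj_sym; apply: (fa_sym Fsym faF).
have [m [B' [Km B'E maxB']]] := linear_max Q GX Xs.
(* Moving the K-factors to the right turns k exp(B) l into the exponential of the symmetric X = k B
   k^T, to which the trace inequality applies. *)
have XE : expmx X = u *m expmx (vsval C) *m (l^T *m k^T).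
  rewrite /X expmx_conj ?(mulmx1C kk) // E.
  by rewrite !mulmxA -(mulmxA _ l) ll mulmx1.
have leQ : \tr (vsval Q *m vsval C) <= \tr (vsval Q *m vsval B').
  by apply: (iwasawa_linear GX Xs maxB' Uu _ XE); apply: KsetM; apply: KsetT.
have -> : rootsum B = rootsum B'.
  apply: (rootsum_conj (m := m *m k)); first exact: KsetM.
  by rewrite B'E /X trmx_mul !mulmxA.
have <- : \tr (vsval Q *m vsval C) = rootsum C.
  by rewrite trQ; apply: eq_bigr => al _; rewrite -normrEsg.
rewrite (le_trans leQ) // trQ; apply: ler_sum => al _.
rewrite (le_trans (ler_norm _)) // normrM normr_sg.
by case: (al C != 0) => /=; rewrite ?mul1r ?mul0r.
Qed.

(** This form refers to the idempotents and to membership in G only, without exponentials of [fa];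
    it is the one that can be written with coefficients in [K]. *)
Lemma rootspace_blocks alpha X : rootset (Lie G) fa alpha ->
  rootspace (Lie G) alpha X <->
  (forall a b, wt F fa a b != alpha -> F a *m X *m F b = 0) /\ G (nilexp X).
Proof.
move=> ra; split=> [hX|[blk GX]].
  split; last by have [] := (rootspace_group X ra).1 hX.
  move=> a b ab; apply: contrapT => /eqP nz.
  by case/eqP: ab; apply: rootspace_block nz.
apply/(rootspace_group X ra); split=> // H; apply: (eq_blocks Fid) => a b.
rewrite -scalemxAr -scalemxAl !mulmxA (expFr Fid Fsym faF) -!mulmxA (expFl Fid faF).
rewrite -!scalemxAr -scalemxAl scalerA mulmxA.
have [E|/blk ->] := eqVneq (wt F fa a b) alpha; last by rewrite !scaler0.
by rewrite -expRD -E wtE subrK.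
Qed.

Lemma root_opp alpha : rootset (Lie G) fa alpha -> rootset (Lie G) fa (- alpha).
Proof.
move=> [a0 [X [GX hX] X0]]; split; first by rewrite oppr_eq0.
exists X^T; last by apply: contra X0 => /eqP E; rewrite -[X]trmxK E trmx0.
split; first exact: Lie_tr.
move=> H; have := congr1 trmx (hX H).
rewrite linearB /= !trmx_mul (fa_sym Fsym faF) linearZ /= opp_lfunE scaleNr => <-.
by rewrite opprB.
Qed.

Lemma dominant_nneg beta H : dominant H -> nneg_comb Delta beta -> 0 <= (beta H : R).
Proof.
move=> dH [c ->]; rewrite sum_lfunE; apply: sumr_ge0 => i _.
rewrite -scaler_nat scale_lfunE; apply: mulr_ge0 => //.
by apply: dH; apply: mem_nth.
Qed.

(** The positive one of the two opposite roots. On a dominant element its value is |beta|, so the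
    maxima in N turn into plain character values. *)
Definition absroot beta : dual fa := if `[< nneg_comb Delta beta >] then beta else - beta.

Lemma absroot_root beta : rootset (Lie G) fa beta -> rootset (Lie G) fa (absroot beta).
Proof. by rewrite /absroot; case: asboolP => // _; apply: root_opp. Qed.

Lemma absroot_nneg beta : rootset (Lie G) fa beta -> nneg_comb Delta (absroot beta).
Proof.
move=> rb; rewrite /absroot; case: asboolP => // nb.
by have [_ _ /(_ _ rb)[]] := basisD.
Qed.

Lemma absrootE beta H : rootset (Lie G) fa beta -> dominant H -> (absroot beta H : R) = `|beta H : R|.
Proof.
move=> rb dH; have := dominant_nneg dH (absroot_nneg rb).
rewrite /absroot; case: asboolP => _; first by move=> h; rewrite ger0_norm.
by rewrite opp_lfunE => h; rewrite -normrN ger0_norm.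
Qed.

End RealGroup.

(** * Monomial tori *)

Section Monomials.
Variables (L : fieldType).

Definition mon m (b : 'I_m -> L) (z : 'rV[int]_m) : L := \prod_j b j ^ z 0 j.

Lemma mon0 m (b : 'I_m -> L) : mon b 0 = 1.
Proof. by rewrite /mon big1 // => j _; rewrite mxE expr0z. Qed.

Lemma monD m (b : 'I_m -> L) y z : (forall j, b j != 0) -> mon b (y + z) = mon b y * mon b z.
Proof.
by move=> b0; rewrite /mon -big_split; apply: eq_bigr => j _; rewrite mxE expfzDr.
Qed.

Lemma mon_neq0 m (b : 'I_m -> L) z : (forall j, b j != 0) -> mon b z != 0.
Proof. by move=> b0; rewrite /mon; apply/prodf_neq0 => j _; rewrite expfz_neq0. Qed.

Lemma monN m (b : 'I_m -> L) z : mon b (- z) = (mon b z)^-1.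
Proof. by rewrite /mon -prodfV; apply: eq_bigr => j _; rewrite mxE -invr_expz. Qed.

Lemma monV m (b : 'I_m -> L) z : mon (fun j => (b j)^-1) z = (mon b z)^-1.
Proof. by rewrite /mon -prodfV; apply: eq_bigr => j _; rewrite exprz_inv invr_expz. Qed.

Lemma monM m (b c : 'I_m -> L) z : mon (fun j => b j * c j) z = mon b z * mon c z.
Proof. by rewrite /mon -big_split; apply: eq_bigr => j _; rewrite expfzMl. Qed.

Lemma monZ m (b : 'I_m -> L) (k : int) z : mon b (k *: z) = mon b z ^ k.
Proof.
rewrite /mon; apply: (big_rec2 (fun x y => x = y ^ k)) => [|j x y _ ->]; first by rewrite exp1rz.
by rewrite mxE expfzMl exprz_exp [z 0 j * k]mulrC.
Qed.

Lemma mon_mul m p (b : 'I_m -> L) (z : 'rV[int]_p) (M : 'M_(p, m)) : (forall j, b j != 0) ->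
  mon b (z *m M) = mon (fun i => mon b (row i M)) z.
Proof.
move=> b0; rewrite mulmx_sum_row [RHS]/mon.
apply: (big_rec2 (fun x y => mon b x = y)) => [|i x y _ <-]; first exact: mon0.
by rewrite monD // monZ.
Qed.

Lemma mon_delta m (b : 'I_m -> L) j : mon b (row j 1%:M) = b j.
Proof.
rewrite /mon (bigD1 j) //= big1 ?mulr1 => [|i ij]; rewrite !mxE ?eqxx ?expr1z //.
by rewrite eq_sym (negbTE ij) expr0z.
Qed.

Lemma eq_mon m (b c : 'I_m -> L) z : b =1 c -> mon b z = mon c z.
Proof. by move=> bc; apply: eq_bigr => j _; rewrite bc. Qed.

End Monomials.

Section SaturatedBasis.
Variables (X : Type) (K : realFieldType) (N : nat) (chi : 'I_N -> X -> K).
Hypothesis chi_gt0 : forall i x, 0 < chi i x.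

Let chi_neq0 x i : chi i x != 0.
Proof. by rewrite gt_eqF. Qed.

Lemma mon_gt0 m (b : 'I_m -> K) z : (forall j, 0 < b j) -> 0 < mon b z.
Proof. by move=> b0; apply: prodr_gt0 => j _; rewrite exprz_gt0. Qed.

Lemma exprz_eq1 (x : K) (k : int) : 0 < x -> k != 0 -> x ^ k = 1 -> x = 1.
Proof.
move=> x0 k0 xk; apply: contraNeq k0 => x1; apply/eqP.
by apply: (ieexprIz x0 x1); rewrite xk expr0z.
Qed.

(* The multiplicative group generated by positive functions is torsion free,
   hence free: a nontrivial relation between m generators is, up to torsion, a
   row of a unimodular matrix (Smith normal form), and one generator drops. *)
Lemma saturated_basis : exists m (B : 'M[int]_(N, m)) (B' : 'M[int]_(m, N)),
  [/\ B' *m B = 1%:M, forall i x, chi i x = mon (chi^~ x) (row i (B *m B')) &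
      forall c : 'rV_N, (forall x, mon (chi^~ x) c = 1) -> c *m B = 0].
Proof.
pose b m (B' : 'M[int]_(m, N)) j x := mon (chi^~ x) (row j B').
have b_gt0 m (B' : 'M_(m, N)) j x : 0 < b m B' j x by apply: mon_gt0.
have b0 m (B' : 'M_(m, N)) x j : b m B' j x != 0 by rewrite gt_eqF.
have gen m : (exists B B', forall i x, chi i x = mon ((b m B')^~ x) (row i B)) ->
    exists m (B : 'M[int]_(N, m)) B', (forall i x, chi i x = mon ((b m B')^~ x) (row i B)) /\
    forall z, (forall x, mon ((b m B')^~ x) z = 1) -> z = 0.
  elim: m => [|m IH] [B [B' BE]].
    by exists 0%N, B, B'; split=> // z _; apply/rowP => -[].
  have [[z [zx z0]]|none] := pselect (exists z, (forall x, mon ((b m.+1 B')^~ x) z = 1) /\ z != 0).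
    2: exists m.+1, B, B'; split=> // z zx; apply: contrapT => /eqP z0; apply: none; exists z; by [].
  apply: IH; have [L _ [U Uu [d _ zE]]] := int_Smith_normal_form z.
  pose c := L 0 0 * d`_0; have {}zE : z = c *: row 0 U.
    rewrite {1}zE; apply/rowP => j; rewrite !mxE (bigD1 0) //= [X in _ + X]big1 ?addr0 => [|k k0].
      by rewrite !mxE big_ord1 !mxE.
    by rewrite !mxE big_ord1 !mxE /= eq_sym (negbTE (k0 : (k : nat) != 0%N)) mulr0 mul0r.
  have c0 : c != 0 by apply: contraNneq z0 => c0; rewrite zE c0 scale0r.
  have u1 x : mon ((b m.+1 B')^~ x) (row 0 U) = 1.
    by apply: (@exprz_eq1 _ c); rewrite ?mon_gt0 // -monZ -zE.
  exists (col' 0 (B *m invmx U)), (row' 0 (U *m B')) => i x.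
  rewrite BE; have -> : row i B = row i (B *m invmx U) *m U.
    by rewrite -row_mul mulmxKV.
  rewrite mon_mul // {1}/mon big_ord_recl u1 exp1rz mul1r.
  apply: eq_bigr => j _; rewrite !mxE; congr (_ ^ _).
  rewrite /b -mon_mul; last exact: chi_neq0.
  by congr (mon _ _); apply/rowP => k; rewrite -row_mul !mxE.
have [|m [B [B' [BE indep]]]] := gen N.
  exists 1%:M, 1%:M => i x; rewrite mon_delta /b mon_delta //.
exists m, B, B'; split; last 1 first.
- move=> c cx; apply: indep => x; rewrite mon_mul // -[RHS](cx x).
  by apply: eq_mon => i; rewrite -BE.
- apply/row_matrixP => j; apply/eqP; rewrite -subr_eq0; apply/eqP/indep => x.
  rewrite monD // monN mon_delta row_mul mon_mul //.
  rewrite (eq_mon _ (c := chi^~ x)) => [|i]; last by rewrite -BE.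
  exact: (mulfV (b0 _ B' x j)).
- by move=> i x; rewrite row_mul mon_mul // -BE.
Qed.

End SaturatedBasis.

Section ToricClosure.
Variables (X : Type) (op : X -> X -> X) (x0 : X) (K : rcfType) (N : nat) (chi : 'I_N -> X -> K).
Hypothesis chiM : forall i x y, chi i (op x y) = chi i x * chi i y.
Hypothesis chi_gt0 : forall i x, 0 < chi i x.
Variables (n : nat) (P : 'I_N -> 'M[K]_n) (Q : seq (mxpoly K n)).
Hypothesis PQ : forall x, zeros idfun Q (\sum_a chi a x *: P a).
Variables (m : nat) (B : 'M[int]_(N, m)).
Hypothesis relB : forall c : 'rV_N, (forall x, mon (chi^~ x) c = 1) -> c *m B = 0.

(** An equation of Q restricted to the given points is a linear relation between monomials in the
    chi, which are characters for [op]. Monomials equal as functions differ by a relation, and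
    relations are killed by B; so substituting t^B for chi respects the classes in
    [character_relation]. *)
Lemma toric_zeros (L : fieldType) (i : {rmorphism K -> L}) (t : 'I_m -> L) :
  (forall j, t j != 0) ->
  zeros i Q (\sum_a mon t (row a B) *: map_mx i (P a)).
Proof.
move=> t0 q qQ; have [J [d [c hc]]] := mxeval_combination [the {rmorphism K -> K} of idfun] P q.
have := hc _ i (fun a => mon t (row a B)); rewrite -[i \o idfun]/(i : K -> L) => ->.
have prodz (F : 'I_N -> L) j : \prod_a F a ^+ c j a = mon F (\row_a (c j a : int)).
  by apply: eq_bigr => a _; rewrite mxE.
apply: (character_relation (op := op) (x0 := x0)
    (chi := fun j x => i (\prod_a chi a x ^+ c j a))) => [j x y|j|x|j k jk].
- rewrite -rmorphM -big_split; congr (i _); apply: eq_bigr => a _.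
  by rewrite chiM exprMn.
- by rewrite fmorph_eq0 gt_eqF // prodr_gt0 // => a _; rewrite exprn_gt0.
- under eq_bigr do rewrite -rmorphM; rewrite -rmorph_sum.
  have := hc _ [the {rmorphism K -> K} of idfun] (chi^~ x).
  under eq_bigr do rewrite map_mx_id //.
  by move=> <-; rewrite [X in i X](PQ x qQ) rmorph0.
have mu0 x a : chi a x != 0 by rewrite gt_eqF.
have : (\row_a (c j a : int) - \row_a (c k a : int)) *m B = 0.
  apply: relB => x; rewrite monD // monN; have := fmorph_inj i (jk x).
  have prodK l : \prod_a chi a x ^+ c l a = mon (chi^~ x) (\row_a (c l a : int)).
    by apply: eq_bigr => a _; rewrite mxE.
  by rewrite !prodK => ->; rewrite mulfV // mon_neq0.
rewrite mulmxBl => /eqP; rewrite subr_eq0 => /eqP E.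
by rewrite !prodz -!mon_mul // E.
Qed.

End ToricClosure.

Lemma exprz_abs (L : fieldType) (x : L) (z : int) :
  x ^ z = (if 0 <= z then x else x^-1) ^+ absz z.
Proof. by case: z => k //=; rewrite exprVn. Qed.

Lemma orthidem_map (K L : comNzRingType) (i : {rmorphism K -> L}) n (I : finType) (P : I -> 'M[K]_n) :
  orthidem P -> orthidem (fun a => map_mx i (P a)).
Proof.
move=> [PP P1]; split=> [a b|]; last by rewrite -map_mx_sum P1 map_mx1.
by rewrite -map_mxM PP; case: eqP => // _; rewrite map_mx0.
Qed.

Section Spectral.
Variables (L : fieldType) (n N : nat) (P : 'I_N -> 'M[L]_n).
Hypothesis Pid : orthidem P.
Hypothesis trP : forall k, \tr (P k) != 0.

Definition specmx (tau : 'I_N -> L) := \sum_k tau k *: P k.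
Definition coef (s : 'M[L]_n) k := (\tr (P k))^-1 * \tr (P k *m s).

Lemma spec_mull tau k : P k *m specmx tau = tau k *: P k.
Proof.
have [PP _] := Pid; rewrite mulmx_sumr (bigD1 k) //= big1 ?addr0 => [|j jk].
  by rewrite -scalemxAr PP eqxx.
by rewrite -scalemxAr PP eq_sym (negbTE jk) scaler0.
Qed.

Lemma spec_mul tau tau' : specmx tau *m specmx tau' = specmx (fun k => tau k * tau' k).
Proof.
rewrite {1}/specmx mulmx_suml; apply: eq_bigr => k _.
by rewrite -scalemxAl spec_mull scalerA.
Qed.

Lemma spec1 : specmx (fun=> 1) = 1%:M.
Proof. by have [_ <-] := Pid; apply: eq_bigr => k _; rewrite scale1r. Qed.

Lemma coef_spec tau k : coef (specmx tau) k = tau k.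
Proof. by rewrite /coef spec_mull mxtraceZ mulrC mulfK. Qed.

Lemma spec_inv tau : (forall k, tau k != 0) ->
  specmx tau *m specmx (fun k => (tau k)^-1) = 1%:M.
Proof.
by move=> t0; rewrite spec_mul -spec1; apply: eq_bigr => k _; rewrite mulfV.
Qed.

Lemma spec_adj tau : (forall k, tau k != 0) -> \det (specmx tau) = 1 ->
  \adj (specmx tau) = specmx (fun k => (tau k)^-1).
Proof.
move=> t0 d1; rewrite -[LHS]mulmx1 -(spec_inv t0) mulmxA mul_adj_mx d1.
by rewrite mul1mx.
Qed.

Lemma spec_neq0 tau : \det (specmx tau) = 1 -> forall k, tau k != 0.
Proof.
move=> d1 k; apply: contraNneq (trP k) => t0; have := spec_mull tau k.
rewrite t0 scale0r => E; have U : specmx tau \in unitmx by rewrite unitmxE d1 unitr1.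
by rewrite -[P k](mulmxK U) E mul0mx mxtrace0.
Qed.

End Spectral.

(** * Equations and splitting of a monomial torus *)

Section MonomialTorus.
Variables (K : rcfType) (n N m : nat) (P : 'I_N -> 'M[K]_n).
Hypothesis Pid : orthidem P.
Hypothesis trP : forall k, \tr (P k) != 0.
Variables (B : 'M[int]_(N, m)) (B' : 'M[int]_(m, N)).
Hypothesis B'B : B' *m B = 1%:M.

Definition constmx (X : 'M[K]_n) : 'M[mxpoly K n]_n := map_mx (@mpoly.mpolyC (n * n) K) X.
Definition coefp (X : 'M[mxpoly K n]_n) k : mxpoly K n :=
  mpoly.mpolyC (n * n) (\tr (P k))^-1 * \tr (constmx (P k) *m X).
(** Negative powers must be polynomial as well: where the determinant is 1 the adjugate is the
    inverse, and its coefficients are the inverses of those of the matrix. *)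
Definition monp (z : 'rV[int]_N) : mxpoly K n :=
  \prod_k (if 0 <= z 0 k then coefp (genericmx K n) k else coefp (\adj (genericmx K n)) k) ^+ absz (z 0 k).

(** The first equations put s in the span of the P_k; the others say that its coefficients satisfy
    tau = tau^(B B'). Since B' B = 1, the solutions with nonzero entries are exactly the t^B, with t
    = tau^(B'). *)
Definition torus_eqs : seq (mxpoly K n) :=
  [seq (genericmx K n - \sum_k coefp (genericmx K n) k *: constmx (P k)) a b
     | a <- enum 'I_n, b <- enum 'I_n] ++
  [seq coefp (genericmx K n) k - monp (row k (B *m B')) | k <- enum 'I_N].

Section Points.
Variables (L : fieldType) (i : {rmorphism K -> L}).
Let PL k := map_mx i (P k).

Lemma PLid : orthidem PL. Proof. exact: orthidem_map. Qed.

Lemma trPL k : \tr (PL k) != 0.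
Proof. by rewrite /PL trace_map_mx fmorph_eq0. Qed.

Lemma mxev_coefp (x : 'M[L]_n) X k :
  mxev i x (coefp X k) = coef PL (map_mx (mxev i x) X) k.
Proof.
rewrite /coefp /coef rmorphM /= -trace_map_mx map_mxM mxev_const_sq /mxev mxevalC.
by rewrite fmorphV trace_map_mx.
Qed.

Lemma mxev_spec s : map_mx (mxev i s) (\sum_k coefp (genericmx K n) k *: constmx (P k)) =
  specmx PL (coef PL s).
Proof.
rewrite map_mx_sum; apply: eq_bigr => k _; rewrite map_mxZ mxev_const_sq; congr (_ *: _).
by rewrite -[LHS]/(mxev i s (coefp (genericmx K n) k)) mxev_coefp mxev_generic.
Qed.

Lemma mxev_monp tau z : (forall k, tau k != 0) -> \det (specmx PL tau) = 1 ->
  mxev i (specmx PL tau) (monp z) = mon tau z.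
Proof.
move=> t0 d1; rewrite rmorph_prod; apply: eq_bigr => k _; rewrite rmorphXn /= exprz_abs.
congr (_ ^+ _); case: ifP => _; rewrite mxev_coefp ?map_mx_adj mxev_generic.
  by rewrite (coef_spec PLid trPL).
by rewrite (spec_adj PLid) // (coef_spec PLid trPL).
Qed.

Lemma torus_in tau : \det (specmx PL tau) = 1 ->
  (forall k, tau k = mon tau (row k (B *m B'))) -> points i torus_eqs (specmx PL tau).
Proof.
move=> d1 tE; have t0 := spec_neq0 PLid trPL d1; split=> // p.
rewrite mem_cat => /orP[/allpairsP[[a b] [_ _ ->]]|/mapP[k _ ->]] /=; rewrite -/(mxev _ _ _).
  have : map_mx (mxev i (specmx PL tau))
      (genericmx K n - \sum_k coefp (genericmx K n) k *: constmx (P k)) = 0.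
    rewrite map_mxB mxev_generic mxev_spec; apply/eqP; rewrite subr_eq0; apply/eqP/eq_bigr => k _.
    by rewrite (coef_spec PLid trPL).
  by move/matrixP/(_ a b); rewrite !mxE.
by rewrite rmorphB /= mxev_monp // mxev_coefp mxev_generic (coef_spec PLid trPL) -tE subrr.
Qed.

Lemma torus_out s : points i torus_eqs s -> let tau := coef PL s in
  [/\ forall k, tau k != 0, s = specmx PL tau, \det s = 1 &
      forall k, tau k = mon tau (row k (B *m B'))].
Proof.
move=> [d1 sE] tau; have sS : s = specmx PL tau.
  apply/eqP; rewrite -subr_eq0; apply/eqP/matrixP => a b; rewrite [RHS]mxE.
  have <- : map_mx (mxev i s)
      (genericmx K n - \sum_k coefp (genericmx K n) k *: constmx (P k)) a b = 0.
    rewrite mxE; apply: sE; rewrite mem_cat; apply/orP; left.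
    by apply/allpairsP; exists (a, b); rewrite !mem_enum.
  by rewrite map_mxB mxev_generic mxev_spec.
have t0 : forall k, tau k != 0 by apply: (spec_neq0 PLid trPL); rewrite -sS.
split=> // k; have : mxev i s (coefp (genericmx K n) k - monp (row k (B *m B'))) = 0.
  apply: sE; rewrite mem_cat; apply/orP; right.
  by apply/mapP; exists k; rewrite ?mem_enum.
rewrite rmorphB /= mxev_coefp mxev_generic -/tau => /eqP; rewrite subr_eq0 => /eqP ->.
by rewrite {1}sS mxev_monp -?sS.
Qed.

Lemma torus_param (t : 'I_m -> L) : (forall j, t j != 0) -> forall k,
  mon t (row k B) = mon (fun l => mon t (row l B)) (row k (B *m B')).
Proof.
by move=> t0 k; rewrite -mon_mul // -row_mul -mulmxA B'B mulmx1.
Qed.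

End Points.

Definition lmon (z : 'rV[int]_m) : mpoly.mpoly (m + m) K :=
  \prod_j (mpoly.mpolyX K (mpoly.mnm1 (if 0 <= z 0 j then lshift m j else rshift m j)))
    ^+ absz (z 0 j).

Lemma mmap_lmon (L : fieldType) (i : {rmorphism K -> L}) (t : 'rV[L]_m) z :
  mpoly.mmap i (fun k => row_mx t (map_mx (fun y => y^-1) t) 0 k) (lmon z) = mon (fun j => t 0 j) z.
Proof.
rewrite rmorph_prod; apply: eq_bigr => j _; rewrite rmorphXn /= exprz_abs; congr (_ ^+ _).
rewrite mpoly.mmapX mpoly.mmap1U; case: ifP => _; first by rewrite row_mxEl.
by rewrite row_mxEr mxE.
Qed.

Let iC : {rmorphism K -> K[i]} := [the {rmorphism K -> K[i]} of real_complex K].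

Hypothesis det1 : forall t : 'I_m -> K[i], (forall j, t j != 0) ->
  \det (specmx (fun k => map_mx iC (P k)) (fun k => mon t (row k B))) = 1.

Lemma torus_param_in (t : 'I_m -> K[i]) : (forall j, t j != 0) ->
  Cpoints torus_eqs (specmx (fun k => map_mx iC (P k)) (fun k => mon t (row k B))).
Proof.
move=> t0; apply: (@torus_in _ iC); first exact: det1.
exact: torus_param.
Qed.

Lemma torus_param_out (s : 'M[K[i]]_n) : Cpoints torus_eqs s ->
  let t j := mon (coef (fun k => map_mx iC (P k)) s) (row j B') in
  (forall j, t j != 0) /\ s = specmx (fun k => map_mx iC (P k)) (fun k => mon t (row k B)).
Proof.
move=> Ts t; have [t0 sE d1 tE] := @torus_out _ iC s Ts.
split=> [j|]; first exact: mon_neq0.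
rewrite [LHS]sE; apply: eq_bigr => k _; congr (_ *: _).
by rewrite [LHS]tE row_mul mon_mul.
Qed.

Lemma torus_split : split_torus torus_eqs.
Proof.
pose PC k := map_mx iC (P k); have PCid : orthidem PC by apply: orthidem_map.
have trPC k : \tr (PC k) != 0 by apply: trPL.
split.
  split.
  - have := torus_param_in (t := fun=> 1) (fun=> oner_neq0 _).
    rewrite (_ : specmx _ _ = specmx PC (fun=> 1)); first by rewrite (spec1 PCid).
    by apply: eq_bigr => k _; congr (_ *: _); rewrite /mon big1 // => j _; rewrite exp1rz.
  - move=> g h /torus_param_out[t0 ->] /torus_param_out[t0' ->].
    rewrite (spec_mul PCid); have := torus_param_in (fun j => mulf_neq0 (t0 j) (t0' j)).
    rewrite (_ : specmx _ _ = specmx PC (fun k => mon (fun j => mon (coef PC g) (row j B')) (row k B) *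
      mon (fun j => mon (coef PC h) (row j B')) (row k B))) //.
    by apply: eq_bigr => k _; rewrite monM.
  - move=> g /torus_param_out[t0 gE]; pose t j := mon (coef PC g) (row j B').
    have {}t0 : forall j, t j != 0 by [].
    have {}gE : g = specmx PC (fun k => mon t (row k B)) by [].
    have tV0 j : (t j)^-1 != 0 by rewrite invr_eq0.
    clearbody t.
    have := torus_param_in tV0; rewrite (_ : specmx _ _ = invmx g) //.
    have gU : g *m specmx PC (fun k => (mon t (row k B))^-1) = 1%:M.
      by rewrite gE; apply: (spec_inv PCid) => k; apply: mon_neq0.
    have [Ug _] := mulmx1_unit gU; rewrite -[RHS]mulmx1 -gU mulmxA mulVmx // mul1mx.
    by apply: eq_bigr => k _; rewrite monV.
exists m, (fun a b => \sum_k mpoly.mpolyC (m + m) (P k a b) * lmon (row k B)),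
  (fun j => monp (row j B')).
set f := fun _ => _; set h := fun _ => _.
have fE t : f t = specmx PC (fun k => mon (fun j => t 0 j) (row k B)).
  apply/matrixP => a b; rewrite mxE (rmorph_sum (mpoly.mmap iC _)) summxE; apply: eq_bigr => k _.
  by rewrite rmorphM /= mpoly.mmapC -/iC (mmap_lmon iC) !mxE mulrC.
have hE s : Cpoints torus_eqs s -> h s = \row_j mon (coef PC s) (row j B').
  move=> Ts; have [t0 sE d1 _] := @torus_out _ iC s Ts.
  by apply/rowP => j; rewrite !mxE {1}sE -[mxeval _ _ _]/(mxev iC _ _) mxev_monp // -sE.
have mrow (s : 'M[K[i]]_n) k : mon (fun j => (\row_j mon (coef PC s) (row j B')) 0 j) (row k B) =
    mon (fun j => mon (coef PC s) (row j B')) (row k B).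
  by apply: eq_mon => j; rewrite mxE.
split.
- by move=> t t0; rewrite fE; apply: torus_param_in.
- move=> t t' t0 t0'; rewrite !fE (spec_mul PCid); apply: eq_bigr => k _; rewrite -monM.
  by congr (_ *: _); apply: eq_mon => j; rewrite mxE.
- by move=> s Ts j; rewrite hE // mxE; have [] := torus_param_out Ts.
- move=> t t0; have Tf : Cpoints torus_eqs (f t) by rewrite fE; apply: torus_param_in.
  rewrite hE //; apply/rowP => j; rewrite mxE fE.
  rewrite (eq_mon _ (c := fun k => mon (fun j => t 0 j) (row k B))) => [|k]; last exact: coef_spec.
  by rewrite -mon_mul // -row_mul B'B mon_delta.
- move=> s Ts; rewrite hE // fE; have [_ {2}->] := torus_param_out Ts.
  by apply: eq_bigr => k _; rewrite mrow.
Qed.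

End MonomialTorus.

(** * Weights of a split torus *)

Local Notation toC K := [the {rmorphism K -> K[i]} of real_complex K].

Lemma mxeval_map (K L M : comNzRingType) (i : {rmorphism K -> L}) (j : {rmorphism L -> M}) n
    (p : mxpoly K n) (x : 'M[L]_n) : mxeval (j \o i) p (map_mx j x) = j (mxeval i p x).
Proof.
rewrite /mxeval /mpoly.mmap rmorph_sum; apply: eq_bigr => m _; rewrite rmorphM /=; congr (_ * _).
rewrite /mpoly.mmap1 rmorph_prod; apply: eq_bigr => l _; rewrite rmorphXn /=; congr (_ ^+ _).
by case/mxvec_indexP: l => a b; rewrite !mxvecE mxE.
Qed.

Lemma points_map (K : rcfType) n (S : seq (mxpoly K n)) (x : 'M[K]_n) :
  Cpoints S (map_mx (toC K) x) <-> points idfun S x.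
Proof.
have E p : mxeval (toC K) p (map_mx (toC K) x) = toC K (mxeval idfun p x).
  exact: (mxeval_map [the {rmorphism K -> K} of idfun] (toC K)).
split=> -[dx Sx]; split=> [|p pS].
- by apply: (fmorph_inj (toC K)); rewrite -det_map_mx dx rmorph1.
- by apply: (fmorph_inj (toC K)); rewrite -E Sx // rmorph0.
- by rewrite det_map_mx dx rmorph1.
- by rewrite E Sx // rmorph0.
Qed.

Section Laurent.
Variables (K L : fieldType) (i : {rmorphism K -> L}) (r n : nat).
Variable phi : 'I_n -> 'I_n -> mpoly.mpoly (r + r) K.

(** The variable with index r + j stands for the inverse of t_j, so different multi-exponents may
    give the same Laurent monomial; [laurent_coef] collects them. *)
Definition laurent_exp (m : mpoly.multinom (r + r)) : 'rV[int]_r :=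
  \row_j ((mpoly.fun_of_multinom m (lshift r j) : int) - (mpoly.fun_of_multinom m (rshift r j) : int)).

Definition laurent_coef (e : 'rV[int]_r) : 'M[K]_n :=
  \matrix_(a, b) \sum_(m <- mpoly.msupp (phi a b) | laurent_exp m == e) mpoly.mcoeff m (phi a b).

Definition laurent_supp : seq 'rV[int]_r :=
  [seq e <- undup [seq laurent_exp m | m <- flatten [seq mpoly.msupp (phi a b) | a <- enum 'I_n, b <- enum 'I_n]]
     | laurent_coef e != 0].

Lemma laurent_expand (t : 'rV[L]_r) : (forall j, t 0 j != 0) ->
  \matrix_(a, b) mpoly.mmap i (fun k => row_mx t (map_mx (fun z => z^-1) t) 0 k) (phi a b) =
  \sum_(e <- laurent_supp) mon (fun j => t 0 j) e *: map_mx i (laurent_coef e).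
Proof.
move=> t0; rewrite /laurent_supp big_filter big_mkcond /=; set s := undup _.
rewrite (eq_bigr (fun e => mon (fun j => t 0 j) e *: map_mx i (laurent_coef e))); last first.
  by move=> e _; case: eqP => // ->; rewrite map_mx0 scaler0.
apply/matrixP => a b; rewrite mxE summxE /mpoly.mmap.
transitivity (\sum_(m <- mpoly.msupp (phi a b)) i (mpoly.mcoeff m (phi a b)) * mon (fun j => t 0 j) (laurent_exp m)).
  apply: eq_bigr => m _; congr (_ * _); rewrite /mpoly.mmap1 big_split_ord /= /mon -big_split /=.
  apply: eq_bigr => j _; rewrite row_mxEl row_mxEr !mxE expfzDr //.
  by rewrite -invr_expz exprVn.
transitivity (\sum_(e <- s) \sum_(m <- mpoly.msupp (phi a b) | laurent_exp m == e)
    i (mpoly.mcoeff m (phi a b)) * mon (fun j => t 0 j) (laurent_exp m)).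
  rewrite (exchange_big_dep predT) //= [LHS]big_seq [RHS]big_seq; apply: eq_bigr => m ms.
  rewrite [RHS]big_mkcond (bigD1_seq (laurent_exp m)) ?undup_uniq //=; last first.
    rewrite mem_undup map_f //; apply/flattenP; exists (mpoly.msupp (phi a b)) => //.
    by apply: allpairs_f; rewrite mem_enum.
  by rewrite eqxx big1 ?addr0 // => e; rewrite eq_sym => /negbTE ->.
apply: eq_bigr => e _; rewrite !mxE rmorph_sum mulr_sumr; apply: eq_bigr => m /eqP <-.
by rewrite mulrC.
Qed.

End Laurent.

(** Test points of the torus. They suffice to separate Laurent monomials because distinct integral
    powers of 2 are distinct, and addition of the x gives multiplication of points. *)
Definition pow2 (L : fieldType) r (x : {ffun 'I_r -> nat}) (j : 'I_r) : L := 2%:R ^+ x j.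

Lemma pow2_neq0 (L : rcfType) r (x : {ffun 'I_r -> nat}) j : pow2 L x j != 0.
Proof. by rewrite expf_neq0 // pnatr_eq0. Qed.

Lemma pow2_delta (L : rcfType) r (z : 'rV[int]_r) (j : 'I_r) :
  mon (@pow2 L r [ffun k => (k == j : nat)]) z = 2%:R ^ z 0 j.
Proof.
rewrite /mon (bigD1 j) //= big1 => [|k kj]; rewrite /pow2 ffunE ?eqxx ?expr1 ?mulr1 //.
by rewrite (negbTE kj) expr0 exp1rz.
Qed.

Lemma mon_pow2_inj (L : rcfType) r (y z : 'rV[int]_r) :
  (forall x, mon (@pow2 L r x) y = mon (@pow2 L r x) z) -> y = z.
Proof.
move=> h; apply/rowP => j; have := h [ffun k => (k == j : nat)]; rewrite !pow2_delta.
apply: ieexprIz; first by rewrite ltr0n.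
by rewrite (eqr_nat _ 2 1).
Qed.

Lemma mon_free (L : rcfType) r N (ex : 'I_N -> 'rV[int]_r) (d : 'I_N -> L) : injective ex ->
  (forall x, \sum_k d k * mon (@pow2 L r x) (ex k) = 0) -> forall k, d k = 0.
Proof.
move=> exI h k; pose op (x y : {ffun 'I_r -> nat}) := [ffun j => (x j + y j)%N].
apply: (@characters_free _ op [ffun=> 0%N] L _ (fun k x => mon (@pow2 L r x) (ex k)) _ _ [set: 'I_N]%SET).
- move=> l x y; rewrite -monM; apply: eq_mon => j.
  by rewrite /pow2 ffunE exprD.
- by move=> l; apply: mon_neq0 => j; apply: pow2_neq0.
- by move=> a b _ _ ab; apply: exI; apply: (@mon_pow2_inj L).
- by move=> x; rewrite -[RHS](h x); apply: eq_bigl => l; rewrite inE.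
- by rewrite inE.
Qed.

Lemma mon_free_mx (L : rcfType) r N n (ex : 'I_N -> 'rV[int]_r) (D : 'I_N -> 'M[L]_n) : injective ex ->
  (forall x, \sum_k mon (@pow2 L r x) (ex k) *: D k = 0) -> forall k, D k = 0.
Proof.
move=> exI h k; apply/matrixP => a b; rewrite [RHS]mxE.
apply: (mon_free (d := fun k => D k a b) exI) => x.
have := congr1 (fun M : 'M[L]_n => M a b) (h x); rewrite summxE [RHS]mxE => E.
by rewrite -[RHS]E; apply: eq_bigr => l _; rewrite !mxE mulrC.
Qed.

Lemma mon_map (K L : fieldType) (i : {rmorphism K -> L}) r (b : 'I_r -> K) z :
  mon (fun j => i (b j)) z = i (mon b z).
Proof. by rewrite /mon rmorph_prod; apply: eq_bigr => j _; rewrite fmorphXz. Qed.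

Lemma specmx_map (K L : fieldType) (i : {rmorphism K -> L}) n N (P : 'I_N -> 'M[K]_n) tau :
  map_mx i (specmx P tau) = specmx (fun k => map_mx i (P k)) (fun k => i (tau k)).
Proof. by rewrite map_mx_sum; apply: eq_bigr => k _; rewrite map_mxZ. Qed.

Lemma symidem_tr (L : rcfType) n (P : 'M[L]_n) : P *m P = P -> P^T = P -> P != 0 -> \tr P != 0.
Proof.
move=> PP PT; apply: contra => /eqP trP; apply/eqP/matrixP => i j; rewrite [RHS]mxE.
have trE : \tr P = \sum_i \sum_j P i j ^+ 2.
  rewrite -{1}PP -{2}PT; apply: eq_bigr => a _; rewrite mxE; apply: eq_bigr => b _.
  by rewrite mxE expr2.
move: trP; rewrite trE => /eqP; rewrite psumr_eq0 => [/allP h|a _]; last first.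
  by apply: sumr_ge0 => b _; apply: sqr_ge0.
have := h i (mem_index_enum i); rewrite psumr_eq0 => [/allP h'|b _]; last exact: sqr_ge0.
by have := h' j (mem_index_enum j); rewrite /= sqrf_eq0 => /eqP.
Qed.

(* F k are the weight projections of the torus, ex k the weights in the
   coordinates psi. *)
Definition torus_data (K : rcfType) n (S : seq (mxpoly K n)) r N (ex : 'I_N -> 'rV[int]_r)
    (F : 'I_N -> 'M[K]_n) (psi : 'I_r -> mxpoly K n) :=
  [/\ orthidem F, forall k, (F k)^T = F k, forall k, F k != 0, injective ex &
   [/\ forall t : 'I_r -> K, (forall j, t j != 0) ->
      points idfun S (specmx F (fun k => mon t (ex k))) /\
      forall j, mxeval idfun (psi j) (specmx F (fun k => mon t (ex k))) = t j,
    forall s, points idfun S s -> (forall j, mxeval idfun (psi j) s != 0) /\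
      s = specmx F (fun k => mon (fun j => mxeval idfun (psi j) s) (ex k)) &
    forall s, Cpoints S s -> exists2 t : 'I_r -> K[i], forall j, t j != 0 &
      s = specmx (fun k => map_mx (toC K) (F k)) (fun k => mon t (ex k))]].

(** The parametrisation is a Laurent polynomial with matrix coefficients F_e. Comparing coefficients
    in f(t t') = f(t) f(t') makes them orthogonal idempotents, and comparing those of f(t)^T = f(t)
    makes them symmetric; independence of the monomials on powers of 2 justifies both. *)
Lemma split_torus_data (K : rcfType) n (S : seq (mxpoly K n)) : split_torus S ->
  (forall s, Cpoints S s -> s = s^T) ->
  exists r N ex F psi, @torus_data K n S r N ex F psi.
Proof.
move=> [[S1 SM SV] [r [phi [psi [fS fM hG hf fh]]]]] Ssym.
pose E := laurent_supp phi; pose N := size E.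
pose ex (k : 'I_N) := E`_k; pose F k := laurent_coef phi (ex k).
pose f (t : 'rV[K[i]]_r) : 'M[K[i]]_n := \matrix_(i, j) mpoly.mmap (real_complex K)
  (fun k => row_mx t (map_mx (fun z => z^-1) t) 0 k) (phi i j).
pose h (s : 'M[K[i]]_n) : 'rV[K[i]]_r := \row_j mxeval (real_complex K) (psi j) s.
have {}fS t : in_Gm t -> Cpoints S (f t) := fS t.
have {}fM t t' : in_Gm t -> in_Gm t' -> f (\row_j (t 0 j * t' 0 j)) = f t *m f t' := fM t t'.
have {}hf t : in_Gm t -> h (f t) = t := hf t.
have {}fh s : Cpoints S s -> f (h s) = s := fh s.
have {}hG s : Cpoints S s -> in_Gm (h s) := hG s.
have fE (t : 'rV[K[i]]_r) : in_Gm t ->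
    f t = specmx (fun k => map_mx (toC K) (F k)) (fun k => mon (fun j => t 0 j) (ex k)).
  move=> t0; rewrite /f (laurent_expand (toC K)) // /specmx (big_nth 0) big_mkord.
  by [].
have exI : injective ex.
  move=> k l /eqP; rewrite nth_uniq ?filter_uniq ?undup_uniq // => /eqP kl.
  exact: val_inj.
pose g (t : 'I_r -> K) := specmx F (fun k => mon t (ex k)).
pose c (t : 'I_r -> K) : 'rV[K[i]]_r := \row_j toC K (t j).
have c0 (t : 'I_r -> K) : (forall j, t j != 0) -> in_Gm (c t) by move=> t0 j; rewrite mxE fmorph_eq0.
have fg t : (forall j, t j != 0) -> f (c t) = map_mx (toC K) (g t).
  move=> t0; rewrite fE; last exact: c0.
  rewrite /g (specmx_map (toC K)); apply: eq_bigr => k _; congr (_ *: _).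
  by rewrite -mon_map; apply: eq_mon => j; rewrite mxE.
have gS t : (forall j, t j != 0) -> points idfun S (g t).
  by move=> t0; apply/points_map; rewrite -fg //; apply/fS/c0.
have gM t t' : (forall j, t j != 0) -> (forall j, t' j != 0) ->
    g (fun j => t j * t' j) = g t *m g t'.
  move=> t0 t0'; have tt0 j : t j * t' j != 0 by rewrite mulf_neq0.
  apply: (map_mx_inj (f := toC K)); rewrite map_mxM -(fg _ t0) -(fg _ t0') -(fg _ tt0).
  rewrite -(fM _ _ (c0 _ t0) (c0 _ t0')); congr (f _); apply/rowP => j.
  by rewrite !mxE rmorphM.
have p0 x j : @pow2 K r x j != 0 by apply: pow2_neq0.
(* The sum is the value at t = 1, an idempotent matrix of determinant 1. *)
have g1 : \sum_k F k = 1%:M.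
  have e1 : g (fun=> 1) = \sum_k F k.
    by apply: eq_bigr => k _; rewrite /mon big1 ?scale1r // => j _; rewrite exp1rz.
  have n1 (j : 'I_r) : (1 : K) != 0 by apply: oner_neq0.
  have [d1 _] := gS _ n1; have U : g (fun=> 1) \in unitmx by rewrite unitmxE d1 unitr1.
  have := gM _ _ n1 n1; rewrite (_ : g (fun=> 1 * 1) = g (fun=> 1)); last first.
    by congr g; apply: funext => j; rewrite mulr1.
  by move=> /(congr1 (mulmx (invmx (g (fun=> 1))))); rewrite mulmxA mulVmx // mul1mx -e1.
have Fid : orthidem F.
  split=> // a b.
  have key k : forall y, F k *m g (pow2 K y) = mon (pow2 K y) (ex k) *: F k.
    move=> y; apply/eqP; rewrite -subr_eq0; apply/eqP; move: k.
    apply: (mon_free_mx exI) => x; have := gM _ _ (p0 x) (p0 y).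
    move=> /eqP; rewrite eq_sym -subr_eq0 => /eqP E0; rewrite -[RHS]E0.
    rewrite {3}/g /specmx mulmx_suml -sumrB; apply: eq_bigr => k _.
    by rewrite scalerBr scalerA -monM -scalemxAl.
  apply/eqP; rewrite -subr_eq0; apply/eqP; move: b; apply: (mon_free_mx exI) => y.
  under eq_bigr do rewrite scalerBr; rewrite sumrB.
  have := key a y; rewrite mulmx_sumr; under eq_bigr do rewrite -scalemxAr.
  move=> ->; rewrite (bigD1 a) //= eqxx big1 ?addr0 ?subrr // => k ka.
  by rewrite eq_sym (negbTE ka) scaler0.
exists r, N, ex, F, psi; split=> //.
- move=> k; apply/eqP; rewrite -subr_eq0; apply/eqP; move: k; apply: (mon_free_mx exI) => x.
  have : (g (pow2 K x))^T = g (pow2 K x).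
    by apply: (map_mx_inj (f := toC K)); rewrite -map_trmx -Ssym //; apply/points_map/gS.
  move=> /eqP; rewrite -subr_eq0 => /eqP E0; rewrite -[RHS]E0 /g /specmx linear_sum -sumrB.
  by apply: eq_bigr => k _; rewrite linearZ /= scalerBr.
- by move=> k; have := mem_nth 0 (ltn_ord k); rewrite mem_filter => /andP[].
- split.
  + move=> t t0; split=> [|j]; first exact: gS.
    have := hf _ (c0 _ t0) => /rowP /(_ j); rewrite !mxE fg //.
    rewrite (mxeval_map [the {rmorphism K -> K} of idfun] (toC K)) => /(fmorph_inj (toC K)) //.
  + move=> s /points_map Ss; have := hG _ Ss; have := fh _ Ss.
    have hE : h (map_mx (toC K) s) = c (fun j => mxeval idfun (psi j) s).
      apply/rowP => j; rewrite !mxE.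
      by rewrite (mxeval_map [the {rmorphism K -> K} of idfun] (toC K)).
    rewrite hE => fs h0; have s0 j : mxeval idfun (psi j) s != 0.
      by have := h0 j; rewrite mxE fmorph_eq0.
    by split=> //; apply: (map_mx_inj (f := toC K)); rewrite -fg.
  + move=> s Ss; exists (fun j => h s 0 j); first exact: hG.
    by rewrite -fE ?fh //; apply: hG.
Qed.

(** * Maximality of the torus *)

Section IdempotentProducts.
Variables (L : fieldType) (n : nat).

Lemma orthidem_nonzero (J : finType) (P : J -> 'M[L]_n) (Z := [set z | P z != 0]%SET) :
  orthidem P -> orthidem (fun i : 'I_#|Z| => P (enum_val i)) /\
  forall c : J -> L, \sum_z c z *: P z = specmx (fun i : 'I_#|Z| => P (enum_val i)) (fun i => c (enum_val i)).
Proof.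
move=> [PP P1]; have sumZ (c : J -> L) : \sum_z c z *: P z =
    specmx (fun i : 'I_#|Z| => P (enum_val i)) (fun i => c (enum_val i)).
  rewrite (bigID (mem Z)) /= [X in _ + X]big1 ?addr0 => [|z]; first exact: big_enum_val.
  by rewrite inE negbK => /eqP ->; rewrite scaler0.
split=> //; split=> [a b|]; first by rewrite PP (inj_eq enum_val_inj).
have := sumZ (fun=> 1); under eq_bigr do rewrite scale1r.
rewrite P1 => ->; apply: eq_bigr => i _; by rewrite scale1r.
Qed.

Lemma orthidem_prod (I J : finType) (P : I -> 'M[L]_n) (E : J -> 'M[L]_n) :
  orthidem P -> orthidem E -> (forall a b, E b *m P a = P a *m E b) ->
  orthidem (fun z : I * J => P z.1 *m E z.2).
Proof.
move=> [PP P1] [EE E1] PE; split=> [[a b] [a' b']|] /=.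
  rewrite mulmxA -(mulmxA (P a)) PE mulmxA PP -mulmxA EE xpair_eqE.
  by case: eqP => [->|_]; case: eqP => [->|_]; rewrite ?mul0mx ?mulmx0.
rewrite -(pair_big predT predT (fun a b => P a *m E b)) /=.
by under eq_bigr do rewrite -mulmx_sumr E1 mulmx1.
Qed.

Lemma commute_eigenidem (J : finType) (E : J -> 'M[L]_n) (nu : J -> L) (X : 'M[L]_n) :
  orthidem E -> injective nu ->
  X *m (\sum_v nu v *: E v) = (\sum_v nu v *: E v) *m X -> forall v, E v *m X = X *m E v.
Proof.
move=> [EE E1] nuI; set q := \sum_v _ => Xq v.
have qr w : q *m E w = nu w *: E w.
  rewrite mulmx_suml (bigD1 w) //= big1 ?addr0 => [|u uw]; first by rewrite -scalemxAl EE eqxx.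
  by rewrite -scalemxAl EE (negbTE uw) scaler0.
have ql w : E w *m q = nu w *: E w.
  rewrite mulmx_sumr (bigD1 w) //= big1 ?addr0 => [|u uw]; first by rewrite -scalemxAr EE eqxx.
  by rewrite -scalemxAr EE eq_sym (negbTE uw) scaler0.
clearbody q; have off a b : a != b -> E a *m X *m E b = 0.
  move=> ab; have := congr1 (fun M => E a *m M *m E b) Xq.
  rewrite /= !mulmxA ql -(mulmxA _ q) qr -scalemxAr -!scalemxAl => /eqP.
  rewrite -subr_eq0 -scalerBl scaler_eq0 subr_eq0 (inj_eq nuI) eq_sym (negbTE ab) /=.
  by move/eqP.
transitivity (E v *m X *m E v).
  rewrite -[LHS]mulmx1 -E1 mulmx_sumr (bigD1 v) //= big1 ?addr0 // => w wv.
  by rewrite off // eq_sym.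
rewrite -[RHS]mul1mx -E1 mulmx_suml (bigD1 v) //= big1 ?addr0 ?mulmxA // => w wv.
by rewrite mulmxA off.
Qed.

End IdempotentProducts.

(** The projections of equal eigenvalues are merged: the index set is that of the values, so the
    eigenvalues are distinct and everything commuting with q commutes with the projections. *)
Lemma symmetric_eigenidem (K : rcfType) n (q : 'M[K]_n) : q^T = q ->
  exists (J : finType) (E : J -> 'M[K]_n) (nu : J -> K),
    [/\ orthidem E, forall v, (E v)^T = E v, injective nu & q = \sum_v nu v *: E v].
Proof.
move=> qs; have [k [d [kk qE]]] := symmetric_diag qs.
pose E0 a := k^T *m delta_mx a a *m k; have [EE E1] : orthidem E0 by apply: orthmx_idem.
pose fv a : seq_sub (codom (d 0)) := SeqSub (codom_f (d 0) a).
pose E v := \sum_(a | fv a == v) E0 a.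
have fvE a : d 0 a = ssval (fv a) by [].
have part (c : 'I_n -> 'M[K]_n) : \sum_a c a = \sum_v \sum_(a | fv a == v) c a.
  by rewrite (partition_big fv predT).
exists (seq_sub (codom (d 0))), E, (fun v => ssval v); split.
- split=> [v w|]; last by rewrite -E1 part.
  rewrite mulmx_suml; under eq_bigr do rewrite mulmx_sumr.
  have [<-|vw] := eqVneq v w; last first.
    rewrite big1 // => a /eqP av; rewrite big1 // => b /eqP bw; rewrite EE.
    by case: eqP => // ab; move: vw; rewrite -av -bw ab eqxx.
  apply: eq_bigr => a av; rewrite (bigD1 a) //= big1 ?addr0 => [|b /andP[_ ba]].
    by rewrite EE eqxx.
  by rewrite EE eq_sym (negbTE ba).
- move=> v; rewrite linear_sum; apply: eq_bigr => a _.
  by rewrite /E0 /= !trmx_mul trmxK trmx_delta mulmxA.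
- exact: val_inj.
- rewrite qE diag_idem part; apply: eq_bigr => v _; rewrite scaler_sumr.
  by apply: eq_bigr => a /eqP <-; rewrite -fvE.
Qed.

Section Maximality.
Variables (K : rcfType) (n : nat) (G S : seq (mxpoly K n)).
Hypothesis G_group : subgroup (Cpoints G).
Hypothesis S_torus : maximal_split_torus S G.
Variables (r N : nat) (ex : 'I_N -> 'rV[int]_r) (F : 'I_N -> 'M[K]_n) (psi : 'I_r -> mxpoly K n).
Hypothesis S_data : torus_data S ex F psi.

Lemma G_mul g h : points idfun G g -> points idfun G h -> points idfun G (g *m h).
Proof.
have [_ GM _] := G_group; move=> /points_map Gg /points_map Gh; apply/points_map.
by rewrite map_mxM; apply: GM.
Qed.

Lemma G_one : points idfun G 1%:M.
Proof. by have [G1 _ _] := G_group; apply/points_map; rewrite map_mx1. Qed.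

Lemma S_G s : points idfun S s -> points idfun G s.
Proof. by have [_ SG _] := S_torus; move=> /points_map Ss; apply/points_map/SG. Qed.

Lemma psiM s s' j : points idfun S s -> points idfun S s' ->
  mxeval idfun (psi j) (s *m s') = mxeval idfun (psi j) s * mxeval idfun (psi j) s'.
Proof.
have [Fid Fs F0 exI [dat1 dat2 _]] := S_data => Ss Ss'.
have [s0 sE] := dat2 s Ss; have [s0' sE'] := dat2 s' Ss'.
rewrite {1}sE {1}sE' (spec_mul Fid).
have [|_ /(_ j) <-] := dat1 (fun j => mxeval idfun (psi j) s * mxeval idfun (psi j) s').
  by move=> l; rewrite mulf_neq0.
by congr mxeval; apply: eq_bigr => k _; rewrite monM.
Qed.

(** Points of S and p = q^2 are simultaneously diagonalisable, and the Zariski closure of what they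
    generate contains a split torus T in G. T contains S, so it equals S. The positive square root
    of p satisfies the monomial relations of T, as a positive number with square 1 is 1. Hence p is
    the square of a point of S, and the coordinates [psi] are positive on it. *)
Lemma torus_maximal q : q^T = q ->
  (forall x, let s := specmx F (fun k => mon (pow2 K x) (ex k)) in s *m q = q *m s) ->
  points idfun G (q *m q) ->
  points idfun S (q *m q) /\ forall j, 0 < mxeval idfun (psi j) (q *m q).
Proof.
move=> qs qcomm Gp; have [Fid Fs F0 exI [dat1 dat2 dat3]] := S_data.
have Fq k : F k *m q = q *m F k.
  apply/eqP; rewrite -subr_eq0; apply/eqP; move: k; apply: (mon_free_mx exI) => x.
  have /eqP := qcomm x; rewrite /= -subr_eq0 => /eqP E0; rewrite -[RHS]E0.
  rewrite /specmx mulmx_suml mulmx_sumr -sumrB; apply: eq_bigr => k _.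
  by rewrite scalerBr -scalemxAl -scalemxAr.
have [J [E [nu [Eid Esym nuI qE]]]] := symmetric_eigenidem qs.
have EF k v : E v *m F k = F k *m E v.
  by apply: (commute_eigenidem Eid nuI); rewrite -qE.
pose P z := F z.1 *m E z.2; have Pid : orthidem P by apply: orthidem_prod.
have Psym z : (P z)^T = P z by rewrite /P trmx_mul Fs Esym EF.
have [PMid] := orthidem_nonzero Pid; set Z := [set z | P z != 0]%SET => PMsum.
pose M := #|Z|; pose PM (i : 'I_M) := P (enum_val i).
pose e (i : 'I_M) := (enum_val i).1; pose v (i : 'I_M) := (enum_val i).2.
have PM0 i : PM i != 0 by have := enum_valP i; rewrite inE.
have trPM i : \tr (PM i) != 0.
  by apply: symidem_tr => //; [have [PP _] := PMid; rewrite /PM PP eqxx|apply: Psym].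
have qU : q \in unitmx.
  have [d1 _] := Gp; rewrite unitmxE; move: d1; rewrite det_mulmx => d1.
  by apply/unitrPr; exists (\det q).
have qE' w : q *m E w = nu w *: E w.
  have [EE _] := Eid; rewrite {1}qE mulmx_suml (bigD1 w) //= big1 ?addr0 => [|u uw].
    by rewrite -scalemxAl EE eqxx.
  by rewrite -scalemxAl EE (negbTE uw) scaler0.
have nu0 i : nu (v i) != 0.
  apply: contra (PM0 i) => /eqP n0; rewrite -(mulKmx qU (PM i)) /PM /P -EF (mulmxA q) qE'.
  by rewrite -/(v i) n0 scale0r mul0mx mulmx0.
have sumFE (c : 'I_N -> K) (b : J -> K) : specmx F c *m (\sum_w b w *: E w) =
    specmx PM (fun i => c (e i) * b (v i)).
  rewrite -(PMsum (fun z => c z.1 * b z.2)) /specmx mulmx_suml.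
  rewrite -(pair_big predT predT (fun k w => (c k * b w) *: (F k *m E w))) /=; apply: eq_bigr => k _.
  rewrite mulmx_sumr; apply: eq_bigr => w _.
  by rewrite -scalemxAl -scalemxAr scalerA.
have qpow k : (q *m q) ^+ k = \sum_w (nu w ^+ 2) ^+ k *: E w.
  elim: k => [|k IH].
    rewrite expr0; have [_ E1] := Eid; rewrite -[LHS]E1.
    by apply: eq_bigr => w _; rewrite expr0 scale1r.
  rewrite exprSr -mulmxE IH mulmx_suml; apply: eq_bigr => w _.
  rewrite -scalemxAl mulmxA.
  have qEw : E w *m q = nu w *: E w by have := congr1 trmx (qE' w); rewrite trmx_mul linearZ /= qs Esym.
  by rewrite qEw -scalemxAl qEw !scalerA (exprSr (nu w ^+ 2)) expr2 mulrA.
pose X : Type := ({ffun 'I_r -> nat} * nat)%type.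
(* Eigenvalues of the products of a test point with a power of q^2. The squares of nu make them
   positive, as [saturated_basis] requires. *)
pose chi (i : 'I_M) (x : X) : K := mon (pow2 K x.1) (ex (e i)) * (nu (v i) ^+ 2) ^+ x.2.
have p20 (x : {ffun 'I_r -> nat}) j : 0 < pow2 K x j by rewrite exprn_gt0.
have chi_gt0 i x : 0 < chi i x.
  by rewrite mulr_gt0 ?mon_gt0 // exprn_gt0 // lt_neqAle eq_sym sqrf_eq0 nu0 sqr_ge0.
have [m [B [B' [B'B chiBB relB]]]] := saturated_basis chi_gt0.
pose op (x y : X) : X := ([ffun j => (x.1 j + y.1 j)%N], (x.2 + y.2)%N).
have chiM i x y : chi i (op x y) = chi i x * chi i y.
  rewrite /chi /= exprD mulrACA -monM; congr (_ * _); apply: eq_mon => j.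
  by rewrite /pow2 ffunE exprD.
have p2S x : points idfun S (specmx F (fun k => mon (pow2 K x) (ex k))).
  by have [] := dat1 (pow2 K x) (fun j => pow2_neq0 _ x j).
have PQ x : zeros idfun (detpoly K n :: G) (\sum_i chi i x *: PM i).
  have -> : \sum_i chi i x *: PM i =
      specmx F (fun k => mon (pow2 K x.1) (ex k)) *m (q *m q) ^+ x.2 by rewrite qpow sumFE.
  apply/(@points_zeros _ _ _ [the {rmorphism K -> K} of idfun]).
  apply: G_mul; first exact/S_G/p2S.
  elim: (x.2) => [|k IH]; first by rewrite expr0; apply: G_one.
  by rewrite exprSr -mulmxE; apply: G_mul.
pose T := torus_eqs PM B B'; pose iC := toC K; pose PC i := map_mx iC (PM i).
have TG0 (t : 'I_m -> K[i]) : (forall j, t j != 0) ->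
    points iC G (specmx PC (fun i => mon t (row i B))).
  move=> t0; apply/points_zeros.
  exact: (@toric_zeros X op ([ffun=> 0%N], 0%N) K _ chi chiM chi_gt0 n PM _ PQ m B relB _ iC t t0).
have det1 (t : 'I_m -> K[i]) : (forall j, t j != 0) -> \det (specmx PC (fun i => mon t (row i B))) = 1.
  by move=> /TG0[].
have Tin (tau : 'I_M -> K[i]) : (forall i, tau i != 0) ->
    (forall i, mon tau (row i (B *m B') - row i 1%:M) = 1) -> Cpoints T (specmx PC tau).
  move=> t0 tr; pose t j := mon tau (row j B').
  have -> : specmx PC tau = specmx PC (fun i => mon t (row i B)).
    apply: eq_bigr => i _; congr (_ *: _); rewrite /t -mon_mul // -row_mul.
    have := tr i; rewrite monD // monN mon_delta => /(congr1 ( *%R^~ (tau i))).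
    by rewrite mulfVK // mul1r.
  by apply: (torus_param_in PMid trPM B'B det1) => j; apply: mon_neq0.
have relc x i : mon (chi^~ x) (row i (B *m B') - row i 1%:M) = 1.
  have c0 l : chi l x != 0 by rewrite gt_eqF.
  by rewrite monD // monN mon_delta -chiBB mulfV.
have [S_split SG Smax] := S_torus.
have TS : Cpoints T = Cpoints S.
  apply: Smax; first exact: (torus_split PMid trPM B'B det1).
    by move=> s /(torus_param_out PMid trPM)[t0 ->]; apply: TG0.
  move=> s /dat3[t t0 ->].
  have -> : specmx (fun k => map_mx (toC K) (F k)) (fun k => mon t (ex k)) =
      specmx PC (fun i => mon t (ex (e i))).
    have PCsum : forall c : 'I_N -> K[i], \sum_z c z.1 *: map_mx iC (P z) =
        specmx PC (fun i => c (e i)).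
      move=> c; rewrite (bigID (mem Z)) /= [X in _ + X]big1 ?addr0 => [|z]; first exact: big_enum_val.
      by rewrite inE negbK => /eqP ->; rewrite map_mx0 scaler0.
    rewrite -(PCsum (fun k => mon t (ex k))) -(pair_big predT predT (fun k w => mon t (ex k) *: map_mx iC (P (k, w)))) /=.
    apply: eq_bigr => k _; rewrite -scaler_sumr -map_mx_sum; congr (_ *: map_mx _ _).
    by rewrite /P /= -mulmx_sumr; have [_ ->] := Eid; rewrite mulmx1.
  apply: Tin => i; first exact: mon_neq0.
  (* To see that S lies in T: a relation between the chi, taken at exponent 0 of q^2, becomes the
     additive relation c EX = 0 between weights, which then holds at every complex point. *)
  pose EX := \matrix_(i < M, j < r) ex (e i) 0 j.
  have EXr l : row l EX = ex (e l) by apply/rowP => j; rewrite !mxE.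
  set c := _ - _; have -> : mon (fun l => mon t (ex (e l))) c = mon t (c *m EX).
    by rewrite (mon_mul c EX t0); apply: eq_mon => l; rewrite EXr.
  suff -> : c *m EX = 0 by rewrite mon0.
  apply: (@mon_pow2_inj K) => x; rewrite mon0 mon_mul => [|j]; last exact: pow2_neq0.
  rewrite -(relc (x, 0%N) i); apply: eq_mon => l.
  by rewrite EXr /chi expr0 mulr1.
pose tau i := `|nu (v i)|; have tau0 i : 0 < tau i by rewrite normr_gt0.
pose s := specmx PM tau.
have ss : s *m s = q *m q.
  rewrite (spec_mul PMid) -[RHS]expr1 qpow.
  rewrite -[RHS]mul1mx -(spec1 Fid) sumFE; apply: eq_bigr => i _.
  by rewrite mul1r expr1 /tau -expr2 real_normK ?num_real.
have Ss : points idfun S s.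
  apply/points_map; rewrite -TS (specmx_map (toC K)); apply: Tin => i.
    by rewrite fmorph_eq0 gt_eqF.
  set c := _ - _; rewrite (mon_map (toC K)); suff -> : mon tau c = 1 by rewrite rmorph1.
  have mp : 0 < mon tau c by apply: mon_gt0.
  have : mon tau c ^+ 2 = 1.
    rewrite -[RHS](relc ([ffun=> 0%N], 1%N) i) expr2 -monM; apply: eq_mon => l.
    rewrite /chi /= /mon big1 => [|j _]; last by rewrite /pow2 ffunE expr0 exp1rz.
    by rewrite mul1r expr1 /tau -expr2 real_normK ?num_real.
  by move=> /eqP; rewrite sqrf_eq1 => /orP[/eqP //|/eqP E1]; move: mp; rewrite E1 oppr_gt0 ltr10.
rewrite -ss; split.
  have [[_ SM _] _] := S_split.
  by apply/points_map; rewrite map_mxM; apply: SM; apply/points_map.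
move=> j; rewrite psiM // -expr2 lt_neqAle eq_sym sqrf_eq0 sqr_ge0 andbT.
by have [] := dat2 s Ss.
Qed.

End Maximality.

(** * Transfer to other real closed fields *)

Local Notation idK K := [the {rmorphism K -> K} of idfun].

Section PointFormulas.
Variables (K : rcfType) (n : nat).

Definition fpts (S : seq (mxpoly K n)) : mform K n :=
  mconj (detpoly K n :: S) (fun p => MZero p (MVar K n 0)).

Definition pt S t : mform K n := MSub (fpts S) [:: t].

Lemma ptP S t (L : rcfType) (i : {rmorphism K -> L}) ms :
  mholds i ms (pt S t) <-> points i S (meval i ms t).
Proof.
have E := mholds_conj (detpoly K n :: S) (fun p => MZero p (MVar K n 0)) i [:: meval i ms t].
split=> [h|/points_zeros Ps]; first by apply/points_zeros => p pS; apply: (E.1 h p pS).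
by apply: (E.2 _) => p pS; apply: Ps.
Qed.

Definition mone : mterm K n := MConst 1%:M.
Lemma mevalone (L : rcfType) (i : {rmorphism K -> L}) ms : meval i ms mone = 1%:M.
Proof. exact: map_mx1. Qed.

End PointFormulas.

Section GroupTransfer.
Variables (K : rcfType) (n : nat) (G : seq (mxpoly K n)).
Hypothesis G_group : subgroup (Cpoints G).
Variables (L : rcfType) (i : {rmorphism K -> L}).

Lemma points_one : points i G 1%:M.
Proof.
rewrite -(@mevalone K n L i [::]); apply/ptP; apply: (@transfer _ _ _ _ (idK K)); apply/ptP.
by rewrite mevalone; apply: G_one.
Qed.

Lemma points_mul g h : points i G g -> points i G h -> points i G (g *m h).
Proof.
pose v := MVar K n; move=> Gg Gh.
have := @transfer _ _ _ _ (idK K) i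
  (MAll (MAll (MImp (pt G (v 0%N)) (MImp (pt G (v 1%N)) (pt G (MMul (v 1%N) (v 0%N))))))).
move=> /(_ _ g h) T; apply/(ptP G (MMul (v 1%N) (v 0%N)) i [:: h; g]); apply: T; try exact/ptP.
by move=> x y /ptP Gy /ptP Gx; apply/ptP; apply: G_mul.
Qed.

Lemma points_inv g : points i G g -> points i G (invmx g).
Proof.
pose v := MVar K n; move=> Gg.
have := @transfer _ _ _ _ (idK K) i
  (MAll (MImp (pt G (v 0%N)) (MEx (MAnd (pt G (v 0%N)) (MEq (MMul (v 1%N) (v 0%N)) (mone K n)))))).
case/(_ _ g) => [x /ptP Gx|| h [/ptP Gh gh]]; last 1 first.
- have {}gh : g *m h = 1%:M by have := gh; rewrite /= map_mx1.
  have [Ug _] := mulmx1_unit gh.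
  by rewrite -[invmx g]mulmx1 -gh mulmxA mulVmx // mul1mx.
- have [_ _ GV] := G_group; have [d1 _] := Gx.
  exists (invmx x); split; last by rewrite mevalone /= mulmxV // unitmxE d1 unitr1.
  by apply/ptP/points_map; rewrite map_invmx; apply: GV; apply/points_map.
- exact/ptP.
Qed.

Lemma points_tr (G_adj : forall g, Cpoints G g -> Cpoints G g^T) g :
  points i G g -> points i G g^T.
Proof.
pose v := MVar K n; move=> Gg.
have := @transfer _ _ _ _ (idK K) i (MAll (MImp (pt G (v 0%N)) (pt G (MTr (v 0%N))))).
move=> /(_ _ g) T; apply/(ptP G (MTr (v 0%N)) i [:: g]); apply: T; last exact/ptP.
by move=> x /ptP Gx; apply/ptP/points_map; rewrite /= -map_trmx; apply: G_adj; apply/points_map.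
Qed.

End GroupTransfer.

Lemma entries_eq0 (A L : nmodType) (f : A -> L) n (E : 'M[A]_n) :
  (forall a b, f (E a b) = 0) <-> map_mx f E = 0.
Proof.
split=> [h|/matrixP h a b]; first by apply/matrixP => a b; rewrite !mxE.
by have := h a b; rewrite !mxE.
Qed.

Section TorusTransfer.
Variables (K : rcfType) (n : nat) (G S : seq (mxpoly K n)).
Hypothesis G_group : subgroup (Cpoints G).
Hypothesis S_torus : maximal_split_torus S G.
Variables (r N : nat) (ex : 'I_N -> 'rV[int]_r) (F : 'I_N -> 'M[K]_n) (psi : 'I_r -> mxpoly K n).
Hypothesis S_data : torus_data S ex F psi.

Let Fid : orthidem F. Proof. by have [] := S_data. Qed.

Lemma trF0 k : \tr (F k) != 0.
Proof.
have [[FF _] Fs F0 _ _] := S_data.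
by apply: symidem_tr => //; rewrite FF eqxx.
Qed.

(** The description of A that can be transferred; [sacomponent_torus] identifies it over [K] with
    the identity component. *)
Definition tpos (L : rcfType) (i : {rmorphism K -> L}) : set 'M[L]_n :=
  [set s | points i S s /\ forall j, 0 < mxeval i (psi j) s].

Definition fA : mform K n :=
  MAnd (fpts S) (mconj (enum 'I_r) (fun j => MPos (psi j) (MVar K n 0))).
Definition inA t : mform K n := MSub fA [:: t].

Lemma inAP t (L : rcfType) (i : {rmorphism K -> L}) ms :
  mholds i ms (inA t) <-> tpos i (meval i ms t).
Proof.
split=> [[h1 h2]|[Ss h]].
  split; first by apply/(ptP S (MVar K n 0) i [:: meval i ms t]).
  by move=> j; move/mholds_conj: h2 => /(_ j); apply; rewrite mem_enum.
split; first by apply/(ptP S (MVar K n 0) i [:: meval i ms t]).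
by apply/mholds_conj => j _; apply: h.
Qed.

Lemma mset_fA (L : rcfType) (i : {rmorphism K -> L}) : mset fA i = tpos i.
Proof. by apply/seteqP; split=> s /(inAP (MVar K n 0) i [:: s]). Qed.

Section Field.
Variables (L : rcfType) (i : {rmorphism K -> L}).
Let FL k := map_mx i (F k).

Lemma torus_sub s : points i S s -> points i G s.
Proof.
move=> Ss; pose v := MVar K n.
have := @transfer _ _ _ _ (idK K) i (MAll (MImp (pt S (v 0%N)) (pt G (v 0%N)))).
move=> /(_ _ s) T; apply/(ptP G (v 0%N) i [:: s]); apply: T; last exact/ptP.
by move=> x /ptP Sx; apply/ptP; apply: (S_G S_torus).
Qed.

Let S_group : subgroup (Cpoints S). Proof. by have [[]] := S_torus. Qed.

Lemma torus_psi_neq0 s j : points i S s -> mxeval i (psi j) s != 0.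
Proof.
move=> Ss; pose v := MVar K n.
have := @transfer _ _ _ _ (idK K) i (MAll (MImp (pt S (v 0%N)) (MNot (MZero (psi j) (v 0%N))))).
move=> /(_ _ s) T; apply/eqP; apply: T; last exact/ptP.
move=> x /ptP Sx; apply/eqP; have [_ _ _ _ [_ dat2 _]] := S_data.
by have [] := dat2 x Sx.
Qed.

Lemma torus_psi_sqr s j : points i S s -> 0 < mxeval i (psi j) (s *m s).
Proof.
move=> Ss; pose v := MVar K n.
have := @transfer _ _ _ _ (idK K) i (MAll (MImp (pt S (v 0%N)) (MPos (psi j) (MMul (v 0%N) (v 0%N))))).
move=> /(_ _ s) T; apply: T; last exact/ptP.
move=> x /ptP Sx; have [_ _ _ _ [_ dat2 _]] := S_data; have [x0 _] := dat2 x Sx.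
rewrite /= (psiM S_data) // -expr2 lt_neqAle eq_sym sqrf_eq0 sqr_ge0 andbT.
exact: x0.
Qed.

Lemma torus_spec s : points i S s -> s = specmx FL (coef FL s).
Proof.
move=> Ss; pose v := MVar K n.
pose E := genericmx K n - \sum_k coefp F (genericmx K n) k *: constmx (F k).
have ev (M : rcfType) (j : {rmorphism K -> M}) (x : 'M[M]_n) :
    (forall a b, mxev j x (E a b) = 0) <->
    x = specmx (fun k => map_mx j (F k)) (coef (fun k => map_mx j (F k)) x).
  have -> : (x = specmx (fun k => map_mx j (F k)) (coef (fun k => map_mx j (F k)) x)) <->
      map_mx (mxev j x) E = 0.
    rewrite map_mxB mxev_generic (mxev_spec F); split=> [{1}->|/eqP]; first by rewrite subrr.
    by rewrite subr_eq0 => /eqP.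
  exact: entries_eq0.
apply/ev => a b.
have := @transfer _ _ _ _ (idK K) i (MAll (MImp (pt S (v 0%N)) (MZero (E a b) (v 0%N)))).
move=> /(_ _ s) T; apply: T; last exact/ptP.
move=> x /ptP Sx; apply: (ev K (idK K) x).2.
have [_ _ _ _ [_ dat2 _]] := S_data; have [_ xE] := dat2 x Sx.
have mid k : map_mx (idK K) (F k) = F k by rewrite map_mx_id.
have -> : (fun k => map_mx (idK K) (F k)) = F by apply: funext.
rewrite [LHS]xE; apply: eq_bigr => k _; congr (_ *: _).
by rewrite [in RHS]xE (coef_spec Fid trF0).
Qed.

Lemma torus_coef_gt0 s k : tpos i s -> 0 < coef FL s k.
Proof.
move=> As; pose v := MVar K n.
have ev (M : rcfType) (j : {rmorphism K -> M}) (x : 'M[M]_n) :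
    mxeval j (coefp F (genericmx K n) k) x = coef (fun k => map_mx j (F k)) x k.
  by rewrite -[LHS]/(mxev j x _) (mxev_coefp F) mxev_generic.
rewrite -ev.
have := @transfer _ _ _ _ (idK K) i (MAll (MImp (inA (v 0%N)) (MPos (coefp F (genericmx K n) k) (v 0%N)))).
move=> /(_ _ s) T; apply: T; last exact/inAP.
move=> x /inAP[Sx x0] /=; rewrite ev.
have mid l : map_mx (idK K) (F l) = F l by rewrite map_mx_id.
have -> : (fun k => map_mx (idK K) (F k)) = F by apply: funext.
have [_ _ _ _ [_ dat2 _]] := S_data; have [_ xE] := dat2 x Sx.
by rewrite [X in coef _ X]xE (coef_spec Fid trF0) mon_gt0.
Qed.

(** A matrix q over [L] defines no torus over [K], so maximality of S does not apply to it directly;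
    [torus_maximal] is a first-order assertion about q and is transferred. *)
Lemma torus_max q : q^T = q -> (forall s, tpos i s -> s *m q = q *m s) ->
  points i G (q *m q) -> tpos i (q *m q).
Proof.
move=> qs qA Gq; pose v := MVar K n.
have := @transfer _ _ _ _ (idK K) i (MAll (MImp (MEq (MTr (v 0%N)) (v 0%N))
  (MImp (MAll (MImp (inA (v 0%N)) (MEq (MMul (v 0%N) (v 1%N)) (MMul (v 1%N) (v 0%N)))))
  (MImp (pt G (MMul (v 0%N) (v 0%N))) (inA (MMul (v 0%N) (v 0%N))))))).
move=> /(_ _ q) T; apply/(inAP (MMul (v 0%N) (v 0%N)) i [:: q]); apply: T => //; last first.
- exact/ptP.
- by move=> s /inAP /qA.
move=> x xs xA /ptP Gx; apply/inAP; apply: (torus_maximal G_group S_torus S_data) => // y s.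
have p0 j : pow2 K y j != 0 by apply: pow2_neq0.
apply: xA; apply/inAP; have [_ _ _ _ [dat1 _ _]] := S_data; have [Ss sE] := dat1 (pow2 K y) p0.
by split=> // j; rewrite sE exprn_gt0.
Qed.

End Field.
End TorusTransfer.

(** * The identity component of the torus *)

(** The defect D, identity minus projection to the span, is linear and bounded and kills 1 and all
    exp(tX). Hence t D(X) = O(t^2), and D(X) = 0. *)
Lemma span_closed_Lie (R : realType) n N (P : 'I_N -> 'M[R]_n) (X : 'M[R]_n) :
  orthidem P -> (forall k, \tr (P k) != 0) ->
  (forall t : R, expmx (t *: X) = specmx P (coef P (expmx (t *: X)))) -> X = specmx P (coef P X).
Proof.
move=> Pid P0 h; pose D (Y : 'M[R]_n) := Y - specmx P (coef P Y).
have coefD (Y Z : 'M[R]_n) (t : R) k : coef P (Y - t *: Z) k = coef P Y k - t * coef P Z k.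
  by rewrite /coef mulmxBr -scalemxAr mxtraceB mxtraceZ mulrBr mulrCA.
have DD (Y Z : 'M[R]_n) (t : R) : D (Y - t *: Z) = D Y - t *: D Z.
  have -> : D (Y - t *: Z) = Y - t *: Z - (specmx P (coef P Y) - t *: specmx P (coef P Z)).
    rewrite /D /specmx scaler_sumr -sumrB; congr (_ - _); apply: eq_bigr => k _.
    by rewrite coefD scalerBl scalerA.
  by rewrite /D scalerBr opprD opprK addrACA [in RHS]opprD opprK.
have D1 : D 1%:M = 0.
  apply/eqP; rewrite subr_eq0; apply/eqP; rewrite -[LHS](spec1 Pid); apply: eq_bigr => k _.
  by rewrite /coef mulmx1 mulVf.
pose c := 1 + \sum_k `|(\tr (P k))^-1| * mnorm (P k) * mnorm (P k).
have normD Y : mnorm (D Y) <= c * mnorm Y.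
  rewrite (le_trans (mnormD _ _)) // mnormN /c mulrDl mul1r lerD2l mulr_suml.
  rewrite /specmx (le_trans (y := \sum_k mnorm (coef P Y k *: P k))) //.
    apply: (big_rec2 (fun x y => mnorm x <= y)) => [|k x y _ xy].
      by rewrite -[0](scale0r (0 : 'M[R]_n)) mnormZ normr0 mul0r.
    by rewrite (le_trans (mnormD _ _)) // lerD2l.
  apply: ler_sum => k _; rewrite mnormZ normrM [leRHS]mulrAC ler_wpM2r ?mnorm_ge0 //.
  rewrite -mulrA ler_wpM2l // (le_trans (mxtrace_le_mnorm _)) //.
  exact: mnormM.
have nDX : mnorm (D X) = 0.
  apply: (@first_order_eq0 _ _ (c * exprem X 2)) => t t1.
  have E : D (expmx (t *: X) - (1%:M + t *: X)) = - (t *: D X).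
    have DDs Y Z : D (Y - Z) = D Y - D Z by have := DD Y Z 1; rewrite !scale1r.
    rewrite opprD addrA DD DDs D1 subr0.
    have -> : D (expmx (t *: X)) = 0 by rewrite /D -h subrr.
    by rewrite sub0r.
  have := normD (expmx (t *: X) - (1%:M + t *: X)); rewrite E mnormN mnormZ => le1.
  rewrite (le_trans (y := `|t| * mnorm (D X))) //.
    by rewrite mulrC ler_wpM2r ?mnorm_ge0 // ler_norm.
  rewrite (le_trans le1) // -mulrA ler_wpM2l ?exp_order2 //.
  by rewrite addr_ge0 // sumr_ge0 // => k _; rewrite !mulr_ge0 ?mnorm_ge0.
have : D X = 0.
  apply/matrixP => i j; rewrite [RHS]mxE; apply/eqP; rewrite -normr_le0 -nDX.
  rewrite /mnorm (bigD1 i) //= (bigD1 j) //= -addrA lerDl addr_ge0 // ?sumr_ge0 // => k _.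
  by rewrite sumr_ge0.
by move/eqP; rewrite subr_eq0 => /eqP.
Qed.

Section RealPoints.
Variables (K : rcfType) (R : realType) (iR : {rmorphism K -> R}) (n : nat) (G : seq (mxpoly K n)).
Hypothesis G_group : subgroup (Cpoints G).

Lemma points_closed : mclosed (points iR G).
Proof.
move=> T FF PF A X AX h; apply/points_zeros => p pG.
have c := @cvg_mxeval R n T FF PF K iR p A X AX.
have z : (fun k => mxeval iR p (A k)) @ FF --> (0 : R).
  by apply: cvg_near_cst; apply: filterS h => t /points_zeros; apply.
exact: (cvg_unique _ c z).
Qed.

Lemma points_log (J : finType) (E : J -> 'M[R]_n) (x : J -> R) : orthidem E ->
  points iR G (\sum_a expR (x a) *: E a) -> forall t, points iR G (\sum_a expR (t * x a) *: E a).
Proof.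
move=> [EE E1] Gx t; apply/points_zeros; apply: zeros_exp => j; apply/points_zeros.
have -> : \sum_a expR (x a *+ j) *: E a = (\sum_a expR (x a) *: E a) ^+ j.
  rewrite (spectral_exp _ _ EE E1); apply: eq_bigr => a _; congr (_ *: _).
  by rewrite -mulr_natl expRM_natl.
by apply: group_exp => //; [apply: points_one|apply: points_mul].
Qed.

Lemma points_poly (gam : 'M[{poly R}]_n) :
  (forall k : nat, points iR G (map_mx (fun p => p.[k%:R]) gam)) ->
  forall t, points iR G (map_mx (fun p => p.[t]) gam).
Proof.
move=> h t; apply/points_zeros => p pG.
pose q : {poly R} := mxeval (polyC \o iR) p gam.
have qE s : mxeval iR p (map_mx (fun p => p.[s]) gam) = q.[s].
  have := mxeval_map [the {rmorphism K -> {poly R}} of polyC \o iR] (horner_eval s) p gam.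
  have -> : horner_eval s \o [the {rmorphism K -> {poly R}} of polyC \o iR] = iR.
    by apply: funext => y; rewrite /= horner_evalE hornerC.
  by [].
rewrite qE (_ : q = 0) ?horner0 //; apply: poly_eq_nat => k.
by rewrite horner0 -qE; have /points_zeros /(_ p pG) := h k.
Qed.

End RealPoints.

Section RealTorus.
Variables (K : rcfType) (n : nat) (G S : seq (mxpoly K n)).
Hypothesis G_group : subgroup (Cpoints G).
Hypothesis S_torus : maximal_split_torus S G.
Variables (r N : nat) (ex : 'I_N -> 'rV[int]_r) (F : 'I_N -> 'M[K]_n) (psi : 'I_r -> mxpoly K n).
Hypothesis S_data : torus_data S ex F psi.
Variables (R : realType) (iR : {rmorphism K -> R}).

Definition FR k := map_mx iR (F k).
Let S_group : subgroup (Cpoints S). Proof. by have [[]] := S_torus. Qed.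

Lemma FRid : orthidem FR.
Proof. by apply: orthidem_map; have [] := S_data. Qed.

Lemma FRsym k : (FR k)^T = FR k.
Proof. by rewrite /FR map_trmx; have [_ -> _ _ _] := S_data. Qed.

Lemma FRtr k : \tr (FR k) != 0.
Proof. by rewrite /FR trace_map_mx fmorph_eq0; apply: (trF0 S_data). Qed.

Lemma FRn0 k : FR k != 0.
Proof. by apply: contraNneq (FRtr k) => ->; rewrite mxtrace0. Qed.

(** The coefficients of s on the idempotents are positive and have logarithms. Vanishing of the
    equations at integer powers keeps the one-parameter group in the torus, and its elements are
    squares, so the [psi] stay positive. *)
Lemma tpos_log s : tpos S psi iR s -> exists l : 'I_N -> R, s = expmx (specmx FR l) /\
  forall t : R, expmx (t *: specmx FR l) = specmx FR (fun k => expR (t * l k)) /\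
    tpos S psi iR (expmx (t *: specmx FR l)).
Proof.
move=> As; have [Ss _] := As; have sE := torus_spec S_data Ss.
pose l k := ln (coef FR s k); have [FF F1] := FRid.
have lE k : expR (l k) = coef FR s k by rewrite lnK // posrE; apply: (torus_coef_gt0 S_data).
have eE (t : R) : expmx (t *: specmx FR l) = specmx FR (fun k => expR (t * l k)).
  rewrite /specmx scaler_sumr; under eq_bigr do rewrite scalerA.
  exact: (@expmx_spectral _ _ _ FR (fun k => t * l k)).
have eS (t : R) : points iR S (expmx (t *: specmx FR l)).
  rewrite eE; apply: (points_log S_group FRid (x := l)).
  by under eq_bigr do rewrite lE; rewrite -/(specmx _ _) -sE.
exists l; split.
  rewrite -[specmx FR l]scale1r eE [LHS]sE; apply: eq_bigr => k _.
  by rewrite mul1r lE.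
move=> t; split=> //; split=> // j.
have -> : t *: specmx FR l = (t / 2) *: specmx FR l + (t / 2) *: specmx FR l.
  by rewrite -scalerDl -splitr.
by rewrite expmxD //; apply: (torus_psi_sqr S_data).
Qed.

Variable fa : {vspace 'M[R]_n}.
Hypothesis faE : [set` fa] = Lie (tpos S psi iR).

Lemma faP X : X \in fa <-> Lie (tpos S psi iR) X.
Proof. by rewrite -faE. Qed.

Lemma fa_spec (H : subvs_of fa) : vsval H = \sum_k lam FR k (vsval H) *: FR k.
Proof.
have /faP HL := subvsP H; rewrite [LHS](span_closed_Lie FRid FRtr) => [|t].
  by apply: eq_bigr => k _; rewrite /coef /lam mulrC.
by apply: (torus_spec S_data); have [] := HL t.
Qed.

Lemma fa_Lie (H : subvs_of fa) : Lie (points iR G) (vsval H).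
Proof.
have /faP HL := subvsP H; move=> t; apply: (torus_sub S_torus).
by have [] := HL t.
Qed.

Lemma tposE s : tpos S psi iR s <-> exists H : subvs_of fa, s = expmx (vsval H).
Proof.
split=> [As|[H ->]]; last by have /faP := subvsP H => /(_ 1); rewrite scale1r.
have [l [sE lA]] := tpos_log As; have lfa : specmx FR l \in fa by apply/faP => t; case: (lA t).
by exists (vsproj fa (specmx FR l)); rewrite vsprojK.
Qed.

(** Apply [torus_max] to q = exp(tX/2): it is symmetric, commutes with A, and its square exp(tX)
    lies in G, hence in A. *)
Lemma fa_max X : Lie (points iR G) X -> X^T = X ->
  (forall H : subvs_of fa, vsval H *m X = X *m vsval H) -> X \in fa.
Proof.
move=> GX Xs XH; apply/faP => t.
have tE : t *: X = (t / 2) *: X + (t / 2) *: X by rewrite -scalerDl -splitr.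
rewrite tE expmxD //; apply: (torus_max G_group S_torus S_data).
- by rewrite trmx_expmx linearZ /= Xs.
- move=> s /tposE[H ->]; apply: expmx_commute; apply/esym; apply: expmx_commute.
  by rewrite -scalemxAl -scalemxAr XH.
- by rewrite -expmxD // -tE.
Qed.

Lemma expfa_closed : mclosed [set expmx (vsval H) | H in [set: subvs_of fa]].
Proof.
have -> : [set expmx (vsval H) | H in [set: subvs_of fa]] = tpos S psi iR.
  apply/seteqP; split=> s; first by case=> H _ <-; apply/tposE; exists H.
  by move/tposE => [H ->]; exists H.
move=> T FF PF A X AX h.
have SX : points iR S X by apply: (@points_closed K R iR n S T FF PF A X AX); apply: filterS h => t [].
split=> // j; rewrite lt_neqAle eq_sym (torus_psi_neq0 S_data) //=.
have c := @cvg_mxeval R n T FF PF K iR (psi j) A X AX; rewrite -(cvg_lim _ c) //.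
apply: limr_ge; first by apply/cvg_ex; exists (mxeval iR (psi j) X).
by apply: filterS h => t [_ /(_ j)/ltW].
Qed.

End RealTorus.

Lemma mxeval_continuous (K : rcfType) n (p : mxpoly K n) :
  continuous (fun x : 'M[K]_n => mxeval idfun p x).
Proof.
move=> x; apply: (@cvg_mxeval K n _ (nbhs x) _ K (idK K) p id x) => i j.
exact: coord_continuous.
Qed.

Section Component.
Variables (K : rcfType) (n : nat) (G S : seq (mxpoly K n)).
Hypothesis G_group : subgroup (Cpoints G).
Hypothesis S_torus : maximal_split_torus S G.
Variables (r N : nat) (ex : 'I_N -> 'rV[int]_r) (F : 'I_N -> 'M[K]_n) (psi : 'I_r -> mxpoly K n).
Hypothesis S_data : torus_data S ex F psi.
Variables (R : realType) (iR : {rmorphism K -> R}).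

Let S_group : subgroup (Cpoints S). Proof. by have [[]] := S_torus. Qed.

Definition trpoly : mxpoly K n := \tr (genericmx K n).

Lemma mxeval_tr (L : rcfType) (i : {rmorphism K -> L}) (x : 'M[L]_n) : mxeval i trpoly x = \tr x.
Proof. by rewrite -[LHS]/(mxev i x _) -trace_map_mx mxev_generic. Qed.

Lemma tpos_one (L : rcfType) (i : {rmorphism K -> L}) : tpos S psi i 1%:M.
Proof.
rewrite -(@mevalone K n L i [::]); apply/inAP; apply: (@transfer _ _ _ _ (idK K)); apply/inAP.
rewrite mevalone; have S1 : points (idK K) S 1%:M by apply: points_one.
split=> // j; have := torus_psi_sqr S_data j S1; rewrite mulmx1; exact.
Qed.

(** Relative closedness as a sentence in matrix variables: tr E plays the part of the squared
    radius, and tr((y - s)(y - s)^T) is the squared distance. *)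
Definition relclosed (f : mform K n) (L : rcfType) (i : {rmorphism K -> L}) :=
  forall s, tpos S psi i s -> ~ mset f i s -> exists E, 0 < \tr E /\
    forall y, tpos S psi i y -> 0 < \tr (E - (y - s) *m (y - s)^T) -> ~ mset f i y.

Lemma relclosed_transfer f (L : rcfType) (i : {rmorphism K -> L}) :
  relclosed f (idK K) -> relclosed f i.
Proof.
pose v := MVar K n; pose d := MAdd (v 0%N) (MScale (-1) (v 2%N)).
pose E := MAdd (v 1%N) (MScale (-1) (MMul d (MTr d))).
pose cl := MAll (MImp (inA S psi (v 0%N)) (MImp (MNot (MSub f [:: v 0%N]))
  (MEx (MAnd (MPos trpoly (v 0%N)) (MAll (MImp (inA S psi (v 0%N))
     (MImp (MPos trpoly E) (MNot (MSub f [:: v 0%N]))))))))).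
have clP (M : rcfType) (j : {rmorphism K -> M}) : mholds j [::] cl <-> relclosed f j.
  have EE (x y e : 'M[M]_n) : meval j [:: y; e; x] E = e - (y - x) *m (y - x)^T.
    by rewrite /= rmorphN1 !scaleN1r.
  split=> h s.
    move=> As fs; case: (h s _ fs) => [|e [/= e0 he]]; first exact/inAP.
    exists e; split; first by rewrite -(mxeval_tr j).
    move=> y Ay ey; apply: (he y); first exact/(inAP S psi (v 0%N) j [:: y; e; s]).
    have : 0 < mxeval j trpoly (meval j [:: y; e; s] E) by rewrite mxeval_tr EE.
    exact.
  move=> /inAP As fs; case: (h s As fs) => e [e0 he]; exists e; split.
    have : 0 < mxeval j trpoly e by rewrite mxeval_tr.
    exact.
  move=> y /inAP Ay ey; apply: he => //.
  by have : 0 < mxeval j trpoly (meval j [:: y; e; s] E) := ey; rewrite mxeval_tr EE.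
by move=> /clP h; apply/clP; apply: transfer h.
Qed.

Lemma closed_in_relclosed (f : mform K n) : (0 < n)%N ->
  closed_in (tpos S psi (idK K)) (mset f (idK K)) -> relclosed f (idK K).
Proof.
move=> n0 [C Cc fE] s As fs; have sC : (~` C) s by move=> Cs; apply: fs; rewrite fE.
have : nbhs s (~` C) by apply: open_nbhs_nbhs; split=> //; apply: closed_openC.
move=> /nbhs_ballP[e /= e0 he]; pose o := Ordinal n0.
(* A matrix of trace e^2; squared distance below it forces each entry of the difference below e. *)
exists (e ^+ 2 *: delta_mx o o); split.
  rewrite mxtraceZ (_ : \tr (delta_mx o o) = 1) ?mulr1 ?exprn_gt0 //.
  rewrite /mxtrace (bigD1 o) //= mxE eqxx big1 ?addr0 // => j /negbTE jo.
  by rewrite mxE jo.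
move=> y Ay; rewrite mxtraceB mxtraceZ (_ : \tr (delta_mx o o) = 1); last first.
  rewrite /mxtrace (bigD1 o) //= mxE eqxx big1 ?addr0 // => j /negbTE jo.
  by rewrite mxE jo.
rewrite mulr1 subr_gt0 => le fy; have : C y by have : mset f (idK K) y by []; rewrite fE => -[].
apply: he; split=> // i j; rewrite -ball_normE /ball_ /= -(@ltr_pXn2r _ 2) ?nnegrE // ?ltW //.
rewrite (le_lt_trans _ le) // real_normK ?num_real // /mxtrace (bigD1 i) //= mxE (bigD1 j) //=.
rewrite !mxE -!expr2 -sqrrN opprB -addrA lerDl addr_ge0 //.
  by apply: sumr_ge0 => k _; rewrite !mxE -expr2 sqr_ge0.
apply: sumr_ge0 => a _; rewrite mxE; apply: sumr_ge0 => k _.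
by rewrite !mxE -expr2 sqr_ge0.
Qed.

(** A real point s = exp(H) is joined to 1 by x -> exp(xH). The parameters x landing in f form a
    subset of the line that is open and closed and contains 0. *)
Lemma relclosed_path (f g : mform K n) :
  relclosed f iR -> relclosed g iR ->
  (forall s, tpos S psi iR s -> ~ mset f iR s -> mset g iR s) ->
  (forall s, mset f iR s -> ~ mset g iR s) -> mset f iR 1%:M ->
  tpos S psi iR `<=` mset f iR.
Proof.
move=> cf cg fg nfg f1 s As; have [l [sE lA]] := tpos_log S_torus S_data As.
pose H := specmx (FR F iR) l; pose A (x : R) := expmx (x *: H).
have AA x : tpos S psi iR (A x) by case: (lA x).
have Acv (x : R) : mcvg (nbhs x) A (A x).
  have -> : A = fun x => \sum_k expR (x * l k) *: FR F iR k.
    by apply: funext => y; case: (lA y).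
  apply: mcvg_sum => k; apply: mcvg_scale; last exact: mcvg_cst.
  apply: (cvg_comp (fun y : R => y * l k) expR); last exact: continuous_expR.
  by apply: cvgMl; exact: cvg_id.
have op (h : mform K n) : relclosed h iR -> open [set x | ~ mset h iR (A x)].
  move=> ch; rewrite openE => x hx; have [E [E0 hE]] := ch _ (AA x) hx.
  have : \tr ((A y - A x) *m (A y - A x)^T) @[y --> x] --> \tr ((A x - A x) *m (A x - A x)^T).
    have c : mcvg (nbhs x) (fun y => A y - A x) (A x - A x).
      by apply: mcvg_add => //; apply: mcvg_cst.
    have cT := mcvg_mul c (mcvg_tr c).
    have {}cT := cT _; exact: cvg_mxtrace (cT _).
  rewrite subrr mul0mx mxtrace0 => /cvgr_lt /(_ _ E0); apply: filterS => y yE.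
  by apply: hE => //; rewrite mxtraceB subr_gt0.
have ofc := op f cf; have ogc := op g cg.
pose U := [set x : R | mset f iR (A x)].
have UE : U = [set x | ~ mset g iR (A x)].
  apply/seteqP; split=> x /=; first exact: nfg.
  by move=> gx; apply: contrapT => fx; apply: gx; apply: fg.
have : U = [set: R].
  have /(_ U) cc := (connected_intervalP [set: R]).2 (fun _ _ _ _ _ _ => I).
  apply: cc.
  - by exists 0; rewrite /U /= /A scale0r expmx0.
  - by exists U; rewrite ?setTI // UE.
  - exists U; rewrite ?setTI //; rewrite -[U]setCK; apply: open_closedC.
    by [].
move=> /seteqP[_ /(_ 1 I)]; rewrite /U /= /A scale1r.
by rewrite sE.
Qed.

(** The path joining a point to 1 exists over the reals only. A decomposition into two closed
    definable pieces over [K] is therefore transferred to [R], refuted there, and the resulting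
    inclusion is brought back. *)
Lemma tpos_connected : saconnected (tpos S psi (idK K)).
Proof.
have [fa faE] := mset_sapoints (fA S psi).
have semi : semialgebraic (tpos S psi (idK K)) by exists fa; rewrite (faE K (idK K)) mset_fA.
split=> // B1 B2 [s1 ->] [s2 ->].
have [f fE] := sapoints_mset s1; have [g gE] := sapoints_mset s2.
rewrite (fE K (idK K)) (gE K (idK K)) => cf cg fg0 fgA.
wlog f1 : f g {fE gE} cf cg fg0 fgA / mset f (idK K) 1%:M.
  move=> wl; have : (mset f (idK K) `|` mset g (idK K)) 1%:M by rewrite fgA; apply: tpos_one.
  case=> [f1|g1]; first exact: (wl f g).
  have g0 : mset g (idK K) `&` mset f (idK K) = set0 by rewrite setIC.
  have gA : mset g (idK K) `|` mset f (idK K) = tpos S psi (idK K) by rewrite setUC.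
  by case: (wl g f cg cf g0 gA g1) => h; [right|left].
(* For n = 0 traces vanish and cannot encode a radius; the single matrix makes the claim trivial. *)
left; have [n0|n0] := posnP n.
  have M1 (x : 'M[K]_n) : x = 1%:M by apply/matrixP => i; have := ltn_ord i; rewrite {2}n0.
  apply/seteqP; split=> x _; first by rewrite (M1 x); apply: tpos_one.
  by rewrite (M1 x).
have fR := relclosed_transfer (i := iR) (closed_in_relclosed n0 cf).
have gR := relclosed_transfer (i := iR) (closed_in_relclosed n0 cg).
pose v := MVar K n; pose mf := MSub f [:: v 0%N]; pose mg := MSub g [:: v 0%N].
have fgR : forall s, tpos S psi iR s -> ~ mset f iR s -> mset g iR s.
  move=> s As fs.
  have := @transfer _ _ _ _ (idK K) iR (MAll (MImp (inA S psi (v 0%N)) (MImp (MNot mf) mg))).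
  move=> /(_ _ s) T; apply: T => //; last exact/inAP.
  move=> x /inAP Ax fx; have : (mset f (idK K) `|` mset g (idK K)) x by rewrite fgA.
  by case.
have nfgR : forall s, mset f iR s -> ~ mset g iR s.
  move=> s fs gs; have := @transfer _ _ _ _ (idK K) iR (MAll (MImp mf (MNot mg))).
  move=> /(_ _ s fs gs); apply=> x fx gx.
  have : (mset f (idK K) `&` mset g (idK K)) x by [].
  by rewrite fg0.
have f1R : mset f iR 1%:M.
  have := @transfer _ _ _ _ (idK K) iR (MSub f [:: mone K n]); rewrite /= !map_mx1.
  exact.
have sub := relclosed_path fR gR fgR nfgR f1R.
apply/seteqP; split; first by rewrite -fgA => x; left.
have := @mset_transfer _ _ (fA S psi) f _ _ iR (idK K); rewrite !mset_fA; exact.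
Qed.

Lemma closed_psi_ge0 : closed [set s : 'M[K]_n | forall j, 0 <= mxeval idfun (psi j) s].
Proof.
rewrite (_ : mkset _ = \bigcap_(j in [set: 'I_r]) [set s : 'M[K]_n | 0 <= mxeval idfun (psi j) s]).
  apply: closed_bigI => j _.
  apply: (@preimage_closed _ _ (fun s : 'M[K]_n => mxeval idfun (psi j) s) [set x : K | 0 <= x]).
    by move=> x _; apply: mxeval_continuous.
  exact: closed_ge.
by apply/seteqP; split=> s /= h j; [move=> _; apply: h|apply: h].
Qed.

Lemma open_psi_gt0 : open [set s : 'M[K]_n | forall j, 0 < mxeval idfun (psi j) s].
Proof.
rewrite openE => s hs.
suff : \forall x \near s, forall j, 0 < mxeval idfun (psi j) x by [].
apply: (@filter_forall _ _ (fun j => [set x | 0 < mxeval idfun (psi j) x]) (nbhs s) _) => j.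
have := @mxeval_continuous K n (psi j) s => /cvgr_gt /(_ _ (hs j)).
exact.
Qed.

(** On the torus the [psi] never vanish, so positivity and nonnegativity coincide there: the
    positive part of any connected W is both open and closed in W, and 1 belongs to it. *)
Lemma sacomponent_torus : sacomponent (points idfun S) 1%:M = tpos S psi (idK K).
Proof.
apply/seteqP; split=> y; last first.
  move=> Ay; exists (tpos S psi (idK K)); split=> //; [by move=> s []|exact: tpos_connected|].
  exact: tpos_one.
move=> [W [WS [[s0 WE] Wc] W1 Wy]].
have [w wE] := sapoints_mset s0; rewrite (wE K (idK K)) in WE.
pose v := MVar K n; pose pos := mconj (enum 'I_r) (fun j => MPos (psi j) (v 0%N)).
have posP s : mholds (idK K) [:: s] pos <-> forall j, 0 < mxeval idfun (psi j) s.
  by rewrite mholds_conj; split=> h j; [apply: h; rewrite mem_enum|move=> _; apply: h].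
have semi (f : mform K n) : semialgebraic (mset f (idK K)).
  by have [t tE] := mset_sapoints f; exists t; rewrite (tE K (idK K)).
have B1E : mset (MAnd w pos) (idK K) = W `&` [set s | forall j, 0 < mxeval idfun (psi j) s].
  by apply/seteqP; rewrite WE; split=> s [ws /posP].
have B2E : mset (MAnd w (MNot pos)) (idK K) = W `&` ~` [set s | forall j, 0 < mxeval idfun (psi j) s].
  by apply/seteqP; rewrite WE; split=> s [ws np]; split=> // /posP.
have Wpos s : W s -> (forall j, 0 < mxeval idfun (psi j) s) <-> (forall j, 0 <= mxeval idfun (psi j) s).
  move=> /WS Ss; split=> h j; first exact: ltW.
  by rewrite lt_neqAle eq_sym h andbT; apply: (torus_psi_neq0 (i := idK K) S_data).
have [||||WB|WB] := Wc _ _ (semi (MAnd w pos)) (semi (MAnd w (MNot pos))).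
- exists [set s | forall j, 0 <= mxeval idfun (psi j) s]; first exact: closed_psi_ge0.
  by rewrite B1E; apply/seteqP; split=> s [Ws /(Wpos _ Ws)].
- exists (~` [set s | forall j, 0 < mxeval idfun (psi j) s]) => //.
  by apply: open_closedC; apply: open_psi_gt0.
- by rewrite B1E B2E setIACA setICr setI0.
- by rewrite B1E B2E -setIUr setUv setIT.
- by move: Wy; rewrite -WB B1E => -[Wy py]; split=> //; apply: WS.
- have : mset (MAnd w (MNot pos)) (idK K) 1%:M by rewrite WB.
  rewrite B2E => -[_ /=]; case=> j; have [_ h1] := tpos_one (idK K).
  exact: h1.
Qed.

End Component.

(** * Scalars encoded as matrix terms *)

Section Terms.
Variables (K : rcfType) (n : nat).
Implicit Types t : mterm K n.

Definition mtsum (I : Type) (s : seq I) (T : I -> mterm K n) : mterm K n :=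
  foldr (fun x => MAdd (T x)) (MConst 0) s.
Definition mtprod (I : Type) (s : seq I) (T : I -> mterm K n) : mterm K n :=
  foldr (fun x => MMul (T x)) (mone K n) s.
Definition mtpow t k : mterm K n := iter k (MMul t) (mone K n).

(** All terms are matrices, so an entry is coded as a scalar matrix: summing E_kj Y E_jk over all k,
    j gives tr(Y) times the identity, and Y is t multiplied by the elementary matrix that extracts
    entry l. *)
Definition entry_term l t : mterm K n :=
  mtsum (enum {: 'I_n * 'I_n}) (fun p =>
    MMul (MConst (delta_mx p.1 p.2 *m (vec_mx (delta_mx 0 l))^T)) (MMul t (MConst (delta_mx p.2 p.1)))).

Definition pterm (p : mxpoly K n) t : mterm K n :=
  mtsum (mpoly.msupp p) (fun m => MScale (mpoly.mcoeff m p)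
    (mtprod (enum 'I_(n * n)) (fun l => mtpow (entry_term l t) (mpoly.fun_of_multinom m l)))).

Definition nilterm t : mterm K n :=
  mtsum (enum 'I_n) (fun k : 'I_n => MScale (k`!%:R)^-1 (mtpow t k)).

Definition ple p t u : mform K n :=
  MNot (MPos (trpoly K n) (MAdd (pterm p t) (MScale (-1) (pterm p u)))).

Section Eval.
Variables (L : rcfType) (i : {rmorphism K -> L}) (ms : seq 'M[L]_n).

Lemma meval_sum (I : Type) (s : seq I) T : meval i ms (mtsum s T) = \sum_(x <- s) meval i ms (T x).
Proof.
by elim: s => [|x s IH] /=; rewrite ?big_nil ?map_mx0 // big_cons IH.
Qed.

Lemma meval_pow t k : meval i ms (mtpow t k) = meval i ms t ^+ k.
Proof.
by elim: k => [|k IH] /=; rewrite ?map_mx1 // exprS -mulmxE -IH.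
Qed.

Lemma sum_delta_conj (Y : 'M[L]_n) :
  \sum_(p : 'I_n * 'I_n) delta_mx p.1 p.2 *m Y *m delta_mx p.2 p.1 = (\tr Y)%:M.
Proof.
have E k a : delta_mx k a *m Y *m delta_mx a k = Y a a *: delta_mx k k.
  rewrite -(mul_delta_mx (0 : 'I_1)) -[delta_mx a k](mul_delta_mx (0 : 'I_1)) -!mulmxA (mulmxA Y).
  rewrite (mulmxA (delta_mx 0 a)) -colE -rowE [row _ _]mx11_scalar !mxE mul_scalar_mx -scalemxAr.
  by rewrite mul_delta_mx.
rewrite -(pair_big predT predT (fun k a => delta_mx k a *m Y *m delta_mx a k)) /=.
under eq_bigr do under eq_bigr do rewrite E.
under eq_bigr do rewrite -scaler_suml.
rewrite -scaler_sumr -[in RHS]scalemx1 scalemx1 -[RHS]scalemx1; congr (_ *: _).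
apply/matrixP => a b; rewrite summxE (bigD1 a) //= big1 => [|c ca]; rewrite !mxE ?eqxx ?addr0 //.
  by rewrite eq_sym.
by rewrite eq_sym (negbTE ca).
Qed.

Lemma trace_delta_mul (x : 'M[L]_n) a b : \tr (delta_mx b a *m x) = x a b.
Proof.
rewrite -(mul_delta_mx (0 : 'I_1)) -mulmxA mxtrace_mulC -rowE -colE /mxtrace big_ord1.
by rewrite !mxE.
Qed.

Lemma meval_entry l t : meval i ms (entry_term l t) = (mxvec (meval i ms t) 0 l)%:M.
Proof.
rewrite meval_sum big_enum /=; case/mxvec_indexP: l => a b.
rewrite mxvecE -(trace_delta_mul _ a b) -sum_delta_conj; apply: eq_bigr => p _.
rewrite vec_mx_delta trmx_delta map_mxM !map_delta_mx !mulmxA.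
by [].
Qed.

Lemma meval_pterm p t : meval i ms (pterm p t) = (mxeval i p (meval i ms t))%:M.
Proof.
rewrite meval_sum /mxeval /mpoly.mmap raddf_sum; apply: eq_bigr => m _ /=.
rewrite -scale_scalar_mx; congr (_ *: _); rewrite /mpoly.mmap1 -big_enum.
elim: (enum _) => [|l s IH] /=; first by rewrite big_nil map_mx1.
rewrite big_cons scalar_mxM -IH meval_pow meval_entry; congr (_ *m _).
elim: (mpoly.fun_of_multinom m l) => [|k IHk]; first by rewrite !expr0.
by rewrite !exprS scalar_mxM -IHk.
Qed.

Lemma meval_nilterm t : meval i ms (nilterm t) = nilexp (meval i ms t).
Proof.
rewrite meval_sum big_enum; apply: eq_bigr => k _ /=.
by rewrite meval_pow fmorphV rmorph_nat.
Qed.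

Lemma pleP p t u : mholds i ms (ple p t u) <->
  mxeval i p (meval i ms t) <= mxeval i p (meval i ms u).
Proof.
have E : mxeval i (trpoly K n) (meval i ms (MAdd (pterm p t) (MScale (-1) (pterm p u)))) =
    (mxeval i p (meval i ms t) - mxeval i p (meval i ms u)) *+ n.
  rewrite mxeval_tr [meval _ _ _]/(meval i ms (pterm p t) + i (-1) *: meval i ms (pterm p u)).
  by rewrite !meval_pterm rmorphN1 scaleN1r mxtraceB !mxtrace_scalar mulrnBl.
have -> : mholds i ms (ple p t u) <->
    ~ (0 < mxeval i (trpoly K n) (meval i ms (MAdd (pterm p t) (MScale (-1) (pterm p u))))) by [].
rewrite E; have [n0|n0] := posnP n.
  split=> _; last by rewrite [X in _ *+ X]n0 mulr0n ltxx.
  have -> : meval i ms t = meval i ms u by apply/matrixP => a; have := ltn_ord a; rewrite {2}n0.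
  exact: lexx.
split=> [/negP|le]; first by rewrite -leNgt pmulrn_lle0 // subr_le0.
by apply/negP; rewrite -leNgt pmulrn_lle0 // subr_le0.
Qed.

End Eval.
End Terms.

(** * Transfer of the decompositions *)

Lemma invmx_eq (L : fieldType) n (g h : 'M[L]_n) : g *m h = 1%:M -> invmx g = h.
Proof.
by move=> gh; have [Ug _] := mulmx1_unit gh; rewrite -[LHS]mulmx1 -gh mulmxA mulVmx // mul1mx.
Qed.

(** * Formulas for the decompositions and the distance, and their transfer *)

Section RealSide.
Variables (K : rcfType) (n : nat) (G S : seq (mxpoly K n)).
Hypothesis G_group : subgroup (Cpoints G).
Hypothesis G_adj : forall g, Cpoints G g -> Cpoints G g^T.
Hypothesis S_torus : maximal_split_torus S G.
Variables (r N : nat) (ex : 'I_N -> 'rV[int]_r) (F : 'I_N -> 'M[K]_n) (psi : 'I_r -> mxpoly K n).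
Hypothesis S_data : torus_data S ex F psi.
Variables (R : realType) (iR : {rmorphism K -> R}).
Variable fa : {vspace 'M[R]_n}.
Hypothesis faE : [set` fa] = Lie (tpos S psi iR).
Variables (chi : dual fa -> mxpoly K n) (Delta : seq (dual fa)) (H0 : subvs_of fa).
Hypothesis basisD : root_basis (Lie (points iR G)) Delta.
Hypothesis chiE : forall al, rootset (Lie (points iR G)) fa al ->
  forall H : subvs_of fa, mxeval iR (chi al) (expmx (vsval H)) = expR (al H).
Hypothesis H0E : forall al, al \in Delta -> al H0 = 1.

Local Notation GR := (points iR G).
Local Notation FF := (FR F iR).

Let Gc : mclosed GR. Proof. exact: points_closed. Qed.
Let G1 : GR 1%:M. Proof. exact: points_one. Qed.
Let GM : forall g h, GR g -> GR h -> GR (g *m h). Proof. exact: points_mul. Qed.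
Let GV : forall g, GR g -> GR (invmx g). Proof. exact: points_inv. Qed.
Let GT : forall g, GR g -> GR g^T. Proof. by move=> g; apply: points_tr. Qed.
Let Gdet : forall g, GR g -> \det g = 1. Proof. by move=> g []. Qed.
Let Glog : forall (J : finType) (E : J -> 'M[R]_n) (x : J -> R), orthidem E ->
  GR (\sum_a expR (x a) *: E a) -> forall t, GR (\sum_a expR (t * x a) *: E a).
Proof. by move=> J E x; apply: points_log. Qed.
Let Gpoly : forall (gam : 'M[{poly R}]_n),
  (forall k : nat, GR (map_mx (fun p => p.[k%:R]) gam)) ->
  forall t, GR (map_mx (fun p => p.[t]) gam).
Proof. exact: points_poly. Qed.
Let Fid : orthidem FF. Proof. eapply FRid; eassumption. Qed.
Let Fsym : forall a, (FF a)^T = FF a. Proof. eapply FRsym; eassumption. Qed.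
Let Fn0 : forall a, FF a != 0. Proof. eapply FRn0; eassumption. Qed.
Let faF : forall H : subvs_of fa, vsval H = \sum_a lam FF a (vsval H) *: FF a.
Proof. eapply fa_spec; eassumption. Qed.
Let faLie : forall H : subvs_of fa, Lie GR (vsval H). Proof. eapply fa_Lie; eassumption. Qed.
Let famax : forall X, Lie GR X -> X^T = X ->
  (forall H : subvs_of fa, vsval H *m X = X *m vsval H) -> X \in fa.
Proof. eapply fa_max; eassumption. Qed.
Let Ac : mclosed [set expmx (vsval H) | H in [set: subvs_of fa]].
Proof. eapply expfa_closed; eassumption. Qed.

Local Notation Uset := (Uset GR FF H0).
Local Notation Kset := (Kset GR).
Local Notation posseq := (posseq GR FF Delta).
Local Notation rootseq := (rootseq GR FF).

Lemma cartanR g : GR g -> exists k k' H, [/\ Kset k, Kset k', dominant Delta H &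
  g = k *m expmx (vsval H) *m k'].
Proof. move: g; eapply cartan; eassumption. Qed.

Lemma iwasawaR g : GR g -> exists u (H : subvs_of fa) k,
  [/\ Uset u, Kset k & g = u *m expmx (vsval H) *m k].
Proof. move: g; eapply iwasawa; eassumption. Qed.

Lemma iwasawa_uniqueR u (H : subvs_of fa) k u' H' k' : Uset u -> Uset u' -> Kset k -> Kset k' ->
  u *m expmx (vsval H) *m k = u' *m expmx (vsval H') *m k' -> H = H'.
Proof. eapply iwasawa_unique; eassumption. Qed.

Lemma rootsumR u k l (B C : subvs_of fa) : Uset u -> Kset k -> Kset l ->
  u *m expmx (vsval C) = k *m expmx (vsval B) *m l -> rootsum GR FF C <= rootsum GR FF B.
Proof. eapply rootsum_iwasawa_cartan; eassumption. Qed.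

Lemma Uset_rootsR u : Uset u <-> exists2 X : dual fa -> 'M[R]_n,
  (forall al, al \in posseq -> rootspace (Lie GR) al (X al)) & u = nilexp (\sum_(al <- posseq) X al).
Proof. eapply Uset_roots; eassumption. Qed.

Lemma rootspaceR al X : rootset (Lie GR) fa al -> rootspace (Lie GR) al X <->
  (forall a b, wt FF fa a b != al -> FF a *m X *m FF b = 0) /\ GR (nilexp X).
Proof. eapply rootspace_blocks; eassumption. Qed.

Lemma mem_posseqR al : (al \in posseq) <-> posroots (Lie GR) Delta al.
Proof. eapply mem_posseq; eassumption. Qed.

Lemma mem_rootseqR (al : dual fa) : (al \in rootseq fa) <-> rootset (Lie GR) fa al.
Proof. eapply mem_rootseq; eassumption. Qed.

Lemma absroot_rootR (be : dual fa) : rootset (Lie GR) fa be -> rootset (Lie GR) fa (absroot Delta be).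
Proof. eapply absroot_root; eassumption. Qed.

Lemma absrootER (be : dual fa) H : rootset (Lie GR) fa be -> dominant Delta H ->
  (absroot Delta be H : R) = `|be H : R|.
Proof. eapply absrootE; eassumption. Qed.

Lemma UsetG u : Uset u -> GR u. Proof. by case. Qed.

Local Notation v := (MVar K n).

Definition fK : mform K n := MAnd (fpts G) (MEq (MMul (v 0%N) (MTr (v 0%N))) (mone K n)).

Definition fAp : mform K n :=
  MAnd (fA S psi) (mconj Delta (fun al => MNot (MPos (1 - chi al) (v 0%N)))).

(** Which blocks must vanish is decided over the reals through [wt], but it is a finite list, and
    the blocks are cut out by idempotents over [K]. *)
Definition frs al : mform K n :=
  MAnd (mconj [seq p <- enum {: 'I_N * 'I_N} | wt FF fa p.1 p.2 != al]
         (fun p => MEq (MMul (MMul (MConst (F p.1)) (v 0%N)) (MConst (F p.2))) (MConst 0)))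
       (pt G (nilterm (v 0%N))).

(** A sum over the roots becomes nested existential quantifiers: a vector of the first space is
    chosen and subtracted, until 0 is left. *)
Fixpoint fsum (l : seq (dual fa)) : mform K n :=
  if l is al :: l' then
    MEx (MAnd (MSub (frs al) [:: v 0%N]) (MSub (fsum l') [:: MAdd (v 1%N) (MScale (-1) (v 0%N))]))
  else MEq (v 0%N) (MConst 0).

Definition fU : mform K n := MEx (MAnd (MSub (fsum posseq) [:: v 0%N]) (MEq (v 1%N) (nilterm (v 0%N)))).

(* fD holds of (x, y, a) when a is a value of the vector-valued distance from x to y. *)
Definition fD : mform K n :=
  MEx (MEx (MEx (MEx (MAnd (MSub (fpts G) [:: v 3%N]) (MAnd (MSub (fpts G) [:: v 2%N])
    (MAnd (MEq (v 4%N) (MMul (v 3%N) (MTr (v 3%N)))) (MAnd (MEq (v 5%N) (MMul (v 2%N) (MTr (v 2%N))))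
    (MAnd (MSub fK [:: v 1%N]) (MAnd (MSub fK [:: v 0%N]) (MAnd (MSub fAp [:: v 6%N])
      (MEq (v 2%N) (MMul (MMul (MMul (v 3%N) (v 1%N)) (v 6%N)) (v 0%N))))))))))))).

(** On the dominant chamber the larger of chi and its inverse is the character of the positive
    representative, so N is given there by this one polynomial. *)
Definition NP : mxpoly K n := \prod_(be <- rootseq fa) chi (absroot Delta be).

Section Semantics.
Variables (L : rcfType) (i : {rmorphism K -> L}).

Lemma fptsP g : mset (fpts G) i g <-> points i G g.
Proof. exact: (ptP G (v 0%N) i [:: g]). Qed.

Lemma fKP k : mset fK i k <-> points i G k /\ k *m k^T = 1%:M.
Proof.
split=> [[Gk kk]|[Gk kk]]; split; try exact/fptsP; first by have := kk; rewrite /= map_mx1.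
by rewrite /= map_mx1.
Qed.

Lemma fApP a : mset fAp i a <-> tpos S psi i a /\ forall al, al \in Delta -> 1 <= mxeval i (chi al) a.
Proof.
have E al : mxeval i (1 - chi al) a = 1 - mxeval i (chi al) a by rewrite mxevalB mxeval1.
split=> [[Aa h]|[Aa h]].
  split; first by rewrite -mset_fA.
  move=> al alD; have /mholds_conj /(_ al alD) := h.
  by rewrite [mholds _ _ _]/(~ (0 < mxeval i (1 - chi al) a)) E subr_gt0 => /negP; rewrite -leNgt.
split; first by have := Aa; rewrite -mset_fA.
apply/mholds_conj => al alD; rewrite [mholds _ _ _]/(~ (0 < mxeval i (1 - chi al) a)) E subr_gt0.
by apply/negP; rewrite -leNgt; apply: h.
Qed.

Lemma frsP al X : mset (frs al) i X <->
  (forall a b, wt FF fa a b != al -> map_mx i (F a) *m X *m map_mx i (F b) = 0) /\ points i G (nilexp X).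
Proof.
split=> [[blk /ptP]|[blk GX]].
  rewrite meval_nilterm => GX; split=> // a b ab.
  have /mholds_conj /(_ (a, b)) := blk; rewrite mem_filter mem_enum /= ab => /(_ isT) ->.
  exact: map_mx0.
split; last by apply/ptP; rewrite meval_nilterm.
apply/mholds_conj => -[a b]; rewrite mem_filter => /andP[/= ab _].
by rewrite blk // map_mx0.
Qed.

Lemma fsumP l Y : uniq l -> mset (fsum l) i Y <-> exists2 X : dual fa -> 'M[L]_n,
  (forall al, al \in l -> mset (frs al) i (X al)) & Y = \sum_(al <- l) X al.
Proof.
elim: l Y => [|al l IH] Y /=.
  split=> [h|[X _ ->]]; last by rewrite /mset /= big_nil map_mx0.
  by exists (fun=> 0) => //; rewrite big_nil; have := h; rewrite /mset /= map_mx0.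
move=> /andP[al_l ul]; split.
  case=> X0 [h0 h1]; have {}h1 : mset (fsum l) i (Y - X0).
    by have := h1; rewrite /= rmorphN1 scaleN1r.
  have [X hX YE] := (IH _ ul).1 h1.
  exists (fun be => if be == al then X0 else X be).
    move=> be; rewrite inE; case: eqP => [-> _|_ /= bel]; [exact: h0|exact: hX].
  rewrite big_cons eqxx -[Y](subrK X0) addrC YE; congr (_ + _).
  rewrite big_seq [RHS]big_seq; apply: eq_bigr => be bel.
  by case: eqP => // E; move: al_l; rewrite -E bel.
case=> X hX ->; exists (X al); split; first by apply: (hX al); rewrite mem_head.
suff : mset (fsum l) i (\sum_(be <- al :: l) X be - X al) by rewrite /mset /= rmorphN1 scaleN1r.
apply/(IH _ ul); exists X; last by rewrite big_cons addrAC subrr add0r.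
by move=> be bel; apply: hX; rewrite inE bel orbT.
Qed.

Lemma fUP u : mset fU i u <-> exists2 X : dual fa -> 'M[L]_n,
  (forall al, al \in posseq -> mset (frs al) i (X al)) & u = nilexp (\sum_(al <- posseq) X al).
Proof.
have up : uniq posseq by exact: posseq_uniq.
split=> [[Y [/(fsumP _ up)[X hX YE]]]|[X hX uE]].
  by move=> uE; exists X => //; rewrite -YE -meval_nilterm.
exists (\sum_(al <- posseq) X al); split; first by apply/(fsumP _ up); exists X.
suff : u = meval i [:: \sum_(al <- posseq) X al; u] (nilterm (v 0%N)) by [].
by rewrite meval_nilterm.
Qed.

End Semantics.

Lemma fUR u : mset fU iR u <-> Uset u.
Proof.
have E al X : al \in posseq -> mset (frs al) iR X <-> rootspace (Lie GR) al X.
  by move=> /mem_posseqR[ra _]; rewrite (rootspaceR X ra); apply: frsP.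
rewrite fUP Uset_rootsR; split=> -[X hX uE]; exists X => // al alp.
  by apply/(E _ _ alp); apply: hX.
by apply/(E _ _ alp); apply: hX.
Qed.

Lemma fApR a : mset fAp iR a <-> exists2 H : subvs_of fa, a = expmx (vsval H) & dominant Delta H.
Proof.
have [_ rD _] := basisD.
rewrite fApP (tposE S_torus S_data faE); split=> [[[H ->] h]|[H -> dH]].
  exists H => // al alD; have := h al alD.
  by rewrite (chiE (rD _ alD)) -expR0 ler_expR.
split=> [|al alD]; first by exists H.
by rewrite (chiE (rD _ alD)) -expR0 ler_expR; apply: dH.
Qed.

Lemma NP_exp H : dominant Delta H -> mxeval iR NP (expmx (vsval H)) = expR (rootsum GR FF H).
Proof.
move=> dH; rewrite /NP mxeval_prod /rootsum expR_sum big_seq [RHS]big_seq.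
apply: eq_bigr => be /mem_rootseqR rb.
by rewrite (chiE (absroot_rootR rb)) absrootER.
Qed.

Lemma Kset_quot P g : GR P -> GR g -> g *m g^T = P *m P^T -> Kset (invmx P *m g).
Proof.
move=> GP Gg gP; split; first by apply: GM => //; apply: GV.
have U : P \in unitmx by rewrite unitmxE Gdet // unitr1.
rewrite trmx_mul mulmxA -(mulmxA (invmx P)) gP mulmxA mulVmx // mul1mx.
by rewrite -trmx_mul mulVmx // trmx1.
Qed.

Lemma fDR P P' a : GR P -> GR P' -> mholds iR [:: P *m P^T; P' *m P'^T; a] fD ->
  exists p q (H : subvs_of fa), [/\ Kset p, Kset q, a = expmx (vsval H), dominant Delta H &
    invmx P *m P' = p *m expmx (vsval H) *m q].
Proof.
move=> GP GP' [g [h [k [k' [/fptsP Gg [/fptsP Gh [gP [hP [/fKP Kk [/fKP Kk' [/fApR[H aE dH] hE]]]]]]]]]]].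
have U (Y : 'M[R]_n) : GR Y -> Y \in unitmx by move=> GY; rewrite unitmxE Gdet // unitr1.
have K1 : Kset (invmx P *m g) by apply: Kset_quot.
have K2 : Kset (invmx P' *m h) by apply: Kset_quot.
exists (invmx P *m g *m k), (k' *m (invmx P' *m h)^T), H; split=> //.
- exact: (KsetM GM).
- by apply: (KsetM GM) => //; apply: (KsetT GT).
- have [_ kk2] := K2; rewrite -[LHS]mulmx1 -kk2 !mulmxA -(mulmxA (invmx P) P') mulmxV ?U // mulmx1.
  congr (_ *m _); rewrite [h in LHS]hE /= -aE !mulmxA.
  by [].
Qed.

Lemma distance_R g h : GR g -> GR h -> exists a, mholds iR [:: g *m g^T; h *m h^T; a] fD.
Proof.
move=> Gg Gh; have [k [k' [H [Kk Kk' dH E]]]] := cartanR (GM (GV Gg) Gh).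
exists (expmx (vsval H)), g, h, k, k'; split; first exact/fptsP.
split; first exact/fptsP.
do 2 split => //; split; first exact/fKP.
split; first exact/fKP.
split; first by apply/fApR; exists H.
have U : g \in unitmx by rewrite unitmxE Gdet // unitr1.
by rewrite /= -!mulmxA (mulmxA k) -E mulKVmx.
Qed.

Lemma diminishing_R u1 u2 a1 a2 a b : mset fU iR u1 -> mset fU iR u2 ->
  tpos S psi iR a1 -> tpos S psi iR a2 ->
  mholds iR [:: (u1 *m a1) *m (u1 *m a1)^T; (u2 *m a2) *m (u2 *m a2)^T; b] fD ->
  mholds iR [:: a1 *m a1^T; a2 *m a2^T; a] fD -> mxeval iR NP a <= mxeval iR NP b.
Proof.
move=> /fUR U1 /fUR U2 /(tposE S_torus S_data faE)[H1 ->] /(tposE S_torus S_data faE)[H2 ->].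
have GA (H : subvs_of fa) : GR (expmx (vsval H)) by apply: Lie_exp.
have Gu1 := UsetG U1; have Gu2 := UsetG U2.
move=> /(fDR (GM Gu1 (GA H1)) (GM Gu2 (GA H2)))[p [q [B [Kp Kq -> dB EB]]]].
move=> /(fDR (GA H1) (GA H2))[p' [q' [A [Kp' Kq' -> dA EA]]]].
have iE : invmx (expmx (vsval H1)) = expmx (- vsval H1) by apply: invmx_eq; apply: expmxNr.
have CE : expmx (vsval (H2 - H1)) = expmx (- vsval H1) *m expmx (vsval H2).
  have -> : vsval (H2 - H1) = vsval (- H1) + vsval H2 by rewrite linearB linearN addrC.
  rewrite expmxD; last exact: (fa_comm Fid Fsym faF).
  by congr (expmx _ *m _); rewrite linearN.
rewrite !NP_exp // ler_expR.
(* The intermediate element is log c = H2 - H1. That its dominant representative has no larger root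
   sum is the same inequality with u = 1. *)
apply: (@le_trans _ _ (rootsum GR FF (H2 - H1))).
  have [_ pp] := Kp'; have [_ qq] := Kq'; rewrite iE -CE in EA.
  apply: (rootsumR (u := 1%:M) (k := p'^T) (l := q'^T)).
  - by apply: Uset1.
  - exact: (KsetT GT).
  - exact: (KsetT GT).
  - by rewrite mul1mx EA !mulmxA (mulmx1C pp) mul1mx -mulmxA qq mulmx1.
(* The unipotent part of (u1 a1)^-1 (u2 a2): u1^-1 u2 conjugated by a1^-1. *)
apply: (rootsumR (u := expmx (vsval (- H1)) *m (invmx u1 *m u2) *m expmx (- vsval (- H1))) _ Kp Kq).
  eapply Uset_conj; try eassumption.
  eapply UsetM; try eassumption.
  eapply UsetV; eassumption.
have mE : vsval (- H1) = - vsval H1 by rewrite linearN.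
rewrite -EB CE mE opprK.
have -> : invmx (u1 *m expmx (vsval H1)) = expmx (- vsval H1) *m invmx u1.
  apply: invmx_eq; rewrite -mulmxA (mulmxA (expmx _)) expmxNr mul1mx mulmxV //.
  by rewrite unitmxE Gdet // unitr1.
have := expmxNr (vsval H1); move: (expmx (vsval H1)) (expmx (- vsval H1)) (expmx (vsval H2)) => e e' f ee'.
by rewrite !mulmxA -(mulmxA _ e e') ee' mulmx1.
Qed.

Variables (E : rcfType) (iE : {rmorphism K -> E}).

Lemma distance_ex g h : points iE G g -> points iE G h ->
  exists a, mholds iE [:: g *m g^T; h *m h^T; a] fD.
Proof.
move=> Gg Gh; have := @transfer _ _ _ _ iR iE (MAll (MAll (MImp (pt G (v 1%N)) (MImp (pt G (v 0%N))
  (MEx (MSub fD [:: MMul (v 2%N) (MTr (v 2%N)); MMul (v 1%N) (MTr (v 1%N)); v 0%N])))))).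
move=> /(_ _ g h) T; apply: T; [|exact/ptP|exact/ptP].
by move=> x y /ptP Gx /ptP Gy; apply: distance_R.
Qed.

Lemma diminishing u1 u2 a1 a2 a b : mset fU iE u1 -> mset fU iE u2 ->
  tpos S psi iE a1 -> tpos S psi iE a2 ->
  mholds iE [:: (u1 *m a1) *m (u1 *m a1)^T; (u2 *m a2) *m (u2 *m a2)^T; b] fD ->
  mholds iE [:: a1 *m a1^T; a2 *m a2^T; a] fD -> mxeval iE NP a <= mxeval iE NP b.
Proof.
pose sq t : mterm K n := MMul t (MTr t).
have := @transfer _ _ _ _ iR iE (MAll (MAll (MAll (MAll (MAll (MAll
  (MImp (MSub fU [:: v 5%N]) (MImp (MSub fU [:: v 4%N])
  (MImp (inA S psi (v 3%N)) (MImp (inA S psi (v 2%N))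
  (MImp (MSub fD [:: sq (MMul (v 5%N) (v 3%N)); sq (MMul (v 4%N) (v 2%N)); v 0%N])
  (MImp (MSub fD [:: sq (v 3%N); sq (v 2%N); v 1%N]) (ple NP (v 1%N) (v 0%N)))))))))))))).
move=> /(_ _ u1 u2 a1 a2 a b) T U1 U2 A1 A2 D1 D2.
apply/(pleP iE [:: b; a; a2; a1; u2; u1] NP (v 1%N) (v 0%N)).
apply: T => //; try exact/inAP.
move=> w1 w2 c1 c2 c d W1 W2 /inAP C1 /inAP C2 D1' D2'; apply/pleP.
exact: (diminishing_R W1 W2 C1 C2 D1' D2').
Qed.

Lemma iwasawa_ex g : points iE G g -> exists u a k,
  [/\ mset fU iE u, tpos S psi iE a, mset fK iE k & g = u *m a *m k].
Proof.
move=> Gg; have := @transfer _ _ _ _ iR iE (MAll (MImp (pt G (v 0%N)) (MEx (MEx (MEx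
  (MAnd (MSub fU [:: v 2%N]) (MAnd (inA S psi (v 1%N)) (MAnd (MSub fK [:: v 0%N])
    (MEq (v 3%N) (MMul (MMul (v 2%N) (v 1%N)) (v 0%N))))))))))).
case/(_ _ g) => [x /ptP Gx||u [a [k [Uu [/inAP Aa [Kk gE]]]]]]; last by exists u, a, k.
- have [u [H [k [Uu Kk xE]]]] := iwasawaR Gx; exists u, (expmx (vsval H)), k.
  split; first exact/fUR; split; first by apply/inAP/(tposE S_torus S_data faE); exists H.
  by split=> //; apply/fKP.
- exact/ptP.
Qed.

(** Stated through (u a)(u a)^T, the point of the orbit, so that the K-component disappears; this is
    the well-definedness of the retraction. *)
Lemma iwasawa_inj u a u' a' : mset fU iE u -> tpos S psi iE a -> mset fU iE u' -> tpos S psi iE a' ->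
  (u *m a) *m (u *m a)^T = (u' *m a') *m (u' *m a')^T -> a = a'.
Proof.
pose sq t : mterm K n := MMul t (MTr t).
have := @transfer _ _ _ _ iR iE (MAll (MAll (MAll (MAll
  (MImp (MSub fU [:: v 3%N]) (MImp (inA S psi (v 2%N)) (MImp (MSub fU [:: v 1%N]) (MImp (inA S psi (v 0%N))
  (MImp (MEq (sq (MMul (v 3%N) (v 2%N))) (sq (MMul (v 1%N) (v 0%N)))) (MEq (v 2%N) (v 0%N))))))))))).
move=> /(_ _ u a u' a') T Uu Aa Uu' Aa' uE; apply: T => //; try exact/inAP.
move=> {u a u' a' Uu Aa Uu' Aa' uE} u a u' a' /fUR Uu /inAP/(tposE S_torus S_data faE)[H aE] /fUR Uu'.
move=> /inAP/(tposE S_torus S_data faE)[H' aE'] uE.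
have {}aE : a = expmx (vsval H) := aE; have {}aE' : a' = expmx (vsval H') := aE'.
have {}uE : (u *m a) *m (u *m a)^T = (u' *m a') *m (u' *m a')^T := uE.
suff : a = a' by []; move: uE; rewrite aE aE' => uE.
have GA (H1 : subvs_of fa) : GR (expmx (vsval H1)) by apply: Lie_exp.
have GP := GM (UsetG Uu) (GA H); have GP' := GM (UsetG Uu') (GA H').
have Kk := Kset_quot GP' GP uE.
have U : u' *m expmx (vsval H') \in unitmx by rewrite unitmxE Gdet // unitr1.
suff -> : H = H' by [].
apply: (iwasawa_uniqueR Uu Uu' _ Kk); first exact: Kset1.
by rewrite mulmx1 mulKVmx.
Qed.

Lemma fU_one : mset fU iE 1%:M.
Proof.
have := @transfer _ _ _ _ iR iE (MSub fU [:: mone K n]); rewrite /= !map_mx1; apply.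
by apply/fUR; apply: Uset1.
Qed.

Lemma chi_ge1 be a : rootset (Lie GR) fa be -> mset fAp iE a -> 1 <= mxeval iE (chi (absroot Delta be)) a.
Proof.
move=> rb Aa.
have := @transfer _ _ _ _ iR iE (MAll (MImp (MSub fAp [:: v 0%N]) (MNot (MPos (1 - chi (absroot Delta be)) (v 0%N))))).
move=> /(_ _ a) T.
have ev (L : rcfType) (i : {rmorphism K -> L}) (x : 'M[L]_n) :
    ~ (0 < mxeval i (1 - chi (absroot Delta be)) x) <-> 1 <= mxeval i (chi (absroot Delta be)) x.
  by rewrite mxevalB mxeval1 subr_gt0 leNgt; split=> /negP.
apply/ev; apply: T => // x /fApR[H xE dH]; apply/ev.
have {}xE : x = expmx (vsval H) := xE.
suff : 1 <= mxeval iR (chi (absroot Delta be)) x by []; rewrite xE.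
by rewrite (chiE (absroot_rootR rb)) absrootER // -expR0 ler_expR.
Qed.

(** The characters are tied to the roots by their values on real exponentials; there the product is
    e^0 = 1, and this polynomial identity on A is transferred. *)
Lemma chi_opp be a : rootset (Lie GR) fa be -> tpos S psi iE a ->
  mxeval iE (chi be) a * mxeval iE (chi (- be)) a = 1.
Proof.
move=> rb Aa.
have := @transfer _ _ _ _ iR iE (MAll (MImp (inA S psi (v 0%N)) (MZero (chi be * chi (- be) - 1) (v 0%N)))).
move=> /(_ _ a) T; apply/eqP; rewrite -subr_eq0 -mxevalM -(mxeval1 iE a) -mxevalB; apply/eqP.
apply: T; last exact/inAP.
move=> x /inAP/(tposE S_torus S_data faE)[H /= xE].
have rb' : rootset (Lie GR) fa (- be) by eapply root_opp; eassumption.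
suff : mxeval iR (chi be * chi (- be) - 1) x = 0 by [].
by rewrite xE mxevalB mxevalM mxeval1 !chiE // -expRD opp_lfunE subrr expR0 subrr.
Qed.

Lemma congact1 (g : 'M[E]_n) : congact g 1%:M = g *m g^T.
Proof. by rewrite /congact mulmx1. Qed.

Lemma diminishing_retraction (O : convexSubring E) :
  let AF := tpos S psi iE in
  let GF : set 'M[E]_n := points iE G in
  let KF : set 'M[E]_n := GF `&` @SOset E n in
  let fg : set 'M[R]_n := Lie (points iR G) in
  let Sigma := rootset fg fa in
  let chiF alpha := mxeval iE (chi alpha) in
  let Aplus : set 'M[E]_n :=
    [set a | AF a /\ forall alpha, alpha \in Delta -> 1 <= chiF alpha a] in
  let UF : set 'M[E]_n :=
    expsum (posroots fg Delta)
      (fun alpha => saext iR iE (rootspace fg alpha)) in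
  let d x y : valueGroup O :=
    oppval O (Nmult Sigma chiF (delta GF KF Aplus x y)) in
  let XF := orbit1 GF in
  let rhoF := rho UF AF KF in
  [/\ forall x, XF x -> orbit1 AF (rhoF x),
      forall u a k, UF u -> AF a -> KF k ->
        rhoF (congact (u *m a *m k) 1%:M) = congact a 1%:M,
      forall x, orbit1 AF x -> rhoF x = x &
      forall x y, XF x -> XF y -> d (rhoF x) (rhoF y) <= d x y].
Proof.
move=> AF GF KF fg Sigma chiF Aplus UF d XF rhoF.
have KFE k : KF k <-> mset fK iE k.
  by rewrite fKP; split=> [[Gk [kk _]] //|[Gk kk]]; split=> //; split=> //; case: Gk.
have AplusE a : Aplus a <-> mset fAp iE a by rewrite fApP.
have UFE u : UF u <-> mset fU iE u.
  have PE : posroots fg Delta = [set` posseq].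
    by apply/seteqP; split=> al /mem_posseqR.
  have up : uniq posseq by exact: posseq_uniq.
  (* The extension may be computed from any formula that describes the root space over the reals,
     and [frs] is one. *)
  have rE al : al \in posseq -> saext iR iE (rootspace fg al) = mset (frs al) iE.
    move=> /mem_posseqR[ra _]; rewrite -(saext_mset iR); congr (saext _ _ _).
    by apply/seteqP; split=> X; rewrite frsP => /(rootspaceR X ra).
  rewrite fUP; split=> -[X hX uE]; exists X.
  - by move=> al alp; rewrite -rE //; apply: hX; rewrite PE.
  - by rewrite uE PE (fsbig_seq _ _ up).
  - by move=> al; rewrite {1}PE => alp; rewrite rE //; apply: hX.
  - by rewrite uE PE (fsbig_seq _ _ up).
have kkE (P k : 'M[E]_n) : KF k -> (P *m k) *m (P *m k)^T = P *m P^T.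
  by move=> /KFE/fKP[_ kk]; rewrite trmx_mul mulmxA -(mulmxA P) kk mulmx1.
have rhoE u a k : UF u -> AF a -> KF k -> rhoF (congact (u *m a *m k) 1%:M) = congact a 1%:M.
  move=> Uu Aa Kk; rewrite /rhoF /rho; apply: xget_unique.
    by exists u, a, k.
  move=> y [u' [a' [k' [[Uu' Aa' Kk'] [E1 ->]]]]].
  move: E1; rewrite !congact1 (kkE _ _ Kk) (kkE _ _ Kk') => E1.
  by congr (_ *m _^T); apply/esym; apply: (iwasawa_inj _ _ _ _ E1) => //; apply/UFE.
have U1 : UF 1%:M by apply/UFE; apply: fU_one.
have K1 : KF 1%:M by apply/KFE/fKP; split; [apply: points_one|rewrite trmx1 mulmx1].
have rhoA a : AF a -> rhoF (congact a 1%:M) = congact a 1%:M.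
  by move=> Aa; have := rhoE _ _ _ U1 Aa K1; rewrite mul1mx mulmx1.
have dec x : XF x -> exists u a, [/\ UF u, AF a, x = (u *m a) *m (u *m a)^T & rhoF x = a *m a^T].
  case=> g Gg <-; have [u [a [k [/UFE Uu Aa /KFE Kk gE]]]] := iwasawa_ex Gg.
  exists u, a; split=> //; first by rewrite congact1 gE (kkE _ _ Kk).
  by rewrite gE rhoE // congact1.
have dE x y a : (Aplus a /\ exists g h k k',
    [/\ GF g, GF h, x = congact g 1%:M & y = congact h 1%:M] /\
    [/\ KF k, KF k' & invmx g *m h = k *m a *m k']) <-> mholds iE [:: x; y; a] fD.
  have gU g : GF g -> g \in unitmx by case=> d1 _; rewrite unitmxE d1 unitr1.
  split.
    case=> /AplusE Aa [g [h [k [k' [[Gg Gh -> ->] [/KFE Kk /KFE Kk' E1]]]]]].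
    rewrite !congact1; exists g, h, k, k'; split; first exact/fptsP.
    split; first exact/fptsP.
    do 2 split => //; split=> //; split=> //; split=> //=.
    by rewrite -!mulmxA (mulmxA k) -E1 mulKVmx ?gU.
  case=> g [h [k [k' [/fptsP Gg [/fptsP Gh [gP [hP [Kk [Kk' [Aa hE]]]]]]]]]].
  split; first exact/AplusE.
  exists g, h, k, k'; rewrite !congact1; split=> //; split; [exact/KFE|exact/KFE|].
  by rewrite [h in LHS]hE /= -!mulmxA mulKmx ?gU // !mulmxA.
have deltaP g h : GF g -> GF h ->
    mholds iE [:: g *m g^T; h *m h^T; delta GF KF Aplus (g *m g^T) (h *m h^T)] fD.
  move=> Gg Gh; have [a /dE Da] := distance_ex Gg Gh; apply/dE.
  apply: (@xgetPex _ 1%:M [set a | Aplus a /\ exists g' h' k k',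
    [/\ GF g', GF h', g *m g^T = congact g' 1%:M & h *m h^T = congact h' 1%:M] /\
    [/\ KF k, KF k' & invmx g' *m h' = k *m a *m k']]).
  by exists a.
have NE a : mset fAp iE a -> Nmult Sigma chiF a = mxeval iE NP a /\ 0 < mxeval iE NP a.
  move=> Aa; have [Ta _] := (fApP iE a).1 Aa.
  have SE : Sigma = [set` rootseq fa] by apply/seteqP; split=> be /mem_rootseqR.
  have ur : uniq (rootseq fa) by exact: rootseq_uniq.
  rewrite /NP mxeval_prod; split; last first.
    rewrite big_seq; apply: prodr_gt0 => be /mem_rootseqR rb.
    exact: lt_le_trans ltr01 (chi_ge1 rb Aa).
  rewrite /Nmult SE -(fsbig_seq _ _ ur) big_seq [RHS]big_seq; apply: eq_bigr => be /mem_rootseqR rb.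
  (* The value at the positive representative is at least 1 and the values at opposite roots are
     inverse to each other; this decides the maximum. *)
  have c1 := chi_ge1 rb Aa; have cc := chi_opp rb Ta.
  move: c1; rewrite /absroot; case: asboolP => _ c1.
    by apply/max_idPl; rewrite (le_trans _ c1) // invf_le1 // (lt_le_trans ltr01).
  have c0 : chiF be a != 0.
    by apply: contraTneq isT => c0; move: cc; rewrite -/(chiF be a) c0 mul0r => /eqP; rewrite eq_sym oner_eq0.
  have cV : (chiF be a)^-1 = mxeval iE (chi (- be)) a by rewrite -[LHS]mulr1 -cc mulKf.
  rewrite cV; apply/max_idPr; rewrite (le_trans _ c1) // -[chiF be a]invrK cV.
  by rewrite invf_le1 // (lt_le_trans ltr01).
have Apl x y a : mholds iE [:: x; y; a] fD -> mset fAp iE a.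
  by move=> /dE[/AplusE].
split.
- move=> x /dec[u [a [_ Aa _ ->]]]; exists a => //.
  exact: congact1.
- exact: rhoE.
- by move=> _ [a Aa <-]; apply: rhoA.
- move=> x y Xx Xy; have [u1 [a1 [U1' A1 xE ->]]] := dec x Xx.
  have [u2 [a2 [U2' A2 yE ->]]] := dec y Xy.
  have AG a : AF a -> GF a by case=> Sa _; apply: (torus_sub S_torus).
  have D2 := deltaP _ _ (AG _ A1) (AG _ A2).
  have D1 : mholds iE [:: x; y; delta GF KF Aplus x y] fD.
    by case: Xx => g Gg <-; case: Xy => h Gh <-; rewrite !congact1; apply: deltaP.
  have D1' := D1; rewrite {1}xE {1}yE in D1'.
  have le := diminishing ((UFE u1).1 U1') ((UFE u2).1 U2') A1 A2 D1' D2.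
  have [Na Na0] := NE _ (Apl _ _ _ D2); have [Nb Nb0] := NE _ (Apl _ _ _ D1).
  rewrite /d Na Nb.
  (* N is positive on both distances, so the default value of [oppval] at 0 is never met. *)
  have val (z : E) : 0 < z -> exists w, valuation O z = Some w.
    by move=> z0; rewrite /valuation insubT ?gt_eqF //; eexists.
  have [va vaE] := val _ Na0; have [vb vbE] := val _ Nb0.
  by rewrite /oppval vaE vbE; apply: (valuation_mono Na0 le vbE vaE).
Qed.

End RealSide.

Unset Implicit Arguments.

Theorem theorem4p4
  (K F : rcfType) (R : realType)
  (iR : {rmorphism K -> R}) (iF : {rmorphism K -> F})
  (O : convexSubring F) (n : nat) (G S : seq (mxpoly K n))
  (G_group : subgroup (Cpoints G)) (G_conn : zconnected (Cpoints G))
  (G_semisimple : semisimple (Cpoints G))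
  (G_adj : forall g, Cpoints G g -> Cpoints G g^T)
  (S_torus : maximal_split_torus S G)
  (S_sym : forall s, Cpoints S s -> s = s^T) :
  let A : set 'M[K]_n := sacomponent (points idfun S) 1%:M in
  let AR : set 'M[R]_n := saext idfun iR A in
  let AF : set 'M[F]_n := saext idfun iF A in
  let GF : set 'M[F]_n := points iF G in
  let KF : set 'M[F]_n := GF `&` @SOset F n in
  let fg : set 'M[R]_n := Lie (points iR G) in
  forall fa : {vspace 'M[R]_n}, [set` fa] = Lie AR ->
  let Sigma := rootset fg fa in
  forall chi : dual fa -> mxpoly K n,
  (forall alpha, Sigma alpha -> character S (chi alpha) /\
     forall H : subvs_of fa,
       mxeval iR (chi alpha) (expmx (vsval H)) = expR (alpha H)) ->
  forall Delta : seq (dual fa), root_basis fg Delta ->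
  let chiF alpha := mxeval iF (chi alpha) in
  let Aplus : set 'M[F]_n :=
    [set a | AF a /\ forall alpha, alpha \in Delta -> 1 <= chiF alpha a] in
  let UF : set 'M[F]_n :=
    expsum (posroots fg Delta)
      (fun alpha => saext iR iF (rootspace fg alpha)) in
  let d x y : valueGroup O :=
    oppval O (Nmult Sigma chiF (delta GF KF Aplus x y)) in
  let XF := orbit1 GF in
  let rhoF := rho UF AF KF in
  [/\ forall x, XF x -> orbit1 AF (rhoF x),
      forall u a k, UF u -> AF a -> KF k ->
        rhoF (congact (u *m a *m k) 1%:M) = congact a 1%:M,
      forall x, orbit1 AF x -> rhoF x = x &
      forall x y, XF x -> XF y -> d (rhoF x) (rhoF y) <= d x y].
Proof.
move=> A AR AF GF KF fg fa faLie Sigma chi chiP Delta basisD chiF Aplus UF d XF rhoF.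
have [S_split _ _] := S_torus.
have [r [N [ex [W [psi S_data]]]]] := split_torus_data S_split S_sym.
(* The identity component is taken over [K]; its extensions are given by the same inequalities over
   every field, which covers both [AR] and [AF]. *)
have AE (L : rcfType) (i : {rmorphism K -> L}) : saext idfun i A = tpos S psi i.
  rewrite /A (sacomponent_torus S_torus S_data iR) -mset_fA.
  by rewrite (saext_mset (idK K)) mset_fA.
have faE : [set` fa] = Lie (tpos S psi iR) by rewrite faLie /AR AE.
have [H0 H0E] : exists H0 : subvs_of fa, forall al, al \in Delta -> al H0 = 1.
  eapply exists_regular; eassumption.
have chiE al : Sigma al -> forall H : subvs_of fa,
    mxeval iR (chi al) (expmx (vsval H)) = expR (al H) by move=> /chiP[].
have := diminishing_retraction G_group G_adj S_torus S_data faE basisD chiE H0E iF O.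
by rewrite /rhoF /XF /d /UF /Aplus /chiF /fg /KF /GF /AF AE.
Qed.
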